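(* Let $d\ge 1$ and let $f_n\in \mathrm{Rat}_d(\mathbb{C})$ be a degenerating sequence. Let $r_n=\max_{y\in (\mathscr{E}f_n)^{-1}(\mathbf 0)} d_{\mathbb{H}^3}(\mathbf 0,y)$ and $\rho_n=e^{-r_n}$. Let $F=\lim_\omega \mathscr{E}f_n:{}^r\mathbb{H}^3\to{}^r\mathbb{H}^3$ be the limiting map on the asymptotic cone, let $\mathbf f$ be the degree $d$ rational map over ${}^\rho\mathbb{C}$ associated with $(f_n)$, and let $B:\mathbb{H}_{Berk}({}^\rho\mathbb{C})\to\mathbb{H}_{Berk}({}^\rho\mathbb{C})$ be its Berkovich extension. Then there is a canonical isometric bijection (given by the explicit map $\Phi$ of the context) $$\Phi:\mathbb{H}_{Berk}({}^\rho\mathbb{C})\longrightarrow {}^r\mathbb{H}^3$$ such that $\Phi\circ B=F\circ\Phi$.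
   Context: Fix a non-principal ultrafilter $\omega$ on $\mathbb{N}$; a property holds $\omega$-almost surely if it holds for all $n$ in some set belonging to $\omega$; the same $\omega$ is used in all constructions. $\mathrm{Rat}_d(\mathbb{C})$ is the space of degree $d$ rational maps; a sequence in it is degenerating ($f_n\to\infty$) if it eventually leaves every compact subset. Barycentric extension. $\mathbb{H}^3$ is hyperbolic 3-space (ball model, centre $\mathbf 0$; in the upper half-space model $\mathbb{C}\times\mathbb{R}_{>0}$ the point $\mathbf 0$ is $(0,1)$), with ideal boundary $S^2=\hat{\mathbb{C}}$; $\mathrm{PSL}_2(\mathbb{C})$ acts by isometries. A probability measure $\mu$ on $S^2$ without atoms of mass $\ge 1/2$ has a unique barycenter $y\in\mathbb{H}^3$, characterized by $\int_{S^2}\zeta\,dM_*\mu(\zeta)=0\in\mathbb{R}^3$ for $M\in\mathrm{PSL}_2(\mathbb{C})$ with $M(y)=\mathbf 0$. For a non-constant rational map $f$, $\mathscr{E}f:\mathbb{H}^3\to\mathbb{H}^3$ sends $x$ to the barycenter of $f_*(M_x)_*\mu_{S^2}$, where $M_x\in\mathrm{PSL}_2(\mathbb{C})$, $M_x(\mathbf 0)=x$, and $\mu_{S^2}$ is the normalized spherical measure. ($\mathscr{E}f$ is $C\deg f$-Lipschitz with $C$ universal.) Asymptotic cone. For positive $r_n\to\infty$, ${}^r\mathbb{H}^3=\lim_\omega(\mathbb{H}^3,\mathbf 0,d_{\mathbb{H}^3}/r_n)$: points are classes $[(x_n)]$ of sequences with $d_{\mathbb{H}^3}(\mathbf 0,x_n)/r_n$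 bounded, where $(x_n)\sim(y_n)$ iff $\lim_\omega d_{\mathbb{H}^3}(x_n,y_n)/r_n=0$, with distance $\lim_\omega d_{\mathbb{H}^3}(x_n,y_n)/r_n$ and base point $x^0=[(\mathbf 0)]$. It is an $\mathbb{R}$-tree. $F([(x_n)])=[(\mathscr{E}f_n(x_n))]$. (If $f_n\in\mathrm{Rat}_d(\mathbb{C})$ is a degenerating sequence, then $r_n=\max_{y\in (\mathscr{E}f_n)^{-1}(\mathbf 0)} d_{\mathbb{H}^3}(\mathbf 0,y)$ tends to $\infty$.) Robinson field. Let ${}^*\mathbb{C}$ be the ultrapower of $\mathbb{C}$ with respect to $\omega$, and $\rho=(\rho_n)\in{}^*\mathbb{C}$. Put $M_0=\{t:|t|<\rho^{-N}\text{ for some }N\in\mathbb{N}\}$, $M_1=\{t:|t|<\rho^{N}\text{ for all }N\in\mathbb{N}\}$ and ${}^\rho\mathbb{C}=M_0/M_1$, a field with the non-Archimedean absolute value $|x|=e^{-\nu(x)}$, $\nu(x)=\lim_\omega\log|x_n|/\log\rho_n$. It is complete and algebraically closed. Associated rational map. For each $n$ write $f_n$ as a quotient of two polynomials of degree at most $d$, scaled so that the largest modulus of the coefficients is $1$. The coefficient sequences define elements of ${}^\rho\mathbb{C}$, hence a rational map $\mathbf f$ over ${}^\rho\mathbb{C}$, which has degree $d$. Berkovich space. For a complete algebraically closed non-Archimedean field $K$, $\mathbb{H}_{Berk}(K)=\mathbb{P}^1_{Berk}(K)\setminus\mathbb{P}^1(K)$. For points corresponding to closed balls $B(a,r),B(b,s)$,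 the metric is $d=2\log R-\log r-\log s$ with $R=\max(r,s,|a-b|)$, extended continuously to $\mathbb{H}_{Berk}(K)$. A rational map over $K$ acts naturally on $\mathbb{P}^1_{Berk}(K)$; $B$ is the induced map on $\mathbb{H}_{Berk}$. The map $\Phi$. Every point $x$ of $\mathbb{H}_{Berk}({}^\rho\mathbb{C})$ corresponds to a closed ball $B(p,R)$, $R>0$. Choose $M(z)=az+b$ with $a,b\in{}^\rho\mathbb{C}$ and $M(B(0,1))=B(p,R)$, represent $a,b$ by $(a_n),(b_n)$, put $M_n(z)=a_nz+b_n$, and set $\Phi(x)=[(M_n(\mathbf 0))]$. *)

(* Defs.v *)
From HB Require Import structures.
From mathcomp Require Import all_boot all_order all_algebra closed_field.
From mathcomp Require Import complex.
From mathcomp Require Import all_classical all_reals all_analysis.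
From mathcomp Require Import ring lra.

Set Implicit Arguments.
Unset Strict Implicit.
Unset Printing Implicit Defensive.

Import Order.TTheory GRing.Theory Num.Theory.
Import numFieldNormedType.Exports.
Import ComplexField.

Local Open Scope classical_set_scope.
Local Open Scope ring_scope.
Local Open Scope complex_scope.

HB.instance Definition _ (R : realType) := PseudoPointedMetric.copy R[i] R[i]^o.

(* The real-valued modulus; the ssrnum norm of z : R[i] lives in R[i]. *)
Notation cabs := Normc.normc.

Record free_ultrafilter := FreeUltrafilter {
  ultraset : set_system nat;
  ultra_ultra : UltraFilter ultraset;
  ultra_free : forall n, ~ ultraset [set n] }.

#[global] Instance ultra_proper_filter (w : free_ultrafilter) :
  ProperFilter (ultraset w).
Proof. exact: (@ultra_proper _ _ (ultra_ultra w)). Qed.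

Section Hyperbolic.
Variable R : realType.
Local Notation C := R[i].

(* Upper half-space model; the centre of the ball model is (0, 1). *)
Definition H3 := {p : C * R | 0 < p.2}.

Definition H3o : H3 := exist _ (0, 1) ltr01.

Definition arcosh (u : R) : R := ln (u + Num.sqrt (u ^+ 2 - 1)).

Definition hcosh (x y : H3) : R :=
  let: (z, t) := val x in let: (u, s) := val y in
  1 + (cabs (z - u) ^+ 2 + (t - s) ^+ 2) / (2 * t * s).

Definition hdist (x y : H3) : R := arcosh (hcosh x y).

(* Poincare extension of z |-> (az+b)/(cz+d), for M in GL_2, not necessarily of
   determinant 1; insubd only makes it total: a singular M acts trivially. *)
Definition mobH (M : 'M[C]_2) (x : H3) : H3 :=
  let: (z, t) := val x in
  let a := M 0 0 in let b := M 0 1 in let c := M 1 0 in let d := M 1 1 in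
  let q := cabs (c * z + d) ^+ 2 + cabs c ^+ 2 * t ^+ 2 in
  insubd x
    (((a * z + b) * conjc (c * z + d) + a * conjc c * (t ^+ 2)%:C) / q%:C,
     cabs (\det M) * t / q).

(* The Riemann sphere, None being the point at infinity, with its Borel sets. *)
Definition Chat := g_sigma_algebraType (@open (one_point_compactification C)).

Definition mobC (M : 'M[C]_2) (x : Chat) : Chat :=
  let a := M 0 0 in let b := M 0 1 in let c := M 1 0 in let d := M 1 1 in
  match x with
  | None => if c == 0 then None else Some (a / c)
  | Some z => if c * z + d == 0 then None else Some ((a * z + b) / (c * z + d))
  end.

(* Identification with the unit sphere of R^3. It is the boundary value of the
   isometry onto the ball model that sends (0, 1) to the origin. *)
Definition stereo (x : Chat) : 'rV[R]_3 :=
  match x with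
  | None => \row_j [:: 0; 0; 1]`_j
  | Some z => let m : R := cabs z ^+ 2 in
      (m + 1)^-1 *: \row_j [:: 2 * complex.Re z; 2 * complex.Im z; m - 1]`_j
  end.

(* In the coordinate z = x + iy the normalized area form of the sphere is
   dx dy / (pi (1 + |z|^2)^2); infinity is a null set. *)
Definition sphere_measure (A : set Chat) : \bar R :=
  (\int[lebesgue_measure \x lebesgue_measure]_(p in
       [set p : measurableTypeR R * measurableTypeR R | A (Some (p.1 +i* p.2))])
     ((pi * (1 + p.1 ^+ 2 + p.2 ^+ 2) ^+ 2)^-1)%:E)%E.

Definition is_barycenter (mu : set Chat -> \bar R) (y : H3) : Prop :=
  forall M : 'M[C]_2, \det M = 1 -> mobH M y = H3o ->
  forall j, (\int[pushforward mu (mobC M)]_x (stereo x 0 j)%:E = 0)%E.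

(* For f a non-constant rational map there is exactly one such y, independent of
   the choice of M; the default value H3o of xget is then irrelevant. *)
Definition bary_ext (f : Chat -> Chat) (x : H3) : H3 :=
  xget H3o [set y | exists M : 'M[C]_2, [/\ \det M = 1, mobH M H3o = x &
    is_barycenter (pushforward (pushforward sphere_measure (mobC M)) f) y]].

End Hyperbolic.

Section RationalMaps.
Variables (R : realType) (d : nat).
Local Notation C := R[i].

Definition coefs := ('rV[C]_d.+1 * 'rV[C]_d.+1)%type.

Definition poly_of (v : 'rV[C]_d.+1) : {poly C} :=
  \poly_(i < d.+1) v 0 (inord i).

(* Pairs (P, Q) such that P / Q is in lowest terms and of degree d. *)
Definition deg_coefs : set coefs :=
  [set v | coprimep (poly_of v.1) (poly_of v.2) /\
           maxn (size (poly_of v.1)) (size (poly_of v.2)) = d.+1].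

Definition proportional (u v : set_type deg_coefs) : bool :=
  `[< exists2 c : C, c != 0 & set_val v = c *: set_val u >].

Lemma proportional_equiv : equiv_class_of proportional.
Proof.
split=> [u|u v|v u t].
- by apply/asboolP; exists 1; rewrite ?oner_neq0 ?scale1r.
- apply/asboolP/asboolP => -[c c0 e]; exists c^-1; rewrite ?invr_eq0 //.
    by rewrite e scalerA mulVf // scale1r.
  by rewrite e scalerA mulVf // scale1r.
- move=> /asboolP [a a0 ea] /asboolP [b b0 eb]; apply/asboolP; exists (b * a).
    by rewrite mulf_neq0.
  by rewrite eb ea scalerA.
Qed.

Canonical proportional_rel := EquivRelPack proportional_equiv.

(* The topology is that of an open subset of projective (2d+1)-space. *)
Definition RatMap := quotient_topology {eq_quot proportional}%qT.

Definition rat_coefs (f : RatMap) : coefs := set_val (repr f).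

Definition rat_fun (f : RatMap) (x : Chat R) : Chat R :=
  let: (p, q) := rat_coefs f in
  match x with
  | None => if q 0 ord_max == 0 then None else Some (p 0 ord_max / q 0 ord_max)
  | Some z => if (poly_of q).[z] == 0 then None
              else Some ((poly_of p).[z] / (poly_of q).[z])
  end.

Definition degenerating (f : nat -> RatMap) : Prop :=
  forall K : set RatMap, compact K -> \forall n \near \oo, ~ K (f n).

(* The greatest element of the set of distances; it exists when 1 <= d. *)
Definition bary_radius (f : RatMap) : R :=
  let D := [set hdist (H3o R) y | y in bary_ext (rat_fun f) @^-1` [set H3o R]] in
  xget 0 [set m | D m /\ ubound D m].

End RationalMaps.

Section HyperbolicMetric.
Variable R : realType.
Implicit Types x y z : H3 R.

Lemma cabs2E (a : R[i]) : cabs a ^+ 2 = complex.Re a ^+ 2 + complex.Im a ^+ 2.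
Proof. by case: a => a b /=; rewrite sqr_sqrtr // addr_ge0 ?sqr_ge0. Qed.

Lemma hcosh_ge1 x y : 1 <= hcosh x y.
Proof.
case: x => -[z t] /= t0; case: y => -[u s] /= s0; rewrite /hcosh /= lerDl.
by rewrite divr_ge0 ?addr_ge0 ?sqr_ge0 // !mulr_ge0 ?ltW.
Qed.

Lemma hcoshxx x : hcosh x x = 1.
Proof.
case: x => -[z t] /= t0; rewrite /hcosh /= !subrr Normc.normc0.
by rewrite expr0n /= addr0 mul0r addr0.
Qed.

Lemma hcoshC x y : hcosh x y = hcosh y x.
Proof.
case: x => -[z t] /= t0; case: y => -[u s] /= s0; rewrite /hcosh /=.
congr (1 + _ / _); last by rewrite -!mulrA (mulrC t).
by rewrite !cabs2E -opprB -(opprB s) sqrrN; case: (u - z) => a b /=; rewrite !sqrrN.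
Qed.

Lemma hdistxx x : hdist x x = 0.
Proof. by rewrite /hdist /arcosh hcoshxx expr1n subrr sqrtr0 addr0 ln1. Qed.

Lemma hdistC x y : hdist x y = hdist y x.
Proof. by rewrite /hdist hcoshC. Qed.

Lemma arcosh_ge0 (u : R) : 1 <= u -> 0 <= arcosh u.
Proof.
by move=> u1; rewrite /arcosh ln_ge0 // (le_trans u1) // lerDl sqrtr_ge0.
Qed.

Lemma hdist_ge0 x y : 0 <= hdist x y.
Proof. exact/arcosh_ge0/hcosh_ge1. Qed.

Lemma arcosh_add (a b c : R) : 1 <= a -> 1 <= b -> 1 <= c ->
  c <= a * b + Num.sqrt ((a ^+ 2 - 1) * (b ^+ 2 - 1)) ->
  arcosh c <= arcosh a + arcosh b.
Proof.
move=> a1 b1 c1 h; rewrite /arcosh.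
have pos (u : R) : 1 <= u -> 0 < u + Num.sqrt (u ^+ 2 - 1).
  by move=> u1; rewrite ltr_pwDl ?sqrtr_ge0 // (lt_le_trans ltr01).
rewrite -lnM ?posrE ?pos // ler_ln ?posrE ?mulr_gt0 ?pos //.
set A := Num.sqrt (a ^+ 2 - 1); set B := Num.sqrt (b ^+ 2 - 1).
have a2 : 0 <= a ^+ 2 - 1 by rewrite subr_ge0 expr_ge1 // (le_trans ler01).
have b2 : 0 <= b ^+ 2 - 1 by rewrite subr_ge0 expr_ge1 // (le_trans ler01).
have hAB : Num.sqrt ((a ^+ 2 - 1) * (b ^+ 2 - 1)) = A * B by rewrite sqrtrM.
rewrite hAB in h.
have A0 : 0 <= A := sqrtr_ge0 _. have B0 : 0 <= B := sqrtr_ge0 _.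
have eA : A ^+ 2 = a ^+ 2 - 1 by rewrite sqr_sqrtr.
have eB : B ^+ 2 = b ^+ 2 - 1 by rewrite sqr_sqrtr.
have -> : (a + A) * (b + B) = (a * b + A * B) + (a * B + A * b) by ring.
apply: lerD => //.
have s0 : 0 <= a * B + A * b.
  by rewrite addr_ge0 // mulr_ge0 // (le_trans ler01).
rewrite -[leRHS](ger0_norm s0) -sqrtr_sqr ler_sqrt ?sqr_ge0 //.
have -> : (a * B + A * b) ^+ 2 = (a * b + A * B) ^+ 2 - 1.
  rewrite !sqrrD !exprMn eA eB; ring.
by rewrite lerB // ler_sqr // nnegrE (le_trans ler01) // (le_trans c1).
Qed.

Lemma hdist_triangle x y z : hdist x z <= hdist x y + hdist y z.
Proof.
apply: arcosh_add; rewrite ?hcosh_ge1 //.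
case: x => -[[a1 a2] t] /= t0; case: y => -[[b1 b2] s] /= s0.
case: z => -[[c1 c2] r] /= r0; rewrite /hcosh /= !sqr_sqrtr ?addr_ge0 ?sqr_ge0 //.
set X1 := a1 - b1; set X2 := a2 - b2; set Z1 := c1 - b1; set Z2 := c2 - b2.
have -> : a1 - c1 = X1 - Z1 by rewrite /X1 /Z1; ring.
have -> : a2 - c2 = X2 - Z2 by rewrite /X2 /Z2; ring.
have -> : b1 - c1 = - Z1 by rewrite /Z1; ring.
have -> : b2 - c2 = - Z2 by rewrite /Z2; ring.
have tn : t != 0 by rewrite gt_eqF. have sn : s != 0 by rewrite gt_eqF.
have rn : r != 0 by rewrite gt_eqF.
pose P := (X1 ^+ 2 + X2 ^+ 2 + t ^+ 2 - s ^+ 2) / (2 * t * s).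
pose Q := (Z1 ^+ 2 + Z2 ^+ 2 + r ^+ 2 - s ^+ 2) / (2 * r * s).
pose D := - (P * Q + (X1 * Z1 + X2 * Z2) / (t * r)).
set U := (_ * _) + Num.sqrt _.
suff hD : D <= Num.sqrt (((1 + (X1 ^+ 2 + X2 ^+ 2 + (t - s) ^+ 2) / (2 * t * s)) ^+ 2 - 1) *
   ((1 + ((- Z1) ^+ 2 + (- Z2) ^+ 2 + (s - r) ^+ 2) / (2 * s * r)) ^+ 2 - 1)).
  rewrite /U; apply: le_trans (lerD (lexx _) hD).
  rewrite /D /P /Q le_eqVlt; apply/orP; left; apply/eqP; field.
  by rewrite tn sn rn.
apply: (le_trans (ler_norm _)); rewrite -sqrtr_sqr; apply: ler_wsqrtr.
have -> : ((1 + (X1 ^+ 2 + X2 ^+ 2 + (t - s) ^+ 2) / (2 * t * s)) ^+ 2 - 1)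
   = P ^+ 2 + (X1 / t) ^+ 2 + (X2 / t) ^+ 2.
  by rewrite /P; field; rewrite tn sn.
have -> : (1 + ((- Z1) ^+ 2 + (- Z2) ^+ 2 + (s - r) ^+ 2) / (2 * s * r)) ^+ 2 - 1
   = Q ^+ 2 + (Z1 / r) ^+ 2 + (Z2 / r) ^+ 2.
  by rewrite /Q; field; rewrite rn sn.
have -> : D = - (P * Q + (X1 / t) * (Z1 / r) + (X2 / t) * (Z2 / r)).
  by rewrite /D; field; rewrite tn rn.
clear D.
move: P Q (X1 / t) (X2 / t) (Z1 / r) (Z2 / r) => p q u v u' v'.
rewrite sqrrN -subr_ge0.
have -> : (p ^+ 2 + u ^+ 2 + v ^+ 2) * (q ^+ 2 + u' ^+ 2 + v' ^+ 2) -
  (p * q + u * u' + v * v') ^+ 2 =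
  (p * u' - q * u) ^+ 2 + (p * v' - q * v) ^+ 2 + (u * v' - u' * v) ^+ 2 by ring.
by rewrite !addr_ge0 // sqr_ge0.
Qed.

End HyperbolicMetric.

Section AsymptoticCone.
Variables (R : realType) (w : free_ultrafilter) (r : nat -> R).
Implicit Types x y : nat -> H3 R.

Record bseq := BSeq {
  bseq_val :> nat -> H3 R;
  _ : `[< exists c : R, forall n, hdist (H3o R) (bseq_val n) / r n <= c >] }.
HB.instance Definition _ := [isSub for bseq_val].
HB.instance Definition _ := [Choice of bseq by <:].

Definition cone_eq (x y : bseq) : bool :=
  `[< (fun n => hdist (x n) (y n) / r n) @ ultraset w --> (0 : R) >].

Lemma cone_eq_equiv : equiv_class_of cone_eq.
Proof.
split=> [x|x y|y x z]; rewrite /cone_eq.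
- apply/asboolP.
  under eq_fun do rewrite hdistxx mul0r.
  exact: cvg_cst.
- by apply/asboolP/asboolP; under eq_fun do rewrite hdistC.
- move=> /asboolP xy /asboolP yz; apply/asboolP.
  apply/norm_cvg0P.
  have h : `|hdist (x n) (y n) / r n| + `|hdist (y n) (z n) / r n|
      @[n --> ultraset w] --> (0 : R).
    have := @cvgD R R nat (ultraset w) _ _ _ _ _ (cvg_norm xy) (cvg_norm yz).
    rewrite !normr0 addr0; exact.
  apply: (squeeze_cvgr _ (cvg_cst (0 : R)) h); apply: nearW => n /=.
  rewrite normr_ge0 /= !normrM -mulrDl ler_wpM2r //.
  by rewrite !ger0_norm ?hdist_ge0 // hdist_triangle.
Qed.

Canonical cone_eq_rel := EquivRelPack cone_eq_equiv.

Definition cone := {eq_quot cone_eq}%qT.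
HB.instance Definition _ := Choice.on cone.
HB.instance Definition _ : EqQuotient bseq cone_eq cone := EqQuotient.on cone.

Definition cone_class (x : bseq) : cone := (\pi_cone x)%qT.

Definition cone_dist (p q : cone) : R :=
  lim ((fun n => hdist (val (repr p) n) (val (repr q) n) / r n) @ ultraset w).

(* F [(x_n)] = [(E_n x_n)], including that (E_n x_n) is again bounded. *)
Definition is_limit_map (E : nat -> H3 R -> H3 R) (F : cone -> cone) : Prop :=
  forall x : bseq, exists2 y : bseq,
    (forall n, y n = E n (x n)) & F (cone_class x) = cone_class y.

End AsymptoticCone.

Section Ultrapower.
Variables (R : realType) (w : free_ultrafilter).
Local Notation C := R[i].

Definition ultranull : {pred nat -> C} := fun u => `[< \forall n \near ultraset w, u n = 0 >].

Lemma ultranull_closed : idealr_closed ultranull.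
Proof.
split.
- by apply/asboolP; exact: nearW.
- by apply/negP => /asboolP /filter_ex [n] /eqP; rewrite oner_eq0.
- move=> a u v /asboolP u0 /asboolP v0; apply/asboolP.
  apply: filterS2 u0 v0 => n /= u0 v0.
  by rewrite -[LHS]/(a n * u n + v n) u0 v0 mulr0 addr0.
Qed.

HB.instance Definition _ := isIdealr.Build (nat -> C) ultranull ultranull_closed.

(* The ultrapower of the complex numbers. *)
Definition hyperC := {ideal_quot ultranull}.
HB.instance Definition _ := GRing.ComNzRing.on hyperC.

Definition hyper_class (u : nat -> C) : hyperC := (\pi u)%qT.

Lemma hyper_reprE (u : nat -> C) : \forall n \near ultraset w, repr (hyper_class u) n = u n.
Proof.
have /eqP : (\pi_hyperC (repr (hyper_class u)) = \pi_hyperC u)%qT by rewrite reprK.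
rewrite -Quotient.idealrBE => /asboolP; apply: filterS => n /= e.
by apply/eqP; rewrite -subr_eq0; apply/eqP.
Qed.

End Ultrapower.

Record infinitesimal (R : realType) (w : free_ultrafilter) := Infinitesimal {
  inf_seq :> nat -> R;
  inf_gt0 : forall n, 0 < inf_seq n;
  inf_cvg0 : inf_seq @ ultraset w --> 0 }.

Section Robinson.
Variables (R : realType) (w : free_ultrafilter) (rho : infinitesimal R w).
Local Notation C := R[i].

(* The subring M_0 of the ultrapower, and below its ideal M_1 (rob_negl). *)
Definition moderate : {pred hyperC R w} := fun t =>
  `[< exists N : nat, \forall n \near ultraset w, cabs (repr t n) < rho n ^- N >].

Lemma rho_lt (e : R) : 0 < e -> \forall n \near ultraset w, rho n < e.
Proof.
by move=> e0; exact: (cvgr_lt 0 (@inf_cvg0 _ _ rho)).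
Qed.

Lemma rho_expn N n : 0 < rho n ^+ N.
Proof. by rewrite exprn_gt0 // inf_gt0. Qed.

Lemma hyper_reprB (s t : hyperC R w) :
  \forall n \near ultraset w, repr (s - t) n = repr s n - repr t n.
Proof.
have -> : s - t = hyper_class w (repr s - repr t).
  by rewrite /hyper_class rmorphB /= !reprK.
exact: hyper_reprE.
Qed.

Lemma hyper_reprM (s t : hyperC R w) :
  \forall n \near ultraset w, repr (s * t) n = repr s n * repr t n.
Proof.
have -> : s * t = hyper_class w (repr s * repr t).
  by rewrite /hyper_class rmorphM /= !reprK.
exact: hyper_reprE.
Qed.

Lemma hyper_repr1 : \forall n \near ultraset w, repr (1 : hyperC R w) n = 1.
Proof.
have -> : 1 = hyper_class w (1 : nat -> C) by rewrite /hyper_class rmorph1.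
exact: hyper_reprE.
Qed.

Lemma cabsB (a b : C) : cabs (a - b) <= cabs a + cabs b.
Proof.
rewrite -(@normcN R b); exact: (@le_normcD R).
Qed.

Lemma cabs_ge0 (a : C) : 0 <= cabs a.
Proof. by case: a => a b; rewrite sqrtr_ge0. Qed.

Lemma moderate_closed : subring_closed moderate.
Proof.
split.
- apply/asboolP; exists 1%N.
  apply: filterS2 hyper_repr1 (rho_lt ltr01) => n -> r1.
  by rewrite Normc.normc1 expr1 invf_gt1 // inf_gt0.
- move=> s t /asboolP [M hM] /asboolP [N hN]; apply/asboolP.
  exists (maxn M N).+1.
  near=> n.
  have -> : repr (s - t) n = repr s n - repr t n.
    by near: n; exact: hyper_reprB.
  have r0 := inf_gt0 rho n.
  have r2 : rho n < 2^-1 by near: n; apply: rho_lt; rewrite invr_gt0.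
  have r1 : rho n < 1 by rewrite (lt_le_trans r2) // invf_le1 // ler1n.
  apply: (le_lt_trans (cabsB _ _)).
  have hs : cabs (repr s n) < rho n ^- maxn M N.
    apply: (@lt_le_trans _ _ (rho n ^- M)); first by near: n.
    by rewrite lef_pV2 ?posrE ?rho_expn // ler_wiXn2l ?leq_maxl // ltW.
  have ht : cabs (repr t n) < rho n ^- maxn M N.
    apply: (@lt_le_trans _ _ (rho n ^- N)); first by near: n.
    by rewrite lef_pV2 ?posrE ?rho_expn // ler_wiXn2l ?leq_maxr // ltW.
  apply: (lt_le_trans (ltrD hs ht)).
  rewrite exprS invfM -mulr2n -mulr_natl.
  apply: ler_wpM2r; first by rewrite invr_ge0 ltW ?rho_expn.
  by rewrite -[X in X <= _]invrK lef_pV2 ?posrE ?invr_gt0 // ltW.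
- move=> s t /asboolP [M hM] /asboolP [N hN]; apply/asboolP.
  exists (M + N)%N; apply: filterS3 hM hN (hyper_reprM s t) => n hs ht ->.
  by rewrite Normc.normcM exprD invfM ltr_pM ?cabs_ge0.
Unshelve. all: by end_near. Qed.

HB.instance Definition _ :=
  GRing.isSubringClosed.Build (hyperC R w) moderate moderate_closed.

Record robinson0 := Robinson0 { rob0_val :> hyperC R w; _ : rob0_val \in moderate }.
HB.instance Definition _ := [isSub for rob0_val].
HB.instance Definition _ := [Choice of robinson0 by <:].
HB.instance Definition _ := [SubChoice_isSubComNzRing of robinson0 by <:].

Definition rob_negl : {pred hyperC R w} := fun t =>
  `[< forall N : nat, \forall n \near ultraset w, cabs (repr t n) < rho n ^+ N >].

Lemma hyper_repr0 : \forall n \near ultraset w, repr (0 : hyperC R w) n = 0.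
Proof.
have -> : 0 = hyper_class w (0 : nat -> C) by rewrite /hyper_class rmorph0.
exact: hyper_reprE.
Qed.

Lemma hyper_reprD (s t : hyperC R w) :
  \forall n \near ultraset w, repr (s + t) n = repr s n + repr t n.
Proof.
have -> : s + t = hyper_class w (repr s + repr t).
  by rewrite /hyper_class rmorphD /= !reprK.
exact: hyper_reprE.
Qed.

Lemma rob_negl0 : 0 \in rob_negl.
Proof.
apply/asboolP => N; apply: filterS hyper_repr0 => n ->.
by rewrite Normc.normc0 rho_expn.
Qed.

Lemma rob_negl1 : 1 \notin rob_negl.
Proof.
apply/negP => /asboolP /(_ 0%N) h.
have /filter_ex [] // : \forall n \near ultraset w, False.
apply: filterS2 h hyper_repr1 => n + e.
by rewrite e Normc.normc1 expr0 ltxx.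
Qed.

Lemma rob_neglD s t : s \in rob_negl -> t \in rob_negl ->
  s + t \in rob_negl.
Proof.
move=> /asboolP hs /asboolP ht; apply/asboolP => N.
have r12 : 0 < 2^-1 :> R by rewrite invr_gt0.
apply: filterS (filterI (filterI (hs N.+1) (ht N.+1))
  (filterI (rho_lt r12) (hyper_reprD s t))) => n [[h1 h2] [r2 ->]].
apply: (le_lt_trans (@le_normcD R _ _)); apply: (lt_le_trans (ltrD h1 h2)).
rewrite exprS -mulrDl -[X in _ <= X]mul1r.
apply: ler_wpM2r; first by rewrite ltW ?rho_expn.
lra.
Qed.

Lemma rob_neglM a s : a \in moderate -> s \in rob_negl ->
  a * s \in rob_negl.
Proof.
move=> /asboolP [M hM] /asboolP hs; apply/asboolP => N.
apply: filterS3 hM (hs (M + N)%N) (hyper_reprM a s) => n h1 h2 ->.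
have -> : rho n ^+ N = rho n ^- M * rho n ^+ (M + N).
  by rewrite exprD mulrA mulVf ?mul1r // gt_eqF ?rho_expn.
by rewrite Normc.normcM ltr_pM ?cabs_ge0.
Qed.

Definition negl_rob : {pred robinson0} := fun t => val t \in rob_negl.

Lemma negl_robE t : (t \in negl_rob) = (val t \in rob_negl).
Proof. by []. Qed.

Lemma negl_rob_closed : idealr_closed negl_rob.
Proof.
split; rewrite ?negl_robE.
- by rewrite rmorph0 rob_negl0.
- by rewrite rmorph1 rob_negl1.
- move=> a s t; rewrite !negl_robE rmorphD rmorphM => hs ht.
  by rewrite rob_neglD // rob_neglM // (valP a).
Qed.

HB.instance Definition _ :=
  isIdealr.Build robinson0 negl_rob negl_rob_closed.

Definition robinson := {ideal_quot negl_rob}.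
HB.instance Definition _ := GRing.ComNzRing.on robinson.

Lemma moderateP (u : nat -> C) :
  (hyper_class w u \in moderate) <->
  exists N : nat, \forall n \near ultraset w, cabs (u n) < rho n ^- N.
Proof.
split=> [/asboolP [N h]|[N h]]; last apply/asboolP; exists N;
  by apply: filterS2 h (hyper_reprE w u) => n + e; rewrite e.
Qed.

Definition robinson_inv (x : robinson) : robinson := xget 0 [set y | y * x = 1].

Lemma robinson_inv0 : robinson_inv 0 = 0.
Proof.
rewrite /robinson_inv; case: xgetP => // y _ /= /esym/eqP.
by rewrite mulr0 oner_eq0.
Qed.

Lemma robinson_mulVf (x : robinson) : x != 0 -> robinson_inv x * x = 1.
Proof.
elim/quotW: x => t t0.
have /existsNP [N hN] : ~ forall N : nat,
    \forall n \near ultraset w, cabs (repr (val t) n) < rho n ^+ N.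
  move=> h; case/negP: t0; rewrite -(rmorph0 (\pi_robinson)%qT).
  by rewrite -Quotient.idealrBE subr0 negl_robE; apply/asboolP.
have {}hN : \forall n \near ultraset w, ~ cabs (repr (val t) n) < rho n ^+ N.
  by case: (@in_ultra_setVsetC _ _ [set n | cabs (repr (val t) n) < rho n ^+ N]
    (ultra_ultra w)).
pose u n := (repr (val t) n)^-1.
have um : hyper_class w u \in moderate.
  apply/moderateP; exists N.+1; apply: filterS2 hN (rho_lt ltr01) => n.
  move=> /negP; rewrite -leNgt => h r1; rewrite Normc.normcV.
  apply: (@le_lt_trans _ _ (rho n ^- N)).
    by rewrite lef_pV2 ?posrE ?rho_expn // (lt_le_trans _ h) ?rho_expn.
  rewrite ltf_pV2 ?posrE ?rho_expn // exprS gtr_pMl ?rho_expn //.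
apply: (@xgetPex _ 0 [set y | y * _ = 1]).
exists (\pi_robinson (Robinson0 um))%qT => /=.
rewrite -rmorphM -(rmorph1 (\pi_robinson)%qT); congr (\pi_robinson _)%qT.
apply: val_inj; rewrite rmorphM rmorph1 /= -[rob0_val t]reprK.
rewrite /hyper_class -rmorphM -(rmorph1 (\pi_(hyperC R w))%qT); apply/eqP.
rewrite -Quotient.idealrBE; apply/asboolP; apply: filterS hN => n /negP.
rewrite -leNgt => h.
rewrite -[LHS]/(u n * repr (val t) n - 1) /u mulVf ?subrr //.
apply/eqP => e; move: h; rewrite e Normc.normc0 leNgt rho_expn //.
Qed.

HB.instance Definition _ :=
  GRing.ComNzRing_isField.Build robinson robinson_mulVf robinson_inv0.

(* A sequence representing x. *)
Definition rep (x : robinson) : nat -> C := repr (val (repr x)).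

Lemma moderate_le (u v : nat -> C) :
  (\forall n \near ultraset w, cabs (u n) <= cabs (v n)) ->
  hyper_class w v \in moderate -> hyper_class w u \in moderate.
Proof.
move=> h /moderateP [N hv]; apply/moderateP; exists N.
by apply: filterS2 h hv => n; exact: le_lt_trans.
Qed.

Lemma cabs_real (a : R) : cabs a%:C = `|a|.
Proof. by rewrite /= expr0n addr0 sqrtr_sqr. Qed.

Lemma cabsX (a : C) n : cabs (a ^+ n) = cabs a ^+ n.
Proof.
elim: n => [|n ih]; first by rewrite !expr0 Normc.normc1.
by rewrite !exprS Normc.normcM ih.
Qed.

Lemma cabs_sum n (F : 'I_n -> C) : cabs (\sum_i F i) <= \sum_i cabs (F i).
Proof.
elim/big_ind2 : _ => [|x a y b ha hb|//]; first by rewrite Normc.normc0.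
exact: le_trans (@le_normcD R _ _) (lerD ha hb).
Qed.

Lemma monic_root_bound (n : nat) (P : 'I_n -> C) (z : C) :
  (0 < n)%N -> z ^+ n = \sum_i P i * z ^+ i ->
  cabs z <= 1 + \sum_i cabs (P i).
Proof.
move=> n0 e; have S0 : 0 <= \sum_i cabs (P i).
  by apply: sumr_ge0 => i _; exact: cabs_ge0.
have [z1|z1] := leP (cabs z) 1; first by rewrite (le_trans z1) // lerDl.
apply: (@le_trans _ _ (\sum_i cabs (P i))); last by rewrite lerDr.
have zn0 : 0 < cabs z ^+ n.-1 by rewrite exprn_gt0 // (lt_trans ltr01).
have en : cabs z * cabs z ^+ n.-1 = cabs (\sum_i P i * z ^+ i).
  by rewrite -e cabsX -exprS prednK.
rewrite -(ler_pM2r zn0) en.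
apply: (le_trans (cabs_sum _)); rewrite mulr_suml; apply: ler_sum => i _.
rewrite Normc.normcM cabsX ler_wpM2l ?cabs_ge0 // ler_weXn2l ?ltW //.
by rewrite -ltnS prednK.
Qed.

Lemma robinson_closed : GRing.closed_field_axiom robinson.
Proof.
move=> n P n0.
have root k : exists z : C, z ^+ n = \sum_(i < n) rep (P i) k * z ^+ i.
  have [z ez] := @solve_monicpoly C n (fun i => rep (P i) k) n0.
  by exists z.
pose z k := projT1 (cid (root k)).
have zE k : z k ^+ n = \sum_(i < n) rep (P i) k * z k ^+ i := projT2 (cid (root k)).
pose b : nat -> C := 1 + \sum_(i < n) (fun k => (cabs (rep (P i) k))%:C).
have bm : hyper_class w b \in moderate.
  rewrite /hyper_class rmorphD rmorph1 rmorph_sum rpredD ?rpred1 //.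
  apply: rpred_sum => i _; apply: (@moderate_le _ (rep (P i))).
    by apply: nearW => k; rewrite cabs_real ger0_norm ?cabs_ge0.
  by rewrite /hyper_class reprK; exact: valP (repr (P i)).
have zm : hyper_class w z \in moderate.
  apply: moderate_le bm; apply: nearW => k.
  apply: (le_trans (monic_root_bound n0 (zE k))).
  rewrite -[b k]/(1 + (\sum_(i < n) (fun k => (cabs (rep (P i) k))%:C)) k).
  rewrite fct_sumE -(rmorph_sum (real_complex R)) -(rmorph1 (real_complex R)) -rmorphD.
  by rewrite cabs_real ler_norm.
exists (\pi_robinson (Robinson0 zm))%qT.
under eq_bigr do rewrite -[P _]reprK.
rewrite -rmorphXn; under eq_bigr do rewrite -rmorphXn -rmorphM.
rewrite -rmorph_sum; congr (\pi_robinson _)%qT; apply: val_inj.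
rewrite rmorphXn rmorph_sum.
have vE i : val (repr (P i)) = hyper_class w (rep (P i)).
  by rewrite /hyper_class reprK.
transitivity (\sum_(i < n) hyper_class w (rep (P i)) * hyper_class w z ^+ i); last first.
  by apply: eq_bigr => i _; rewrite rmorphM rmorphXn -vE.
change (hyper_class w z ^+ n =
  \sum_(i < n) hyper_class w (rep (P i)) * hyper_class w z ^+ i).
rewrite /hyper_class -rmorphXn; under eq_bigr do rewrite -rmorphXn -rmorphM.
rewrite -rmorph_sum; congr (\pi_(hyperC R w) _)%qT; apply/funext => k.
rewrite fct_sumE exprfctE zE; apply: eq_bigr => i _.
by rewrite -[RHS]/(rep (P i) k * (z ^+ i) k) exprfctE.
Qed.

HB.instance Definition _ := Field_isAlgClosed.Build robinson robinson_closed.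

End Robinson.

Section RobinsonAbs.
Variables (R : realType) (w : free_ultrafilter) (rho : infinitesimal R w).
Local Notation C := R[i].

Definition robinson_abs (x : robinson rho) : R :=
  if x == 0 then 0
  else expR (- lim ((fun n => ln (cabs (rep x n)) / ln (rho n)) @ ultraset w)).

Definition represents (x : robinson rho) (u : nat -> C) : Prop :=
  exists2 t : robinson0 rho, val t = hyper_class w u & (\pi_(robinson rho) t)%qT = x.

(* Junk unless u is moderate. *)
Definition of_seq (u : nat -> C) : robinson rho :=
  (\pi_(robinson rho) (insubd 0 (hyper_class w u)))%qT.

Lemma represents_rep x : represents x (rep x).
Proof. by exists (repr x); rewrite /hyper_class !reprK. Qed.

Lemma of_seqP (u : nat -> C) : hyper_class w u \in moderate rho ->
  represents (of_seq u) u.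
Proof. by move=> h; exists (insubd 0 (hyper_class w u)); rewrite ?insubdK. Qed.

Definition max_modulus d (v : coefs R d) : R :=
  \big[Num.max/0]_(i < d.+1) Num.max (cabs (v.1 0 i)) (cabs (v.2 0 i)).

(* The coefficients c n have largest modulus 1; they are determined by f n up to
   a common factor of modulus 1, which does not affect the quotient. *)
Definition assoc_map d (f : nat -> RatMap R d) : {fraction {poly robinson rho}} :=
  let c n := ((max_modulus (rat_coefs (f n)))%:C)^-1 *: rat_coefs (f n) in
  let P := \poly_(i < d.+1) of_seq (fun n => (c n).1 0 (inord i)) in
  let Q := \poly_(i < d.+1) of_seq (fun n => (c n).2 0 (inord i)) in
  FracField.tofrac P / FracField.tofrac Q.

End RobinsonAbs.

Section Berkovich.
Variables (R : realType) (K : closedFieldType) (absK : K -> R).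

Record A1Berk := A1BerkPoint {
  snorm :> {poly K} -> R;
  snorm_ge0 : forall g, 0 <= snorm g;
  snormC : forall c, snorm c%:P = absK c;
  snormM : forall g h, snorm (g * h) = snorm g * snorm h;
  snormD : forall g h, snorm (g + h) <= snorm g + snorm h }.

(* Type I points. The remaining point of P^1(K), infinity, is not in A1Berk. *)
Definition type1 (x : A1Berk) : Prop :=
  exists a : K, forall g, x g = absK g.[a].

Definition HBerk := {x : A1Berk | ~ type1 x}.

Definition hsnorm (x : HBerk) : {poly K} -> R := proj1_sig x.

(* The extension of x to K(T); a point which is not of type I is a norm, since K
   is algebraically closed, so the denominator does not vanish. *)
Definition frac_norm (x : HBerk) (phi : {fraction {poly K}}) : R :=
  hsnorm x (val (repr phi)).1 / hsnorm x (val (repr phi)).2.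

Definition comp_frac (g : {poly K}) (phi : {fraction {poly K}}) :
    {fraction {poly K}} :=
  (map_poly (@FracField.tofrac {poly K} \o polyC) g).[phi].

(* The image of x under phi is g |-> |g o phi|_x. *)
Definition is_berk_map (phi : {fraction {poly K}}) (B : HBerk -> HBerk) : Prop :=
  forall x g, hsnorm (B x) g = frac_norm x (comp_frac g phi).

Definition cball (p : K) (r : R) : set K := [set z | absK (z - p) <= r].

Definition ball_norm (p : K) (r : R) (g : {poly K}) : R :=
  sup [set absK g.[z] | z in cball p r].

Definition is_ball_point (x : HBerk) (p : K) (r : R) : Prop :=
  0 < r /\ forall g, hsnorm x g = ball_norm p r g.

Definition ball_dist (p : K) (r : R) (q : K) (s : R) : R :=
  2 * ln (Num.max (Num.max r s) (absK (p - q))) - ln r - ln s.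

(* x is the limit of a decreasing sequence of balls. The sequence may be constant
   when x corresponds to a ball; for type IV points the intersection is empty. *)
Definition nested_to (x : HBerk) (p : nat -> K) (r : nat -> R) : Prop :=
  [/\ forall i, 0 < r i,
      forall i, cball (p i.+1) (r i.+1) `<=` cball (p i) (r i) &
      forall g, (fun i => ball_norm (p i) (r i) g) @ \oo --> hsnorm x g].

(* The extension by continuity of ball_dist to all of HBerk. *)
Definition berk_dist (x y : HBerk) : R :=
  xget 0 [set l : R | exists p r q s, [/\ nested_to x p r, nested_to y q s &
    (fun i => ball_dist (p i) (r i) (q i) (s i)) @ \oo --> l]].

End Berkovich.

Section Phi.
Variables (R : realType) (w : free_ultrafilter) (rho : infinitesimal R w).
Variable r : nat -> R.
Local Notation C := R[i].
Local Notation K := (robinson rho).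
Local Notation absK := (@robinson_abs R w rho).

Definition affine_mx (a b : C) : 'M[C]_2 :=
  \matrix_(i, j) if i == 0 then (if j == 0 then a else b) else (j == 1)%:R.

Definition is_chart (x : HBerk absK) (a b : K) : Prop :=
  exists p s, is_ball_point x p s /\
    [set a * z + b | z in cball absK 0 1] = cball absK p s.

(* Phi x = [(M_n(0))] for every choice of M and of representatives of a and b,
   at least one such M existing. As a <> 0, M_n is invertible for almost all n
   only, so [(M_n(0))] is the class of any bounded sequence y that agrees with it
   almost surely. *)
Definition is_Phi (Phi : HBerk absK -> cone w r) : Prop :=
  forall x, (exists a b, is_chart x a b) /\
  forall a b (a_ b_ : nat -> C), is_chart x a b ->
    represents a a_ -> represents b b_ ->
    exists2 y : bseq r,
      \forall n \near ultraset w,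
        a_ n != 0 /\ y n = mobH (affine_mx (a_ n) (b_ n)) (H3o R) &
      Phi x = cone_class w y.

End Phi.

Lemma free_oo (w : free_ultrafilter) : \oo `<=` ultraset w.
Proof.
move=> A [N _ hN]; apply: filterS hN _.
elim: N => [|N ih]; first by apply: nearW.
have hN : ultraset w (~` [set N]).
  case: (@in_ultra_setVsetC _ _ [set N] (ultra_ultra w)) => // /ultra_free [].
apply: filterS2 ih hN => n /= h1 /eqP h2.
by rewrite ltn_neqAle eq_sym h2.
Qed.

Section Scale.
Variables (R : realType) (w : free_ultrafilter) (r : nat -> R).

Lemma exp_scale_gt0 n : 0 < expR (- r n).
Proof. exact: expR_gt0. Qed.

Lemma exp_scale_cvg : r @ \oo --> +oo ->
  (fun n => expR (- r n)) @ ultraset w --> (0 : R).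
Proof.
move=> roo; apply: (@cvg_trans _ ((fun n => expR (- r n)) @ \oo)).
  by move=> A; exact: free_oo.
exact: (cvg_comp _ _ roo (@cvgr_expR R)).
Qed.

Definition exp_scale (roo : r @ \oo --> +oo) : infinitesimal R w :=
  Infinitesimal exp_scale_gt0 (exp_scale_cvg roo).

End Scale.

(* Main.v *)
(* A point x of H^3 is encoded by a positive Hermitian form of determinant 1 on C^2, and
   E f (x) is the point at which the lift of f to C^2, read in a frame of x, is balanced.
   Replace the integral over the sphere by a sum over the points z + j t, j = 0, ..., d: the
   Gram matrix of the pair (P, Q) for the norm sum_j |p(z + j t)|^2 is again a point of
   H^3, at a distance from E f (z, t) bounded in terms of d only. Over the Robinson field,
   the norm attached to the ball B(b, |a|) is p |-> max_j |p(b + j a)|, because integers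
   have absolute value 1. Hence the ultralimit of the Gram points gives the centre and
   the radius of the image of B(b, |a|), and this is the conjugacy.

   The Robinson field is spherically complete with value group R_{>0}, so every point of
   its hyperbolic Berkovich space is a ball. Hyperbolic distance in the upper half-space is
   2 ln max(t, s, |z - u|) - ln t - ln s up to a bounded error, so Phi is an isometry.

   For r_n -> oo: a limit of normalized coefficients of a degenerating sequence has a
   common zero v, of order k > 0. If E f_n took the value 0 nowhere in the small
   half-ball at v, then the vector field whose zeros are the preimages of 0 would lift to
   a nonvanishing map to C^2, although its rim winds k times. So there are preimages of 0
   tending to v, at distances tending to infinity. *)
Require Import Defs.
From HB Require Import structures.
From mathcomp Require Import all_boot all_order all_algebra closed_field.
From mathcomp Require Import complex.
From mathcomp Require Import all_classical all_reals all_analysis.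
From mathcomp Require Import measurable_realfun.
From mathcomp Require Import ring lra.

Set Implicit Arguments.
Unset Strict Implicit.
Unset Printing Implicit Defensive.

Import Order.TTheory GRing.Theory Num.Theory.
Import numFieldNormedType.Exports.

Local Open Scope classical_set_scope.
Local Open Scope ring_scope.

(** * Hermitian forms and points of hyperbolic space *)

Section ComplexReal.
Variable R : realType.
Local Notation C := R[i].
Local Notation Re := complex.Re.
Local Notation Im := complex.Im.
Implicit Types (z w : C) (x y : H3 R).

(** The barycentre minimizes the average of the Busemann functions, which are the logarithms
    [ln (form y)]. This average is convex. If no small cap carries a quarter of the mass in the
    frame of a point, the average exceeds its value there outside a ball whose radius depends only
    on the cap size, so the barycentre lies in that ball. The Gram point has such a frame: there P
    and Q become orthogonal of equal norm at the nodes, and a combination that is small on much of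
    the sphere would, by interpolation, be small at the nodes. The Gram form at (k, 1) is, up to a
    factor, the norm of P - k Q. In the ultralimit this is an identity between the Gauss norms of P
    - k Q and of Q, and it determines the Berkovich image because a test polynomial splits into
    linear factors. The scale enters twice. The Gram point moves at most polynomially in the cosh of
    the distance, and some point at distance r_n goes to the centre; so E f_n displaces the centre
    by O(1 + r_n) and acts on bounded sequences. Moreover r_n -> oo erases all bounded errors. *)

Definition nsq (z : C) : R := Re z ^+ 2 + Im z ^+ 2.

Lemma nsqE z : nsq z = cabs z ^+ 2.
Proof. by rewrite cabs2E. Qed.

Lemma nsq_ge0 z : 0 <= nsq z.
Proof. by rewrite addr_ge0 ?sqr_ge0. Qed.

Lemma nsq0 : nsq 0 = 0.
Proof. by rewrite /nsq /= expr0n /= addr0. Qed.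

Lemma nsq1 : nsq 1 = 1.
Proof. by rewrite /nsq /= expr0n expr1n /= addr0. Qed.

Lemma nsq_eq0 z : (nsq z == 0) = (z == 0).
Proof.
by case: z => a b; rewrite /nsq /= paddr_eq0 ?sqr_ge0 // !sqrf_eq0 eq_complex.
Qed.

Lemma nsq_gt0 z : (0 < nsq z) = (z != 0).
Proof. by rewrite lt_def nsq_ge0 andbT nsq_eq0. Qed.

Lemma nsqM z w : nsq (z * w) = nsq z * nsq w.
Proof. by case: z => a b; case: w => c d; rewrite /nsq /=; ring. Qed.

Lemma nsqN z : nsq (- z) = nsq z.
Proof. by case: z => a b; rewrite /nsq /= !sqrrN. Qed.

Lemma nsqV z : nsq z^-1 = (nsq z)^-1.
Proof.
have [->|z0] := eqVneq z 0; first by rewrite invr0 nsq0 invr0.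
apply: (@mulfI _ (nsq z)); first by rewrite nsq_eq0.
by rewrite -nsqM divff // nsq1 divff // nsq_eq0.
Qed.

Lemma nsq_real (a : R) : nsq a%:C%C = a ^+ 2.
Proof. by rewrite /nsq /= expr0n addr0. Qed.

Lemma nsqX z n : nsq (z ^+ n) = nsq z ^+ n.
Proof. by elim: n => [|n ih]; rewrite ?expr0 ?nsq1 // !exprS nsqM ih. Qed.

Lemma nsqD_le z w : nsq (z + w) <= 2 * nsq z + 2 * nsq w.
Proof.
case: z => a b; case: w => c d; rewrite /nsq /=.
have := sqr_ge0 (a - c); have := sqr_ge0 (b - d); nra.
Qed.

(* Homogeneous coordinates [v.1 : v.2] on the sphere, and its coordinates in R^3. *)
Definition n2 (v : C * C) : R := nsq v.1 + nsq v.2.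
Definition S1 (v : C * C) : R := 2 * (Re v.1 * Re v.2 + Im v.1 * Im v.2).
Definition S2 (v : C * C) : R := 2 * (Im v.1 * Re v.2 - Re v.1 * Im v.2).
Definition S3 (v : C * C) : R := nsq v.1 - nsq v.2.

Definition Sv (j : 'I_3) (v : C * C) : R := nth 0 [:: S1 v; S2 v; S3 v] j.

Lemma n2_ge0 v : 0 <= n2 v.
Proof. by rewrite addr_ge0 ?nsq_ge0. Qed.

Lemma n2_gt0 v : (0 < n2 v) = (v != 0).
Proof.
case: v => a b; rewrite /n2 lt_def addr_ge0 ?nsq_ge0 // andbT.
by rewrite paddr_eq0 ?nsq_ge0 //= !nsq_eq0 -xpair_eqE.
Qed.

Lemma S_sqr v : S1 v ^+ 2 + S2 v ^+ 2 + S3 v ^+ 2 = n2 v ^+ 2.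
Proof. by case: v => -[a b] [c d]; rewrite /S1 /S2 /S3 /n2 /nsq /=; ring. Qed.

Lemma S3_ord (P : 'I_3 -> Prop) :
  (forall j, P j) <-> [/\ P ord0, P (inord 1) & P (inord 2)].
Proof.
split=> [h|[h0 h1 h2]]; first by split.
case=> -[|[|[|//]]] lt.
- by have -> : Ordinal lt = ord0 by exact: val_inj.
- by have -> : Ordinal lt = inord 1 by apply: val_inj; rewrite /= inordK.
- by have -> : Ordinal lt = inord 2 by apply: val_inj; rewrite /= inordK.
Qed.

Definition mulv (M : 'M[C]_2) (v : C * C) : C * C :=
  (M 0 0 * v.1 + M 0 1 * v.2, M 1 0 * v.1 + M 1 1 * v.2).

Lemma det2 (M : 'M[C]_2) : \det M = M 0 0 * M 1 1 - M 0 1 * M 1 0.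
Proof.
rewrite (expand_det_row _ ord0) !big_ord_recl big_ord0 addr0 /cofactor !det_mx11.
rewrite !mxE /= expr0 mul1r expr1 mulN1r mulrN.
by congr (M _ _ * M _ _ - M _ _ * M _ _); apply: val_inj.
Qed.

Lemma mulv_eq0 M v : \det M != 0 -> mulv M v = 0 -> v = 0.
Proof.
rewrite det2; case: v => a b; rewrite /mulv /= => d [] /eqP + /eqP +.
rewrite !addr_eq0 => /eqP e1 /eqP e2.
have ha : (M 0 0 * M 1 1 - M 0 1 * M 1 0) * a = 0.
  rewrite mulrBl mulrAC e1 -(mulrA _ (M 1 0)) e2; ring.
have hb : (M 0 0 * M 1 1 - M 0 1 * M 1 0) * b = 0.
  have {}e1 : M 0 0 * a = - (M 0 1 * b) by [].
  transitivity (M 0 0 * (M 1 0 * a + M 1 1 * b) - M 1 0 * (M 0 0 * a + M 0 1 * b)).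
    ring.
  by rewrite e1 e2; ring.
move/eqP: ha; rewrite mulf_eq0 (negbTE d) /= => /eqP ->.
by move/eqP: hb; rewrite mulf_eq0 (negbTE d) /= => /eqP ->.
Qed.

Lemma mulv_surj (M : 'M[C]_2) (v : C * C) : \det M = 1 -> exists w : C * C, v = mulv M w.
Proof.
rewrite det2 => d1; exists (M 1 1 * v.1 - M 0 1 * v.2, M 0 0 * v.2 - M 1 0 * v.1).
case: v => a b; rewrite /mulv /=; congr (_, _).
  by rewrite -[LHS]mul1r -d1; ring.
by rewrite -[LHS]mul1r -d1; ring.
Qed.

Definition hz x : C := (val x).1.
Definition ht x : R := (val x).2.

Lemma ht_gt0 x : 0 < ht x. Proof. exact: valP x. Qed.

(* The positive definite Hermitian form of determinant 1 attached to a point. *)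
Definition form x (v : C * C) : R :=
  (nsq (v.1 - hz x * v.2) + ht x ^+ 2 * nsq v.2) / ht x.

Lemma form0 v : form (H3o R) v = n2 v.
Proof. by rewrite /form /hz /ht /= mul0r subr0 expr1n mul1r divr1. Qed.

Lemma h3_ext x y : hz x = hz y -> ht x = ht y -> x = y.
Proof.
by move=> h1 h2; apply: val_inj; rewrite [LHS]surjective_pairing [RHS]surjective_pairing; congr (_, _).
Qed.

(** The vector (1, 0) reads off the height; the vector ([hz y], 1), at which the first term of
    [form y] vanishes, then reads off the other coordinate. *)
Lemma form_inj x y : (forall v, form x v = form y v) -> x = y.
Proof.
have tx := ht_gt0 x; have ty := ht_gt0 y.
have txn : ht x != 0 by rewrite gt_eqF. have tyn : ht y != 0 by rewrite gt_eqF.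
move=> h; have e : ht x = ht y.
  have := h (1, 0); rewrite /form /= !mulr0 !subr0 nsq1 nsq0 !mulr0 !addr0 !mul1r.
  by move/invr_inj.
apply: h3_ext => //.
have := h (hz y, 1); rewrite /form /= !mulr1 subrr nsq0 nsq1 add0r !mulr1 e.
move/(mulIf (invr_neq0 tyn)) => h2; have /eqP : nsq (hz y - hz x) = 0 by lra.
by rewrite nsq_eq0 subr_eq0 => /eqP.
Qed.

Lemma hcoshE x y : hcosh x y = (nsq (hz x - hz y) + ht x ^+ 2 + ht y ^+ 2) / (2 * ht x * ht y).
Proof.
have := ht_gt0 x; have := ht_gt0 y.
case: x => -[z t] /= t0; case: y => -[u s] /= s0; rewrite /hcosh /hz /ht /= -nsqE => sp tp.
by field; rewrite !gt_eqF.
Qed.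

Lemma form_gt0 x v : v != 0 -> 0 < form x v.
Proof.
move=> v0; rewrite divr_gt0 ?ht_gt0 // lt_def.
have h0 : 0 <= ht x ^+ 2 * nsq v.2 by rewrite mulr_ge0 ?sqr_ge0 ?nsq_ge0.
rewrite (addr_ge0 (nsq_ge0 _) h0) andbT; apply: contra v0.
rewrite paddr_eq0 ?nsq_ge0 // => /andP[].
rewrite mulf_eq0 sqrf_eq0 (gt_eqF (ht_gt0 x)) /= !nsq_eq0 => /[swap] /eqP.
by case: v {h0} => a b /= ->; rewrite mulr0 subr0 => /eqP ->.
Qed.

Lemma mk_h3_subproof (p r : R) : 0 < p -> 0 < p^-1. Proof. by rewrite invr_gt0. Qed.

(* The point whose form is [p|v1|^2 + 2 Re(q v2 conj(v1)) + r|v2|^2], p r - |q|^2 = 1. *)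
Definition form_pt (p : R) (q : C) (hp : 0 < p) : H3 R :=
  exist _ (- q / p%:C%C, p^-1) (mk_h3_subproof 0 hp).

Lemma form_ptE (p r : R) (q : C) (hp : 0 < p) v : p * r - nsq q = 1 ->
  form (form_pt q hp) v =
  p * nsq v.1 + 2 * (Re v.1 * Re (q * v.2) + Im v.1 * Im (q * v.2)) + r * nsq v.2.
Proof.
move=> h; have pn : p != 0 by rewrite gt_eqF.
have -> : r = (1 + nsq q) / p by rewrite -h; field.
have -> : form (form_pt q hp) v = p * (nsq (v.1 + q * v.2 * (p^-1)%:C%C) + p ^- 2 * nsq v.2).
  rewrite /form /hz /ht /= invrK mulrC exprVn; congr (_ * (nsq _ + _)).
  rewrite mulNr mulNr opprK; congr (_ + _).
  rewrite -(rmorphV (real_complex R)) ?unitfE //; ring.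
case: v => -[a b] [c d]; case: q {h} => q1 q2; rewrite /nsq /=; field.
exact: pn.
Qed.

(** This is the hyperboloid model: n2, S1, S2, S3 form a basis of the Hermitian forms, and the
    determinant is c^2 - |b|^2. The coefficient of |v1|^2 is c + b3, positive because (c + b3) (c -
    b3) is at least 1. *)
Lemma form_pt_exists (c b1 b2 b3 : R) : 0 < c -> c ^+ 2 - (b1 ^+ 2 + b2 ^+ 2 + b3 ^+ 2) = 1 ->
  exists y, forall v, form y v = c * n2 v + b1 * S1 v + b2 * S2 v + b3 * S3 v.
Proof.
move=> c0 h; have hp : 0 < c + b3.
  have h1 : 0 < (c + b3) * (c - b3) by nra.
  by nra.
exists (form_pt (b1 +i* b2)%C hp) => v; rewrite (@form_ptE _ (c - b3)); last first.
  by rewrite /nsq /=; nra.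
by case: v => -[x1 x2] [y1 y2]; rewrite /n2 /S1 /S2 /S3 /nsq /=; ring.
Qed.

Lemma mulcJ z : z * conjc z = (nsq z)%:C%C.
Proof. by case: z => a b; rewrite /nsq; simpc; congr (_ +i* _)%C; ring. Qed.

Definition qden (M : 'M[C]_2) x : R := nsq (M 1 0 * hz x + M 1 1) + nsq (M 1 0) * ht x ^+ 2.

Lemma qden_gt0 M x : \det M != 0 -> 0 < qden M x.
Proof.
move=> d0; rewrite lt_def.
have h0 : 0 <= nsq (M 1 0) * ht x ^+ 2 by rewrite mulr_ge0 ?sqr_ge0 ?nsq_ge0.
rewrite (addr_ge0 (nsq_ge0 _) h0) andbT.
apply: contra d0; rewrite paddr_eq0 ?nsq_ge0 //.
rewrite mulf_eq0 sqrf_eq0 (gt_eqF (ht_gt0 x)) orbF !nsq_eq0 det2 => /andP[+ /eqP c0].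
by rewrite c0 mul0r add0r => /eqP ->; rewrite !mulr0 subr0.
Qed.

Lemma mobH_val M x : \det M != 0 ->
  hz (mobH M x) = ((M 0 0 * hz x + M 0 1) * conjc (M 1 0 * hz x + M 1 1) +
     M 0 0 * conjc (M 1 0) * (ht x ^+ 2)%:C%C) / (qden M x)%:C%C /\
  ht (mobH M x) = cabs (\det M) * ht x / qden M x.
Proof.
move=> d0; have q0 := qden_gt0 x d0; have t0 := ht_gt0 x.
have dp : 0 < cabs (\det M).
  rewrite lt_def cabs_ge0 andbT; apply: contra d0.
  by rewrite -(sqrf_eq0 (cabs _)) -nsqE nsq_eq0.
have h : 0 < cabs (\det M) * ht x / qden M x by rewrite divr_gt0 // mulr_gt0.
move: q0 h t0; rewrite /qden !nsqE /hz /ht /mobH; case: x => -[z t] /= t0 q0 h _.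
by rewrite !insubdK.
Qed.

(** Equivariance of the form under GL_2. It replaces all computations with the Poincare extension by
    linear algebra on C^2. *)
Lemma form_mobH M x v : \det M != 0 ->
  form (mobH M x) (mulv M v) = cabs (\det M) * form x v.
Proof.
move=> d0; have q0 := qden_gt0 x d0; have t0 := ht_gt0 x.
have [ez et] := mobH_val x d0.
have dp : 0 < cabs (\det M).
  rewrite lt_def cabs_ge0 andbT; apply: contra d0.
  by rewrite -(sqrf_eq0 (cabs _)) -nsqE nsq_eq0.
rewrite /form ez et.
set a := M 0 0; set b := M 0 1; set c := M 1 0; set d := M 1 1.
set z := hz x; set t := ht x; set q := qden M x; set D := \det M.
set u := v.1 - z * v.2; set X := c * z + d.
have qn : q != 0 by rewrite gt_eqF. have tn : t != 0 by rewrite gt_eqF.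
have qCn : q%:C%C != 0 by rewrite -(rmorph0 (real_complex R)) (inj_eq (@complexI R)).
have qE : q%:C%C = X * conjc X + c * conjc c * (t ^+ 2)%:C%C.
  by rewrite !mulcJ -rmorphM -rmorphD.
have DE : D = a * d - b * c by rewrite /D det2.
have e1 : (mulv M v).1 - ((a * z + b) * conjc X + a * conjc c * (t ^+ 2)%:C%C) / q%:C%C * (mulv M v).2
   = D * (conjc X * u - conjc c * (t ^+ 2)%:C%C * v.2) / q%:C%C.
  apply: (mulIf qCn); rewrite mulrBl mulrAC divfK // mulrAC divfK // /mulv /= -/a -/b -/c -/d qE DE.
  rewrite /u /X; set Y := conjc _; ring.
have e2 : (mulv M v).2 = c * u + X * v.2 by rewrite /mulv /= -/c -/d /u /X; ring.
rewrite e1 e2 !nsqM nsqV nsq_real.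
(* Multiplicativity of the quaternion norm, for the pairs (X, t c) and (u, t v2). *)
have k1 : nsq (conjc X * u - conjc c * (t ^+ 2)%:C%C * v.2) + t ^+ 2 * nsq (c * u + X * v.2) =
   q * (nsq u + t ^+ 2 * nsq v.2).
  rewrite /q /qden -/c -/d -/z -/t -/X; clearbody X u; clear -X u.
  case: X u (v.2) c => [x1 x2] [u1 u2] [w1 w2] [c1 c2].
  by rewrite /nsq /=; ring.
rewrite (nsqE D).
have -> : cabs D ^+ 2 * nsq (conjc X * u - conjc c * (t ^+ 2)%:C%C * v.2) / q ^+ 2 +
    (cabs D * t / q) ^+ 2 * nsq (c * u + X * v.2) =
    cabs D ^+ 2 / q ^+ 2 * (q * (nsq u + t ^+ 2 * nsq v.2)).
  by rewrite -k1; field.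
by field; rewrite qn tn gt_eqF.
Qed.

Lemma mobH_to0 M x v : \det M = 1 -> mobH M x = H3o R -> n2 (mulv M v) = form x v.
Proof.
move=> d1 e; have := @form_mobH M x v; rewrite d1 e form0 Normc.normc1 mul1r.
by apply; exact: oner_neq0.
Qed.

Lemma mobH_from0 M x v : \det M = 1 -> mobH M (H3o R) = x -> form x (mulv M v) = n2 v.
Proof.
move=> d1 e; have := @form_mobH M (H3o R) v; rewrite d1 e form0 Normc.normc1 mul1r.
by apply; exact: oner_neq0.
Qed.

Lemma n2_mulv_from0 M x : \det M = 1 -> (forall v, form x (mulv M v) = n2 v) ->
  mobH M (H3o R) = x.
Proof.
move=> d1 h; apply: form_inj => v; have d0 : \det M != 0 by rewrite d1 oner_neq0.
have [w ->] := mulv_surj v d1.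
by rewrite (form_mobH _ _ d0) d1 Normc.normc1 mul1r form0 h.
Qed.

Lemma n2_mulv_to0 M x : \det M = 1 -> (forall v, n2 (mulv M v) = form x v) ->
  mobH M x = H3o R.
Proof.
move=> d1 h; apply: form_inj => v; have d0 : \det M != 0 by rewrite d1 oner_neq0.
have [w ->] := mulv_surj v d1.
by rewrite (form_mobH _ _ d0) d1 Normc.normc1 mul1r form0 h.
Qed.

End ComplexReal.

(** * Continuity of real and complex maps *)

Section ContinuityCalculus.
Variables (R : realType) (X : topologicalType).
Implicit Types f g : X -> R.
Local Notation C := R[i].
Local Notation Re := complex.Re.
Local Notation Im := complex.Im.

Lemma ct_cst (a : R) : continuous (fun _ : X => a).
Proof. exact: cst_continuous. Qed.
Lemma ctD f g : continuous f -> continuous g -> continuous (fun x => f x + g x).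
Proof. by move=> cf cg x; apply: cvgD; [exact: cf|exact: cg]. Qed.
Lemma ctN f : continuous f -> continuous (fun x => - f x).
Proof. by move=> cf x; apply: cvgN; exact: cf. Qed.
Lemma ctM f g : continuous f -> continuous g -> continuous (fun x => f x * g x).
Proof. by move=> cf cg x; apply: cvgM; [exact: cf|exact: cg]. Qed.
Lemma ctX f n : continuous f -> continuous (fun x => f x ^+ n).
Proof.
move=> cf; elim: n => [|n ih]; first by under eq_fun do rewrite expr0; exact: ct_cst.
by under eq_fun do rewrite exprS; exact: ctM.
Qed.
Lemma ctV f : (forall x, f x != 0) -> continuous f -> continuous (fun x => (f x)^-1).
Proof. by move=> f0 cf x; apply: cvgV => //; exact: cf. Qed.
Lemma ctcomp (h : R -> R) f : continuous h -> continuous f -> continuous (fun x => h (f x)).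
Proof. by move=> ch cf x; apply: continuous_comp; [exact: cf|exact: ch]. Qed.

(** Continuity is stated coordinatewise, so that the calculus of real-valued functions above applies
    directly. *)
Definition ccont (f : X -> C) : Prop :=
  continuous (fun x => Re (f x)) /\ continuous (fun x => Im (f x)).

Lemma ccont_cst (a : C) : ccont (fun _ => a).
Proof. by split; exact: ct_cst. Qed.

Lemma ReD (z w : C) : Re (z + w) = Re z + Re w. Proof. by case: z; case: w. Qed.
Lemma ImD (z w : C) : Im (z + w) = Im z + Im w. Proof. by case: z; case: w. Qed.
Lemma ReN (z : C) : Re (- z) = - Re z. Proof. by case: z. Qed.
Lemma ImN (z : C) : Im (- z) = - Im z. Proof. by case: z. Qed.
Lemma ReM (z w : C) : Re (z * w) = Re z * Re w - Im z * Im w.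
Proof. by case: z; case: w. Qed.
Lemma ImM (z w : C) : Im (z * w) = Re z * Im w + Im z * Re w.
Proof. by case: z => a b; case: w => c d /=; rewrite (mulrC b). Qed.
Lemma ReJ (z : C) : Re (conjc z) = Re z. Proof. by case: z. Qed.
Lemma ImJ (z : C) : Im (conjc z) = - Im z. Proof. by case: z. Qed.

Lemma ccontD (f g : X -> C) : ccont f -> ccont g -> ccont (fun x => f x + g x).
Proof.
move=> [f1 f2] [g1 g2]; split.
  by under eq_fun do rewrite ReD; exact: ctD.
by under eq_fun do rewrite ImD; exact: ctD.
Qed.

Lemma ccontJ (f : X -> C) : ccont f -> ccont (fun x => conjc (f x)).
Proof.
move=> [f1 f2]; split; first by under eq_fun do rewrite ReJ.
by under eq_fun do rewrite ImJ; exact: ctN.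
Qed.
Lemma ccontM (f g : X -> C) : ccont f -> ccont g -> ccont (fun x => f x * g x).
Proof.
move=> [f1 f2] [g1 g2]; split.
  by under eq_fun do rewrite ReM; apply: ctD; [|apply: ctN]; exact: ctM.
by under eq_fun do rewrite ImM; apply: ctD; exact: ctM.
Qed.
Lemma ccontX (f : X -> C) n : ccont f -> ccont (fun x => f x ^+ n).
Proof.
move=> cf; elim: n => [|n ih]; first by under eq_fun do rewrite expr0; exact: ccont_cst.
by under eq_fun do rewrite exprS; exact: ccontM.
Qed.

Lemma ccont_horner (p : {poly C}) (f : X -> C) : ccont f -> ccont (fun x => p.[f x]).
Proof.
move=> cf; elim/poly_ind: p => [|p c ih].
  by under eq_fun do rewrite horner0; exact: ccont_cst.
under eq_fun do rewrite hornerMXaddC.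
by apply: ccontD; [exact: ccontM|exact: ccont_cst].
Qed.
Lemma ct_nsq (f : X -> C) : ccont f -> continuous (fun x => nsq (f x)).
Proof. by move=> [f1 f2]; apply: ctD; exact: ctX. Qed.

Section Pair.
Variables v1 v2 : X -> C.
Hypotheses (c1 : ccont v1) (c2 : ccont v2).
Lemma ct_n2 : continuous (fun x => n2 (v1 x, v2 x)).
Proof. by apply: ctD; exact: ct_nsq. Qed.
Lemma ct_Sv j : continuous (fun x => Sv j (v1 x, v2 x)).
Proof.
have [a1 b1] := c1; have [a2 b2] := c2.
rewrite /Sv; case: j => -[|[|[|//]]] lt /=.
- by apply: ctM; [exact: ct_cst|apply: ctD; exact: ctM].
- by apply: ctM; [exact: ct_cst|apply: ctD; [|apply: ctN]; exact: ctM].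
- by apply: ctD; [|apply: ctN]; exact: ct_nsq.
Qed.
End Pair.

End ContinuityCalculus.

Lemma ct_fst (R : realType) (X Y : topologicalType) (f : X -> R) :
  continuous f -> continuous (fun p : X * Y => f p.1).
Proof. by move=> cf p; apply: (continuous_comp (f := fst)); [exact: cvg_fst|exact: cf]. Qed.

Lemma ct_snd (R : realType) (X Y : topologicalType) (f : Y -> R) :
  continuous f -> continuous (fun p : X * Y => f p.2).
Proof. by move=> cf p; apply: (continuous_comp (f := snd)); [exact: cvg_snd|exact: cf]. Qed.

Lemma ct_pair (R : realType) (X Y Z : topologicalType) (f : X * Y -> R) (g : Z -> X) (h : Z -> Y) :
  continuous f -> continuous g -> continuous h -> continuous (fun p => f (g p, h p)).
Proof.
move=> cf cg ch p; apply: (continuous_comp (f := fun p => (g p, h p)) (g := f)) => //.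
  by apply: cvg_pair; [exact: cg|exact: ch].
exact: cf.
Qed.

Lemma ccont_comp (R : realType) (X Y : topologicalType) (f : Y -> R[i]) (g : X -> Y) :
  ccont f -> continuous g -> ccont (fun p => f (g p)).
Proof.
move=> [f1 f2] cg; split => p.
  by apply: (continuous_comp (f := g) (g := fun x => complex.Re (f x))); [exact: cg|exact: f1].
by apply: (continuous_comp (f := g) (g := fun x => complex.Im (f x))); [exact: cg|exact: f2].
Qed.

Lemma ct_mkpair (X Y Z : topologicalType) (g : Z -> X) (h : Z -> Y) :
  continuous g -> continuous h -> continuous (fun p => (g p, h p)).
Proof. by move=> cg ch p; apply: cvg_pair; [exact: cg|exact: ch]. Qed.

Section QuadProj.
Variable R : realType.
Let V := ((R * R) * (R * R))%type.
Lemma ct_pr12 : continuous (fun p : V => p.1.2).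
Proof. by move=> p; apply: (@continuous_comp _ _ _ fst snd); [exact: cvg_fst|exact: cvg_snd]. Qed.
Lemma ct_pr21 : continuous (fun p : V => p.2.1).
Proof. by move=> p; apply: (@continuous_comp _ _ _ snd fst); [exact: cvg_snd|exact: cvg_fst]. Qed.
Lemma ct_pr22 : continuous (fun p : V => p.2.2).
Proof. by move=> p; apply: (@continuous_comp _ _ _ snd snd); [exact: cvg_snd|exact: cvg_snd]. Qed.
End QuadProj.

(** * The spherical measure *)

Section LineChange.
Variable R : realType.
Local Notation leb := (@lebesgue_measure R).
Local Open Scope ereal_scope.

Lemma measurable_affine (k m : R) :
  measurable_fun setT (fun x : measurableTypeR R => (k * x + m)%R : measurableTypeR R).
Proof. by apply: measurable_funD => //; apply: measurable_funM. Qed.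

(** Lebesgue measure equals k times its image under x -> k x + m, by uniqueness on half-open
    intervals; the formula is then the one for image measures. *)
Lemma integral_affine_pos (k m : R) (f : R -> \bar R) : (0 < k)%R ->
  measurable_fun setT f -> (forall x, 0 <= f x) ->
  \int[leb]_x f x = \int[leb]_x (k%:E * f (k * x + m)%R).
Proof.
move=> k0 mf f0; have ma := measurable_affine k m.
pose g (x : measurableTypeR R) : measurableTypeR R := (k * x + m)%R.
have mg : measurable_fun setT g := ma.
pose mu0 : measure (measurableTypeR R) R := mscale (NngNum (ltW k0)) (pushforward leb g).
pose mu := mu0 mg.
have E A : measurable A -> leb A = mu A.
  apply: lebesgue_measure_unique => // _ [[a b]] _ <-.
  have pE : g @^-1` `]a, b] = `]((a - m) / k)%R, ((b - m) / k)%R]%classic :> set R.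
    apply/seteqP; split=> x /=; rewrite !in_itv /= ltr_pdivrMr // ler_pdivlMr //
      (mulrC x) => /andP[h1 h2]; apply/andP; split; rewrite /g in h1 h2 *; lra.
  transitivity (k%:E * leb `]((a - m) / k)%R, ((b - m) / k)%R]); last first.
    by rewrite -pE.
  rewrite !lebesgue_measure_itv /= !lte_fin ltr_pM2r ?invr_gt0 // ltrD2r.
  case: ifP => [ab|_]; last by rewrite mule0.
  rewrite -!EFinB -EFinM; congr (_%:E); field.
  by rewrite gt_eqF.
rewrite (eq_measure_integral mu); last by move=> A mA _; exact: E.
rewrite ge0_integral_mscale //= ge0_integral_pushforward // preimage_setT.
rewrite ge0_integralZl //; first exact: measurableT_comp.
by rewrite lee_fin ltW.
Qed.

Lemma integral_opp (f : R -> \bar R) :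
  measurable_fun setT f -> (forall x, 0 <= f x) ->
  \int[leb]_x f x = \int[leb]_x f (- x)%R.
Proof.
move=> mf f0.
have mo : measurable_fun setT (-%R : measurableTypeR R -> measurableTypeR R).
  exact: oppr_measurable.
rewrite (eq_measure_integral (pushforward leb (-%R : _ -> measurableTypeR R))).
  by rewrite ge0_integral_pushforward // preimage_setT.
by move=> A mA _; exact/esym/(lebesgue_measureN mA).
Qed.

Lemma integral_affine (k m : R) (f : R -> \bar R) : (k != 0)%R ->
  measurable_fun setT f -> (forall x, 0 <= f x) ->
  \int[leb]_x f x = \int[leb]_x (`|k|%:E * f (k * x + m)%R).
Proof.
move=> k0 mf f0; have [kp|kn|/eqP] := ltgtP k 0%R; last by rewrite (negbTE k0).
- rewrite (integral_opp mf) // (@integral_affine_pos (- k) (- m)) ?oppr_gt0 //.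
    apply: eq_integral => x _; rewrite ltr0_norm //; congr (_ * f _)%E; ring.
  by apply: measurableT_comp => //; exact: oppr_measurable.
- by rewrite (@integral_affine_pos k m) // gtr0_norm.
Qed.

Lemma measurable_invr : measurable_fun setT (fun x : R => x^-1)%R.
Proof.
have -> : (setT : set R) = [set 0%R] `|` ~` [set 0%R] by rewrite setUv.
apply/measurable_funU => //; first exact: measurableC.
split; first exact: measurable_fun_set1.
apply: open_continuous_measurable_fun.
  by apply: closed_openC; exact: closed_eq.
by move=> x; rewrite inE /= => /eqP x0; exact: inv_continuous.
Qed.

End LineChange.

Section InvChange.
Variable R : realType.
Local Notation leb := (@lebesgue_measure R).
Local Open Scope ereal_scope.

Lemma derive1_inv (x : R) : (x != 0)%R -> (derive1 (fun y : R => y^-1)%R) x = (- (x ^- 2))%R.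
Proof.
move=> x0; rewrite derive1E deriveV //= derive_id.
exact: mulr1.
Qed.

(** The interval is symmetric under inversion, so the decreasing substitution x -> 1/x keeps the
    domain. These intervals exhaust the positive half-line. *)
Lemma integral_inv_itv (G : R -> R) (n : nat) :
  {in `]0%R, +oo[, continuous G} ->
  \int[leb]_(x in `[n.+1%:R^-1%R, n.+1%:R]) (G x)%:E =
  \int[leb]_(x in `[n.+1%:R^-1%R, n.+1%:R]) (G x^-1 * x ^- 2)%:E.
Proof.
move=> cG; set a := (n.+1%:R^-1)%R; set b := n.+1%:R%R.
have a0 : (0 < a :> R)%R by rewrite invr_gt0 ltr0n.
have ba : (b = a^-1 :> R)%R by rewrite /a invrK.
have b1 : (1 <= b :> R)%R by rewrite ler1n.
have ab : (a <= b)%R by rewrite (@le_trans _ _ 1%R) // /a invf_le1 // ltr0n.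
have pos x : x \in `[a, b] -> (0 < x)%R.
  by rewrite in_itv /= => /andP[h _]; exact: lt_le_trans h.
have cF' x : (0 < x)%R -> {for x, continuous (derive1 (fun y : R => y^-1)%R)}.
  move=> x0; apply: cvg_trans; first (apply: (@near_eq_cvg _ _ _ _ (fun y : R => - (y ^- 2))%R)).
    near=> y; rewrite derive1_inv //.
    have : (0 < y)%R by near: y; exact: lt_nbhsr.
    by move/gt_eqF/negbT.
  rewrite derive1_inv ?gt_eqF //.
  apply: cvgN; apply: cvgV; first by rewrite expf_neq0 // gt_eqF.
  exact: exprn_continuous.
transitivity (\int[leb]_(x in `[(b^-1)%R, (a^-1)%R]) (G x)%:E).
  by rewrite -ba {1}ba invrK.
rewrite (@integration_by_substitution_decreasing _ (fun x => x^-1)%R) //.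
- apply: eq_integral => x /[!inE] xab; rewrite !fctE derive1_inv ?opprK //.
  by rewrite gt_eqF // pos.
- move=> x y xab yab xy; rewrite ltf_pV2 ?posrE ?pos //.
- move=> x xab; apply: cF'; move: xab; rewrite in_itv /= => /andP[h _].
  exact: lt_trans h.
- by apply/cvg_ex; eexists; apply: cvg_at_right_filter; exact: cF'.
- by apply/cvg_ex; eexists; apply: cvg_at_left_filter; apply: cF'; rewrite ba invr_gt0.
- split.
  + move=> x; rewrite in_itv /= => /andP[h _]; apply: derivableV => //.
    by rewrite gt_eqF // (lt_trans a0).
  + by apply: cvg_at_right_filter; apply: inv_continuous; rewrite gt_eqF.
  + by apply: cvg_at_left_filter; apply: inv_continuous; rewrite gt_eqF // ba invr_gt0.
- apply: continuous_in_subspaceT => x; rewrite inE /= in_itv /= -ba => /andP[h _].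
  by apply: cG; rewrite in_itv /= andbT (lt_le_trans _ h) // ba invrK.
Unshelve. all: by end_near. Qed.

Lemma bigcup_inv_itv : \bigcup_n `[n.+1%:R^-1%R, n.+1%:R]%classic = `]0%R, +oo[%classic :> set R.
Proof.
apply/seteqP; split=> x /=.
  move=> [n _] /=; rewrite !in_itv /= andbT => /andP[h _].
  by rewrite (lt_le_trans _ h) // invr_gt0 ltr0n.
rewrite in_itv /= andbT => x0.
pose n := maxn (Num.truncn x) (Num.truncn x^-1)%R.
exists n => //=; rewrite in_itv /=; apply/andP; split.
  rewrite -[leRHS]invrK lef_pV2 ?posrE ?invr_gt0 ?ltr0n //.
  apply: ltW; apply: (lt_le_trans (truncnS_gt _)).
  by rewrite ler_nat ltnS leq_maxr.
apply: ltW; apply: (lt_le_trans (truncnS_gt _)).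
by rewrite ler_nat ltnS leq_maxl.
Qed.

Lemma integral_inv_pos (G : R -> R) :
  {in `]0%R, +oo[, continuous G} -> {in `]0%R, +oo[, forall x, (0 <= G x)%R} ->
  \int[leb]_(x in `]0%R, +oo[) (G x)%:E =
  \int[leb]_(x in `]0%R, +oo[) (G x^-1 * x ^- 2)%:E.
Proof.
move=> cG G0.
have mG : measurable_fun (`]0%R, +oo[%classic : set R) (fun x => (G x)%:E).
  apply/measurable_EFinP; apply: open_continuous_measurable_fun => //.
  by move=> x; rewrite inE /=; exact: cG.
have V0 x : (x \in `]0%R, +oo[ -> x^-1%R \in `]0%R, +oo[)%R.
  by rewrite !in_itv /= !andbT invr_gt0.
have mG' : measurable_fun (`]0%R, +oo[%classic : set R) (fun x => (G x^-1 * x ^- 2)%:E).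
  apply/measurable_EFinP; apply: open_continuous_measurable_fun => // x.
  rewrite inE /= => x0; have xn : (x != 0)%R.
    by move: x0; rewrite in_itv /= andbT => /gt_eqF ->.
  apply: cvgM.
    apply: (@cvg_comp _ _ _ (fun y => y^-1)%R G); first exact: inv_continuous.
    by apply: cG; exact: V0.
  by apply: cvgV; [rewrite expf_neq0|exact: exprn_continuous].
rewrite -bigcup_inv_itv.
have nd : nondecreasing_seq (fun n => `[n.+1%:R^-1, n.+1%:R]%classic : set R)%R.
  move=> m n mn; apply/subsetPset => x /=; rewrite !in_itv /= => /andP[h1 h2].
  apply/andP; split; [apply: le_trans h1|apply: (le_trans h2)].
    by rewrite lef_pV2 ?posrE ?ltr0n // ler_nat.
  by rewrite ler_nat.
have sub n : (`[n.+1%:R^-1%R, n.+1%:R]%classic : set R) `<=` `]0%R, +oo[%classic.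
  by rewrite -bigcup_inv_itv => x hx; exists n.
apply: (@cvg_unique _ (@ereal_hausdorff R) ((fun n => \int[leb]_(x in `[n.+1%:R^-1%R, n.+1%:R]) (G x)%:E) @ \oo)).
  apply: ge0_nondecreasing_set_cvg_integral => //.
  - by move=> n; exact: measurable_funS (sub n) mG.
  - by move=> n x hx; rewrite lee_fin G0 //; exact: sub hx.
rewrite (_ : (fun n => _) = fun n => \int[leb]_(x in `[n.+1%:R^-1%R, n.+1%:R]) (G x^-1 * x ^- 2)%:E); last first.
  by apply/funext => n; exact: integral_inv_itv.
apply: ge0_nondecreasing_set_cvg_integral => //.
- by move=> n; exact: measurable_funS (sub n) mG'.
- move=> n x hx; rewrite lee_fin mulr_ge0 ?invr_ge0 ?sqr_ge0 // G0 //.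
  by apply: V0; exact: sub hx.
Qed.

Lemma integral_line_split (f : R -> \bar R) :
  measurable_fun setT f -> (forall x, 0 <= f x) ->
  \int[leb]_x f x = \int[leb]_(x in `]0%R, +oo[) f x + \int[leb]_(x in `]0%R, +oo[) f (- x)%R.
Proof.
move=> mf f0.
have -> : (setT : set R) = `]-oo, 0%R] `|` `]0%R, +oo[%classic.
  by apply/seteqP; split=> // x _ /=; rewrite !in_itv /= andbT; case: (leP x 0%R); [left|right].
rewrite ge0_integral_setU //; last 2 first.
  - exact: measurable_funS mf.
  - apply/disj_set2P; apply/seteqP; split=> // x /=; rewrite !in_itv /= andbT => -[] h1 h2.
    by move: h1; rewrite leNgt h2.
rewrite addeC; congr (_ + _).
have := @ge0_integration_by_substitution0 R (fun x => f (- x)%R).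
have E : \int[leb]_(x in `]-oo, 0%R]) f x = \int[leb]_(x in `]-oo, 0%R]) f (- - x)%R.
  by apply: eq_integral => x _; rewrite opprK.
rewrite E => <- //; last by apply: measurableT_comp => //; exact: oppr_measurable.
rewrite integral_itv_obnd_cbnd //.
apply: measurable_funTS; by apply: measurableT_comp => //; exact: oppr_measurable.
Qed.

Lemma integral_inv_line (G : R -> R) :
  measurable_fun setT G -> (forall x, x != 0 -> {for x, continuous G})%R ->
  (forall x, 0 <= G x)%R ->
  \int[leb]_x (G x)%:E = \int[leb]_x (G x^-1 * x ^- 2)%:E.
Proof.
move=> mG cG G0.
have mG' : measurable_fun setT (fun x : R => (G x^-1 * x ^- 2))%R.
  apply: measurable_funM; first by apply: measurableT_comp mG _; exact: measurable_invr.
  by apply: measurableT_comp (@measurable_invr R) _; exact: measurable_funX.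
have pos (x : R) : x \in `]0%R, +oo[ -> (0 < x)%R by rewrite in_itv /= andbT.
rewrite integral_line_split //; last exact/measurable_EFinP.
rewrite [RHS]integral_line_split //; last 2 first.
- exact/measurable_EFinP.
- by move=> x; rewrite lee_fin mulr_ge0 ?invr_ge0 ?sqr_ge0.
congr (_ + _); first apply: integral_inv_pos => //.
  by move=> x /pos x0; apply: cG; rewrite gt_eqF.
rewrite (@integral_inv_pos (fun x => G (- x)%R)) //.
  by apply: eq_integral => x _; rewrite invrN sqrrN.
move=> x /pos x0; apply: continuous_comp; first exact: opp_continuous.
by apply: cG; rewrite oppr_eq0 gt_eqF.
Qed.

End InvChange.

(** * A winding number obstruction *)

Section Winding.
Variable R : realType.
Local Notation C := R[i].
Local Notation Re := complex.Re.
Local Notation Im := complex.Im.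

Definition cis (x : R) : C := (cos x +i* sin x)%C.

Lemma cisD x y : cis (x + y) = cis x * cis y.
Proof. by rewrite /cis cosD sinD; simpc; congr (_ +i* _)%C; ring. Qed.

Lemma cisX x n : cis x ^+ n = cis (n%:R * x).
Proof.
elim: n => [|n ih]; first by rewrite expr0 mul0r /cis cos0 sin0.
by rewrite exprS ih -cisD; congr cis; rewrite -natr1; ring.
Qed.

Lemma nsq_cis x : nsq (cis x) = 1.
Proof. by rewrite /nsq /= cos2Dsin2. Qed.

(* A loop on [0, 2pi] has a logarithm if its argument is a continuous loop. *)
Definition has_arg (f : R -> C) : Prop :=
  exists (A : R -> R) (c : C), [/\ continuous A, A (2 * pi) = A 0, c != 0 &
    forall x, exists2 m : R, 0 < m & f x = m%:C%C * c * cis (A x)].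

Lemma has_arg_cst (c : C) : c != 0 -> has_arg (fun=> c).
Proof.
move=> c0; exists (fun=> 0), c; split => // [|x]; first exact: ct_cst.
by exists 1 => //; rewrite /cis cos0 sin0 mul1r mulr1.
Qed.

Lemma cos_atan_gt0 (x : R) : 0 < cos (atan x).
Proof. by rewrite cos_atan invr_gt0 sqrtr_gt0 ltr_pwDl ?sqr_ge0. Qed.

Lemma arg_right_half (q : C) : 0 < Re q ->
  exists2 m : R, 0 < m & q = m%:C%C * cis (atan (Im q / Re q)).
Proof.
case: q => x y /= x0; set a := atan _; have c0 : 0 < cos a := cos_atan_gt0 _.
exists (x / cos a); first exact: divr_gt0.
have e : sin a = y / x * cos a.
  by have := atanK (y / x); rewrite -/a /tan => <-; rewrite divfK // gt_eqF.
rewrite /cis e; simpc; congr (_ +i* _)%C; field; by rewrite !gt_eqF.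
Qed.

(** The quotient g / f stays in the right half-plane, where [atan] of the slope is a continuous
    argument; added to the argument of f it gives one for g, and it is again a loop. This is the
    elementary homotopy step of all winding arguments below. *)
Lemma has_arg_step (f g : R -> C) : ccont f -> ccont g ->
  f (2 * pi) = f 0 -> g (2 * pi) = g 0 ->
  (forall x, 0 < Re (g x * conjc (f x))) -> has_arg f -> has_arg g.
Proof.
move=> cf cg pf pg pos [A [c [cA pA c0 hA]]].
pose q x := g x * conjc (f x).
have cq : ccont q by apply: ccontM => //; exact: ccontJ.
exists (fun x => A x + atan (Im (q x) / Re (q x))), c; split => //.
- apply: ctD => //; apply: (@ctcomp _ _ (@atan R)); first exact: continuous_atan.
  have [q1 q2] := cq; apply: ctM => //; apply: ctV => // x.
  by rewrite gt_eqF // pos.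
- by rewrite pA /q pf pg.
- move=> x; have [m m0] := arg_right_half (pos x : 0 < Re (q x)).
  set phi := atan _ => em.
  have [l l0 el] := hA x.
  exists (m / (l * nsq c)); first by rewrite divr_gt0 // mulr_gt0 // nsq_gt0.
  have fn : nsq (f x) != 0.
    apply/eqP => /eqP; rewrite nsq_eq0 => /eqP e.
    by have := pos x; rewrite e conjc0 mulr0 /= ltxx.
  have gE : g x = q x * f x / (nsq (f x))%:C%C.
    rewrite /q -(mulrA (g x)) (mulrC (conjc _)) mulcJ mulfK //.
    by rewrite -(rmorph0 (real_complex R)) (inj_eq (@complexI R)).
  have cn : nsq c != 0 by rewrite nsq_eq0.
  rewrite gE em el !nsqM nsq_cis nsq_real mulr1 cisD.
  have ln : l != 0 by rewrite gt_eqF.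
  have lC : l%:C%C != 0 by rewrite -(rmorph0 (real_complex R)) (inj_eq (@complexI R)).
  have nC : (nsq c)%:C%C != 0 by rewrite -(rmorph0 (real_complex R)) (inj_eq (@complexI R)).
  rewrite expr2 !rmorphM /= !(rmorphV (real_complex R)) ?unitfE ?mulf_neq0 // !rmorphM /=.
  move: lC nC; set u := cis phi; set v := cis (A x); set M := m%:C%C; set L := l%:C%C.
  by set K := (nsq c)%:C%C => lC nC; field; rewrite ?nC ?lC.
Qed.

(** The clamp extends the loop c cis (k x) from [0, 2 pi] to a continuous function on the line,
    constant on both sides. *)
Lemma has_arg_cis_eq0 (k : nat) (c : C) :
  has_arg (fun x => c * cis (k%:R * Num.max 0 (Num.min (2 * pi) x))) -> c != 0 -> k = 0%N.
Proof.
move=> [A [b [cA pA b0 hA]]] c0; apply/eqP/negP => /negP; rewrite -lt0n => k0.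
have pi0 : 0 < pi :> R := pi_gt0 R.
pose cl x : R := Num.max 0 (Num.min (2 * pi) x).
have cl0 : cl 0 = 0 by rewrite /cl min_r ?maxxx // mulr_ge0 // ltW.
have cl2 : cl (2 * pi) = 2 * pi by rewrite /cl minxx max_r // mulr_ge0 // ltW.
(* D increases by 2 pi k over the interval, while c cis (D x) stays on one open ray. If k > 0, then
   D takes the value D 0 + pi, at which c cis (D x) lies on the opposite ray. *)
pose D x : R := k%:R * cl x - A x.
have ccl : continuous cl.
  move=> x; apply: continuous_max; first exact: cst_continuous.
  by apply: continuous_min => //; exact: cst_continuous.
have cD : continuous D.
  by apply: ctD; [apply: ctM => //; exact: ct_cst|exact: ctN].
have hD x : exists2 m : R, 0 < m & c * cis (D x) = m%:C%C * b.
  have [m m0 em] := hA x; exists m => //.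
  rewrite /D addrC cisD mulrA (mulrAC _ _ (cis _)) em -(mulrA (m%:C%C * b)) -cisD subrr.
  by rewrite /cis cos0 sin0 mulr1.
have : exists x, D x = D 0 + pi.
  have hD2 : D (2 * pi) = D 0 + k%:R * (2 * pi) by rewrite /D cl0 cl2 pA; ring.
  have k1 : 1 <= k%:R :> R by rewrite ler1n.
  have := @IVT R D 0 (2 * pi) (D 0 + pi); case.
  - by rewrite mulr_ge0 // ltW.
  - exact: continuous_subspaceT.
  - apply/andP; split; first by rewrite ge_min lerDl ltW.
    by rewrite le_max hD2 lerD2l; apply/orP; right; nra.
  - by move=> x _ h; exists x.
move=> [x hx]; have [m m0 em] := hD x; have [l l0 el] := hD 0.
have : m%:C%C = - l%:C%C :> C.
  apply: (mulIf b0); rewrite mulNr -em -el hx cisD {2}/cis cospi sinpi.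
  by rewrite -mulrN; congr (_ * _); rewrite /cis; simpc.
by case=> e; move: m0; rewrite e oppr_gt0 ltNge ltW.
Qed.

(** Positivity on the diagonal t = t' extends, by compactness of the parameter box, to a strip of
    uniform width. It fixes the number of steps of a discrete homotopy. *)
Lemma uniform_pos (Phi : (R * R) * (R * R) -> R) : continuous Phi ->
  (forall x t, 0 <= x.1 <= 1 -> 0 <= x.2 <= 2 * pi -> 0 <= t <= 1 -> 0 < Phi (x, (t, t))) ->
  exists N : nat, forall x t t', 0 <= x.1 <= 1 -> 0 <= x.2 <= 2 * pi -> 0 <= t <= 1 ->
    `|t - t'| <= N.+1%:R^-1 -> 0 < Phi (x, (t, t')).
Proof.
move=> cP pos.
pose K : set ((R * R) * R) := (`[0, 1]%classic `*` `[0, 2 * pi]%classic) `*` `[0, 1]%classic.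
have cK : compact K.
  by apply: compact_setX; [apply: compact_setX|]; exact: segment_compact.
have [N _ hN] : \forall N \near \oo, K `<=` (fun x => forall t',
    `|x.2 - t'| <= N.+1%:R^-1 -> 0 < Phi (x.1, (x.2, t'))); last first.
  exists N => x t t' x1 x2 t1 h.
  apply: (hN N (leqnn N) (x, t)) => //.
apply: (proj1 (compact_near_coveringP K) cK nat \oo (fun N x => forall t',
   `|x.2 - t'| <= N.+1%:R^-1 -> 0 < Phi (x.1, (x.2, t')))).
case=> x t [[/= x1 x2] t1].
have p0 : 0 < Phi (x, (t, t)) by apply: pos; rewrite ?in_itv in x1 x2 t1 *.
have := cvgr_gt _ (cP (x, (t, t))) _ p0.
move=> [[U V] /= [Ux [[A B] /= [At Bt] AB]] UV].
have {}Bt : nbhs (t : R) (A `&` B) by exact: filterI.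
have /nbhs_ballP[e /= e0 he] := Bt.
have e20 : 0 < e / 2 by rewrite divr_gt0.
exists (U `*` ball t (e / 2), [set N : nat | N.+1%:R^-1 < e / 2]) => /=.
  split; last exact: near_infty_natSinv_lt (PosNum e20).
  exists (U, ball t (e / 2)) => //=; split => //.
  by apply: nbhsx_ballx; rewrite divr_gt0.
move=> [[y s] N] /= [[Uy hs] hN] t' ht'.
apply: (UV (y, (s, t'))); split => //=; apply: AB; split => /=.
  by apply: (he s _).1; apply: le_ball hs; lra.
apply: (he t' _).2; rewrite -ball_normE /= in hs *.
have -> : t - t' = (t - s) + (s - t') by ring.
apply: (le_lt_trans (ler_normD _ _)).
have := lt_le_trans hs (lexx _); move: (le_lt_trans ht' hN); lra.
Qed.

(* (1 + u.sigma) a: twice the projection of a on the line with point u on the sphere. *)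
Definition projv (u1 u2 u3 : R) (a : C * C) : C * C :=
  ((1 + u3)%:C%C * a.1 + (u1 +i* u2)%C * a.2, (u1 -i* u2)%C * a.1 + (1 - u3)%:C%C * a.2).

Definition herm (a b : C * C) : C := a.1 * conjc b.1 + a.2 * conjc b.2.

Definition onray (u1 u2 u3 : R) (a : C * C) : Prop :=
  [/\ S1 a = n2 a * u1, S2 a = n2 a * u2 & S3 a = n2 a * u3].

Lemma projv_onray u1 u2 u3 a : u1 ^+ 2 + u2 ^+ 2 + u3 ^+ 2 = 1 -> onray u1 u2 u3 (projv u1 u2 u3 a).
Proof.
(* The identities are polynomial in u, with a defect that is a multiple of 1 - |u|^2. *)
move=> h; pose s := u1 ^+ 2 + u2 ^+ 2 + u3 ^+ 2.
have e1 : S1 (projv u1 u2 u3 a) = n2 (projv u1 u2 u3 a) * u1 + (1 - s) * (S1 a + u1 * n2 a).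
  by case: a => -[a b] [c d]; rewrite /projv /s /S1 /n2 /nsq /=; ring.
have e2 : S2 (projv u1 u2 u3 a) = n2 (projv u1 u2 u3 a) * u2 + (1 - s) * (S2 a + u2 * n2 a).
  by case: a {e1} => -[a b] [c d]; rewrite /projv /s /S2 /n2 /nsq /=; ring.
have e3 : S3 (projv u1 u2 u3 a) = n2 (projv u1 u2 u3 a) * u3 + (1 - s) * (S3 a + u3 * n2 a).
  by case: a {e1 e2} => -[a b] [c d]; rewrite /projv /s /S3 /n2 /nsq /=; ring.
by split; rewrite ?e1 ?e2 ?e3 /s h subrr mul0r addr0.
Qed.

Lemma n2_projv u1 u2 u3 a : u1 ^+ 2 + u2 ^+ 2 + u3 ^+ 2 = 1 ->
  n2 (projv u1 u2 u3 a) = 2 * (n2 a + u1 * S1 a + u2 * S2 a + u3 * S3 a).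
Proof.
case: a => -[a b] [c d] h; rewrite /projv /S1 /S2 /S3 /n2 /nsq /=.
apply/eqP; rewrite -subr_eq0; apply/eqP; transitivity ((u1 ^+ 2 + u2 ^+ 2 + u3 ^+ 2 - 1) * (a ^+ 2 + b ^+ 2 + (c ^+ 2 + d ^+ 2))); first by ring.
by rewrite h subrr mul0r.
Qed.

(** If a and v lie over the unit vectors alpha and beta, the right-hand side is n2 a n2 v (1 +
    u.alpha + u.beta + alpha.beta) / 2. It is positive as soon as the three angles are acute, which
    is the condition of [has_arg_step]. *)
Lemma herm_projv u1 u2 u3 a v : Re (herm (projv u1 u2 u3 a) v * conjc (herm a v)) =
  (n2 a * n2 v + n2 v * (u1 * S1 a + u2 * S2 a + u3 * S3 a) + n2 a * (u1 * S1 v + u2 * S2 v + u3 * S3 v)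
   + (S1 a * S1 v + S2 a * S2 v + S3 a * S3 v)) / 2.
Proof.
case: a => -[a b] [c d]; case: v => -[e f] [g h].
by rewrite /herm /projv /S1 /S2 /S3 /n2 /nsq /=; field.
Qed.

Lemma nsq_herm a b : nsq (herm a b) = (n2 a * n2 b + S1 a * S1 b + S2 a * S2 b + S3 a * S3 b) / 2.
Proof.
case: a => -[a1 a2] [a3 a4]; case: b => -[b1 b2] [b3 b4].
by rewrite /herm /S1 /S2 /S3 /n2 /nsq /=; field.
Qed.

Lemma herm_CS a b : nsq (herm a b) <= n2 a * n2 b.
Proof.
rewrite -subr_ge0 (_ : _ - _ = nsq (a.1 * b.2 - a.2 * b.1)) ?nsq_ge0 //.
case: a => -[d1 d2] [d3 d4]; case: b => -[l3 l4] [l5 l6].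
by rewrite /n2 /herm /nsq /=; ring.
Qed.

Lemma hermC a b : herm b a = conjc (herm a b).
Proof. by rewrite /herm rmorphD !rmorphM /= !conjcK; congr (_ + _); exact: mulrC. Qed.

Lemma herm_split a b c l : herm a l = c * herm b l + herm (a.1 - c * b.1, a.2 - c * b.2) l.
Proof. by rewrite /herm /=; ring. Qed.

Lemma rim_identity (c z H E : C) : c * z * conjc ((c * z * H + E) * conjc H) =
  (nsq c * nsq z * nsq H)%:C%C + c * z * H * conjc E.
Proof.
have -> : (nsq c * nsq z * nsq H)%:C%C = c * conjc c * (z * conjc z) * (H * conjc H).
  by rewrite !mulcJ -!rmorphM.
rewrite rmorphM rmorphD !rmorphM [in LHS]/= conjcK; ring.
Qed.

(** * Lifting a field of directions from the sphere to C^2 *)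

Section NoLift.
(** [G x t] is a vector field on a solid cylinder, x being the pair (radius, angle) and t the
    height. [Gper], [Gcen] and their analogues for W say that the data descend from polar
    coordinates to the disc. At t = 0 the field points to the point of the sphere with homogeneous
    coordinates W; on the top and on the side it makes an acute angle with v0; on the rim W is close
    to c z^k v0. *)
Variables (G : 'I_3 -> (R * R) -> R -> R) (W1 W2 : R * R -> C) (v0 : C * C) (c : C) (k : nat).
Let dot x t x' t' := \sum_j G j x t * G j x' t'.
Let dotv x t (v : C * C) := \sum_j G j x t * Sv j v.
Let cl1 (x : R) : R := Num.max 0 (Num.min 1 x).
Let cl2 (x : R) : R := Num.max 0 (Num.min (2 * pi) x).
Hypothesis cG : forall j, continuous (fun p : (R * R) * R => G j p.1 p.2).
Hypotheses (cW1 : ccont W1) (cW2 : ccont W2).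
Hypothesis G0 : forall x t, 0 <= x.1 <= 1 -> 0 <= x.2 <= 2 * pi -> 0 <= t <= 1 ->
  0 < dot x t x t.
Hypothesis W0 : forall x, (W1 x, W2 x) != 0.
Hypothesis GW : forall x, exists2 m, 0 < m & forall j, G j x 0 = m * Sv j (W1 x, W2 x).
Hypothesis Gper : forall j r t, G j (r, 2 * pi) t = G j (r, 0) t.
Hypothesis Wper : forall r, W1 (r, 2 * pi) = W1 (r, 0) /\ W2 (r, 2 * pi) = W2 (r, 0).
Hypothesis Gcen : forall j x t, G j (0, x) t = G j (0, 0) t.
Hypothesis Wcen : forall x, W1 (0, x) = W1 (0, 0) /\ W2 (0, x) = W2 (0, 0).
Hypothesis Gtop : forall x, 0 <= x.1 <= 1 -> 0 <= x.2 <= 2 * pi -> 0 < dotv x 1 v0.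
Hypothesis Grim : forall x t, 0 <= x <= 2 * pi -> 0 <= t <= 1 -> 0 < dotv (1, x) t v0.
Hypotheses (c0 : c != 0) (v00 : v0 != 0).
Hypothesis Wrim : forall x, 0 <= x <= 2 * pi ->
  4 * n2 (W1 (1, x) - c * cis (k%:R * x) * v0.1, W2 (1, x) - c * cis (k%:R * x) * v0.2)
  <= nsq c * n2 v0.

Let cl1P x : 0 <= cl1 x <= 1.
Proof. by rewrite /cl1 le_max lexx /= ge_max ler01 ge_min lexx. Qed.

Let cl2P x : 0 <= cl2 x <= 2 * pi.
Proof.
have pi0 : 0 <= 2 * pi :> R by rewrite mulr_ge0 // ltW // pi_gt0.
by rewrite /cl2 le_max lexx /= ge_max pi0 ge_min lexx.
Qed.

Let cl1_id x : 0 <= x <= 1 -> cl1 x = x.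
Proof. by move=> /andP[x0 x1]; rewrite /cl1 min_r // max_r. Qed.

Let cl2_id x : 0 <= x <= 2 * pi -> cl2 x = x.
Proof. by move=> /andP[x0 x1]; rewrite /cl2 min_r // max_r. Qed.

Let ccl1 : continuous cl1.
Proof.
move=> x; apply: continuous_max; first exact: cst_continuous.
by apply: continuous_min => //; exact: cst_continuous.
Qed.

Let ccl2 : continuous cl2.
Proof.
move=> x; apply: continuous_max; first exact: cst_continuous.
by apply: continuous_min => //; exact: cst_continuous.
Qed.

Let pr (x : R * R) : R * R := (cl1 x.1, cl2 x.2).

Let cpr : continuous pr.
Proof.
by apply: ct_mkpair; [exact: ct_fst|exact: ct_snd].
Qed.

Let cGt j t : continuous (fun x => G j (pr x) t).
Proof.
apply: (@ct_pair _ _ _ _ (fun p => G j p.1 p.2) pr (fun=> t)) => //.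
exact: cst_continuous.
Qed.

(* Clamping to the polar rectangle makes the field uniformly continuous. *)
Let nrm x t := Num.sqrt (dot (pr x) t (pr x) t).
Let u j x t : R := G j (pr x) t / nrm x t.

Let nrm_gt0 x t : 0 <= t <= 1 -> 0 < nrm x t.
Proof. by move=> t1; rewrite sqrtr_gt0 G0 // ?cl1P ?cl2P. Qed.

Let cu j t : 0 <= t <= 1 -> continuous (fun x => u j x t).
Proof.
move=> t1; apply: ctM; first exact: cGt.
apply: (ctV (f := fun x => nrm x t)); first by move=> x; rewrite gt_eqF ?nrm_gt0.
apply: (@ctcomp _ _ (@Num.sqrt R)); first exact: sqrt_continuous.
rewrite /dot; under eq_fun do rewrite !big_ord_recl big_ord0 addr0.
by do !apply: ctD; apply: ctM; exact: cGt.
Qed.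

Let u_unit x t : 0 <= t <= 1 -> \sum_j u j x t ^+ 2 = 1.
Proof.
move=> t1; have n0 := nrm_gt0 x t1.
under eq_bigr do rewrite exprMn.
rewrite -mulr_suml; have -> : \sum_i G i (pr x) t ^+ 2 = nrm x t ^+ 2.
  by rewrite sqr_sqrtr ?ltW ?G0 ?cl1P ?cl2P.
by rewrite -exprMn divff ?expr1n // gt_eqF.
Qed.

(** The times descend from 1, where every direction is at an acute angle to v0, to 0, where the
    direction is that of W. *)
Let tn (N i : nat) : R := 1 - i%:R / N%:R.
Let step x t a := projv (u ord0 x t) (u (inord 1) x t) (u (inord 2) x t) a.
Fixpoint lift_seq (N i : nat) (x : R * R) : C * C :=
  if i is i'.+1 then step x (tn N i') (lift_seq N i' x) else v0.

(** The unit vector over which the i-th lift lies. The index is shifted: lift i + 1 is obtained by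
    projecting at time [tn N i], and lift 0 is v0. *)
Let ray i x (N : nat) j : R := if i is i'.+1 then u j x (tn N i') else Sv j v0 / n2 v0.

Section WithN.
Variable N : nat.
Hypothesis hN : forall x t t', 0 <= x.1 <= 1 -> 0 <= x.2 <= 2 * pi -> 0 <= t <= 1 ->
    0 <= t' <= 1 -> `|t - t'| <= N.+1%:R^-1 -> 0 < dot x t x t'.

Let tnP i : (i <= N.+1)%N -> 0 <= tn N.+1 i <= 1.
Proof.
move=> iN; rewrite /tn subr_ge0 ler_pdivrMr ?ltr0n // mul1r ler_nat iN /=.
by rewrite lerBlDr lerDl divr_ge0 ?ler0n.
Qed.

Let sum3 (f g : 'I_3 -> R) : \sum_j f j * g j =
  f ord0 * g ord0 + f (inord 1) * g (inord 1) + f (inord 2) * g (inord 2).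
Proof.
rewrite !big_ord_recl big_ord0 addr0 addrA; congr (_ + _ * _ + _ * _); congr (_ _);
by apply: val_inj; rewrite /= inordK.
Qed.

Let SvE (v : C * C) : [/\ Sv ord0 v = S1 v, Sv (inord 1) v = S2 v & Sv (inord 2) v = S3 v].
Proof. by rewrite /Sv !inordK. Qed.

Let v0n : 0 < n2 v0. Proof. by rewrite n2_gt0. Qed.

(** An acute angle between consecutive directions is what keeps the projected vector from vanishing,
    by [n2_projv]. *)
Let ray_step i x : (i <= N.+1)%N -> 0 < \sum_j ray i x N.+1 j * ray i.+1 x N.+1 j.
Proof.
move=> iN; have t1 := tnP iN; have n0 := nrm_gt0 x t1.
rewrite /= /u; case: i iN t1 n0 => [|i] iN t1 n0.
  have -> : \sum_j Sv j v0 / n2 v0 * (G j (pr x) (tn N.+1 0) / nrm x (tn N.+1 0)) =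
     dotv (pr x) 1 v0 / (n2 v0 * nrm x (tn N.+1 0)).
    rewrite /dotv mulr_suml; apply: eq_bigr => j _.
    by rewrite {1}/tn mul0r subr0 invfM; ring.
  by rewrite divr_gt0 ?Gtop ?cl1P ?cl2P // mulr_gt0.
have t2 : 0 <= tn N.+1 i <= 1 by apply: tnP; exact: ltnW.
have n1 := nrm_gt0 x t2.
have -> : \sum_j G j (pr x) (tn N.+1 i) / nrm x (tn N.+1 i) *
    (G j (pr x) (tn N.+1 i.+1) / nrm x (tn N.+1 i.+1)) =
  dot (pr x) (tn N.+1 i) (pr x) (tn N.+1 i.+1) / (nrm x (tn N.+1 i) * nrm x (tn N.+1 i.+1)).
  by rewrite /dot mulr_suml; apply: eq_bigr => j _; rewrite invfM; ring.
rewrite divr_gt0 ?mulr_gt0 // hN ?cl1P ?cl2P //.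
have -> : tn N.+1 i - tn N.+1 i.+1 = N.+1%:R^-1.
  by rewrite /tn -[in i.+1%:R]natr1; ring.
by rewrite ger0_norm // invr_ge0 ler0n.
Qed.

Let ray_unit i x : (i <= N.+2)%N -> \sum_j ray i x N.+1 j ^+ 2 = 1.
Proof.
case: i => [|i] iN; last by apply: u_unit; exact: tnP.
have [e1 e2 e3] := SvE v0.
under eq_bigr do rewrite expr2; rewrite sum3 /= e1 e2 e3.
have n0 : n2 v0 != 0 by rewrite gt_eqF.
transitivity ((S1 v0 ^+ 2 + S2 v0 ^+ 2 + S3 v0 ^+ 2) / n2 v0 ^+ 2); first by field.
by rewrite S_sqr divff // expf_neq0.
Qed.

Let lift_ray i x : (i <= N.+2)%N ->
  0 < n2 (lift_seq N.+1 i x) /\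
  forall j, Sv j (lift_seq N.+1 i x) = n2 (lift_seq N.+1 i x) * ray i x N.+1 j.
Proof.
elim: i => [|i ih] iN.
  by split=> //= j; rewrite mulrCA divff ?mulr1 // gt_eqF.
have [n0 hS] := ih (ltnW iN).
have un := ray_unit x iN; move: un; under eq_bigr do rewrite expr2.
rewrite sum3 -!expr2 => un.
have [e1 e2 e3] := SvE (lift_seq N.+1 i x).
have [f1 f2 f3] := SvE (lift_seq N.+1 i.+1 x).
split.
  rewrite [lift_seq _ i.+1 _]/= /step n2_projv // -e1 -e2 -e3 !hS.
  have := ray_step x iN; rewrite sum3 /=.
  set n := n2 _ in n0 *; set r0 := ray i x _ _; set r1 := ray i x _ _; set r2 := ray i x _ _.
  move=> h; rewrite mulr_gt0 //.
  rewrite (_ : _ + _ = n * (1 + (r0 * u ord0 x (tn N.+1 i) + r1 * u (inord 1) x (tn N.+1 i) + r2 * u (inord 2) x (tn N.+1 i)))); last by ring.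
  by rewrite mulr_gt0 // ltr_pwDl // ltW.
apply/S3_ord; rewrite f1 f2 f3; exact: projv_onray.
Qed.

Let lift_ccont i : (i <= N.+2)%N ->
  ccont (fun x => (lift_seq N.+1 i x).1) /\ ccont (fun x => (lift_seq N.+1 i x).2).
Proof.
elim: i => [|i ih] iN /=; first by split; exact: ccont_cst.
have [h1 h2] := ih (ltnW iN); have ci j : continuous (fun x => u j x (tn N.+1 i)) by apply: cu; exact: tnP.
split; apply: ccontD; apply: ccontM => //; split => /=; do ?exact: ct_cst;
 by do ?[exact: ci | apply: ctN | apply: ctD; first exact: ct_cst].
Qed.

Let pr_id x : pr (pr x) = pr x.
Proof. by rewrite /pr /= cl1_id ?cl1P // cl2_id ?cl2P. Qed.

Let lift_pr i x : lift_seq N.+1 i (pr x) = lift_seq N.+1 i x.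
Proof.
by elim: i => //= i ->; rewrite /step /u /nrm pr_id.
Qed.

Let lift_congr i x y : (forall j t, G j (pr x) t = G j (pr y) t) ->
  lift_seq N.+1 i x = lift_seq N.+1 i y.
Proof.
move=> h; elim: i => //= i ->; rewrite /step /u /nrm !h.
suff -> : dot (pr x) (tn N.+1 i) (pr x) (tn N.+1 i) = dot (pr y) (tn N.+1 i) (pr y) (tn N.+1 i) by [].
by apply: eq_bigr => j _; rewrite !h.
Qed.

Let pi0 : 0 <= 2 * pi :> R.
Proof. by rewrite mulr_ge0 // ltW // pi_gt0. Qed.
Let cl20 : cl2 0 = 0. Proof. by rewrite cl2_id // lexx pi0. Qed.
Let cl2pi : cl2 (2 * pi) = 2 * pi. Proof. by rewrite cl2_id // lexx pi0. Qed.

Let rim_ccont j : (j <= N.+2)%N -> ccont (fun x => herm (lift_seq N.+1 j (1, x)) v0).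
Proof.
move=> jN; have [h1 h2] := lift_ccont jN.
have cp : continuous (fun x : R => (1 : R, x)).
  by apply: ct_mkpair; [exact: cst_continuous|move=> ?; exact: cvg_id].
apply: ccontD; apply: ccontM; try exact: ccont_cst.
  exact: (ccont_comp h1 cp).
exact: (ccont_comp h2 cp).
Qed.

(** On the rim every direction used is at an acute angle to v0, so each projection changes the
    argument of the product with v0 by less than a right angle. The product starts as the constant
    |v0|^2. *)
Let rim_arg i : (i <= N.+2)%N -> has_arg (fun x => herm (lift_seq N.+1 i (1, x)) v0).
Proof.
have cc := rim_ccont.
have per j : herm (lift_seq N.+1 j (1, 2 * pi)) v0 = herm (lift_seq N.+1 j (1, 0)) v0.
  congr (herm _ _); apply: lift_congr => l t; rewrite /pr /= cl20 cl2pi; exact: Gper.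
elim: i => [|i ih] iN.
  apply: (has_arg_cst (c := herm v0 v0)); rewrite -nsq_gt0 nsq_herm.
  rewrite (_ : _ / 2 = (n2 v0 ^+ 2 + (S1 v0 ^+ 2 + S2 v0 ^+ 2 + S3 v0 ^+ 2)) / 2); last by ring.
  by rewrite S_sqr divr_gt0 // addr_gt0 // exprn_gt0.
apply: has_arg_step (cc i (ltnW iN)) (cc i.+1 iN) (per i) (per i.+1) _ (ih (ltnW iN)) => x.
rewrite [lift_seq _ i.+1 _]/= /step herm_projv divr_gt0 //.
have [n0 hS] := lift_ray (1, x) (ltnW iN).
have [e1 e2 e3] := SvE (lift_seq N.+1 i (1, x)).
have [f1 f2 f3] := SvE v0.
have iN' : (i <= N.+1)%N by [].
have := ray_step (1, x) iN'; rewrite sum3 /= => h1.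
have rim t : 0 <= t <= 1 -> 0 < \sum_j u j (1, x) t * Sv j v0.
  move=> t1; rewrite /u; have n1 := nrm_gt0 (1, x) t1.
  rewrite (_ : \sum__ _ = dotv (pr (1, x)) t v0 / nrm (1, x) t); last first.
    by rewrite /dotv mulr_suml; apply: eq_bigr => j _; ring.
  rewrite divr_gt0 // /pr /= (_ : cl1 1 = 1) ?cl1_id ?ler01 ?lexx //.
  by rewrite Grim ?cl2P.
have h2 : 0 < \sum_j u j (1, x) (tn N.+1 i) * Sv j v0 by apply: rim; exact: tnP.
have h3 : 0 < \sum_j ray i (1, x) N.+1 j * Sv j v0.
  case: (i) iN => [|l] lN /=; last by apply: rim; apply: tnP; exact: ltnW.
  rewrite sum3 f1 f2 f3 (_ : _ + _ = (S1 v0 ^+ 2 + S2 v0 ^+ 2 + S3 v0 ^+ 2) / n2 v0); last by ring.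
  by rewrite S_sqr divr_gt0 // exprn_gt0.
rewrite !sum3 in h2 h3; rewrite -e1 -e2 -e3 -f1 -f2 -f3 !hS.
set n := n2 _ in n0 *; move: h1 h2 h3; set m := n2 v0.
set a0 := ray i _ _ _; set a1 := ray i _ _ _; set a2 := ray i _ _ _.
set b0 := u _ _ _; set b1 := u _ _ _; set b2 := u _ _ _.
set s0 := Sv _ _; set s1 := Sv _ _; set s2 := Sv _ _ => h1 h2 h3.
rewrite (_ : _ + _ = n * (m + m * (a0 * b0 + a1 * b1 + a2 * b2) + (b0 * s0 + b1 * s1 + b2 * s2)
  + (a0 * s0 + a1 * s1 + a2 * s2))); last by ring.
by apply: mulr_gt0 => //; apply: addr_gt0 h3; apply: addr_gt0 h2; apply: addr_gt0; [exact: v0n|apply: mulr_gt0].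
Qed.

(** The last projection is made at time 0, onto the line of W itself, so this product has no zero on
    the disc. *)
Let lam x := herm (W1 (pr x), W2 (pr x)) (lift_seq N.+1 N.+2 x).

Let tnN : tn N.+1 N.+1 = 0.
Proof. by rewrite /tn divff ?subrr // pnatr_eq0. Qed.

Let lam_gt0 x : 0 < nsq (lam x).
Proof.
rewrite nsq_herm.
have [n0 hS] := lift_ray x (leqnn N.+2).
have [e1 e2 e3] := SvE (lift_seq N.+1 N.+2 x).
rewrite -e1 -e2 -e3 !hS [ray N.+2]/ray tnN.
set w := (_, _); have w0 : 0 < n2 w by rewrite n2_gt0 W0.
have [f1 f2 f3] := SvE w; set n := n2 (lift_seq _ _ _) in n0 *.
have [m m0 hm] := GW (pr x).
rewrite /u !hm -/w f1 f2 f3.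
have t0 : 0 <= (0 : R) <= 1 by rewrite lexx ler01.
have r0 := nrm_gt0 x t0; set r := nrm x 0 in r0 *.
rewrite (_ : _ / 2 = (n2 w * n + n * m / r * (S1 w ^+ 2 + S2 w ^+ 2 + S3 w ^+ 2)) / 2); last by ring.
by rewrite S_sqr divr_gt0 // addr_gt0 ?mulr_gt0 ?exprn_gt0 ?invr_gt0.
Qed.

Let lam_pr x : lam (pr x) = lam x.
Proof. by rewrite /lam pr_id lift_pr. Qed.

Let lam_ccont : ccont lam.
Proof.
have [h1 h2] := lift_ccont (leqnn N.+2).
by apply: ccontD; apply: ccontM; first [exact: ccontJ | exact: ccont_comp cpr].
Qed.

Let lam_per r : lam (r, 2 * pi) = lam (r, 0).
Proof.
have [w1 w2] := Wper (cl1 r).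
rewrite /lam (_ : lift_seq N.+1 N.+2 (r, 2 * pi) = lift_seq N.+1 N.+2 (r, 0)); last first.
  apply: lift_congr => j t; rewrite /pr /= cl20 cl2pi; exact: Gper.
by rewrite /pr /= cl20 cl2pi w1 w2.
Qed.

Let lam_slice r : ccont (fun x => lam (r, x)).
Proof.
apply: (ccont_comp lam_ccont).
by apply: ct_mkpair; [exact: cst_continuous|move=> ?; exact: cvg_id].
Qed.

(** Having no zero on the disc, lam restricted to the rim is deformed through concentric circles to
    its value at the centre. *)
Let lam_arg : has_arg (fun x => lam (1, x)).
Proof.
pose Phi (p : (R * R) * (R * R)) : R := Re (lam (p.2.1, p.1.2) * conjc (lam (p.2.2, p.1.2))).
have cP : continuous Phi.
  have c1 : ccont (fun p : (R * R) * (R * R) => lam (p.2.1, p.1.2)).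
    apply: (ccont_comp lam_ccont); by apply: ct_mkpair; [exact: ct_pr21|exact: ct_pr12].
  have c2 : ccont (fun p : (R * R) * (R * R) => lam (p.2.2, p.1.2)).
    apply: (ccont_comp lam_ccont); by apply: ct_mkpair; [exact: ct_pr22|exact: ct_pr12].
  by have [] := ccontM c1 (ccontJ c2).
have [|M hM] := uniform_pos cP.
  by move=> x t _ _ _; rewrite /Phi /= mulcJ /= lam_gt0.
have ih i : (i <= M.+1)%N -> has_arg (fun x => lam (i%:R / M.+1%:R, x)).
  elim: i => [|i ih] iM.
    have -> : (fun x => lam (0%:R / M.+1%:R, x)) = (fun=> lam (0, 0)).
      apply/funext => x; rewrite mul0r /lam (_ : lift_seq N.+1 N.+2 (0, x) = lift_seq N.+1 N.+2 (0, 0)); last first.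
        by apply: lift_congr => j t; rewrite /pr /= cl1_id ?lexx ?ler01 // Gcen [RHS]Gcen.
      rewrite /pr /= cl1_id ?lexx ?ler01 //; congr (herm (_, _) _).
        by rewrite (Wcen _).1 [RHS](Wcen _).1.
      by rewrite (Wcen _).2 [RHS](Wcen _).2.
    by apply: has_arg_cst; rewrite -nsq_gt0.
  apply: has_arg_step (lam_slice _) (lam_slice _) (lam_per _) (lam_per _) _ (ih (ltnW iM)) => x.
  have lamcl r y : 0 <= r <= 1 -> lam (r, y) = lam (r, cl2 y).
    by move=> r1; rewrite -lam_pr -[RHS]lam_pr /pr /= [cl2 (cl2 y)]cl2_id ?cl2P.
  have q1 : 0 <= (i.+1%:R / M.+1%:R : R) <= 1.
    by rewrite divr_ge0 ?ler0n // ler_pdivrMr ?ltr0n // mul1r ler_nat.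
  have q0 : 0 <= (i%:R / M.+1%:R : R) <= 1.
    by rewrite divr_ge0 ?ler0n // ler_pdivrMr ?ltr0n // mul1r ler_nat ltnW.
  rewrite (lamcl _ x q1) (lamcl _ x q0).
  apply: (hM (0, cl2 x) (i.+1%:R / M.+1%:R) (i%:R / M.+1%:R)) => //=.
  - by rewrite lexx ler01.
  - rewrite -mulrBl -natr1 addrAC subrr add0r mul1r.
    by rewrite ger0_norm // invr_ge0 ler0n.
by have := ih M.+1 (leqnn _); rewrite divff // pnatr_eq0.
Qed.

Lemma winding_eq0 : k = 0%N.
Proof.
have [A [a [cA pA a0 hA]]] := lam_arg.
have [B [b [cB pB b0 hB]]] := rim_arg (leqnn N.+2).
pose h x := herm (lift_seq N.+1 N.+2 (1, x)) v0.
have ch : ccont h := rim_ccont (leqnn N.+2).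
have hper : h (2 * pi) = h 0.
  congr (herm _ _); apply: lift_congr => l t; rewrite /pr /= cl20 cl2pi; exact: Gper.
(* With l the last lift, the product is <W, l> <l, v0>. Since W is nearly c z^k v0, it is c z^k
   |<v0, l>|^2 plus a smaller error, hence homotopic to the loop c z^k. *)
have prod : has_arg (fun x => lam (1, x) * h x).
  exists (fun x => A x + B x), (a * b); split.
  - exact: ctD.
  - by rewrite pA pB.
  - by rewrite mulf_neq0.
  move=> x; have [m m0 em] := hA x; have [l l0 el] := hB x; exists (m * l); first exact: mulr_gt0.
  by rewrite /h em el cisD rmorphM /=; ring.
apply: (has_arg_cis_eq0 (c := c)) => //.
apply: has_arg_step _ _ _ _ _ prod.
- by apply: ccontM.
- apply: ccontM; first exact: ccont_cst.
  have ck : continuous (fun x => k%:R * cl2 x) by apply: ctM => //; exact: ct_cst.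
  by split; [apply: (@ctcomp _ _ (@cos R)) => //; exact: continuous_cos |
             apply: (@ctcomp _ _ (@sin R)) => //; exact: continuous_sin].
- by rewrite lam_per hper.
- by rewrite -/(cl2 _) -/(cl2 0) cl20 cl2pi mulr0 -cisX /cis cos0 sin0 mulr_natl cos2pi sin2pi expr1n.
move=> x; rewrite -/(cl2 x); set z := cis _.
have nz : nsq z = 1 by exact: nsq_cis.
set q := cl2 x in z nz *.
have [n0 hS] := lift_ray (1, x) (leqnn N.+2).
set l := lift_seq _ _ _ in n0 hS.
have prE : pr (1, x) = (1, q) by rewrite /pr /= cl1_id // ler01 lexx.
pose D := (W1 (1, q) - c * z * v0.1, W2 (1, q) - c * z * v0.2).
have hD : 4 * n2 D <= nsq c * n2 v0 by apply: Wrim; exact: cl2P.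
have lamE : lam (1, x) = c * z * herm v0 l + herm D l.
  by rewrite /lam prE -/l; exact: herm_split.
have hE : h x = conjc (herm v0 l).
  exact: hermC.
have csN := herm_CS D l.
(* An acute angle between the lines of v0 and l means that |<v0, l>|^2 exceeds half of its maximum.
   With the factor 4 of [Wrim] and Cauchy-Schwarz this bounds the error. *)
have hv : n2 v0 * n2 l < 2 * nsq (herm v0 l).
  rewrite nsq_herm; have [f1 f2 f3] := SvE v0; have [e1 e2 e3] := SvE l.
  rewrite -e1 -e2 -e3 -f1 -f2 -f3 !hS.
  have t0 : 0 <= (0 : R) <= 1 by rewrite lexx ler01.
  have := Grim (cl2P x) t0; rewrite /dotv sum3 -/q => hr.
  have r0 := nrm_gt0 (1, x) t0.
  rewrite [ray N.+2]/ray tnN /u prE.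
  move: hr; set g0 := G _ _ _; set g1 := G _ _ _; set g2 := G _ _ _; set s0 := Sv _ _; set s1 := Sv _ _; set s2 := Sv _ _.
  move=> hr; rewrite [ltRHS]mulrC divfK // -!addrA ltrDl.
  rewrite (_ : _ + _ = n2 l / nrm (1, x) 0 * (g0 * s0 + g1 * s1 + g2 * s2)); last by ring.
  by rewrite mulr_gt0 // divr_gt0.
set H := herm v0 l in lamE hE hv.
have -> : c * z * conjc (lam (1, x) * h x) = (nsq c * nsq H)%:C%C + c * z * H * conjc (herm D l).
  by rewrite lamE hE rim_identity nz mulr1.
set E := c * z * H * _.
have nE : nsq E < (nsq c * nsq H) ^+ 2.
  rewrite /E !nsqM nz mulr1 (_ : nsq (conjc _) = nsq (herm D l)); last first.
    by case: (herm D l) => p1 p2; rewrite /nsq /= sqrrN.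
  have c1 : 0 < nsq c by rewrite nsq_gt0.
  have H1 : 0 < nsq H.
    have : 0 < 2 * nsq H by apply: lt_trans hv; rewrite mulr_gt0.
    by rewrite pmulr_rgt0.
  rewrite expr2 ltr_pM2l ?mulr_gt0 //.
  apply: (le_lt_trans csN).
  have : 4 * (n2 D * n2 l) <= nsq c * (n2 v0 * n2 l) by rewrite !mulrA ler_wpM2r // ltW.
  have : nsq c * (n2 v0 * n2 l) < nsq c * (2 * nsq H) by rewrite ltr_pM2l.
  have : 0 < nsq c * nsq H by rewrite mulr_gt0.
  by lra.
have k0 : 0 <= nsq c * nsq H by rewrite mulr_ge0 ?nsq_ge0.
rewrite ReD /=; move: nE k0; rewrite {1}/nsq; set K := _ * _; set e := Re E; set e' := Im E => nE k0.
rewrite ltNge; apply/negP => hle.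
have : K ^+ 2 <= e ^+ 2 by rewrite -(sqrrN e) ler_sqr ?nnegrE; lra.
by have := sqr_ge0 e'; lra.
Qed.

End WithN.

(* Projecting step by step in t lifts the field of directions G to a nonvanishing map to
   C^2. Its Hermitian product with W is a nonvanishing function on the disc, and winds k
   times along the rim. *)
Lemma no_nonvanishing_lift : k = 0%N.
Proof.
pose Phi (p : (R * R) * (R * R)) : R := dot p.1 p.2.1 p.1 p.2.2.
have cP : continuous Phi.
  rewrite /Phi /dot; under eq_fun do rewrite !big_ord_recl big_ord0 addr0.
  have h j : continuous (fun p : (R * R) * (R * R) => G j p.1 p.2.1 * G j p.1 p.2.2).
    apply: ctM; apply: (@ct_pair _ _ _ _ (fun p => G j p.1 p.2)) => //.
    - by move=> p; exact: cvg_fst.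
    - exact: ct_pr21.
    - by move=> p; exact: cvg_fst.
    - exact: ct_pr22.
  by do !apply: ctD.
have [|N hN] := uniform_pos cP; first by move=> x t; exact: G0.
by apply: (@winding_eq0 N) => x t t' x1 x2 t1 _ h; exact: (hN x t t').
Qed.

End NoLift.

End Winding.

(** * Barycenters *)

Section BoundedMeasurable.
Context {d} {T : measurableType d} {R : realType}.
Variable P : {finite_measure set T -> \bar R}.
Implicit Types f g : T -> R.

Definition bm f : Prop := measurable_fun setT f /\ exists K, forall x, `|f x| <= K.

Definition mass : R := fine (P setT).

Definition Int f : R := Rintegral P setT f.

Lemma bm_integrable f : bm f -> P.-integrable setT (EFin \o f).
Proof.
move=> [mf [K hK]]; apply: measurable_bounded_integrable => //.
  by rewrite ltey_eq fin_num_measure.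
exists K; split; first exact: num_real.
by move=> y Ky x _; apply: le_trans (ltW Ky).
Qed.

Lemma bm_cst c : bm (fun=> c).
Proof. by split; [exact: measurable_cst|exists `|c|]. Qed.

Lemma bmD f g : bm f -> bm g -> bm (fun x => f x + g x).
Proof.
move=> [mf [K hK]] [mg [L hL]]; split; first exact: measurable_realfun.measurable_funD.
by exists (K + L) => x; apply: (le_trans (ler_normD _ _)); rewrite lerD.
Qed.

Lemma bmM f g : bm f -> bm g -> bm (fun x => f x * g x).
Proof.
move=> [mf [K hK]] [mg [L hL]]; split; first exact: measurable_realfun.measurable_funM.
by exists (K * L) => x; rewrite normrM ler_pM.
Qed.

Lemma bmN f : bm f -> bm (fun x => - f x).
Proof.
move=> [mf [K hK]]; split; first exact: measurable_realfun.measurable_funN.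
by exists K => x; rewrite normrN.
Qed.

Lemma bm_indic (A : set T) : measurable A -> bm (\1_A).
Proof.
move=> mA; split; first exact: measurable_indic.
by exists 1 => x; rewrite indicE; case: (_ \in _); rewrite /= ?normr1 ?normr0.
Qed.

Lemma bm_ln f (a b : R) : 0 < a -> measurable_fun setT f ->
  (forall x, a <= f x <= b) -> bm (fun x => ln (f x)).
Proof.
move=> a0 mf h; split; first by apply: measurableT_comp mf; exact: measurable_ln.
exists (Num.max `|ln a| `|ln b|) => x; have /andP[h1 h2] := h x.
have f0 : 0 < f x by apply: lt_le_trans h1.
have k1 : ln a <= ln (f x) by rewrite ler_ln ?posrE.
have k2 : ln (f x) <= ln b by rewrite ler_ln ?posrE // (lt_le_trans f0).
rewrite le_max; case: (lerP 0 (ln (f x))) => c0.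
  apply/orP; right; rewrite ger0_norm // ger0_norm //; exact: le_trans k2.
by apply/orP; left; rewrite !ltr0_norm // ?lerN2 // (le_lt_trans k1).
Qed.

Lemma IntD f g : bm f -> bm g -> Int (fun x => f x + g x) = Int f + Int g.
Proof. by move=> bf bg; apply: RintegralD => //; exact: bm_integrable. Qed.

Lemma IntZ c f : bm f -> Int (fun x => c * f x) = c * Int f.
Proof. by move=> bf; apply: RintegralZl => //; exact: bm_integrable. Qed.

Lemma IntN f : bm f -> Int (fun x => - f x) = - Int f.
Proof.
move=> bf; rewrite -mulN1r -IntZ //; congr Int; apply/funext => x.
by rewrite mulN1r.
Qed.

Lemma Int_cst c : Int (fun=> c) = c * mass.
Proof. by rewrite /Int Rintegral_cst. Qed.

Lemma Int_le f g : bm f -> bm g -> (forall x, f x <= g x) -> Int f <= Int g.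
Proof. by move=> bf bg h; apply: le_Rintegral => //; exact: bm_integrable. Qed.

Lemma Int_ge0 f : (forall x, 0 <= f x) -> 0 <= Int f.
Proof. by move=> h; exact: Rintegral_ge0. Qed.

Lemma Int_indic (A : set T) : measurable A -> Int (\1_A) = fine (P A).
Proof. by move=> mA; rewrite /Int /Rintegral integral_indic // setIT. Qed.

Lemma mass_ge0 : 0 <= mass.
Proof. by rewrite fine_ge0. Qed.

Lemma Int_norm_le f K : bm f -> (forall x, `|f x| <= K) -> `|Int f| <= K * mass.
Proof.
move=> bf h; have bK := bm_cst K; rewrite ler_norml -!Int_cst; apply/andP; split.
  rewrite -(IntN bK); apply: Int_le => //; first exact: bmN.
  by move=> x; have := h x; rewrite ler_norml => /andP[].
by apply: Int_le => // x; have := h x; rewrite ler_norml => /andP[].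
Qed.

Lemma Int_eq0_null f : bm f -> (forall x, 0 <= f x) -> Int f = 0 ->
  P [set x | f x != 0] = 0%E.
Proof.
move=> bf f0 h; have [mf _] := bf.
have h0 : (\int[P]_x `|(f x)%:E| = 0)%E.
  under eq_integral do rewrite gee0_abs ?lee_fin //.
  have := integrable_fin_num measurableT (bm_integrable bf).
  by move=> hf; rewrite -(fineK hf); move: h; rewrite /Int /Rintegral => ->.
have /ae_eq_integral_abs := h0 => /(_ measurableT) h1.
have [|N [mN N0 sN]] := h1; first exact/measurable_EFinP.
apply/eqP; rewrite eq_le measure_ge0 andbT -N0 le_measure ?inE //.
  rewrite (_ : [set x | _] = f @^-1` (~` [set 0])); last first.
    by apply/seteqP; split=> x /= /eqP.
  by rewrite -[X in measurable X]setTI; apply: mf => //; exact: measurableC.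
move=> x /= fx; apply: sN => /= /(_ I) [] e; by rewrite e eqxx in fx.
Qed.

End BoundedMeasurable.

Section FormCoordinates.
Variable R : realType.
Local Notation C := R[i].
Local Notation Re := complex.Re.
Local Notation Im := complex.Im.
Implicit Types y : H3 R.

(** [fc0] and [fc] are the hyperboloid coordinates of y, the coefficients of [form y] in the basis
    n2, S1, S2, S3. In particular [fc0] is the cosh of the distance to the centre. *)
Definition fc0 y : R := (nsq (hz y) + ht y ^+ 2 + 1) / (2 * ht y).
Definition fc y (j : 'I_3) : R :=
  nth 0 [:: - Re (hz y) / ht y; - Im (hz y) / ht y; (1 - nsq (hz y) - ht y ^+ 2) / (2 * ht y)] j.

Lemma sum3E (f : 'I_3 -> R) : \sum_j f j = f ord0 + f (inord 1) + f (inord 2).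
Proof.
rewrite !big_ord_recl big_ord0 addr0 addrA; congr (_ + f _ + f _);
by apply: val_inj; rewrite /= inordK.
Qed.

Lemma SvE3 (v : C * C) : [/\ Sv ord0 v = S1 v, Sv (inord 1) v = S2 v & Sv (inord 2) v = S3 v].
Proof. by rewrite /Sv !inordK. Qed.

Lemma fc0E y : fc0 y = hcosh (H3o R) y.
Proof.
rewrite hcoshE /fc0 /H3o /hz /ht /= sub0r nsqN; field.
by rewrite gt_eqF // ht_gt0.
Qed.

Lemma form_fc y v : form y v = fc0 y * n2 v + \sum_j fc y j * Sv j v.
Proof.
have t0 := ht_gt0 y; have tn : ht y != 0 by rewrite gt_eqF.
have [e0 e1 e2] : [/\ fc y ord0 = - Re (hz y) / ht y, fc y (inord 1) = - Im (hz y) / ht y &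
   fc y (inord 2) = (1 - nsq (hz y) - ht y ^+ 2) / (2 * ht y)] by rewrite /fc !inordK.
rewrite sum3E e0 e1 e2; have [-> -> ->] := SvE3 v.
rewrite /form /fc0; move: (hz y) (ht y) tn => [z1 z2] t tn.
by case: v => -[a b] [c d]; rewrite /n2 /S1 /S2 /S3 /nsq /=; field; exact: tn.
Qed.

Lemma fc_unit y : fc0 y ^+ 2 - \sum_j fc y j ^+ 2 = 1.
Proof.
have t0 := ht_gt0 y; have tn : ht y != 0 by rewrite gt_eqF.
have [e0 e1 e2] : [/\ fc y ord0 = - Re (hz y) / ht y, fc y (inord 1) = - Im (hz y) / ht y &
   fc y (inord 2) = (1 - nsq (hz y) - ht y ^+ 2) / (2 * ht y)] by rewrite /fc !inordK.
rewrite sum3E e0 e1 e2 /fc0 /nsq; field.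
exact: tn.
Qed.

Lemma fc0_ge1 y : 1 <= fc0 y.
Proof. by rewrite fc0E hcosh_ge1. Qed.

(** The affine map z -> (z - [hz y]) / [ht y], normalized to determinant 1. *)
Definition to0 y : 'M[C]_2 :=
  \matrix_(i, j) if i == 0 then (if j == 0 then (Num.sqrt (ht y))^-1%:C%C else - hz y * (Num.sqrt (ht y))^-1%:C%C)
                 else (if j == 0 then 0 else (Num.sqrt (ht y))%:C%C).

Lemma to0_det y : \det (to0 y) = 1.
Proof.
rewrite det2 !mxE /= mulr0 subr0 -rmorphM /= mulVf //.
by rewrite gt_eqF // sqrtr_gt0 ht_gt0.
Qed.

Lemma mulv_to0 y v : mulv (to0 y) v =
  ((Num.sqrt (ht y))^-1%:C%C * (v.1 - hz y * v.2), (Num.sqrt (ht y))%:C%C * v.2).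
Proof. by rewrite /mulv !mxE /= mul0r add0r; congr (_, _); ring. Qed.

Lemma to0P y : mobH (to0 y) y = H3o R.
Proof.
have t0 := ht_gt0 y; apply: n2_mulv_to0; first exact: to0_det.
move=> v; rewrite mulv_to0 /n2 /= !nsqM !nsq_real exprVn sqr_sqrtr ?ltW // /form.
by field; rewrite gt_eqF.
Qed.

Lemma mulv_adjK (A : 'M[C]_2) : \det A = 1 -> exists A', [/\ \det A' = 1,
   forall v, mulv A' (mulv A v) = v & forall v, mulv A (mulv A' v) = v].
Proof.
rewrite det2 => d1.
pose A' : 'M[C]_2 := \matrix_(i, j) if i == 0 then (if j == 0 then A 1 1 else - A 0 1)
   else (if j == 0 then - A 1 0 else A 0 0).
exists A'; split.
- by rewrite det2 !mxE /= -d1; ring.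
- move=> w; rewrite /mulv !mxE /= [RHS]surjective_pairing; congr (_, _).
    by rewrite -[RHS]mul1r -d1; ring.
  by rewrite -[RHS]mul1r -d1; ring.
- move=> w; rewrite /mulv !mxE /= [RHS]surjective_pairing; congr (_, _).
    by rewrite -[RHS]mul1r -d1; ring.
  by rewrite -[RHS]mul1r -d1; ring.
Qed.

Lemma form_frame_exists (A : 'M[C]_2) (c : R) (b : 'I_3 -> R) : \det A = 1 -> 0 < c ->
  c ^+ 2 - \sum_j b j ^+ 2 = 1 ->
  exists y, forall v, form y v = c * n2 (mulv A v) + \sum_j b j * Sv j (mulv A v).
Proof.
move=> d1 c0; rewrite sum3E => h; have [p hp] := form_pt_exists c0 h.
have [A' [d1' _ K2]] := mulv_adjK d1.
exists (mobH A' p) => v.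
have d0 : \det A' != 0 by rewrite d1' oner_neq0.
have -> : form (mobH A' p) v = form p (mulv A v).
  have := form_mobH p (mulv A v) d0; rewrite d1' Normc.normc1 mul1r => <-; congr form.
  have [w ->] := mulv_surj v d1'; by rewrite K2.
by rewrite hp sum3E; have [-> -> ->] := SvE3 (mulv A v); rewrite !addrA.
Qed.

Lemma form_frame (A : 'M[C]_2) y v : \det A = 1 ->
  form y v = fc0 (mobH A y) * n2 (mulv A v) + \sum_j fc (mobH A y) j * Sv j (mulv A v).
Proof.
move=> d1; rewrite -form_fc form_mobH d1 ?oner_neq0 //.
by rewrite Normc.normc1 mul1r.
Qed.

(** The right-hand side is the mean of exp s and exp (- s) with weights (1 + x) / 2 and (1 - x) / 2,
    whose geometric mean is exp (s x). The extra factor makes the comparison of means strict except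
    at x = 1 and x = -1. *)
Lemma cosh_sinh_ge (s x : R) : 0 <= s -> -1 <= x <= 1 ->
  expR (s * x) * (1 + s ^+ 2 * (1 - x ^+ 2) * (1 - x) / 8) <=
  (expR s + expR (- s)) / 2 + (expR s - expR (- s)) / 2 * x.
Proof.
move=> s0 /andP[x1 x2].
have e1 : expR s = expR (s * x) * expR (s * (1 - x)) by rewrite -expRD; congr expR; ring.
have e2 : expR (- s) = expR (s * x) * expR (- (s * (1 + x))) by rewrite -expRD; congr expR; ring.
rewrite e1 e2.
have -> : (expR (s * x) * expR (s * (1 - x)) + expR (s * x) * expR (- (s * (1 + x)))) / 2 +
   (expR (s * x) * expR (s * (1 - x)) - expR (s * x) * expR (- (s * (1 + x)))) / 2 * x =
   expR (s * x) * ((1 + x) / 2 * expR (s * (1 - x)) + (1 - x) / 2 * expR (- (s * (1 + x)))) by field.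
rewrite ler_wpM2l ?expR_ge0 //.
have u0 : 0 <= s * (1 - x) by rewrite mulr_ge0 // subr_ge0.
(* From exp u >= (1 + u / 2)^2. Multiplied by the weight (1 + x) / 2, the quadratic term gives the
   constant 8. *)
have h1 : 1 + s * (1 - x) + (s * (1 - x)) ^+ 2 / 4 <= expR (s * (1 - x)).
  rewrite (_ : s * (1 - x) = s * (1 - x) / 2 + s * (1 - x) / 2); last by field.
  rewrite expRD -expr2; apply: (@le_trans _ _ ((1 + s * (1 - x) / 2) ^+ 2)).
    by rewrite le_eqVlt; apply/orP; left; apply/eqP; field.
  by rewrite ler_sqr ?nnegrE ?expR_ge0 ?expR_ge1Dx // addr_ge0 // divr_ge0.
have h2 : 1 - s * (1 + x) <= expR (- (s * (1 + x))) by exact: expR_ge1Dx.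
have k1 : 0 <= (1 + x) / 2 by lra. have k2 : 0 <= (1 - x) / 2 by lra.
have := ler_wpM2l k1 h1; have := ler_wpM2l k2 h2.
set E1 := expR _; set E2 := expR _ => i1 i2.
apply: le_trans (lerD i2 i1); rewrite le_eqVlt; apply/orP; left; apply/eqP; by field.
Qed.

(** With c = cosh s and be = sinh s, this is quantitative convexity of a Busemann function along a
    geodesic, x being the cosine of the angle between the geodesic and the boundary point. *)
Lemma ln_cosh_sinh_ge (c be x : R) : 0 <= be -> c ^+ 2 - be ^+ 2 = 1 -> 1 <= c ->
  -1 <= x <= 1 ->
  ln (c + be) * x + ln (1 + ln (c + be) ^+ 2 * (1 - x ^+ 2) * (1 - x) / 8) <= ln (c + be * x).
Proof.
move=> b0 h c1 x1; have cb : 1 <= c + be by lra.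
have cbp : 0 < c + be by lra.
set s := ln (c + be); have s0 : 0 <= s by rewrite ln_ge0.
have es : expR s = c + be by rewrite lnK.
have ens : expR (- s) = c - be.
  rewrite expRN es; apply: (mulfI (lt0r_neq0 cbp)); rewrite divff ?gt_eqF //.
  by rewrite -h; ring.
have q0 : 0 <= s ^+ 2 * (1 - x ^+ 2) * (1 - x) / 8.
  have /andP[h1 h2] := x1; have : 0 <= 1 - x ^+ 2 by nra.
  by move=> h3; rewrite divr_ge0 // !mulr_ge0 ?sqr_ge0 // subr_ge0.
have q1 : 0 < 1 + s ^+ 2 * (1 - x ^+ 2) * (1 - x) / 8 by rewrite ltr_pwDl.
have := cosh_sinh_ge s0 x1; rewrite es ens.
rewrite (_ : _ / 2 + _ / 2 * x = c + be * x); last by field.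
move=> hle; rewrite -ler_expR expRD lnK ?posrE // lnK //.
by rewrite posrE (lt_le_trans _ hle) // mulr_gt0 ?expR_gt0.
Qed.

End FormCoordinates.

Section Barycenter.
Context {d} {T : measurableType d} {R : realType}.
Variable P : {finite_measure set T -> \bar R}.
Local Notation C := R[i].
Local Notation Re := complex.Re.
Local Notation Im := complex.Im.

Definition cmeas (f : T -> C) : Prop :=
  measurable_fun setT (fun x => Re (f x)) /\ measurable_fun setT (fun x => Im (f x)).

Definition vmeas (V : T -> C * C) : Prop :=
  cmeas (fun x => (V x).1) /\ cmeas (fun x => (V x).2).

Lemma cmeas_lin (a b : C) (f g : T -> C) : cmeas f -> cmeas g -> cmeas (fun x => a * f x + b * g x).
Proof.
move=> [f1 f2] [g1 g2]; split.
  rewrite (_ : (fun x => _) = (fun x => (Re a * Re (f x) - Im a * Im (f x)) + (Re b * Re (g x) - Im b * Im (g x)))); last first.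
    by apply/funext => x; rewrite ReD !ReM.
  apply: measurable_realfun.measurable_funD; apply: measurable_realfun.measurable_funB;
   by apply: measurable_realfun.measurable_funM.
rewrite (_ : (fun x => _) = (fun x => (Re a * Im (f x) + Im a * Re (f x)) + (Re b * Im (g x) + Im b * Re (g x)))); last first.
  by apply/funext => x; rewrite ImD !ImM.
apply: measurable_realfun.measurable_funD; apply: measurable_realfun.measurable_funD;
   by apply: measurable_realfun.measurable_funM.
Qed.

Lemma vmeas_mulv A V : vmeas V -> vmeas (fun x => mulv A (V x)).
Proof. by move=> [v1 v2]; split; exact: cmeas_lin. Qed.

Lemma meas_nsq (f : T -> C) : cmeas f -> measurable_fun setT (fun x => nsq (f x)).
Proof.
by move=> [f1 f2]; apply: measurable_realfun.measurable_funD; exact: measurable_realfun.measurable_funX.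
Qed.

Lemma meas_n2 V : vmeas V -> measurable_fun setT (fun x => n2 (V x)).
Proof. by move=> [v1 v2]; apply: measurable_realfun.measurable_funD; exact: meas_nsq. Qed.

Lemma meas_Sv V j : vmeas V -> measurable_fun setT (fun x => Sv j (V x)).
Proof.
move=> [v1 v2]; have [a1 b1] := v1; have [a2 b2] := v2.
rewrite /Sv; case: j => -[|[|[|//]]] lt /=.
- apply: measurable_realfun.measurable_funM => //.
  by apply: measurable_realfun.measurable_funD; exact: measurable_realfun.measurable_funM.
- apply: measurable_realfun.measurable_funM => //.
  by apply: measurable_realfun.measurable_funB; exact: measurable_realfun.measurable_funM.
- by apply: measurable_realfun.measurable_funB; exact: meas_nsq.
Qed.

Lemma meas_div (f g : T -> R) : measurable_fun setT f -> measurable_fun setT g ->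
  measurable_fun setT (fun x => f x / g x).
Proof.
move=> mf mg; apply: measurable_realfun.measurable_funM => //.
by apply: (measurableT_comp (@measurable_invr R)).
Qed.

Definition sv j (v : C * C) : R := Sv j v / n2 v.

Lemma Sv_sqr (v : C * C) : \sum_j Sv j v ^+ 2 = n2 v ^+ 2.
Proof. by rewrite sum3E; have [-> -> ->] := SvE3 v; exact: S_sqr. Qed.

Lemma sv_unit (v : C * C) : v != 0 -> \sum_j sv j v ^+ 2 = 1.
Proof.
rewrite -n2_gt0 => v0; under eq_bigr do rewrite exprMn.
by rewrite -mulr_suml Sv_sqr -exprMn divff ?expr1n // gt_eqF.
Qed.

Lemma sv_le1 j (v : C * C) : `|sv j v| <= 1.
Proof.
have [->|v0] := eqVneq v 0.
  rewrite /sv (_ : n2 0 = 0) ?invr0 ?mulr0 ?normr0 //.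
  by rewrite /n2 nsq0 addr0.
rewrite -(@ler_sqr _ `|_|) ?nnegrE // expr1n -normrX ger0_norm ?sqr_ge0 // -(sv_unit v0).
by rewrite (bigD1 j) //= lerDl sumr_ge0 // => i _; exact: sqr_ge0.
Qed.

Lemma bm_sv V j : vmeas V -> bm (fun x => sv j (V x)).
Proof.
move=> mV; split; first by apply: meas_div; [exact: meas_Sv|exact: meas_n2].
by exists 1 => x; exact: sv_le1.
Qed.

Lemma dot_sv_le (b : 'I_3 -> R) (v : C * C) : (\sum_j b j * sv j v) ^+ 2 <= \sum_j b j ^+ 2.
Proof.
have [->|v0] := eqVneq v 0.
  rewrite (_ : \sum_j b j * sv j 0 = 0) ?expr0n ?sumr_ge0 // => [i _|]; first exact: sqr_ge0.
  by rewrite big1 // => i _; rewrite /sv (_ : n2 0 = 0) ?invr0 ?mulr0 // /n2 nsq0 addr0.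
have u := sv_unit v0; move: u; rewrite !sum3E.
set x := sv ord0 v; set y := sv (inord 1) v; set z := sv (inord 2) v.
set a := b _; set e := b _; set g := b _ => u.
rewrite -subr_ge0 -[X in X - _]mulr1 -u.
rewrite (_ : _ - _ = (a * y - e * x) ^+ 2 + (a * z - g * x) ^+ 2 + (e * z - g * y) ^+ 2); last by ring.
by rewrite !addr_ge0 ?sqr_ge0.
Qed.

(** Since |b|^2 = c^2 - 1 is at most (c - 1 / (2 c))^2, Cauchy-Schwarz gives both bounds. *)
Lemma sv_dot_bound (c : R) (b : 'I_3 -> R) (v : C * C) : 1 <= c -> c ^+ 2 - \sum_j b j ^+ 2 = 1 ->
  (2 * c)^-1 <= c + \sum_j b j * sv j v <= 2 * c.
Proof.
move=> c1 h; have := dot_sv_le b v; set x := \sum_j _ * _; set B := \sum_j _ => hx.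
have c0 : 0 < 2 * c by lra.
have {}hx : x ^+ 2 <= c ^+ 2 - 1 by move: h; rewrite -/B; lra.
have xc : `|x| <= c - (2 * c)^-1.
  have k0 : 0 <= c - (2 * c)^-1.
    by rewrite subr_ge0 -[_^-1]mul1r ler_pdivrMr //; nra.
  rewrite -(@ler_sqr _ `|x|) ?nnegrE // -normrX ger0_norm ?sqr_ge0 //.
  apply: (le_trans hx); rewrite sqrrB (_ : c * (2 * c)^-1 *+ 2 = 1).
    by rewrite lerDl sqr_ge0.
  by field; lra.
have i0 : 0 < (2 * c)^-1 by rewrite invr_gt0.
by have := ler_norm x; have := ler_norm (- x); rewrite normrN; lra.
Qed.

Variable V : T -> C * C.
Hypotheses (mV : vmeas V) (V0 : forall x, V x != 0).

Definition balanced (y : H3 R) : Prop := forall A : 'M[C]_2, \det A = 1 ->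
  mobH A y = H3o R -> forall j, Int P (fun x => sv j (mulv A (V x))) = 0.

Lemma mulvV0 (A : 'M[C]_2) x : \det A = 1 -> mulv A (V x) != 0.
Proof.
move=> d1; apply: contra (V0 x) => /eqP e.
by apply/eqP/(@mulv_eq0 _ A) => //; rewrite d1 oner_neq0.
Qed.

Lemma form_ratio (A : 'M[C]_2) y x : \det A = 1 ->
  form y (V x) / n2 (mulv A (V x)) = fc0 (mobH A y) + \sum_j fc (mobH A y) j * sv j (mulv A (V x)).
Proof.
move=> d1; rewrite (form_frame _ _ d1) mulrDl mulfK; last by rewrite gt_eqF // n2_gt0 mulvV0.
by rewrite mulr_suml; congr (_ + _); apply: eq_bigr => j _; rewrite mulrA.
Qed.

Lemma meas_form y : measurable_fun setT (fun x => form y (V x)).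
Proof.
rewrite (_ : (fun x => _) = (fun x => n2 (mulv (to0 y) (V x)))).
  by apply: meas_n2; exact: vmeas_mulv.
by apply/funext => x; rewrite (mobH_to0 _ (to0_det y) (to0P y)).
Qed.

(** The difference at y' and y of the Busemann function at the boundary point V x. Balanced points
    turn out to be the minima of its integral. *)
Definition lnratio (y y' : H3 R) (x : T) : R := ln (form y' (V x) / form y (V x)).

Lemma lnratioE (A : 'M[C]_2) y y' : \det A = 1 -> mobH A y = H3o R -> forall x,
  lnratio y y' x = ln (fc0 (mobH A y') + \sum_j fc (mobH A y') j * sv j (mulv A (V x))).
Proof. by move=> d1 Ay x; rewrite /lnratio -(form_ratio y' x d1) (mobH_to0 _ d1 Ay). Qed.

Lemma bm_lnratio y y' : bm (lnratio y y').
Proof.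
pose A := to0 y; pose y'' := mobH A y'.
have c1 := fc0_ge1 y''; have c0 : 0 < (2 * fc0 y'')^-1 by rewrite invr_gt0; lra.
apply: (bm_ln (b := 2 * fc0 y'') c0); first by apply: meas_div; exact: meas_form.
move=> x; rewrite -(mobH_to0 _ (to0_det y) (to0P y)) form_ratio ?to0_det //.
by apply: sv_dot_bound => //; exact: fc_unit.
Qed.

Lemma lnratio_trans y1 y2 y3 x : lnratio y1 y3 x = lnratio y1 y2 x + lnratio y2 y3 x.
Proof.
have f0 y : 0 < form y (V x) by exact: form_gt0.
have p1 : 0 < form y2 (V x) / form y1 (V x) by rewrite divr_gt0.
have p2 : 0 < form y3 (V x) / form y2 (V x) by rewrite divr_gt0.
rewrite /lnratio -(lnM p1 p2); congr (ln _).
by field; rewrite !gt_eqF.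
Qed.

Lemma Int_sum3 (b : 'I_3 -> R) (f : 'I_3 -> T -> R) : (forall j, bm (f j)) ->
  Int P (fun x => \sum_j b j * f j x) = \sum_j b j * Int P (f j).
Proof.
move=> bf; under eq_fun do rewrite sum3E.
have bb j : bm (fun x => b j * f j x) by apply: bmM => //; exact: bm_cst.
by rewrite IntD ?IntD ?IntZ ?sum3E //; apply: bmD.
Qed.

(** Balance tested in the single frame [to0 y]; by [frame_balancedE] it implies balance in all
    frames. *)
Definition frame_balanced (y : H3 R) : Prop :=
  forall j, Int P (fun x => sv j (mulv (to0 y) (V x))) = 0.

Lemma balanced_frame y : balanced y -> frame_balanced y.
Proof. by move=> h j; rewrite h ?to0_det ?to0P. Qed.

(** The convexity estimate is integrated along the geodesic from y to y', of length s. The linear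
    term s u integrates to 0 because y is balanced, and only the convexity defect remains. *)
Lemma balanced_convex y y' : frame_balanced y ->
  let A := to0 y in let z := mobH A y' in let be := Num.sqrt (\sum_j fc z j ^+ 2) in
  let s := ln (fc0 z + be) in
  let u x := \sum_j fc z j / be * sv j (mulv A (V x)) in
  0 <= Int P (fun x => ln (1 + s ^+ 2 * (1 - u x ^+ 2) * (1 - u x) / 8)) /\
  Int P (fun x => ln (1 + s ^+ 2 * (1 - u x ^+ 2) * (1 - u x) / 8)) <= Int P (lnratio y y').
Proof.
move=> hb A z be s u.
have zu := fc_unit z; have z1 := fc0_ge1 z.
have be0 : 0 <= be by exact: sqrtr_ge0.
have be2 : be ^+ 2 = \sum_j fc z j ^+ 2 by rewrite sqr_sqrtr // sumr_ge0 // => i _; exact: sqr_ge0.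
have bs j : bm (fun x => sv j (mulv A (V x))) by apply: bm_sv; exact: vmeas_mulv.
have bu : bm u.
  rewrite /u; under eq_fun do rewrite sum3E.
  have bb j : bm (fun x => fc z j / be * sv j (mulv A (V x))) by apply: bmM => //; exact: bm_cst.
  by do 2 apply: bmD => //.
have u1 x : -1 <= u x <= 1.
  rewrite -ler_norml -(@ler_sqr _ `|_|) ?nnegrE // -normrX ger0_norm ?sqr_ge0 // expr1n.
  apply: (le_trans (dot_sv_le _ _)); under eq_bigr do rewrite exprMn.
  rewrite -mulr_suml -be2 -exprMn; have [->|b0] := eqVneq be 0; first by rewrite mul0r expr0n.
  by rewrite divff // expr1n.
have q0 x : 0 <= s ^+ 2 * (1 - u x ^+ 2) * (1 - u x) / 8.
  have /andP[] := u1 x; move: (u x) => t h1 h2; have h3 : 0 <= 1 - t ^+ 2 by nra.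
  have h4 : 0 <= 1 - t by lra.
  by apply: divr_ge0 => //; apply: mulr_ge0 => //; apply: mulr_ge0 => //; exact: sqr_ge0.
have bq : bm (fun x => s ^+ 2 * (1 - u x ^+ 2) * (1 - u x) / 8).
  have bX : bm (fun x => 1 - u x ^+ 2).
    by apply: bmD; [exact: bm_cst|apply: bmN; apply: bmM].
  do !apply: bmM; rewrite ?bm_cst //; try exact: bm_cst.
  by apply: bmD; [exact: bm_cst|exact: bmN].
have bl : bm (fun x => ln (1 + s ^+ 2 * (1 - u x ^+ 2) * (1 - u x) / 8)).
  have [mq [K hK]] := bq.
  apply: (bm_ln (a := 1) (b := 1 + K)) => //.
    by apply: measurable_realfun.measurable_funD.
  by move=> x; rewrite lerDl q0 lerD2l (le_trans (ler_norm _)).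
split; first by apply: Int_ge0 => x; rewrite ln_ge0 // lerDl.
have Iu : Int P (fun x => s * u x) = 0.
  rewrite IntZ // /u Int_sum3 // big1 ?mulr0 // => j _.
  by rewrite hb mulr0.
rewrite -[leLHS]add0r -Iu -IntD //; last by apply: bmM => //; exact: bm_cst.
apply: Int_le; [|exact: bm_lnratio|].
  by apply: bmD => //; apply: bmM => //; exact: bm_cst.
move=> x; rewrite (lnratioE _ (to0_det y) (to0P y)).
rewrite (_ : fc0 _ + _ = fc0 z + be * u x).
  by apply: ln_cosh_sinh_ge; rewrite // be2.
congr (_ + _); rewrite /u mulr_sumr; apply: eq_bigr => j _.
have [b0|b0] := eqVneq be 0; last by rewrite [RHS]mulrA [be * _]mulrC divfK.
move: be2; rewrite b0 expr0n /= => /esym/eqP; rewrite psumr_eq0 => [/allP h|i _]; last exact: sqr_ge0.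
by have := h j (mem_index_enum _); rewrite sqrf_eq0 => /eqP ->; rewrite !mul0r.
Qed.

Lemma balanced_min y y' : frame_balanced y -> 0 <= Int P (lnratio y y').
Proof. by move=> h; have /= [] := balanced_convex y' h; exact: le_trans. Qed.

(** The vector a lies over m, so that its product with W vanishes exactly when W lies over the
    antipode. It is the projection of a standard basis vector, chosen so as not to lie over -m. *)
Lemma opposite_line (m : 'I_3 -> R) : \sum_j m j ^+ 2 = 1 -> exists2 a : C * C, a != 0 &
  forall W, nsq (herm W a) = n2 a * (n2 W + \sum_j m j * Sv j W) / 2.
Proof.
rewrite sum3E => h; set m0 := m _ in h; set m1 := m _ in h; set m2 := m _ in h.
have key a : onray m0 m1 m2 a -> forall W, nsq (herm W a) = n2 a * (n2 W + \sum_j m j * Sv j W) / 2.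
  move=> [e1 e2 e3] W; rewrite nsq_herm e1 e2 e3 sum3E; have [-> -> ->] := SvE3 W.
  by rewrite -/m0 -/m1 -/m2; field.
have [p|p] := ltP 0 (1 + m2).
  exists (projv m0 m1 m2 (1, 0)); last by apply: key; exact: projv_onray.
  rewrite -n2_gt0 n2_projv // /n2 /S1 /S2 /S3 /= nsq1 nsq0 /=; lra.
exists (projv m0 m1 m2 (0, 1)); last by apply: key; exact: projv_onray.
rewrite -n2_gt0 n2_projv // /n2 /S1 /S2 /S3 /= nsq1 nsq0 /=; lra.
Qed.

(** The integral of [lnratio] between two balanced points is nonnegative in both directions, hence
    0, so the convexity defect vanishes almost everywhere. If y and y' differ, this confines V to
    two lines, each of measure 0. *)
Lemma balanced_unique y y' : 0 < mass P -> balanced y -> balanced y' ->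
  (forall u : C * C, u != 0 -> P [set x | u.1 * (V x).1 + u.2 * (V x).2 = 0] = 0%E) -> y = y'.
Proof.
move=> m0 hy hy' nd.
have [l1 l2] := balanced_convex y' (balanced_frame hy).
set A := to0 y in l1 l2; set z := mobH A y' in l1 l2; set be := Num.sqrt _ in l1 l2.
set s := ln _ in l1 l2.
have I0 : Int P (lnratio y y') <= 0.
  rewrite -oppr_ge0 -IntN; last exact: bm_lnratio.
  rewrite (_ : (fun x => _) = lnratio y' y); first exact/balanced_min/balanced_frame.
  apply/funext => x; apply/eqP; rewrite eqr_oppLR -addr_eq0 -lnratio_trans.
  by rewrite /lnratio divff ?ln1 // gt_eqF // form_gt0.
have zu := fc_unit z; have z1 := fc0_ge1 z.
have be0 : 0 <= be by exact: sqrtr_ge0.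
have be2 : be ^+ 2 = \sum_j fc z j ^+ 2 by rewrite sqr_sqrtr // sumr_ge0 // => i _; exact: sqr_ge0.
have [b0|b0] := eqVneq be 0.
  apply: form_inj => v; apply/esym.
  rewrite (form_frame _ _ (to0_det y)) -/A -/z -(mobH_to0 _ (to0_det y) (to0P y)) -/A.
  have f0 j : fc z j = 0.
    move: be2; rewrite b0 expr0n /= => /esym/eqP; rewrite psumr_eq0 => [/allP h|i _]; last exact: sqr_ge0.
    by have := h j (mem_index_enum _); rewrite sqrf_eq0 => /eqP.
  rewrite big1 ?addr0 => [|j _]; last by rewrite f0 mul0r.
  suff -> : fc0 z = 1 by rewrite mul1r.
  by move: zu; rewrite -be2 b0 expr0n /= subr0; nra.
have bp : 0 < be by rewrite lt_def b0.
have s0 : 0 < s by rewrite ln_gt0 //; lra.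
pose n j := fc z j / be.
have nu : \sum_j n j ^+ 2 = 1.
  by rewrite /n; under eq_bigr do rewrite exprMn; rewrite -mulr_suml -be2 -exprMn divff // expr1n.
pose u x := \sum_j n j * sv j (mulv A (V x)).
have u1 x : -1 <= u x <= 1.
  rewrite -ler_norml -(@ler_sqr _ `|_|) ?nnegrE // -normrX ger0_norm ?sqr_ge0 // expr1n.
  by apply: (le_trans (dot_sv_le _ _)); rewrite nu.
have q0 x : 0 <= s ^+ 2 * (1 - u x ^+ 2) * (1 - u x) / 8.
  have /andP[] := u1 x; move: (u x) => t h1 h2; have h3 : 0 <= 1 - t ^+ 2 by nra.
  have h4 : 0 <= 1 - t by lra.
  by apply: divr_ge0 => //; apply: mulr_ge0 => //; apply: mulr_ge0 => //; exact: sqr_ge0.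
have bs j : bm (fun x => sv j (mulv A (V x))) by apply: bm_sv; exact: vmeas_mulv.
have bu : bm u.
  rewrite /u; under eq_fun do rewrite sum3E.
  have bb j : bm (fun x => n j * sv j (mulv A (V x))) by apply: bmM => //; exact: bm_cst.
  by do 2 apply: bmD => //.
have bq : bm (fun x => s ^+ 2 * (1 - u x ^+ 2) * (1 - u x) / 8).
  have bX : bm (fun x => 1 - u x ^+ 2).
    by apply: bmD; [exact: bm_cst|apply: bmN; apply: bmM].
  do !apply: bmM; rewrite ?bm_cst //; try exact: bm_cst.
  by apply: bmD; [exact: bm_cst|exact: bmN].
have bl : bm (fun x => ln (1 + s ^+ 2 * (1 - u x ^+ 2) * (1 - u x) / 8)).
  have [mq [K hK]] := bq.
  apply: (bm_ln (a := 1) (b := 1 + K)) => //.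
    by apply: measurable_realfun.measurable_funD.
  by move=> x; rewrite lerDl q0 lerD2l (le_trans (ler_norm _)).
have li0 : Int P (fun x => ln (1 + s ^+ 2 * (1 - u x ^+ 2) * (1 - u x) / 8)) = 0.
  by apply/eqP; rewrite eq_le l1 andbT (le_trans l2).
have lge0 x : 0 <= ln (1 + s ^+ 2 * (1 - u x ^+ 2) * (1 - u x) / 8).
  by rewrite ln_ge0 // lerDl.
have null := Int_eq0_null bl lge0 li0.
(* Outside the null set W := A V lies on one of the two lines fixed by the boost. *)
have line (e : R) : e ^+ 2 = 1 -> P [set x | u x = e] = 0%E.
  move=> e2; have mu1 : \sum_j (- e * n j) ^+ 2 = 1.
    by under eq_bigr do rewrite exprMn sqrrN e2 mul1r.
  have [a a0 ha] := opposite_line mu1.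
  pose w : C * C := (A 0 0 * conjc a.1 + A 1 0 * conjc a.2, A 0 1 * conjc a.1 + A 1 1 * conjc a.2).
  have wE x : w.1 * (V x).1 + w.2 * (V x).2 = herm (mulv A (V x)) a.
    by rewrite /w /herm /mulv /=; ring.
  have w0 : w != 0.
    apply: contra a0 => /eqP e0; have := to0_det y; rewrite det2 -/A => d1.
    have h v : herm (mulv A v) a = 0.
      by transitivity (w.1 * v.1 + w.2 * v.2); [rewrite /w /herm /mulv /=; ring|rewrite e0 /= !mul0r addr0].
    have [v0 hv0] := mulv_surj a (to0_det y).
    have := h v0; rewrite -hv0 /herm !mulcJ -rmorphD => /complexI /eqP.
    by rewrite -/(n2 a) => /eqP a00; rewrite -[_ == _]negbK -n2_gt0 a00 ltxx.
  apply/eqP; rewrite eq_le measure_ge0 andbT -(nd w w0).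
  have mw : measurable [set x | w.1 * (V x).1 + w.2 * (V x).2 = 0].
    have [c1 c2] := cmeas_lin w.1 w.2 mV.1 mV.2.
    rewrite (_ : [set x | _] = (fun x => Re (w.1 * (V x).1 + w.2 * (V x).2)) @^-1` [set 0] `&`
       (fun x => Im (w.1 * (V x).1 + w.2 * (V x).2)) @^-1` [set 0]); last first.
      apply/seteqP; split=> x /= => [->//|[]].
      by case: (_ + _) => p q /= -> ->.
    by apply: measurableI; rewrite -[X in measurable X]setTI; [apply: c1|apply: c2].
  rewrite le_measure ?inE //; last first.
    move=> x /= ux; rewrite wE; apply/eqP; rewrite -nsq_eq0 ha.
    have W0 := mulvV0 x (to0_det y); rewrite -/A -n2_gt0 in W0.
    rewrite (_ : \sum_j _ = - e * (u x * n2 (mulv A (V x)))).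
      by rewrite ux mulrA mulNr -expr2 e2 mulN1r subrr mulr0 mul0r.
    rewrite /u mulr_suml mulr_sumr; apply: eq_bigr => j _.
    by rewrite /sv -!mulrA mulVf ?mulr1 // gt_eqF.
  rewrite (_ : [set x | _] = u @^-1` [set e]) // -[X in measurable X]setTI.
  by apply: bu.1.
have c1 := line 1 (expr1n _ _); have c2 : P [set x | u x = -1] = 0%E by apply: line; rewrite sqrrN expr1n.
have : P setT = 0%E.
  have mu (c : R) : measurable [set x | u x = c].
    by rewrite (_ : [set x | _] = u @^-1` [set c]) // -[X in measurable X]setTI; apply: bu.1.
  pose N := [set x | ln (1 + s ^+ 2 * (1 - u x ^+ 2) * (1 - u x) / 8) != 0].
  have mN : measurable N.
    rewrite /N (_ : [set x | _] = (fun x => ln (1 + s ^+ 2 * (1 - u x ^+ 2) * (1 - u x) / 8)) @^-1` (~` [set 0])).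
      by rewrite -[X in measurable X]setTI; apply: bl.1 => //; exact: measurableC.
    by apply/seteqP; split=> x /= /eqP.
  apply/eqP; rewrite eq_le measure_ge0 andbT.
  have -> : setT = N `|` ([set x | u x = 1] `|` [set x | u x = -1]) :> set T.
    apply/seteqP; split=> // x _.
    have [lx|lx] := pselect (N x); [by left|right].
    have {}lx : ln (1 + s ^+ 2 * (1 - u x ^+ 2) * (1 - u x) / 8) = 0.
      by apply/eqP; apply: contra_notT lx.
    have [t ut] : exists t, u x = t by exists (u x).
    have := q0 x; have := u1 x; move: lx; rewrite ut => lx /andP[t1 t2] tq.
    have e0 : s ^+ 2 * (1 - t ^+ 2) * (1 - t) / 8 = 0.
      move/eqP: lx; rewrite ln_eq0 ?ltr_pwDl //.
      by rewrite -[X in _ == X]addr0 (inj_eq (addrI _)) => /eqP.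
    have : (1 + t) * (1 - t) ^+ 2 = 0.
      have s2 : s ^+ 2 != 0 by rewrite sqrf_eq0 gt_eqF.
      apply: (mulfI s2); rewrite mulr0.
      have -> : s ^+ 2 * ((1 + t) * (1 - t) ^+ 2) = 8 * (s ^+ 2 * (1 - t ^+ 2) * (1 - t) / 8) by field.
      by rewrite e0 mulr0.
    move/eqP; rewrite mulf_eq0 sqrf_eq0 => /orP[/eqP h|/eqP h]; [right|left]; rewrite /= ut; lra.
  apply: (le_trans (measureU2 _ _ _)) => //; first exact: measurableU.
  rewrite -(adde0 0%E); apply: leeD; first by move/eqP: null; rewrite eq_le => /andP[].
  apply: (le_trans (measureU2 _ _ _)) => //; rewrite -(adde0 0%E); apply: leeD.
    by move/eqP: c1; rewrite eq_le => /andP[].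
  by move/eqP: c2; rewrite eq_le => /andP[].
by move=> h; move: m0; rewrite /mass h ltxx.
Qed.

(** First variation: moving y in the j-th direction of the frame A, to the point with hyperboloid
    coordinates sqrt (1 + b^2) and b, changes the integral by at most b^2 [mass P] + b I. This is
    nonnegative for every b only if I = 0. *)
Lemma min_balanced y : (forall y', 0 <= Int P (lnratio y y')) -> balanced y.
Proof.
move=> hmin A d1 Ay j; set I := Int P _.
have bs : bm (fun x => sv j (mulv A (V x))) by apply: bm_sv; exact: vmeas_mulv.
have key (b : R) : 0 <= b ^+ 2 * mass P + b * I.
  pose c := Num.sqrt (1 + b ^+ 2).
  have b2 : 0 <= b ^+ 2 by exact: sqr_ge0.
  have c2 : c ^+ 2 = 1 + b ^+ 2 by rewrite sqr_sqrtr // addr_ge0.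
  have c0 : 0 < c by rewrite sqrtr_gt0; lra.
  have cle : c - 1 <= b ^+ 2 by nra.
  have [|y' hy'] := @form_frame_exists _ A c (fun i => if i == j then b else 0) d1 c0.
    rewrite (bigD1 j) //= eqxx big1 ?addr0 ?c2; first ring.
    by move=> i /negbTE ->; rewrite expr0n.
  apply: (le_trans (hmin y')).
  have -> : b ^+ 2 * mass P + b * I = Int P (fun x => b ^+ 2 + b * sv j (mulv A (V x))).
    have b1 : bm (fun _ : T => b ^+ 2) by exact: bm_cst.
    have b3 : bm (fun x => b * sv j (mulv A (V x))) by apply: bmM => //; exact: bm_cst.
    by rewrite (IntD _ b1 b3) IntZ // Int_cst.
  apply: Int_le; first exact: bm_lnratio.
    by apply: bmD; [exact: bm_cst|apply: bmM => //; exact: bm_cst].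
  move=> x; rewrite /lnratio hy' -(mobH_to0 _ d1 Ay).
  have n0 : n2 (mulv A (V x)) != 0 by rewrite gt_eqF // n2_gt0 mulvV0.
  rewrite (bigD1 j) //= eqxx big1 ?addr0; last by move=> i /negbTE ->; rewrite mul0r.
  have fp : 0 < c + b * sv j (mulv A (V x)).
    have : 0 < form y' (V x) / form y (V x) by rewrite divr_gt0 ?form_gt0.
    rewrite hy' -(mobH_to0 _ d1 Ay) (bigD1 j) //= eqxx big1 ?addr0; last by move=> i /negbTE ->; rewrite mul0r.
    by rewrite mulrDl mulfK // /sv -mulrA.
  rewrite mulrDl mulfK // -mulrA -/(sv _ _).
  have := @le_ln1Dx R (c + b * sv j (mulv A (V x)) - 1).
  rewrite (_ : 1 + _ = c + b * sv j (mulv A (V x))); last by ring.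
  move=> h; apply: (le_trans (h _)); first by lra.
  by lra.
have m0 := mass_ge0 P.
apply/eqP; rewrite -sqrf_eq0 eq_le sqr_ge0 andbT leNgt; apply/negP => hI.
have m1 : 0 < 1 + 2 * mass P by lra.
(* A step of this size makes the quadratic expression negative, also when the mass is 0. *)
have := key (- I / (1 + 2 * mass P)).
have -> : (- I / (1 + 2 * mass P)) ^+ 2 * mass P + - I / (1 + 2 * mass P) * I =
    - (I ^+ 2 * (1 + mass P) / (1 + 2 * mass P) ^+ 2).
  by field; rewrite gt_eqF.
have m2 : 0 < 1 + mass P by lra.
have : 0 < I ^+ 2 * (1 + mass P) / (1 + 2 * mass P) ^+ 2.
  by apply: divr_gt0; [exact: mulr_gt0|exact: exprn_gt0].
by set X := _ / _; lra.
Qed.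

Lemma frame_balancedE y : frame_balanced y -> balanced y.
Proof. by move=> h; apply: min_balanced => y'; exact: balanced_min. Qed.

(* No spherical cap of chordal size about [eps] carries more than a quarter of the mass. *)
Definition spread (eps : R) (W : T -> C * C) : Prop := forall a : C * C, a != 0 ->
  fine (P [set x | nsq (herm (W x) a) <= eps * (n2 (W x) * n2 a)]) <= mass P / 4.

(** With c the cosh of the distance from y to y', the ratio of forms is at least c eps outside a cap
    opposite to the direction of y', and at least 1 / (2 c) inside. The cap has at most a quarter of
    the mass, so the loss (ln 2 + 2 ln c) / 4 leaves half of ln c. *)
Lemma spread_lnratio (A : 'M[C]_2) (eps : R) y y' : \det A = 1 -> mobH A y = H3o R ->
  0 < eps <= 1 -> spread eps (fun x => mulv A (V x)) ->
  mass P * (ln (fc0 (mobH A y')) / 2 + ln eps - ln 2 / 4) <= Int P (lnratio y y').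
Proof.
move=> d1 Ay /andP[e0 e1] sp; set z := mobH A y'.
have zu := fc_unit z; have c1 : 1 <= fc0 z := fc0_ge1 z; set c := fc0 z in zu c1 *.
pose W x := mulv A (V x).
have mW : vmeas W by exact: vmeas_mulv.
have W0 x : 0 < n2 (W x) by rewrite n2_gt0 mulvV0.
have lc : 0 <= ln c by rewrite ln_ge0.
have le : ln eps <= 0 by rewrite ln_le0.
have l2 : 0 <= ln 2 :> R by rewrite ln_ge0 // ler1n.
have m0 := mass_ge0 P.
have cp : 0 < c by lra.
pose be := Num.sqrt (\sum_j fc z j ^+ 2).
have be2 : be ^+ 2 = \sum_j fc z j ^+ 2 by rewrite sqr_sqrtr // sumr_ge0 // => i _; exact: sqr_ge0.
have be0 : 0 <= be := sqrtr_ge0 _.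
have bec : be <= c.
  by rewrite -ler_sqr ?nnegrE ?(ltW cp) // be2; lra.
have lnE x : lnratio y y' x = ln (c + \sum_j fc z j * sv j (W x)).
  by rewrite (lnratioE _ d1 Ay).
clearbody c.
have [b0|b0] := eqVneq be 0.
  have f0 j : fc z j = 0.
    move: be2; rewrite b0 expr0n /= => /esym/eqP; rewrite psumr_eq0 => [/allP h|i _]; last exact: sqr_ge0.
    by have := h j (mem_index_enum _); rewrite sqrf_eq0 => /eqP.
  have -> : c = 1 by move: zu; rewrite -be2 b0 expr0n /= subr0; nra.
  apply: (@le_trans _ _ 0).
    by rewrite ln1 mul0r add0r mulr_ge0_le0 // subr_le0 (le_trans le) // divr_ge0.
  by apply: Int_ge0 => x; rewrite lnE ln_ge0 // big1 ?addr0 // => j _; rewrite f0 mul0r.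
pose m j := fc z j / be.
have mu : \sum_j m j ^+ 2 = 1.
  by rewrite /m; under eq_bigr do rewrite exprMn; rewrite -mulr_suml -be2 -exprMn divff // expr1n.
have [a a0 ha] := opposite_line mu.
have an : 0 < n2 a by rewrite n2_gt0.
pose B := [set x | nsq (herm (W x) a) <= eps * (n2 (W x) * n2 a)].
have mB : measurable B.
  have mh : measurable_fun setT (fun x => nsq (herm (W x) a)).
    apply: meas_nsq; rewrite (_ : (fun x => _) = (fun x => conjc a.1 * (W x).1 + conjc a.2 * (W x).2)).
      exact: cmeas_lin mW.1 mW.2.
    by apply/funext => x; rewrite /herm; ring.
  have mr : measurable_fun setT (fun x => eps * (n2 (W x) * n2 a)).
    by apply: measurable_realfun.measurable_funM => //; apply: measurable_realfun.measurable_funM => //; exact: meas_n2.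
  rewrite /B -[X in measurable X]setTI; have := measurable_fun_ler mh mr.
  by move=> h; have := h measurableT [set true] I; congr (measurable (_ `&` _)); apply/seteqP; split.
have bI := bm_indic mB.
have bc k : bm (fun _ : T => k : R) by exact: bm_cst.
have bR : bm (fun x => (ln c + ln eps) + - (ln 2 + 2 * ln c) * \1_B x).
  by apply: bmD => //; apply: bmM.
have key x : (ln c + ln eps) + - (ln 2 + 2 * ln c) * \1_B x <= lnratio y y' x.
  rewrite lnE; have /andP[h1 h2] := sv_dot_bound (W x) c1 zu.
  have xp : 0 < c + \sum_j fc z j * sv j (W x).
    by apply: lt_le_trans h1; rewrite invr_gt0; lra.
  rewrite indicE; case: (boolP (x \in B)) => xB /=.
    have : ln (2 * c)^-1 <= ln (c + \sum_j fc z j * sv j (W x)) by rewrite ler_ln ?posrE ?invr_gt0 //; lra.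
    rewrite lnV ?posrE; last by lra.
    rewrite lnM ?posrE //; lra.
  rewrite mulr0 addr0 -lnM ?posrE // ler_ln ?posrE ?mulr_gt0 //.
  have {}xB : eps * (n2 (W x) * n2 a) < nsq (herm (W x) a).
    by rewrite ltNge; apply: contra xB => h; rewrite inE.
  have -> : \sum_j fc z j * sv j (W x) = be * (\sum_j m j * Sv j (W x)) / n2 (W x).
    rewrite mulr_sumr mulr_suml; apply: eq_bigr => j _; rewrite /m /sv; field.
    by rewrite b0 gt_eqF.
  move: xB; rewrite ha => xB.
  have {}xB : 2 * eps * n2 (W x) < n2 (W x) + \sum_j m j * Sv j (W x).
    rewrite -(ltr_pM2l an); lra.
  set X := \sum_j _ in xB *.
  rewrite -(ler_pM2r (W0 x)) mulrDl divfK ?gt_eqF //.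
  have k1 : be * (2 * eps * n2 (W x)) <= be * (n2 (W x) + X) by rewrite ler_wpM2l // ltW.
  have [e2|e2] := leP (2 * eps) 1.
    have : (c - be) * (eps * n2 (W x)) <= (c - be) * n2 (W x).
      by rewrite ler_wpM2l ?subr_ge0 // ler_piMl // ltW.
    have : 0 <= be * (eps * n2 (W x)) by rewrite !mulr_ge0 // ltW.
    by nra.
  have : (c - be) * (eps * n2 (W x)) <= (c - be) * n2 (W x).
    by rewrite ler_wpM2l ?subr_ge0 // ler_piMl // ltW.
  have : 0 <= be * (eps * n2 (W x)) by rewrite !mulr_ge0 // ltW.
  by nra.
apply: (le_trans _ (Int_le P bR (bm_lnratio y y') key)).
have bX : bm (fun x => - (ln 2 + 2 * ln c) * \1_B x) by apply: bmM.
rewrite (IntD P (bc _) bX) Int_cst IntZ // Int_indic //.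
have := sp a a0; rewrite -/B => hB.
have : (ln 2 + 2 * ln c) * fine (P B) <= (ln 2 + 2 * ln c) * (mass P / 4).
  by rewrite ler_wpM2l //; lra.
by set p := fine _; lra.
Qed.

(** A balanced y' minimizes, so the integral of [lnratio y y'] is at most 0. With the previous
    growth estimate this bounds the distance. *)
Lemma balanced_bound (A : 'M[C]_2) (eps : R) y y' : \det A = 1 -> mobH A y = H3o R ->
  0 < eps <= 1 -> 0 < mass P -> spread eps (fun x => mulv A (V x)) -> balanced y' ->
  fc0 (mobH A y') <= 2 / eps ^+ 2.
Proof.
move=> d1 Ay e01 m0 sp hb; have /andP[e0 e1] := e01.
have h := spread_lnratio y' d1 Ay e01 sp.
have h2 := balanced_min y (balanced_frame hb).
have I0 : Int P (lnratio y y') <= 0.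
  rewrite -oppr_ge0 -IntN; last exact: bm_lnratio.
  rewrite (_ : (fun x => _) = lnratio y' y) //.
  apply/funext => x; apply/eqP; rewrite eqr_oppLR -addr_eq0 -lnratio_trans.
  by rewrite /lnratio divff ?ln1 // gt_eqF // form_gt0.
have {}h := le_trans h I0; rewrite pmulr_rle0 // in h.
have c1 := fc0_ge1 (mobH A y'); move: h c1; set c := fc0 _; clearbody c => h c1.
rewrite -ler_ln ?posrE ?divr_gt0 ?exprn_gt0 //; last by lra.
rewrite ln_div ?posrE ?exprn_gt0 // lnXn //.
have l2 : 0 <= ln 2 :> R by rewrite ln_ge0 // ler1n.
by rewrite [ln eps *+ 2]mulr2n; lra.
Qed.

End Barycenter.

Lemma ct_eps (R : realType) (X : topologicalType) (f : X -> R) :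
  (forall x e, 0 < e -> \forall y \near nbhs x, `|f x - f y| <= e) -> continuous f.
Proof. by move=> h x; apply/cvgrPdist_le => e; exact: h. Qed.

Lemma ct_near_lt (R : realType) (X : topologicalType) (f : X -> R) (x : X) (e : R) :
  continuous f -> f x < e -> \forall y \near nbhs x, f y < e.
Proof. by move=> cf; exact: (cvgr_lt (f x) (cf x)). Qed.

Section Existence.
Context {d} {T : measurableType d} {R : realType}.
Variable P : {finite_measure set T -> \bar R}.
Local Notation C := R[i].
Local Notation Re := complex.Re.
Local Notation Im := complex.Im.
Variable V : T -> C * C.
Hypotheses (mV : vmeas V) (V0 : forall x, V x != 0).

(** The form is summed over the two vectors that [to0 y0] sends to the standard basis: the S3 terms
    cancel and the n2 terms give twice [fc0]. *)
Lemma fc0_to0 (y0 y : H3 R) : fc0 (mobH (to0 y0) y) = hcosh y0 y.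
Proof.
have t0 := ht_gt0 y0; have t := ht_gt0 y.
have s0 : Num.sqrt (ht y0) ^+ 2 = ht y0 by rewrite sqr_sqrtr ?ltW.
have sn : Num.sqrt (ht y0) != 0 by rewrite gt_eqF // sqrtr_gt0.
have sC : (Num.sqrt (ht y0))%:C%C != 0 by rewrite -(rmorph0 (real_complex R)) (inj_eq (@complexI R)).
set r := Num.sqrt _ in s0 sn sC.
have h1 := form_frame y (r%:C%C, 0) (to0_det y0).
have h2 := form_frame y (hz y0 * r^-1%:C%C, r^-1%:C%C) (to0_det y0).
rewrite mulv_to0 /= -/r mulr0 subr0 mulr0 -rmorphM mulVf //= in h1.
rewrite mulv_to0 /= -/r subrr mulr0 -rmorphM mulfV //= in h2.
have [a1 a2 a3] := SvE3 ((1, 0) : C * C); have [b1 b2 b3] := SvE3 ((0, 1) : C * C).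
rewrite !sum3E a1 a2 a3 in h1; rewrite !sum3E b1 b2 b3 in h2.
have e : form y (r%:C%C, 0) + form y (hz y0 * r^-1%:C%C, r^-1%:C%C) = 2 * fc0 (mobH (to0 y0) y).
  by rewrite h1 h2 /n2 /S1 /S2 /S3 /= nsq0 nsq1 /=; ring.
apply: (@mulfI _ 2) => //; rewrite -e hcoshE /form /= mulr0 subr0 nsq0 mulr0 addr0 nsq_real s0.
rewrite -mulrBl nsqM !nsq_real exprVn s0 (_ : nsq (hz y0 - hz y) = nsq (hz y0 - hz y)) //.
by field; rewrite !gt_eqF.
Qed.

(** Taking the logarithm of the height gives a global chart, in which hyperbolic balls lie in
    compact boxes ([hcosh_box]). *)
Definition pt_of (p : (R * R) * R) : H3 R :=
  exist _ ((p.1.1 +i* p.1.2)%C, expR p.2) (expR_gt0 p.2).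

Lemma pt_of_surj y : exists p, y = pt_of p.
Proof.
exists ((Re (hz y), Im (hz y)), ln (ht y)); apply: h3_ext; rewrite /pt_of /hz /ht /=.
  by case: ((val y).1).
by rewrite lnK // posrE; exact: ht_gt0.
Qed.

Lemma ct_fc0 : continuous (fun p => fc0 (pt_of p)).
Proof.
have c1 : continuous (fun p : (R * R) * R => p.1.1) by apply: ct_fst => x; exact: cvg_fst.
have c2 : continuous (fun p : (R * R) * R => p.1.2) by apply: ct_fst => x; exact: cvg_snd.
have c3 : continuous (fun p : (R * R) * R => expR p.2).
  by apply: ct_snd; exact: continuous_expR.
apply: ctM; first by do !apply: ctD; try exact: ct_cst; exact: ctX.
apply: (ctV (f := fun p : (R * R) * R => 2 * expR p.2)).
  by move=> p; rewrite mulf_neq0 // gt_eqF // expR_gt0.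
by apply: ctM => //; exact: ct_cst.
Qed.

Lemma ct_fc j : continuous (fun p => fc (pt_of p) j).
Proof.
have c1 : continuous (fun p : (R * R) * R => p.1.1) by apply: ct_fst => x; exact: cvg_fst.
have c2 : continuous (fun p : (R * R) * R => p.1.2) by apply: ct_fst => x; exact: cvg_snd.
have c3 : continuous (fun p : (R * R) * R => expR p.2).
  by apply: ct_snd; exact: continuous_expR.
have ci : continuous (fun p : (R * R) * R => (expR p.2)^-1).
  by apply: (ctV (f := fun p : (R * R) * R => expR p.2)) => // p; rewrite gt_eqF // expR_gt0.
rewrite /fc; case: j => -[|[|[|//]]] lt /=.
- by apply: ctM => //; exact: ctN.
- by apply: ctM => //; exact: ctN.
- apply: ctM.
    apply: ctD; last by apply: ctN; exact: ctX.
    apply: ctD; first exact: ct_cst.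
    by apply: ctN; apply: ctD; exact: ctX.
  apply: (ctV (f := fun p : (R * R) * R => 2 * expR p.2)).
    by move=> p; rewrite mulf_neq0 // gt_eqF // expR_gt0.
  by apply: ctM => //; exact: ct_cst.
Qed.

Lemma form_diff_le (y y' : H3 R) v :
  `|form y' v - form y v| <= (`|fc0 y' - fc0 y| + \sum_j `|fc y' j - fc y j|) * n2 v.
Proof.
rewrite !form_fc opprD addrACA -mulrBl -sumrB.
apply: (le_trans (ler_normD _ _)); rewrite [leRHS]mulrDl; apply: lerD.
  by rewrite normrM (ger0_norm (n2_ge0 v)).
apply: (le_trans (ler_norm_sum _ _ _)); rewrite mulr_suml ler_sum // => j _.
rewrite -mulrBl normrM ler_wpM2l //.
have [->|v0] := eqVneq v 0.
  rewrite /Sv /S1 /S2 /S3 /n2 /= nsq0 !mul0r addr0 subrr mulr0.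
  by case: j => -[|[|[|//]]] lt /=; rewrite normr0.
have h := sv_le1 j v; have n0 : 0 < n2 v by rewrite n2_gt0.
by move: h; rewrite /sv normrM normrV ?unitfE ?gt_eqF // (ger0_norm (ltW n0)) ler_pdivrMr // mul1r.
Qed.

Lemma lnratio_small y y' x (del : R) :
  `|fc0 y' - fc0 y| + \sum_j `|fc y' j - fc y j| <= del -> 4 * fc0 y * del <= 1 ->
  `|lnratio V y y' x| <= 4 * fc0 y * del.
Proof.
move=> hd h4; have c1 := fc0_ge1 y.
have n0 : 0 < n2 (V x) by rewrite n2_gt0.
have fy := form_gt0 y (V0 x); have fy' := form_gt0 y' (V0 x).
have lo : n2 (V x) <= 2 * fc0 y * form y (V x).
  have := sv_dot_bound (V x) c1 (fc_unit y) => /andP[h _].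
  have fE : form y (V x) = n2 (V x) * (fc0 y + \sum_j fc y j * sv j (V x)).
    rewrite form_fc [RHS]mulrDr [in RHS]mulr_sumr [fc0 y * _]mulrC; congr (_ + _); apply: eq_bigr => j _.
    by rewrite /sv; field; rewrite gt_eqF.
  rewrite fE mulrCA -[leLHS]mulr1 ler_wpM2l ?(ltW n0) //.
  rewrite -(@ler_pM2l _ (2 * fc0 y)) in h; last by lra.
  by rewrite mulfV in h; lra.
have df := le_trans (form_diff_le y y' (V x)) (ler_wpM2r (ltW n0) hd).
have del0 : 0 <= del.
  by apply: le_trans hd; rewrite addr_ge0 // sumr_ge0.
have key : `|form y' (V x) - form y (V x)| <= 2 * fc0 y * del * form y (V x).
  apply: (le_trans df); have := ler_wpM2l del0 lo; nra.
set e := 2 * fc0 y * del in key.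
have e1 : e <= 2^-1 by rewrite /e; lra.
have e0 : 0 <= e by rewrite /e; apply: mulr_ge0 => //; lra.
have {}h4 : 4 * fc0 y * del = 2 * e by rewrite /e; ring.
rewrite h4 /lnratio; move: key; set a := form y' _ in fy' *; set b := form y _ in fy *.
rewrite ler_norml => /andP[k1 k2].
have r1 : a / b <= 1 + e by rewrite ler_pdivrMr // mulrDl; lra.
have r2 : 1 - e <= a / b by rewrite ler_pdivlMr // mulrBl; lra.
have r0 : 0 < a / b by rewrite divr_gt0.
rewrite ler_norml; apply/andP; split.
  have i0 : 0 < b / a by rewrite divr_gt0.
  rewrite lerNl -lnV ?posrE // invf_div.
  have := @le_ln1Dx R (b / a - 1); rewrite (_ : 1 + _ = b / a); last by ring.
  move=> h; apply: (le_trans (h _)); first by lra.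
  rewrite lerBlDr ler_pdivrMr //.
  have q1 : 0 <= a - b + e * b by lra.
  have q2 : 0 <= (2 * e + 1) * (a - b + e * b) by apply: mulr_ge0 => //; lra.
  have q3 : 0 <= e * b * (1 - 2 * e) by apply: mulr_ge0; [apply: mulr_ge0 => //; exact: ltW|lra].
  by nra.
have := @le_ln1Dx R (a / b - 1); rewrite (_ : 1 + _ = a / b); last by ring.
by move=> h; apply: (le_trans (h _)); lra.
Qed.

Lemma ct_Int_lnratio y0 : continuous (fun p => Int P (lnratio V y0 (pt_of p))).
Proof.
apply: ct_eps => p e e0.
pose D q := `|fc0 (pt_of q) - fc0 (pt_of p)| + \sum_j `|fc (pt_of q) j - fc (pt_of p) j|.
have cabsf (f : (R * R) * R -> R) : continuous f -> continuous (fun q => `|f q|).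
  by move=> cf q; apply: cvg_norm; exact: cf.
have cD : continuous D.
  apply: ctD; first by apply: cabsf; apply: ctD; [exact: ct_fc0|exact: ct_cst].
  under eq_fun do rewrite sum3E.
  by do !apply: ctD; apply: cabsf; apply: ctD; try exact: ct_cst; exact: ct_fc.
have c1 := fc0_ge1 (pt_of p); set c := fc0 (pt_of p) in c1.
have m0 := mass_ge0 P.
pose del := Num.min (4 * c)^-1 (e / ((4 * c) * (1 + mass P))).
have del0 : 0 < del.
  have c4 : 0 < 4 * c by lra.
  have m1 : 0 < 1 + mass P by lra.
  rewrite /del lt_min invr_gt0 c4 /=; apply: divr_gt0 => //; exact: mulr_gt0.
have Dp : D p < del.
  by rewrite /D subrr normr0 add0r big1 // => j _; rewrite subrr normr0.
have hnear := ct_near_lt cD Dp.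
apply: filterS hnear => q Dq.
have b q' : bm (lnratio V y0 (pt_of q')) by exact: bm_lnratio.
rewrite distrC -(IntN P (b p)) -(IntD P (b q)); last exact: bmN.
rewrite (_ : (fun x => _) = lnratio V (pt_of p) (pt_of q)); last first.
  by apply/funext => x; rewrite (lnratio_trans V0 y0 (pt_of p)) addrAC subrr add0r.
have d1 : del <= (4 * c)^-1 by rewrite /del ge_min lexx.
have d2 : del <= e / ((4 * c) * (1 + mass P)) by rewrite /del ge_min lexx orbT.
have c4 : 0 < 4 * c by lra.
have h4 : 4 * c * del <= 1.
  by have := ler_wpM2l (ltW c4) d1; rewrite mulfV // gt_eqF.
apply: (le_trans (Int_norm_le P (bm_lnratio mV V0 _ _) (fun x => lnratio_small x (ltW Dq) h4))).
apply: (@le_trans _ _ (e / (1 + mass P) * mass P)).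
  rewrite ler_wpM2r //; apply: (le_trans (ler_wpM2l (ltW c4) d2)).
  by rewrite le_eqVlt; apply/orP; left; apply/eqP; field; apply/andP; split; lra.
by rewrite mulrAC ler_pdivrMr; [nra|lra].
Qed.

Lemma hcosh_box (y0 : H3 R) (K : R) (p : (R * R) * R) : hcosh y0 (pt_of p) <= K ->
  let rho := `|Re (hz y0)| + `|Im (hz y0)| + 2 * K * (ht y0 + (ht y0)^-1) in
  [/\ - rho <= p.1.1 <= rho, - rho <= p.1.2 <= rho & - rho <= p.2 <= rho].
Proof.
move=> hK rho; have s0 := ht_gt0 y0; have hK1 := le_trans (hcosh_ge1 _ _) hK.
move: hK; rewrite hcoshE.
have -> : hz (pt_of p) = (p.1.1 +i* p.1.2)%C by [].
have -> : ht (pt_of p) = expR p.2 by [].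
have t0 := expR_gt0 p.2; set t := expR p.2 in t0 *.
rewrite ler_pdivrMr ?mulr_gt0 // /nsq => hK.
set s := ht y0 in s0 hK.
have i0 : 0 < s^-1 by rewrite invr_gt0.
move: hK; set x := complex.Re _; set y := complex.Im _ => hK.
have x2 := sqr_ge0 x; have y2 := sqr_ge0 y.
have tK : t <= 2 * K * s.
  by rewrite -(ler_pM2r t0); have := sqr_ge0 s; nra.
have sK : s <= 2 * K * t.
  by rewrite -(ler_pM2r s0); have := sqr_ge0 t; nra.
have ti : t^-1 <= 2 * K * s^-1.
  by rewrite ler_pdivlMr // mulrC ler_pdivrMr //; lra.
have K0 : 0 < K by lra.
have r1 : 0 < 2 * K * s by rewrite !mulr_gt0.
have r2 : 0 < 2 * K * s^-1 by rewrite !mulr_gt0.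
have xy : x ^+ 2 + y ^+ 2 <= (2 * K * s) ^+ 2.
  have := ler_wpM2l (ltW r1) tK; have := sqr_ge0 s; have := sqr_ge0 t; nra.
have xb : `|x| <= 2 * K * s.
  by rewrite -(@ler_sqr _ `|x|) ?nnegrE ?(ltW r1) // -normrX ger0_norm //; lra.
have yb : `|y| <= 2 * K * s.
  by rewrite -(@ler_sqr _ `|y|) ?nnegrE ?(ltW r1) // -normrX ger0_norm //; lra.
have rhoE : rho = `|Re (hz y0)| + `|Im (hz y0)| + 2 * K * s + 2 * K * s^-1 by rewrite /rho mulrDr addrA.
have n1 := normr_ge0 (Re (hz y0)); have n2' := normr_ge0 (Im (hz y0)).
have lt1 : p.2 < t by have := ln_sublinear t0; rewrite /t expRK.
have lt2 : - p.2 < t^-1.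
  have ti0 : 0 < t^-1 by rewrite invr_gt0.
  by have := ln_sublinear ti0; rewrite lnV ?posrE // /t expRK.
split; rewrite -ler_norml rhoE.
- have -> : p.1.1 = Re (hz y0) - x by rewrite /x ReD ReN /=; ring.
  by apply: (le_trans (ler_normB _ _)); lra.
- have -> : p.1.2 = Im (hz y0) - y by rewrite /y ImD ImN /=; ring.
  by apply: (le_trans (ler_normB _ _)); lra.
- by rewrite ler_norml; apply/andP; split; lra.
Qed.

(** Spread in the frame of y0 makes the integral nonnegative where the cosh of the distance is at
    least K, and it is 0 at y0. So the minimum over a compact box containing the remaining points is
    a global minimum. *)
Lemma exists_balanced y0 (eps : R) : 0 < eps <= 1 -> 0 < mass P ->
  spread P eps (fun x => mulv (to0 y0) (V x)) -> exists y, balanced P V y.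
Proof.
move=> e01 m0 sp; have /andP[e0 e1] := e01.
pose K : R := 2 / eps ^+ 2.
have K1 : 1 <= K.
  rewrite /K ler_pdivlMr ?exprn_gt0 // mul1r.
  have : eps ^+ 2 <= 1 by rewrite expr_le1 // ltW.
  by lra.
have far y : K <= hcosh y0 y -> 0 <= Int P (lnratio V y0 y).
  move=> hK; apply: le_trans (spread_lnratio mV V0 y (to0_det y0) (to0P y0) e01 sp).
  rewrite fc0_to0 mulr_ge0 ?(ltW m0) //.
  have : ln K <= ln (hcosh y0 y) by rewrite ler_ln ?posrE ?(lt_le_trans ltr01) // (le_trans K1).
  rewrite /K ln_div ?posrE ?exprn_gt0 // lnXn // [ln eps *+ 2]mulr2n.
  have : 0 <= ln 2 :> R by rewrite ln_ge0 // ler1n.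
  by lra.
have t0 := ht_gt0 y0.
pose rho : R := `|Re (hz y0)| + `|Im (hz y0)| + 2 * K * (ht y0 + (ht y0)^-1).
pose B : set ((R * R) * R) := (`[- rho, rho]%classic `*` `[- rho, rho]%classic) `*` `[- rho, rho]%classic.
have cB : compact B by apply: compact_setX; [apply: compact_setX|]; exact: segment_compact.
have inB p : hcosh y0 (pt_of p) <= K -> B p.
  by move=> /hcosh_box[h1 h2 h3]; split; [split|]; rewrite /= in_itv.
have [p0 hp0] := pt_of_surj y0.
have Bp0 : B p0 by apply: inB; rewrite -hp0 hcoshxx.
have Bne : B !=set0 by exists p0.
have [|p pB hmin] := compact_EVT_min Bne cB (f := fun p => Int P (lnratio V y0 (pt_of p))).
  by apply: continuous_subspaceT; exact: ct_Int_lnratio.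
have lnxx : lnratio V y0 y0 = (fun=> 0).
  by apply/funext => x; rewrite /lnratio divff ?ln1 // gt_eqF // form_gt0.
have min0 : Int P (lnratio V y0 (pt_of p)) <= 0.
  have := hmin p0 (mem_set Bp0); rewrite -hp0 lnxx Int_cst mul0r; exact.
exists (pt_of p); apply: min_balanced => // y'.
have [q ->] := pt_of_surj y'.
have bq y : bm (lnratio V y0 y) by exact: bm_lnratio.
rewrite (_ : lnratio V (pt_of p) (pt_of q) = fun x => lnratio V y0 (pt_of q) x + - lnratio V y0 (pt_of p) x); last first.
  by apply/funext => x; rewrite (lnratio_trans V0 y0 (pt_of p)) addrAC subrr add0r.
rewrite (IntD P (bq _)) ?IntN //; last exact: bmN.
rewrite subr_ge0; have [hq|hq] := leP (hcosh y0 (pt_of q)) K.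
  by apply: hmin; apply: mem_set; exact: inB.
by apply: (le_trans min0); apply: far; exact: ltW.
Qed.

End Existence.

(** * Invariance of the spherical measure *)

Section PlaneChange.
Variable R : realType.
Local Notation leb := (@lebesgue_measure R).
Local Notation RR := (measurableTypeR R).
Local Notation mu2 := (leb \x leb)%E.
Local Open Scope ereal_scope.

Lemma integral_off0 (f g : R -> \bar R) : measurable_fun setT f -> measurable_fun setT g ->
  (forall y, (y != 0)%R -> f y = g y) -> \int[leb]_y f y = \int[leb]_y g y.
Proof.
move=> mf mg h; apply: ae_eq_integral => //.
exists [set 0%R]; split => //; first exact: lebesgue_measure_set1.
move=> y /= /not_implyP[_]; apply: contra_notP => /eqP; exact: h.
Qed.

Lemma integral_shear_x (k m c : R) (h : RR * RR -> \bar R) : (k != 0)%R ->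
  measurable_fun setT h -> (forall p, 0 <= h p) ->
  \int[mu2]_p h p = \int[mu2]_p (`|k|%:E * h (k * p.1 + m * p.2 + c, p.2)%R).
Proof.
move=> k0 mh h0.
have mk : measurable_fun setT (fun p : RR * RR => h (k * p.1 + m * p.2 + c, p.2)%R).
  apply: (measurableT_comp mh); apply: measurable_fun_pair => //.
  apply: measurable_realfun.measurable_funD => //; apply: measurable_realfun.measurable_funD;
   by apply: measurable_realfun.measurable_funM.
have mk2 : measurable_fun setT (fun p : RR * RR => `|k|%:E * h (k * p.1 + m * p.2 + c, p.2)%R).
  exact: measurable_funeM.
rewrite fubini_tonelli2 // [RHS]fubini_tonelli2 //; last by move=> p; rewrite mule_ge0.
apply: eq_integral => y _; rewrite /fubini_G.
rewrite (@integral_affine _ k (m * y + c)%R) //; last exact: measurableT_comp.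
by apply: eq_integral => x _; rewrite addrA.
Qed.

Lemma integral_shear_y (k m c : R) (h : RR * RR -> \bar R) : (k != 0)%R ->
  measurable_fun setT h -> (forall p, 0 <= h p) ->
  \int[mu2]_p h p = \int[mu2]_p (`|k|%:E * h (p.1, k * p.2 + m * p.1 + c)%R).
Proof.
move=> k0 mh h0.
have mk : measurable_fun setT (fun p : RR * RR => h (p.1, k * p.2 + m * p.1 + c)%R).
  apply: (measurableT_comp mh); apply: measurable_fun_pair => //.
  apply: measurable_realfun.measurable_funD => //; apply: measurable_realfun.measurable_funD;
   by apply: measurable_realfun.measurable_funM.
have mk2 : measurable_fun setT (fun p : RR * RR => `|k|%:E * h (p.1, k * p.2 + m * p.1 + c)%R).
  exact: measurable_funeM.
rewrite fubini_tonelli1 // [RHS]fubini_tonelli1 //; last by move=> p; rewrite mule_ge0.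
apply: eq_integral => x _; rewrite /fubini_F.
rewrite (@integral_affine _ k (m * x + c)%R) //; last exact: measurableT_comp.
by apply: eq_integral => y _; rewrite addrA.
Qed.

Lemma integral_plane_shift (a b : R) (h : RR * RR -> \bar R) :
  measurable_fun setT h -> (forall p, 0 <= h p) ->
  \int[mu2]_p h p = \int[mu2]_p h (p.1 + a, p.2 + b)%R.
Proof.
move=> mh h0.
rewrite (@integral_shear_x 1 0 a) ?oner_neq0 //.
have mk : measurable_fun setT (fun p : RR * RR => h (1 * p.1 + 0 * p.2 + a, p.2)%R).
  apply: (measurableT_comp mh); apply: measurable_fun_pair => //.
  apply: measurable_realfun.measurable_funD => //; apply: measurable_realfun.measurable_funD;
   by apply: measurable_realfun.measurable_funM.
rewrite (@integral_shear_y 1 0 b) ?oner_neq0 //; last 2 first.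
- by apply: measurable_funeM.
- by move=> p; rewrite mule_ge0.
by apply: eq_integral => p _ /=; rewrite normr1 !mul1e !mul1r !mul0r !addr0.
Qed.

(** Multiplication by a + i b is a product of two shears, with scale factors a and (a^2 + b^2) /
    a. *)
Lemma integral_plane_mul1 (a b : R) (h : RR * RR -> \bar R) : (a != 0)%R ->
  measurable_fun setT h -> (forall p, 0 <= h p) ->
  \int[mu2]_p h p = \int[mu2]_p ((a ^+ 2 + b ^+ 2)%:E * h (a * p.1 - b * p.2, b * p.1 + a * p.2)%R).
Proof.
move=> a0 mh h0; pose k := ((a ^+ 2 + b ^+ 2) / a)%R.
have n0 : (a ^+ 2 + b ^+ 2 != 0)%R by rewrite paddr_eq0 ?sqr_ge0 // sqrf_eq0 (negbTE a0).
have k0 : (k != 0)%R by rewrite mulf_neq0 // invr_eq0.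
rewrite (@integral_shear_y k (b / a) 0) //.
have mk : measurable_fun setT (fun p : RR * RR => h (p.1, k * p.2 + b / a * p.1 + 0)%R).
  apply: (measurableT_comp mh); apply: measurable_fun_pair => //.
  apply: measurable_realfun.measurable_funD => //; apply: measurable_realfun.measurable_funD;
   by apply: measurable_realfun.measurable_funM.
rewrite (@integral_shear_x a (- b) 0) //; last 2 first.
- by apply: measurable_funeM.
- by move=> p; rewrite mule_ge0.
apply: eq_integral => p _ /=; rewrite !addr0 muleA -EFinM; congr (_%:E * h (_, _)).
- rewrite /k normrM normrV ?unitfE // mulrCA divff ?normr_eq0 // mulr1.
  by rewrite ger0_norm // addr_ge0 ?sqr_ge0.
- ring.
- rewrite /k; field; exact: a0.
Qed.

Lemma measurable_plane_lin (a b c d : R) (h : RR * RR -> \bar R) : measurable_fun setT h ->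
  measurable_fun setT (fun p : RR * RR => h (a * p.1 + b * p.2, c * p.1 + d * p.2)%R).
Proof.
move=> mh; apply: (measurableT_comp mh); apply: measurable_fun_pair => //;
apply: measurable_realfun.measurable_funD; by apply: measurable_realfun.measurable_funM.
Qed.

Lemma integral_plane_mul (a b : R) (h : RR * RR -> \bar R) : (a ^+ 2 + b ^+ 2 != 0)%R ->
  measurable_fun setT h -> (forall p, 0 <= h p) ->
  \int[mu2]_p h p = \int[mu2]_p ((a ^+ 2 + b ^+ 2)%:E * h (a * p.1 - b * p.2, b * p.1 + a * p.2)%R).
Proof.
move=> n0 mh h0; have [a0|a0] := eqVneq a 0%R; last exact: integral_plane_mul1.
have b0 : (b != 0)%R by apply: contra n0 => /eqP ->; rewrite a0 !expr0n /= addr0.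
have b2 : (b / 2 != 0)%R by rewrite mulf_neq0.
(* i b = (b / 2 + i b / 2) (1 + i), and both factors have nonzero real part. *)
rewrite (@integral_plane_mul1 (b / 2) (b / 2)) // (@integral_plane_mul1 1 1) ?oner_neq0 //; last 2 first.
- apply: measurable_funeM.
  by under eq_fun do rewrite -mulNr; exact: measurable_plane_lin.
- by move=> p; rewrite mule_ge0 // lee_fin addr_ge0 ?sqr_ge0.
apply: eq_integral => p _ /=; rewrite muleA -EFinM a0; congr (_%:E * h (_, _)); by field.
Qed.

Lemma integral_plane_inv (h : RR * RR -> R) : continuous (h : R * R -> R) ->
  measurable_fun setT h -> (forall p, 0 <= h p)%R ->
  \int[mu2]_p (h p)%:E =
  \int[mu2]_p (h (p.1 / (p.1 ^+ 2 + p.2 ^+ 2), - p.2 / (p.1 ^+ 2 + p.2 ^+ 2)) /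
     (p.1 ^+ 2 + p.2 ^+ 2) ^+ 2)%:E.
Proof.
move=> ch mh h0.
(* The point (y x, y) is described by the ratio x and by y, with Jacobian |y|. In these coordinates
   z -> 1 / z is x -> - x together with y -> - 1 / ((1 + x^2) y), so for fixed x it reduces to
   inversion and scaling on the line. *)
have polar (f : RR * RR -> R) : measurable_fun setT f -> (forall p, 0 <= f p)%R ->
  \int[mu2]_p (f p)%:E = \int[leb]_x \int[leb]_y (`|y| * f (y * x, y))%:E.
  move=> mf f0; have mf' : measurable_fun setT (fun p => (f p)%:E) by exact/measurable_EFinP.
  pose g (p : RR * RR) : \bar R := (`|p.2| * f (p.2 * p.1, p.2)%R)%:E.
  have mg : measurable_fun setT g.
    apply/measurable_EFinP; apply: measurable_realfun.measurable_funM.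
      by apply: measurableT_comp.
    apply: (measurableT_comp mf); apply: measurable_fun_pair => //.
    exact: measurable_realfun.measurable_funM.
  have g0 p : 0 <= g p by rewrite lee_fin mulr_ge0.
  transitivity (\int[mu2]_p g p); last by rewrite fubini_tonelli1.
  have f0' p : 0 <= (f p)%:E by rewrite lee_fin.
  rewrite fubini_tonelli2 // [RHS]fubini_tonelli2 //.
  apply: integral_off0; [exact: measurable_fun_fubini_tonelli_G|exact: measurable_fun_fubini_tonelli_G|].
  move=> y y0; rewrite /fubini_G (@integral_affine _ y 0%R) //; last first.
    by apply/measurable_EFinP; apply: (measurableT_comp mf); apply: measurable_fun_pair => //.
  by apply: eq_integral => x _; rewrite /g /= addr0 EFinM.
pose H (p : RR * RR) : R := (h (p.1 / (p.1 ^+ 2 + p.2 ^+ 2), - p.2 / (p.1 ^+ 2 + p.2 ^+ 2)) /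
     (p.1 ^+ 2 + p.2 ^+ 2) ^+ 2)%R.
have msq : measurable_fun setT (fun p : RR * RR => (p.1 ^+ 2 + p.2 ^+ 2)%R).
  by apply: measurable_realfun.measurable_funD; exact: measurable_realfun.measurable_funX.
have mV (f : RR * RR -> R) : measurable_fun setT f -> measurable_fun setT (fun p => (f p)^-1)%R.
  by move=> mf; apply: (measurableT_comp (@measurable_invr R)).
have mH : measurable_fun setT H.
  apply: measurable_realfun.measurable_funM.
    apply: (measurableT_comp mh); apply: measurable_fun_pair.
      by apply: measurable_realfun.measurable_funM => //; exact: mV.
    by apply: measurable_realfun.measurable_funM; [exact: measurable_realfun.measurable_funN|exact: mV].
  by apply: mV; exact: measurable_realfun.measurable_funX.
have H0 p : (0 <= H p)%R by rewrite divr_ge0 // exprn_ge0 // addr_ge0 ?sqr_ge0.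
rewrite (polar h) // (polar H) //.
pose g (x y : R) : R := (`|y| * h (y * x, y))%R.
have cg x : continuous (g x).
  apply: ctM; first by move=> y; apply: cvg_norm.
  apply: (@ct_pair R R R R h (fun y => y * x)%R (fun y => y)) => //; last by move=> y; exact: cvg_id.
  by apply: ctM; [move=> y; exact: cvg_id|exact: ct_cst].
have g0 x y : (0 <= g x y)%R by rewrite mulr_ge0.
have mg2 : measurable_fun setT (fun p : RR * RR => (g p.1 p.2)%:E).
  apply/measurable_EFinP; apply: measurable_realfun.measurable_funM.
    by apply: measurableT_comp.
  apply: (measurableT_comp mh); apply: measurable_fun_pair => //.
  exact: measurable_realfun.measurable_funM.
have mint : measurable_fun setT (fun x : R => \int[leb]_y (g x y)%:E).
  apply: (@measurable_fun_fubini_tonelli_F _ _ _ _ _ leb (fun p : RR * RR => (g p.1 p.2)%:E)) => //.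
  by move=> p; rewrite lee_fin.
rewrite (integral_opp mint); last by move=> x; apply: integral_ge0 => y _; rewrite lee_fin.
apply: eq_integral => x _.
have mgx : measurable_fun setT (g (- x)%R) by apply: continuous_measurable_fun; exact: cg.
rewrite (integral_inv_line mgx) //; last by move=> y _; exact: cg.
have mgi : measurable_fun setT (fun y : R => (g (- x) y^-1 * y ^- 2)%:E).
  apply/measurable_EFinP; apply: measurable_realfun.measurable_funM.
    by apply: (measurableT_comp mgx); exact: measurable_invr.
  by apply: (measurableT_comp (@measurable_invr R)); exact: measurable_realfun.measurable_funX.
have x1 : (0 < 1 + x ^+ 2)%R by rewrite ltr_pwDl ?sqr_ge0.
rewrite (@integral_affine _ (- (1 + x ^+ 2))%R 0%R) //; last 2 first.
- by rewrite oppr_eq0 gt_eqF.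
- by move=> y; rewrite lee_fin mulr_ge0 // invr_ge0 sqr_ge0.
apply: eq_integral => y _; rewrite -EFinM; congr (_%:E); rewrite addr0 /g /H /=.
have [->|y0] := eqVneq y 0%R.
  by rewrite !mulr0 invr0 normr0 !mul0r mulr0 /=; ring.
have x1n : (1 + x ^+ 2 != 0)%R by rewrite gt_eqF.
have E : ((y * x) ^+ 2 + y ^+ 2 = y ^+ 2 * (1 + x ^+ 2))%R by ring.
rewrite E normrN (ger0_norm (ltW x1)) invrM ?unitfE ?oppr_eq0 // normrM !normrV ?unitfE ?oppr_eq0 //.
rewrite normrN (ger0_norm (ltW x1)).
rewrite (_ : (y^-1 / - (1 + x ^+ 2) * - x, y^-1 / - (1 + x ^+ 2)) =
   (y * x / (y ^+ 2 * (1 + x ^+ 2)), - y / (y ^+ 2 * (1 + x ^+ 2))))%R; last first.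
  have x1n' : (-1 - x ^+ 2 != 0)%R by rewrite -opprD oppr_eq0.
  by congr (_, _); field; rewrite ?y0 ?x1n ?x1n'.
set K := h _; have yn : `|y|%R != 0%R by rewrite normr_eq0.
rewrite !exprMn sqrrN; have -> : (y ^+ 2 = `|y| ^+ 2)%R by rewrite real_normK // num_real.
by field; rewrite yn x1n.
Qed.

End PlaneChange.

(** By uniqueness of the Radon-Nikodym derivative, g is the density of nu, and the change of
    variables formula extends the identity from sets to functions. *)
Lemma integral_density {d} {T : measurableType d} {R : realType}
    (mu : {sigma_finite_measure set T -> \bar R}) (nu : {finite_measure set T -> \bar R})
    (g : T -> R) : mu.-integrable setT (EFin \o g) -> (forall x, 0 <= g x) ->
  (forall A, measurable A -> nu A = \int[mu]_(x in A) (g x)%:E)%E ->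
  forall f : T -> \bar R, measurable_fun setT f -> (forall x, 0 <= f x)%E ->
  (\int[nu]_x f x = \int[mu]_x (f x * (g x)%:E))%E.
Proof.
move=> ig g0 nuE f mf f0.
have mg := measurable_int _ ig.
have dom : nu `<< mu.
  apply/null_content_dominatesP => A mA A0; rewrite nuE //.
  by apply: null_set_integral => //; exact: measurable_funS mg.
rewrite -(Radon_Nikodym_SigmaFinite.change_of_variables dom f0 measurableT mf).
have irn := Radon_Nikodym_SigmaFinite.f_integrable dom.
have mrn := measurable_int _ irn.
apply: ae_eq_integral => //; [exact: emeasurable_funM|exact: emeasurable_funM|].
have : ae_eq mu setT (Radon_Nikodym_SigmaFinite.f nu mu) (EFin \o g).
  apply: (integral_ae_eq measurableT irn mg) => E _ mE.
  by rewrite -Radon_Nikodym_SigmaFinite.f_integral // nuE.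
by apply: filterS => x h Dx; rewrite (h Dx).
Qed.

Section SphereMeasure.
Variable R : realType.
Local Notation C := R[i].
Local Notation leb := (@lebesgue_measure R).
Local Notation RR := (measurableTypeR R).
Local Notation mu2 := (leb \x leb)%E.
Local Notation T := (RR * RR)%type.

Lemma plane_sigma_finite : sigma_finite setT mu2.
Proof.
pose F (n : nat) : set R := `[(- n%:R)%R, n%:R%R]%classic.
have fF n : (leb (F n) < +oo)%E.
  by rewrite lebesgue_measure_itv /=; case: ifP => _; [rewrite -EFinB ltry|].
have mF n : measurable (F n : set RR) by exact: measurable_itv.
exists (fun n => F n `*` F n).
  apply/seteqP; split => // p _.
  have [n hn] : exists n : nat, (`|p.1| + `|p.2| <= n%:R)%R.
    by exists (Num.trunc (`|p.1| + `|p.2|)).+1; exact/ltW/truncnS_gt.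
  have h1 := normr_ge0 p.1; have h2 := normr_ge0 p.2.
  by exists n => //; split; rewrite /F /= in_itv /= -ler_norml; apply: le_trans hn; rewrite ?lerDl ?lerDr.
move=> n; split; first exact: measurableX.
rewrite product_measure1E //; apply: lte_mul_pinfty => //.
  by rewrite ge0_fin_numE //; exact: fF.
exact: fF.
Qed.

Definition cpt (p : R * R) : C := (p.1 +i* p.2)%C.

Definition dens (p : R * R) : R := (pi * (1 + p.1 ^+ 2 + p.2 ^+ 2) ^+ 2)^-1.

Lemma densE p : dens p = (pi * (1 + nsq (cpt p)) ^+ 2)^-1.
Proof. by rewrite /dens /nsq /= addrA. Qed.

Lemma dens_gt0 p : 0 < dens p.
Proof.
rewrite invr_gt0; apply: mulr_gt0; first exact: pi_gt0.
by rewrite exprn_gt0 // -addrA ltr_pwDl // addr_ge0 // sqr_ge0.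
Qed.

Lemma meas_dens : measurable_fun setT (dens : T -> R).
Proof.
apply: (measurableT_comp (@measurable_invr R)).
apply: measurable_realfun.measurable_funM => //; apply: measurable_realfun.measurable_funX.
apply: measurable_realfun.measurable_funD; last exact: measurable_realfun.measurable_funX.
by apply: measurable_realfun.measurable_funD => //; exact: measurable_realfun.measurable_funX.
Qed.

Lemma ct_dens : continuous (dens : R * R -> R).
Proof.
apply: ctV.
  by move=> p; have := dens_gt0 p; rewrite invr_gt0 => /gt_eqF ->.
apply: ctM; first exact: ct_cst.
have c1 : continuous (fun p : R * R => p.1) by move=> p; exact: cvg_fst.
have c2 : continuous (fun p : R * R => p.2) by move=> p; exact: cvg_snd.
by apply: ctX; apply: ctD; [apply: ctD; [exact: ct_cst|]|]; exact: ctX.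
Qed.

Lemma integral_oneDsqr_fin : (\int[leb]_x ((1 + x ^+ 2)^-1)%:E < +oo)%E.
Proof.
have mf : measurable_fun setT (fun x : R => ((1 + x ^+ 2)^-1)%:E).
  apply/measurable_EFinP; apply: (measurableT_comp (@measurable_invr R)).
  by apply: measurable_realfun.measurable_funD => //; exact: measurable_realfun.measurable_funX.
have f0 x : (0 <= ((1 + x ^+ 2)^-1)%:E :> \bar R)%E by rewrite lee_fin invr_ge0 addr_ge0 // sqr_ge0.
have half : (\int[leb]_(x in (`]0%R, +oo[%classic : set R)) ((1 + x ^+ 2)^-1)%:E < +oo)%E.
  apply: (@le_lt_trans _ _ (\int[leb]_(x in (`[0%R, +oo[%classic : set R)) ((1 + x ^+ 2)^-1)%:E)%E).
    apply: ge0_subset_integral => //; first exact: measurable_funS mf.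
    by move=> x /=; rewrite !in_itv /= !andbT; exact: ltW.
  have := @integral0y_oneDsqr R; rewrite /oneDsqr /= => ->; exact: ltry.
rewrite integral_line_split //.
under [X in (_ + X)%E]eq_integral do rewrite sqrrN.
by rewrite lte_add_pinfty.
Qed.

(** As (1 + x^2 + y^2)^2 >= (1 + x^2) (1 + y^2), the density is dominated by a product of two
    one-variable Cauchy densities up to a constant. *)
Lemma integral_dens_fin : (\int[mu2]_p (dens p)%:E < +oo)%E.
Proof.
pose a (x : R) : R := (1 + x ^+ 2)^-1.
have a0 x : 0 < a x by rewrite invr_gt0 ltr_pwDl ?sqr_ge0.
have ma : measurable_fun setT a.
  apply: (measurableT_comp (@measurable_invr R)).
  by apply: measurable_realfun.measurable_funD => //; exact: measurable_realfun.measurable_funX.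
pose g (p : T) : \bar R := ((pi^-1 * a p.1) * a p.2)%:E.
have pi0 := pi_gt0 R.
have g0 p : (0 <= g p)%E by rewrite lee_fin ltW // (mulr_gt0 (mulr_gt0 _ (a0 _)) (a0 _)) // invr_gt0.
have mg : measurable_fun setT g.
  apply/measurable_EFinP; apply: measurable_realfun.measurable_funM.
    by apply: measurable_realfun.measurable_funM => //; exact: measurableT_comp.
  exact: measurableT_comp.
apply: (@le_lt_trans _ _ (\int[mu2]_p g p)%E).
  apply: ge0_le_integral => //.
  - by move=> p _; rewrite lee_fin ltW // dens_gt0.
  - by apply/measurable_EFinP; exact: meas_dens.
  - move=> p _; rewrite lee_fin /dens /a invfM -mulrA ler_wpM2l ?invr_ge0 ?(ltW pi0) // -invfM.
    have h1 := sqr_ge0 p.1; have h2 := sqr_ge0 p.2.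
    rewrite lef_pV2 ?posrE; last 2 first.
    - by rewrite exprn_gt0 // -addrA ltr_pwDl // addr_ge0.
    - by apply: mulr_gt0; rewrite ltr_pwDl.
    have := mulr_ge0 h1 h2; nra.
rewrite fubini_tonelli1 //.
set K := (\int[leb]_x (a x)%:E)%E.
have Kfin : K \is a fin_num.
  rewrite ge0_fin_numE; first exact: integral_oneDsqr_fin.
  by apply: integral_ge0 => x _; rewrite lee_fin ltW.
have E x : fubini_F leb g x = ((pi^-1 * fine K)%:E * (a x)%:E)%E.
  rewrite /fubini_F /g /=.
  under eq_integral do rewrite EFinM.
  rewrite ge0_integralZl //; last 3 first.
  - exact/measurable_EFinP.
  - by move=> y _; rewrite lee_fin ltW.
  - by rewrite lee_fin; apply: mulr_ge0; [rewrite invr_ge0 ltW|exact: ltW].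
  by rewrite -/K -[in LHS](fineK Kfin) -!EFinM; congr (_%:E); ring.
under eq_integral do rewrite E.
have K0 : (0 <= fine K)%R by apply: fine_ge0; apply: integral_ge0 => x _; rewrite lee_fin ltW.
rewrite ge0_integralZl //; last 3 first.
- exact/measurable_EFinP.
- by move=> y _; rewrite lee_fin ltW.
- by rewrite lee_fin mulr_ge0 // invr_ge0 ltW.
by rewrite -/K -(fineK Kfin) -EFinM ltry.
Qed.

Definition sph (A : set T) : \bar R := (\int[mu2]_(p in A) (dens p)%:E)%E.

Let sph0 : sph set0 = 0%E. Proof. by rewrite /sph integral_set0. Qed.
Let sph_ge0 A : (0 <= sph A)%E.
Proof. by apply: integral_ge0 => p _; rewrite lee_fin ltW // dens_gt0. Qed.
Let sph_additive : semi_sigma_additive sph.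
Proof.
move=> /= F mF tF mUF; rewrite /sph; apply: cvg_toP.
  apply: ereal_nondecreasing_is_cvgn => m n mn.
  by apply: lee_sum_nneg_natr => // k _ _; exact: sph_ge0.
rewrite ge0_integral_bigcup//=.
- by apply: measurable_funTS; apply/measurable_EFinP; exact: meas_dens.
- by move=> x _; rewrite lee_fin ltW // dens_gt0.
Qed.
HB.instance Definition _ := isMeasure.Build _ _ _ sph sph0 sph_ge0 sph_additive.

Let sph_fin : fin_num_fun sph.
Proof. by apply: lty_fin_num_fun; exact: integral_dens_fin. Qed.
HB.instance Definition _ := Measure_isFinite.Build _ _ _ sph sph_fin.

Lemma integral_sph (f : T -> \bar R) : measurable_fun setT f -> (forall x, 0 <= f x)%E ->
  (\int[sph]_x f x = \int[mu2]_x (f x * (dens x)%:E))%E.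
Proof.
move=> mf f0; pose m : {sigma_finite_measure set T -> \bar R} :=
  HB.pack mu2 (Measure_isSigmaFinite.Build _ _ _ mu2 plane_sigma_finite).
rewrite -[mu2]/(m : _ -> _) (@integral_density _ _ _ m sph dens) //; last by move=> x; rewrite ltW // dens_gt0.
apply/integrableP; split; first by apply/measurable_EFinP; exact: meas_dens.
under eq_integral do rewrite gee0_abs ?lee_fin ?(ltW (dens_gt0 _)) //.
exact: integral_dens_fin.
Qed.

Lemma mass_sph_gt0 : 0 < mass sph.
Proof.
pose B : set T := (`[0%R, 1%R]%classic : set R) `*` (`[0%R, 1%R]%classic : set R).
have mB : measurable B by exact: measurableX.
have dB : (mu2 B = 1)%E.
  have el : leb (`[0%R, 1%R]%classic : set R) = 1%E.
    by rewrite lebesgue_measure_itv /= lte_fin ltr01 oppr0 adde0.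
  transitivity (leb (`[0%R, 1%R]%classic : set R) * leb (`[0%R, 1%R]%classic : set R))%E.
    exact: product_measure1E.
  by rewrite el mule1.
rewrite /mass -lte_fin fineK; last by rewrite fin_num_measure.
apply: (@lt_le_trans _ _ ((pi * 9)^-1)%:E).
  by rewrite lte_fin invr_gt0 mulr_gt0 // pi_gt0.
apply: (@le_trans _ _ (sph B)); last by rewrite le_measure ?inE.
rewrite /sph; have -> : (((pi * 9)^-1)%:E = \int[mu2]_(p in B) ((pi * 9)^-1)%:E :> \bar R)%E.
  by rewrite integral_cst // [X in (_ * X)%E]dB mule1.
apply: ge0_le_integral => //.
- by move=> p _; rewrite lee_fin invr_ge0 mulr_ge0 // pi_ge0.
- by apply: measurable_funTS; apply/measurable_EFinP; exact: meas_dens.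
move=> p [/=]; rewrite !in_itv /= => /andP[x0 x1] /andP[y0 y1].
have q : 0 < 1 + p.1 ^+ 2 + p.2 ^+ 2 by rewrite -addrA ltr_pwDl // addr_ge0 // sqr_ge0.
rewrite lee_fin /dens lef_pV2 ?posrE ?mulr_gt0 ?pi_gt0 ?exprn_gt0 //.
rewrite ler_wpM2l ?pi_ge0 // (_ : 9 = 3 ^+ 2); last by ring.
by rewrite ler_pXn2r ?nnegrE ?(ltW q) //; nra.
Qed.

Lemma mu2_set1 (q : R * R) : mu2 [set q] = 0%E.
Proof.
have -> : [set q] = [set q.1] `*` [set q.2] :> set T.
  by apply/seteqP; split => [_ ->|[a b] /= [-> ->]] //; case: q.
by rewrite product_measure1E // [X in (X * _)%E]lebesgue_measure_set1 mul0e.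
Qed.

Lemma measurable_pt (q : R * R) : measurable ([set q] : set T).
Proof.
have -> : [set q] = [set q.1] `*` [set q.2] :> set T.
  by apply/seteqP; split => [_ ->|[a b] /= [-> ->]] //; case: q.
exact: measurableX.
Qed.

Lemma sph_null (A : set T) : measurable A -> mu2 A = 0%E -> sph A = 0%E.
Proof.
move=> mA A0; apply: null_set_integral => //.
by apply: measurable_funTS; apply/measurable_EFinP; exact: meas_dens.
Qed.

Lemma mu2_seq (s : seq C) : measurable ([set p | cpt p \in s] : set T) /\ mu2 [set p | cpt p \in s] = 0%E.
Proof.
elim: s => [|z s [ms s0]].
  by rewrite (_ : [set p | _] = set0) ?measure0 //; apply/seteqP; split.
have E : [set p | cpt p \in z :: s] = [set (complex.Re z, complex.Im z)] `|` [set p | cpt p \in s] :> set T.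
  apply/seteqP; split => p /=; rewrite inE.
    move=> /orP[/eqP<-|h]; last by right.
    by left; case: p.
  by move=> [->|->]; [case: z {ms s0} => a b; rewrite eqxx|rewrite orbT].
have m1 := measurable_pt (complex.Re z, complex.Im z).
rewrite E; split; first exact: measurableU.
have h1 := mu2_set1 (complex.Re z, complex.Im z).
apply/eqP; rewrite -measure_le0; apply: (le_trans (measureU2 _ m1 ms)).
rewrite le_eqVlt; apply/orP; left; apply/eqP; transitivity (0 + 0 : \bar R)%E; last by rewrite adde0.
by congr (_ + _)%E; [exact: h1|exact: s0].
Qed.

Lemma poly_zero_null (q : {poly C}) : q != 0 ->
  measurable ([set p | q.[cpt p] = 0] : set T) /\ mu2 [set p | q.[cpt p] = 0] = 0%E.
Proof.
move=> q0; have [s qE] := closed_field_poly_normal q.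
have -> : [set p | q.[cpt p] = 0] = [set p | cpt p \in s].
  apply/seteqP; split => p /=.
    move=> /eqP; rewrite -[_ == 0]/(root q _) qE rootZ ?lead_coef_eq0 //.
    by rewrite root_prod_XsubC.
  by move=> ps; apply/eqP; rewrite -[_ == 0]/(root q _) qE rootZ ?lead_coef_eq0 // root_prod_XsubC.
exact: mu2_seq.
Qed.

End SphereMeasure.

Section SphereInvariance.
Variable R : realType.
Local Notation C := R[i].
Local Notation leb := (@lebesgue_measure R).
Local Notation RR := (measurableTypeR R).
Local Notation mu2 := (leb \x leb)%E.
Local Notation T := (RR * RR)%type.
Local Notation Re := complex.Re.
Local Notation Im := complex.Im.

Definition cm (h : C -> R) := measurable_fun setT (fun p : T => h (cpt p)).

Lemma cm_shift h c : cm h -> cm (fun z => h (z + c)).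
Proof.
move=> mh; pose s (p : T) : T := (p.1 + Re c, p.2 + Im c).
have -> : cm (fun z => h (z + c)) = measurable_fun setT ((fun p : T => h (cpt p)) \o s).
  by rewrite /cm; congr measurable_fun; apply/funext => p; rewrite /= /cpt /=; case: c {s}.
apply: measurableT_comp mh _; apply: measurable_fun_pair; exact: measurable_realfun.measurable_funD.
Qed.

Lemma cm_mul h c : cm h -> cm (fun z => h (c * z)).
Proof.
move=> mh; pose s (p : T) : T := (Re c * p.1 + - (Im c) * p.2, Re c * p.2 + Im c * p.1).
have -> : cm (fun z => h (c * z)) = measurable_fun setT ((fun p : T => h (cpt p)) \o s).
  rewrite /cm; congr measurable_fun; apply/funext => p; rewrite /= /cpt /s /=; case: c {s} => a b /=.
  by rewrite mulNr.
apply: measurableT_comp mh _; apply: measurable_fun_pair;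
  apply: measurable_realfun.measurable_funD; exact: measurable_realfun.measurable_funM.
Qed.

Lemma cm_nsq : cm (@nsq R).
Proof.
apply: (@measurable_realfun.measurable_funD _ T R setT (fun p => p.1 ^+ 2) (fun p => p.2 ^+ 2));
  exact: measurable_realfun.measurable_funX.
Qed.

Lemma cpt_inv (p : R * R) : (cpt p)^-1 = (p.1 / (p.1 ^+ 2 + p.2 ^+ 2) +i* (- p.2 / (p.1 ^+ 2 + p.2 ^+ 2)))%C.
Proof. by case: p => a b; rewrite /cpt /= mulNr. Qed.

Lemma cm_inv h : cm h -> cm (fun z => h z^-1).
Proof.
move=> mh; pose s (p : T) : T := (p.1 / (p.1 ^+ 2 + p.2 ^+ 2), - p.2 / (p.1 ^+ 2 + p.2 ^+ 2)).
have -> : cm (fun z => h z^-1) = measurable_fun setT ((fun p : T => h (cpt p)) \o s).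
  by rewrite /cm; congr measurable_fun; apply/funext => p; rewrite cpt_inv.
have mv : measurable_fun setT (fun p : T => (p.1 ^+ 2 + p.2 ^+ 2)^-1).
  by apply: (measurableT_comp (@measurable_invr R)); exact: cm_nsq.
apply: measurableT_comp mh _; apply: measurable_fun_pair;
  apply: measurable_realfun.measurable_funM => //.
exact: measurable_realfun.measurable_funN.
Qed.

Definition cint (h : C -> R) : \bar R := (\int[mu2]_p (h (cpt p))%:E)%E.

Lemma cint_shift h c : cm h -> (forall z, 0 <= h z) -> cint h = cint (fun z => h (z + c)).
Proof.
move=> mh h0; rewrite /cint (@integral_plane_shift _ (Re c) (Im c)); last 2 first.
- exact/measurable_EFinP.
- by move=> p; rewrite lee_fin.
by apply: eq_integral => p _; rewrite /cpt /=; case: c.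
Qed.

Lemma cint_mul h c : c != 0 -> cm h -> (forall z, 0 <= h z) ->
  cint h = cint (fun z => nsq c * h (c * z)).
Proof.
move=> c0 mh h0; rewrite /cint (@integral_plane_mul _ (Re c) (Im c)); last 3 first.
- by rewrite -[X in X != 0]/(nsq c) nsq_eq0.
- exact/measurable_EFinP.
- by move=> p; rewrite lee_fin.
apply: eq_integral => p _; rewrite EFinM; congr (_ * (h _)%:E)%E.
by rewrite /cpt /=; case: c {c0} => a b /=; rewrite [(b * _ + _)%R]addrC.
Qed.

Lemma cint_inv h : continuous (fun p : R * R => h (cpt p)) -> cm h -> (forall z, 0 <= h z) ->
  cint h = cint (fun z => h z^-1 / nsq z ^+ 2).
Proof.
move=> ch mh h0; rewrite /cint (@integral_plane_inv _ (fun p => h (cpt p))) //.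
by apply: eq_integral => p _; rewrite cpt_inv.
Qed.

Lemma cint_ext h g z0 : cm h -> cm g -> (forall z, z != z0 -> h z = g z) -> cint h = cint g.
Proof.
move=> mh mg hg; apply: ae_eq_integral => //; try exact/measurable_EFinP.
exists [set (Re z0, Im z0)]; split; [exact: measurable_pt|exact: mu2_set1|].
move=> p /= /not_implyP[_]; apply: contra_notP => pz.
congr (_%:E); apply: hg; apply/eqP => e; apply: pz; rewrite -e.
by case: p {e}.
Qed.

Lemma ct_shift (h : C -> R) c : continuous (fun p : R * R => h (cpt p)) ->
  continuous (fun p : R * R => h (cpt p + c)).
Proof.
move=> ch; have E : (fun p : R * R => h (cpt p + c)) = fun p => (fun p : R * R => h (cpt p)) (p.1 + Re c, p.2 + Im c).
  by apply/funext => p; rewrite /cpt /=; case: c.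
rewrite E; apply: (@ct_pair R R R (R * R)%type (fun p => h (cpt p))) => //.
  by apply: ctD; [move=> p; exact: cvg_fst|exact: ct_cst].
by apply: ctD; [move=> p; exact: cvg_snd|exact: ct_cst].
Qed.

Lemma cm_mob h (a b c d : C) : c != 0 -> a * d - b * c = 1 -> cm h ->
  cm (fun z => h ((a * z + b) / (c * z + d)) / nsq (c * z + d) ^+ 2).
Proof.
move=> c0 D mh.
have mnsq2 : cm (fun z => (nsq z ^+ 2)^-1).
  by apply: (measurableT_comp (@measurable_invr R)); apply: measurable_realfun.measurable_funX; exact: cm_nsq.
apply: measurable_realfun.measurable_funM.
    (* The quotient is a / c - 1 / (c (c z + d)). At the pole division by 0 returns 0, whence the
       branch with value h 0. *)
    have -> : (fun p : T => h ((a * cpt p + b) / (c * cpt p + d))) = fun p : T => 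
     (fun z => if z == 0 then h 0 else h (a / c - z^-1 / c)) (c * cpt p + d).
      apply/funext => p; case: eqP => [->|/eqP n0]; first by rewrite invr0 mulr0.
      congr h; have -> : b = (a * d - 1) / c by rewrite -D opprB addrC subrK mulfK.
      by field; rewrite c0 n0.
    apply: (@cm_mul (fun z => (fun z => if z == 0 then h 0 else h (a / c - z^-1 / c)) (z + d)) c).
    apply: (@cm_shift (fun z => if z == 0 then h 0 else h (a / c - z^-1 / c)) d).
    apply: measurable_fun_ifT.
    + rewrite (_ : (fun p : T => cpt p == 0) = (fun p : T => nsq (cpt p) == 0)).
        by apply: measurable_fun_eqr => //; exact: cm_nsq.
      by apply/funext => p; rewrite nsq_eq0.
    + exact: measurable_cst.
    + have -> : (fun p : T => h (a / c - (cpt p)^-1 / c)) = fun p : T => (fun z => h (z + a / c)) ((- c^-1) * (cpt p)^-1).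
        by apply/funext => p; rewrite mulNr (mulrC c^-1) addrC.
      apply: (@cm_inv (fun z => (fun z => h (z + a / c)) ((- c^-1) * z))).
      by apply: (@cm_mul (fun z => h (z + a / c))); exact: cm_shift.
apply: (@cm_mul (fun z => (nsq (z + d) ^+ 2)^-1)).
exact: (@cm_shift (fun z => (nsq z ^+ 2)^-1)).
Qed.

(* z |-> (a z + b) / (c z + d) as the shift by a / c, inversion, multiplication
   by - c ^ 2 and the shift by d / c. *)
Lemma cint_mob h (a b c d : C) : c != 0 -> a * d - b * c = 1 ->
  continuous (fun p : R * R => h (cpt p)) -> cm h -> (forall z, 0 <= h z) ->
  cint h = cint (fun z => h ((a * z + b) / (c * z + d)) / nsq (c * z + d) ^+ 2).
Proof.
move=> c0 D ch mh h0.
rewrite (cint_shift (a / c)) //.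
pose h1 z := h (z + a / c).
have mh1 : cm h1 by exact: cm_shift.
rewrite (_ : cint _ = cint (fun z => h1 z^-1 / nsq z ^+ 2)); last first.
  rewrite -(@cint_inv h1) //; last by move=> z; exact: h0.
  exact: (@ct_shift h (a / c) ch).
have mnsq2 : cm (fun z => (nsq z ^+ 2)^-1).
  by apply: (measurableT_comp (@measurable_invr R)); apply: measurable_realfun.measurable_funX; exact: cm_nsq.
pose h2 z := h1 z^-1 / nsq z ^+ 2; rewrite -/h2.
have mh2 : cm h2 by apply: measurable_realfun.measurable_funM => //; exact: cm_inv.
have h20 z : 0 <= h2 z by rewrite divr_ge0 ?h0 // exprn_ge0 // nsq_ge0.
have c2 : - c ^+ 2 != 0 by rewrite oppr_eq0 expf_neq0.
rewrite (cint_mul c2) //.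
pose h3 z := nsq (- c ^+ 2) * h2 (- c ^+ 2 * z); rewrite -/h3.
have mh3 : cm h3 by apply: measurable_realfun.measurable_funM => //; exact: cm_mul.
rewrite (cint_shift (d / c)) //; last by move=> z; rewrite mulr_ge0 ?nsq_ge0.
apply: (@cint_ext _ _ (- d / c)).
- exact: (@cm_shift h3).
- exact: cm_mob.
move=> z zd; have n0 : c * z + d != 0.
  apply: contra zd => /eqP e; apply/eqP; have -> : d = - (c * z) by apply/eqP; rewrite -addr_eq0 addrC e.
  by rewrite opprK mulrC mulKf.
rewrite /h3 /h2 /h1.
have E1 : (- c ^+ 2 * (z + d / c))^-1 + a / c = (a * z + b) / (c * z + d).
  have -> : b = (a * d - 1) / c by rewrite -D opprB addrC subrK mulfK.
  by field; rewrite c0 n0.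
rewrite E1; have E2 : nsq (- c ^+ 2 * (z + d / c)) = nsq c * nsq (c * z + d).
  by rewrite -nsqM -[RHS]nsqN; congr nsq; field.
rewrite E2 nsqN nsqX; have : nsq c != 0 by rewrite nsq_eq0.
have : nsq (c * z + d) != 0 by rewrite nsq_eq0.
by move: (nsq c) (nsq _) (h _) => u v k v0 u0; field; rewrite u0 v0.
Qed.

(** K has degree 0, so it is a function on the sphere. Unitarity turns 1 + |z|^2 into |c z + d|^2 (1
    + |M z|^2), and the factor |c z + d|^4 in the density is compensated by the Jacobian of M. *)
Lemma sph_invariant_ge0 (K : C * C -> R) (a b c d : C) :
  a * d - b * c = 1 -> (forall v, n2 (a * v.1 + b * v.2, c * v.1 + d * v.2) = n2 v) ->
  (forall v, 0 <= K v) -> (forall (k : C) v, k != 0 -> K (k * v.1, k * v.2) = K v) ->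
  continuous (fun p : R * R => K (cpt p, 1)) -> cm (fun z => K (z, 1)) ->
  cm (fun z => K (a * z + b, c * z + d)) ->
  (\int[@sph R]_p (K (a * cpt p + b, c * cpt p + d))%:E = \int[@sph R]_p (K (cpt p, 1))%:E)%E.
Proof.
move=> D U K0 KZ cK mK mKU.
pose de (z : C) : R := (pi * (1 + nsq z) ^+ 2)^-1.
have de0 z : 0 <= de z by rewrite invr_ge0 mulr_ge0 ?pi_ge0 // exprn_ge0 // addr_ge0 ?nsq_ge0.
have mde : cm de.
  have := @meas_dens R; rewrite /cm; congr measurable_fun; apply/funext => p; exact: densE.
have cde : continuous (fun p : R * R => de (cpt p)).
  have -> : (fun p : R * R => de (cpt p)) = @dens R by apply/funext => p; rewrite densE.
  exact: ct_dens.
rewrite integral_sph; [|exact/measurable_EFinP|by move=> p; rewrite lee_fin].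
rewrite [RHS]integral_sph; [|exact/measurable_EFinP|by move=> p; rewrite lee_fin].
transitivity (cint (fun z => K (a * z + b, c * z + d) * de z)).
  by apply: eq_integral => p _; rewrite -EFinM densE.
transitivity (cint (fun z => K (z, 1) * de z)); last first.
  by apply: eq_integral => p _; rewrite -EFinM densE.
have m1 : cm (fun z => K (a * z + b, c * z + d) * de z) by exact: measurable_realfun.measurable_funM.
have m2 : cm (fun z => K (z, 1) * de z) by exact: measurable_realfun.measurable_funM.
have key z : c * z + d != 0 ->
  K (a * z + b, c * z + d) * de z =
  K ((a * z + b) / (c * z + d), 1) * de ((a * z + b) / (c * z + d)) / nsq (c * z + d) ^+ 2.
  move=> n0; have := U (z, 1); rewrite /n2 /= !mulr1 nsq1 => Uz.
  have -> : K (a * z + b, c * z + d) = K ((a * z + b) / (c * z + d), 1).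
    by rewrite -[in LHS](mulfVK n0 (a * z + b)) mulrC -[X in (_, X)](mulr1) (KZ _ (_, _)).
  rewrite /de -mulrA -invfM; congr (_ * _^-1).
  rewrite nsqM nsqV addrC -Uz; have : nsq (c * z + d) != 0 by rewrite nsq_eq0.
  by move: (nsq (c * z + d)) (nsq _) => u v u0; field.
have pos z : 0 <= K (z, 1) * de z by rewrite mulr_ge0.
(* If c = 0, unitarity forces b = 0 and |a| = |d| = 1, so that the map is a rotation of the
   plane. *)
have [c0|c0] := eqVneq c 0; last first.
  have ccK : continuous (fun p : R * R => K (cpt p, 1) * de (cpt p)) by exact: ctM.
  rewrite [RHS](@cint_mob (fun z => K (z, 1) * de z) a b c d) //.
  apply: (@cint_ext _ _ (- d / c)) => //; last first.
    move=> z zd; apply: key.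
    apply: contra zd => /eqP e; apply/eqP; have -> : d = - (c * z) by apply/eqP; rewrite -addr_eq0 addrC e.
    by rewrite opprK mulrC mulKf.
  exact: (@cm_mob (fun z => K (z, 1) * de z)).
have d0 : d != 0 by apply/eqP => d0; move: D; rewrite d0 c0 !mulr0 subr0 => /eqP; rewrite eq_sym oner_eq0.
have a0 : a != 0 by apply/eqP => a0; move: D; rewrite a0 c0 mul0r mulr0 subr0 => /eqP; rewrite eq_sym oner_eq0.
have na : nsq a = 1.
  transitivity (n2 (a * 1 + b * 0, c * 1 + d * 0)).
    by rewrite c0 !mulr0 !addr0 mulr1 mul0r /n2 /= nsq0 addr0.
  by rewrite (U (1, 0)) /n2 /= nsq0 nsq1 addr0.
have ad : a * d = 1 by rewrite -D c0 mulr0 subr0.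
have nd : nsq d = 1 by have := nsqM a d; rewrite ad na nsq1 mul1r.
have b0 : b = 0.
  apply/eqP; rewrite -nsq_eq0; apply/eqP.
  have : n2 (a * 0 + b * 1, c * 0 + d * 1) = nsq b + 1.
    by rewrite !mulr0 !add0r !mulr1 /n2 /= nd.
  by rewrite (U (0, 1)) /n2 /= nsq0 nsq1 add0r => e; lra.
have k0 : a / d != 0 by rewrite mulf_neq0 // invr_eq0.
have nk : nsq (a / d) = 1 by rewrite nsqM nsqV na nd invr1 mulr1.
rewrite (cint_mul k0 m2 pos); apply: eq_integral => p _; congr (_%:E).
rewrite nk mul1r /de nsqM nk mul1r; congr (_ * _).
rewrite c0 b0 mul0r addr0 add0r.
have -> : a / d * cpt p = d^-1 * (a * cpt p) by rewrite mulrCA mulrA.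
have := KZ d^-1 (a * cpt p, d); rewrite invr_eq0 /= mulVf // => -> //.
Qed.

(** Adding the constant 1 makes k nonnegative. *)
Lemma sph_invariant (k : C * C -> R) (a b c d : C) :
  a * d - b * c = 1 -> (forall v, n2 (a * v.1 + b * v.2, c * v.1 + d * v.2) = n2 v) ->
  (forall v, `|k v| <= 1) -> (forall (x : C) v, x != 0 -> k (x * v.1, x * v.2) = k v) ->
  continuous (fun p : R * R => k (cpt p, 1)) -> cm (fun z => k (z, 1)) ->
  cm (fun z => k (a * z + b, c * z + d)) ->
  Int (@sph R) (fun p => k (a * cpt p + b, c * cpt p + d)) = Int (@sph R) (fun p => k (cpt p, 1)).
Proof.
move=> D U kb kZ ck mk mkU.
have b1 : bm (fun p : T => k (a * cpt p + b, c * cpt p + d)) by split => //; exists 1.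
have b2 : bm (fun p : T => k (cpt p, 1)) by split => //; exists 1.
have [K KE] : exists K : C * C -> R, forall v, K v = 1 + k v by exists (fun v => 1 + k v).
have K1 : (fun p : T => K (a * cpt p + b, c * cpt p + d)) = (fun p => 1 + k (a * cpt p + b, c * cpt p + d)).
  by apply/funext.
have K2 : (fun p : T => K (cpt p, 1)) = (fun p => 1 + k (cpt p, 1)) by apply/funext.
have : Int (@sph R) (fun p => K (a * cpt p + b, c * cpt p + d)) = Int (@sph R) (fun p => K (cpt p, 1)).
  rewrite /Int /Rintegral; congr fine; apply: sph_invariant_ge0 => //.
  - by move=> v; rewrite KE; have := kb v; rewrite ler_norml => /andP[h _]; lra.
  - by move=> x v x0; rewrite !KE kZ.
  - by under eq_fun do rewrite KE; apply: ctD => //; exact: ct_cst.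
  - by rewrite /cm K2; exact: measurable_realfun.measurable_funD.
  - by rewrite /cm K1; exact: measurable_realfun.measurable_funD.
rewrite K1 K2 !(IntD (@sph R) (bm_cst 1)) //; exact: addrI.
Qed.

End SphereInvariance.

(** * Lifts of rational maps *)

Section PlaneTopology.
Variable R : realType.
Local Notation C := R[i].
Local Notation Re := complex.Re.
Local Notation Im := complex.Im.
Local Notation RR := (measurableTypeR R).
Local Notation T := (RR * RR)%type.

Lemma ballC (z w : C) (e : R) : @ball _ C z e%:C%C w <-> cabs (z - w) < e.
Proof.
rewrite -[ball _ _ _]/(is_true (`|z - w| < e%:C%C)) /Num.norm /= ltcE /= eqxx.
by [].
Qed.

Lemma nbhsC (z : C) (A : set C) :
  nbhs z A <-> exists2 e : R, 0 < e & forall w, cabs (z - w) < e -> A w.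
Proof.
split.
  move=> /nbhs_ballP[e /= e0 h]; move: e0; rewrite ltcE /= => /andP[/eqP ie re].
  exists (Re e) => // w zw; apply: h; have -> : e = (Re e)%:C%C by case: (e) ie => a b /= ->.
  exact/ballC.
move=> [e e0 h]; apply/nbhs_ballP; exists e%:C%C; first by rewrite /= ltcE /= eqxx.
by move=> w /ballC; exact: h.
Qed.

Lemma cabs_ge_Re (z : C) : `|Re z| <= cabs z.
Proof.
rewrite -(@ler_sqr _ `|Re z|) ?nnegrE ?cabs_ge0 // -normrX ger0_norm ?sqr_ge0 // cabs2E.
by rewrite lerDl sqr_ge0.
Qed.

Lemma cabs_ge_Im (z : C) : `|Im z| <= cabs z.
Proof.
rewrite -(@ler_sqr _ `|Im z|) ?nnegrE ?cabs_ge0 // -normrX ger0_norm ?sqr_ge0 // cabs2E.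
by rewrite lerDr sqr_ge0.
Qed.

Lemma cabs_le_ReIm (z : C) : cabs z <= `|Re z| + `|Im z|.
Proof.
rewrite -(@ler_sqr _ (cabs z)) ?nnegrE ?cabs_ge0 ?addr_ge0 // cabs2E sqrrD -!normrX !(ger0_norm (sqr_ge0 _)).
by rewrite lerD2r lerDl mulrn_wge0 // mulr_ge0.
Qed.

Lemma open_plane (U : set C) : open U -> open [set p : R * R | U (cpt p)].
Proof.
move=> oU; rewrite openE => p Up.
have /nbhsC[e e0 h] : nbhs (cpt p) U by apply: open_nbhs_nbhs; split.
apply/nbhs_ballP; exists (e / 2); first by rewrite /= divr_gt0.
move=> q [/= h1 h2]; apply: h; apply: (le_lt_trans (cabs_le_ReIm _)).
by rewrite /cpt /=; rewrite /ball /= in h1 h2; rewrite (splitr e) ltrD.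
Qed.

Lemma open_C (U : set C) : open [set p : R * R | U (cpt p)] -> open U.
Proof.
move=> oU; rewrite openE => z Uz; apply/nbhsC.
have Uz' : [set p : R * R | U (cpt p)] (Re z, Im z) by rewrite /= /cpt; case: z Uz.
have /nbhs_ballP[e e0 h] : nbhs (Re z, Im z) [set p : R * R | U (cpt p)].
  by apply: open_nbhs_nbhs; split.
exists e => // w zw; have := h (Re w, Im w); rewrite /= /cpt; case: w zw => a b zw; apply.
split; apply: le_lt_trans zw; rewrite /=.
  by have := cabs_ge_Re (z - (a +i* b)%C); case: z {Uz Uz' h}.
by have := cabs_ge_Im (z - (a +i* b)%C); case: z {Uz Uz' h}.
Qed.

(** An open set is a countable union of boxes with rational centres and sides 2 / (n + 1), each of
    which is measurable for the product of the Borel structures. *)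
Lemma open_plane_measurable (U : set (R * R)) : open U -> measurable (U : set T).
Proof.
move=> oU.
pose box (a b : rat) (n : nat) : set T :=
  (`]ratr a - n.+1%:R^-1, ratr a + n.+1%:R^-1[%classic : set R) `*`
  (`]ratr b - n.+1%:R^-1, ratr b + n.+1%:R^-1[%classic : set R).
have mbox a b n : measurable (box a b n) by apply: measurableX; exact: measurable_itv.
have -> : U = \bigcup_(a : rat) \bigcup_(b : rat) \bigcup_(n : nat)
   (if pselect (box a b n `<=` U) then box a b n else set0) :> set T.
  apply/seteqP; split; last by move=> p [a _ [b _ [n _]]]; case: pselect => // h /h.
  move=> p Up; have /nbhs_ballP[e /= e0 h] : nbhs p U by apply: open_nbhs_nbhs; split.
  have [n hn] : exists n : nat, n.+1%:R^-1 < e / 2.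
    exists (Num.trunc (e / 2)^-1); rewrite invf_plt ?posrE ?divr_gt0 //.
    exact: truncnS_gt.
  have i0 : 0 < n.+1%:R^-1 :> R by rewrite invr_gt0.
  set i := n.+1%:R^-1 in i0 hn.
  have l1 : p.1 - i < p.1 + i by lra.
  have l2 : p.2 - i < p.2 + i by lra.
  have [a] := rat_in_itvoo l1; have [b] := rat_in_itvoo l2.
  rewrite !in_itv /= => /andP[b1 b2] /andP[a1 a2].
  exists a => //; exists b => //; exists n => //.
  have pb : box a b n p.
    by split; rewrite /= in_itv /= -/i; apply/andP; split; lra.
  suff bU : box a b n `<=` U by case: (pselect (box a b n `<=` U)).
  move=> q [] /=; rewrite -/i; rewrite !in_itv /= => /andP[h1 h2] /andP[h3 h4]; apply: h.
  by split; rewrite /ball /= ltr_norml; apply/andP; split; lra.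
apply: bigcupT_measurable_rat => a; apply: bigcupT_measurable_rat => b.
by apply: bigcup_measurable => n _; case: ifPn => _; [exact: mbox|exact: measurable0].
Qed.

Lemma measurable_cpt (W : T -> C) (U : set C) : cmeas W -> open U -> measurable [set p | U (W p)].
Proof.
move=> [m1 m2] oU.
have mU := open_plane_measurable (open_plane oU).
have mW : measurable_fun setT (fun p => (Re (W p), Im (W p)) : T) by exact: measurable_fun_pair.
have := mW measurableT _ mU; rewrite setTI; congr measurable.
by apply/seteqP; split => p /=; rewrite /cpt /=; case: (W p).
Qed.

End PlaneTopology.

Section SphereMaps.
Variable R : realType.
Local Notation C := R[i].
Local Notation Re := complex.Re.
Local Notation Im := complex.Im.
Local Notation RR := (measurableTypeR R).
Local Notation T := (RR * RR)%type.

Definition proj (v : C * C) : Chat R := if v.2 == 0 then None else Some (v.1 / v.2).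

Lemma proj_stereo (v : C * C) (j : 'I_3) : v != 0 -> stereo (proj v) 0 j = sv j v.
Proof.
case: v => a b; rewrite xpair_eqE negb_and /proj /= => v0.
have [b0|b0] := eqVneq b 0.
  move: v0; rewrite b0 eqxx orbF => a0; rewrite /sv /Sv /S1 /S2 /S3 /n2 /= nsq0 subr0 addr0 mxE.
  have na : nsq a != 0 by rewrite nsq_eq0.
  case: j => -[|[|[|//]]] lt /=; rewrite ?mulr0 ?subr0 ?addr0 ?mulr0 ?mul0r //.
  by rewrite divff.
rewrite /stereo mxE mxE -nsqE nsqM nsqV /sv /n2 /=.
have nb : nsq b != 0 by rewrite nsq_eq0.
have ab : nsq a + nsq b != 0.
  by rewrite gt_eqF // ltr_wpDl ?nsq_ge0 // nsq_gt0.
have E : a / b = (((Re a * Re b + Im a * Im b) / nsq b) +i* ((Im a * Re b - Re a * Im b) / nsq b))%C.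
  case: a {v0 ab} => a1 a2; case: b b0 nb => b1 b2 b0 nb; rewrite /nsq /=.
  by congr (_ +i* _)%C; ring.
rewrite E /Sv /S1 /S2 /S3; move: (nsq a) ab => na ab; case: j => -[|[|[|//]]] lt /=.
- by field; rewrite nb ab.
- by field; rewrite nb ab.
- by field; rewrite nb ab.
Qed.

Lemma mobC_proj (M : 'M[C]_2) (v : C * C) : \det M != 0 -> v != 0 -> mobC M (proj v) = proj (mulv M v).
Proof.
case: v => a b D v0; rewrite /proj /mulv /=.
have [b0|b0] := eqVneq b 0.
  have a0 : a != 0 by move: v0; rewrite xpair_eqE b0 eqxx andbT.
  rewrite b0 /= !mulr0 !addr0 mulf_eq0 (negbTE a0) orbF.
  by case: eqP => // c0; congr Some; rewrite -mulf_div divff ?mulr1.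
rewrite /mobC.
have -> : M 1 0 * (a / b) + M 1 1 = (M 1 0 * a + M 1 1 * b) / b by field.
rewrite mulf_eq0 invr_eq0 (negbTE b0) orbF; case: eqP => // c0; congr Some.
by rewrite invf_div [LHS]mulrA; congr (_ / _); rewrite mulrDl -mulrA mulfVK.
Qed.

Lemma measurable_None : measurable ([set None] : set (Chat R)).
Proof.
have mS : measurable (Some @` setT : set (Chat R)).
  apply: sub_sigma_algebra; apply: one_point_compactification_open_some; exact: openT.
have -> : [set None] = ~` (Some @` setT) :> set (Chat R).
  apply/seteqP; split; first by move=> _ -> [z].
  by case=> // z /= []; exists z.
exact: measurableC.
Qed.

Lemma measurable_proj (W : T -> C * C) : vmeas W -> measurable_fun setT (fun p => proj (W p) : Chat R).
Proof.
move=> mW; 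
pose G : set (set (Chat R)) := @open (one_point_compactification C).
have H : @measurable _ (Chat R) = <<s G >> by [].
apply: (measurability G H).
move=> _ [U oU <-]; rewrite setTI.
have [m1 m2] := mW.
have m0 : measurable [set p | (W p).2 = 0].
  have := meas_nsq m2 measurableT (measurable_set1 0); rewrite setTI; congr measurable.
  apply/seteqP; split => p /=; first by move=> /eqP; rewrite nsq_eq0 => /eqP.
  by move=> ->; rewrite nsq0.
pose U' : set C := [set z | U (Some z)].
have oU' : open U'.
  have := @one_point_compactification_some_continuous C.
  by move=> /continuousP /(_ U oU).
have mdiv : cmeas (fun p => (W p).1 / (W p).2).
  have mn : measurable_fun setT (fun p => (nsq (W p).2)^-1).
    by apply: (measurableT_comp (@measurable_invr R)); exact: meas_nsq.
  have E p : (W p).1 / (W p).2 = ((Re (W p).1 * Re (W p).2 + Im (W p).1 * Im (W p).2) * (nsq (W p).2)^-1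
     +i* ((Im (W p).1 * Re (W p).2 + - (Re (W p).1 * Im (W p).2)) * (nsq (W p).2)^-1))%C.
    case: (W p) => -[a1 a2] [b1 b2]; rewrite /nsq /=; congr (_ +i* _)%C; ring.
  have [[r1 i1] [r2 i2]] := mW.
  split.
    under eq_fun do rewrite E /=.
    apply: measurable_realfun.measurable_funM => //; apply: measurable_realfun.measurable_funD;
      exact: measurable_realfun.measurable_funM.
  under eq_fun do rewrite E /=.
  apply: measurable_realfun.measurable_funM => //; apply: measurable_realfun.measurable_funD.
    exact: measurable_realfun.measurable_funM.
  apply: measurableT_comp => //; exact: measurable_realfun.measurable_funM.
have mU' := measurable_cpt mdiv oU'.
have -> : (fun p => proj (W p)) @^-1` U = ([set p | U' ((W p).1 / (W p).2)] `\` [set p | (W p).2 = 0])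
   `|` (if pselect (U None) then [set p | (W p).2 = 0] else set0).
  apply/seteqP; split => p; rewrite /preimage /= /proj.
    case: eqP => [e|e] h; last by left.
    by right; case: pselect.
  by move=> [[h] /eqP/negbTE ->|] //; case: pselect => // h /= ->; rewrite eqxx.
apply: measurableU; first exact: measurableD.
by case: ifPn => _; [exact: m0|exact: measurable0].
Qed.

Lemma ct_openC (h : C -> R) (a : R) : continuous (fun p : R * R => h (cpt p)) -> open [set z | a < h z].
Proof.
move=> ch; apply: open_C.
have := @open_comp _ _ (fun p : R * R => h (cpt p)) [set x | a < x] (fun p _ => ch p) (@open_gt R a).
by [].
Qed.

Lemma measurable_stereo j : measurable_fun setT (fun x : Chat R => stereo x 0 j).
Proof.
apply: (measurability _ (RGenOInfty.measurableE R)) => _ [_ [a ->] <-]; rewrite setTI.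
pose h (z : C) : R := sv j (z, 1).
have hz z : stereo (Some z : Chat R) 0 j = h z.
  rewrite /h -proj_stereo; last by rewrite xpair_eqE oner_eq0 andbF.
  by rewrite /proj /= oner_eq0 divr1.
have ch : continuous (fun p : R * R => h (cpt p)).
  have c1 : ccont (fun p : R * R => cpt p) by split; [move=> p; exact: cvg_fst|move=> p; exact: cvg_snd].
  have c2 : ccont (fun p : R * R => 1 : C) by exact: ccont_cst.
  apply: ctM; first exact: ct_Sv.
  apply: ctV; last exact: ct_n2.
  by move=> p; rewrite gt_eqF // n2_gt0 xpair_eqE oner_eq0 andbF.
have mS : measurable (Some @` [set z | a < h z] : set (Chat R)).
  apply: sub_sigma_algebra; apply: one_point_compactification_open_some; exact: ct_openC.
have -> : (fun x : Chat R => stereo x 0 j) @^-1` `]a, +oo[%classic =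
  (Some @` [set z | a < h z]) `|` (if a < stereo (None : Chat R) 0 j then [set None] else set0).
  apply/seteqP; split => x; rewrite /preimage /= in_itv /= andbT.
    case: x => [z|] h1; last by right; rewrite h1.
    by left; exists z => //=; rewrite -hz.
  by move=> [[z /= h1 <-]|]; [rewrite hz|case: ifP => // h1 ->].
apply: measurableU => //; case: ifP => // _; exact: measurable_None.
Qed.

Lemma integral_stereo_proj (W : T -> C * C) j : vmeas W -> (forall p, W p != 0) ->
  (\int[pushforward (@sph R) (fun p => proj (W p) : Chat R)]_x (stereo x 0 j)%:E = (Int (@sph R) (fun p => sv j (W p)))%:E)%E.
Proof.
move=> mW W0; have mp := measurable_proj mW.
have b := bm_sv j mW.
have E : (fun x : Chat R => (stereo x 0 j)%:E) \o (fun p => proj (W p)) = EFin \o (fun p => sv j (W p)).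
  by apply/funext => p /=; rewrite proj_stereo.
have ib := bm_integrable (@sph R) b.
rewrite (integral_pushforward mp) //.
- rewrite preimage_setT E /Int /Rintegral fineK //; exact: integrable_fin_num.
- by apply: measurableT_comp => //; exact: measurable_stereo.
- by rewrite preimage_setT E.
Qed.

End SphereMaps.

Section Homogeneous.
Variable R : realType.
Local Notation C := R[i].
Local Notation RR := (measurableTypeR R).
Local Notation T := (RR * RR)%type.

Lemma ct_meas (f : R * R -> R) : continuous f -> measurable_fun setT (f : T -> R).
Proof.
move=> cf; apply: (measurability _ (RGenOInfty.measurableE R)) => _ [_ [a ->] <-]; rewrite setTI.
have := @open_comp _ _ f [set x | a < x] (fun p _ => cf p) (@open_gt R a).
move=> /open_plane_measurable; congr measurable.
by apply/seteqP; split => p; rewrite /preimage /= in_itv /= andbT.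
Qed.

Lemma cpt_ccont : ccont (@cpt R).
Proof. by split; [move=> p; exact: cvg_fst|move=> p; exact: cvg_snd]. Qed.

Lemma svZ j (k : C) (v : C * C) : k != 0 -> sv j (k * v.1, k * v.2) = sv j v.
Proof.
move=> k0; have nk : nsq k != 0 by rewrite nsq_eq0.
have En : n2 (k * v.1, k * v.2) = nsq k * n2 v by transitivity (nsq (k * v.1) + nsq (k * v.2)); rewrite // !nsqM -mulrDr.
have ES : Sv j (k * v.1, k * v.2) = nsq k * Sv j v.
  case: v k {nk k0 En} => -[a1 a2] [b1 b2] [k1 k2]; rewrite /Sv /S1 /S2 /S3 /nsq /=.
  by case: j => -[|[|[|//]]] lt /=; ring.
by rewrite /sv En ES -mulf_div divff // mul1r.
Qed.

Variable d : nat.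
Implicit Types (c : coefs R d) (v : C * C).

Definition hom (p : 'rV[C]_d.+1) v : C := \sum_(i < d.+1) p 0 i * v.1 ^+ i * v.2 ^+ (d - i).
Definition homp c v : C * C := (hom c.1 v, hom c.2 v).

Lemma hom1 p z : hom p (z, 1) = (poly_of p).[z].
Proof.
rewrite /hom horner_poly; apply: eq_bigr => i _; rewrite expr1n mulr1.
by rewrite inord_val.
Qed.

Lemma homZ p (k : C) v : hom p (k * v.1, k * v.2) = k ^+ d * hom p v.
Proof.
rewrite /hom mulr_sumr; apply: eq_bigr => i _ /=.
have e : k ^+ d = k ^+ i * k ^+ (d - i) by rewrite -exprD subnKC // -ltnS.
rewrite !exprMn e; move: (k ^+ i) (k ^+ (d - i)) (v.1 ^+ i) (v.2 ^+ (d - i)) => k1 k2 x y.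
by ring.
Qed.

Lemma hom_inf p (a : C) : hom p (a, 0) = p 0 ord_max * a ^+ d.
Proof.
rewrite /hom (bigD1 ord_max) //= subnn expr0 mulr1 big1 ?addr0 // => i hi.
rewrite expr0n subn_eq0 leqNgt; have : (i < d)%N; last by move=> ->; rewrite mulr0.
by rewrite ltn_neqAle -ltnS ltn_ord andbT; apply: contra hi => /eqP e; apply/eqP/val_inj.
Qed.

Lemma hompZ c (k : C) v : homp c (k * v.1, k * v.2) = (k ^+ d * (homp c v).1, k ^+ d * (homp c v).2).
Proof. by rewrite /homp !homZ. Qed.

Lemma homp_neq0 c v : deg_coefs c -> v != 0 -> homp c v != 0.
Proof.
move=> [cop sz]; case: v => a b v0.
have [b0|b0] := eqVneq b 0.
  have a0 : a != 0 by move: v0; rewrite xpair_eqE b0 eqxx andbT.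
  rewrite b0 /homp !hom_inf; apply/negP; rewrite xpair_eqE !mulf_eq0 !expf_eq0 (negbTE a0) !andbF !orbF.
  move=> /andP[/eqP p0 /eqP q0].
  have small (p : 'rV[C]_d.+1) : p 0 ord_max = 0 -> (size (poly_of p) <= d)%N.
    move=> e; apply/leq_sizeP => j dj; rewrite /poly_of coef_poly.
    case: ltnP => // jd; have -> : j = d by apply/eqP; rewrite eqn_leq dj andbT -ltnS.
    by rewrite (_ : inord d = ord_max) //; apply/val_inj; rewrite /= inordK.
  have : (maxn (size (poly_of c.1)) (size (poly_of c.2)) <= d)%N by rewrite geq_max !small.
  by rewrite sz ltnn.
have -> : (a, b) = (b * (a / b, 1 : C).1, b * (a / b, 1 : C).2) by rewrite /= mulr1 mulrC mulfVK.
rewrite hompZ /homp !hom1 xpair_eqE !mulf_eq0 !expf_eq0 (negbTE b0) !andbF /=.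
apply/negP => /andP[p0 q0].
have := coprimep_root cop p0; rewrite (eqP q0) eqxx //.
Qed.

Lemma ccont_sum (X : topologicalType) n (F : 'I_n -> X -> C) : (forall i, ccont (F i)) -> ccont (fun x => \sum_(i < n) F i x).
Proof.
elim: n F => [|n ih] F cF.
  by under eq_fun do rewrite big_ord0; exact: ccont_cst.
by under eq_fun do rewrite big_ord_recr; apply: ccontD; [exact: ih|exact: cF].
Qed.

Lemma ccont_hom (X : topologicalType) p (f g : X -> C) : ccont f -> ccont g -> ccont (fun x => hom p (f x, g x)).
Proof.
move=> cf cg; apply: ccont_sum => i /=.
by apply: ccontM; [apply: ccontM; [exact: ccont_cst|]|]; exact: ccontX.
Qed.

Lemma ct_sv (X : topologicalType) j (f g : X -> C) : ccont f -> ccont g -> (forall x, (f x, g x) != 0) ->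
  continuous (fun x => sv j (f x, g x)).
Proof.
move=> cf cg h; apply: ctM; first exact: ct_Sv.
by apply: ctV; [move=> x; rewrite gt_eqF // n2_gt0|exact: ct_n2].
Qed.

Lemma ct_vmeas (f g : R * R -> C) : ccont f -> ccont g -> vmeas (fun p : T => (f p, g p)).
Proof. by move=> [f1 f2] [g1 g2]; split; split; exact: ct_meas. Qed.

Lemma ccont_lin (X : topologicalType) (a b : C) (f g : X -> C) : ccont f -> ccont g -> ccont (fun x => a * f x + b * g x).
Proof. by move=> cf cg; apply: ccontD; apply: ccontM => //; exact: ccont_cst. Qed.

Lemma pt1_neq0 (z : C) : (z, 1 : C) != 0.
Proof. by rewrite xpair_eqE oner_eq0 andbF. Qed.

Lemma mulv_neq0 (M : 'M[C]_2) v : \det M != 0 -> v != 0 -> mulv M v != 0.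
Proof. by move=> D; apply: contra => /eqP /(mulv_eq0 D) ->. Qed.

Section Invariance.
Variable G : C * C -> C * C.
Hypothesis G0 : forall v, v != 0 -> G v != 0.
Hypothesis GZ : forall (k : C) v, k != 0 -> exists2 l : C, l != 0 & G (k * v.1, k * v.2) = (l * (G v).1, l * (G v).2).
Hypothesis cG : forall f g : R * R -> C, ccont f -> ccont g ->
  ccont (fun p => (G (f p, g p)).1) /\ ccont (fun p => (G (f p, g p)).2).

Lemma sph_invariant_sv (U : 'M[C]_2) j : \det U = 1 -> (forall v, n2 (mulv U v) = n2 v) ->
  Int (@sph R) (fun p => sv j (G (mulv U (cpt p, 1)))) = Int (@sph R) (fun p => sv j (G (cpt p, 1))).
Proof.
move=> DU nU.
have U0 p : G (mulv U (cpt p, 1)) != 0.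
  by apply: G0; apply: mulv_neq0; [rewrite DU oner_eq0|exact: pt1_neq0].
have I0 p : G (cpt p, 1) != 0 by apply: G0; exact: pt1_neq0.
have c1 (a b : C) : ccont (fun p : R * R => a * cpt p + b * 1).
  by apply: ccont_lin; [exact: cpt_ccont|exact: ccont_cst].
have [u1 u2] := cG (c1 (U 0 0) (U 0 1)) (c1 (U 1 0) (U 1 1)).
have [i1 i2] := cG cpt_ccont (@ccont_cst R _ 1).
have g_eta x : ((G x).1, (G x).2) = G x by case: (G x).
have cU : continuous (fun p => sv j (G (mulv U (cpt p, 1)))).
  under eq_fun do rewrite -g_eta.
  by apply: (@ct_sv _ j _ _ u1 u2) => p; rewrite g_eta; exact: U0.
have cI' : continuous (fun p => sv j (G (cpt p, 1))).
  under eq_fun do rewrite -g_eta.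
  by apply: (@ct_sv _ j _ _ i1 i2) => p; rewrite g_eta.
have E p : mulv U (cpt p, 1) = (U 0 0 * cpt p + U 0 1, U 1 0 * cpt p + U 1 1) by rewrite /mulv /= !mulr1.
pose k v : R := sv j (G v).
have kE v : sv j (G v) = k v by [].
have kb v : `|k v| <= 1 by exact: sv_le1.
have kZ (x : C) v : x != 0 -> k (x * v.1, x * v.2) = k v.
  by move=> x0; rewrite /k; have [l l0 ->] := GZ v x0; rewrite svZ.
have mU := ct_meas cU; have mI := ct_meas cI'.
rewrite (_ : (fun p => sv j (G (mulv U (cpt p, 1)))) = fun p => k (U 0 0 * cpt p + U 0 1, U 1 0 * cpt p + U 1 1)); last first.
  by apply/funext => p; rewrite E.
apply: sph_invariant => //; first by rewrite -det2.
rewrite /cm; have -> : (fun p : T => k (U 0 0 * cpt p + U 0 1, U 1 0 * cpt p + U 1 1)) = fun p => sv j (G (mulv U (cpt p, 1))).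
  by apply/funext => p; rewrite E.
exact: mU.
Qed.

End Invariance.
End Homogeneous.

Section BarycentricExtension.
Variable R : realType.
Local Notation C := R[i].
Local Notation RR := (measurableTypeR R).
Local Notation T := (RR * RR)%type.
Local Notation P := (@sph R).

Lemma mulvM (A B : 'M[C]_2) v : mulv (A *m B) v = mulv A (mulv B v).
Proof.
have o1 : lift ord0 ord0 = 1 :> 'I_2 by apply/val_inj.
have E i j : (A *m B) i j = A i 0 * B 0 j + A i 1 * B 1 j.
  by rewrite mxE big_ord_recl big_ord1 o1.
by rewrite /mulv !E /=; congr (_, _); ring.
Qed.

(** The affine map z -> [ht x] z + [hz x], normalized to determinant 1; it is inverse to the one of
    [to0 x]. *)
Definition frame (x : H3 R) : 'M[C]_2 :=
  \matrix_(i, j) if i == 0 then (if j == 0 then (Num.sqrt (ht x))%:C%C else hz x * (Num.sqrt (ht x))^-1%:C%C)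
                 else (if j == 0 then 0 else (Num.sqrt (ht x))^-1%:C%C).

Lemma mulv_frame x v : mulv (frame x) v =
  ((Num.sqrt (ht x))^-1%:C%C * ((ht x)%:C%C * v.1 + hz x * v.2), (Num.sqrt (ht x))^-1%:C%C * v.2).
Proof.
have s0 : 0 < Num.sqrt (ht x) by rewrite sqrtr_gt0 ht_gt0.
rewrite /mulv !mxE /= mul0r add0r; congr (_, _).
rewrite mulrDr mulrA -rmorphM /=.
have -> : (Num.sqrt (ht x))^-1 * ht x = Num.sqrt (ht x).
  by rewrite -[in X in _ * X](sqr_sqrtr (ltW (ht_gt0 x))) expr2 mulKf // gt_eqF.
by rewrite [hz x * _]mulrC -mulrA.
Qed.

Lemma det_frame x : \det (frame x) = 1.
Proof.
have s0 : 0 < Num.sqrt (ht x) by rewrite sqrtr_gt0 ht_gt0.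
by rewrite det2 !mxE /= mulr0 subr0 -rmorphM /= divff // gt_eqF.
Qed.

Lemma frame0 x : mobH (frame x) (H3o R) = x.
Proof.
apply: n2_mulv_from0; first exact: det_frame.
move=> v; rewrite mulv_frame /form /=; have t0 := ht_gt0 x.
set s := (Num.sqrt (ht x))^-1%:C%C.
have -> : s * ((ht x)%:C%C * v.1 + hz x * v.2) - hz x * (s * v.2) = s * ((ht x)%:C%C * v.1) by ring.
rewrite !nsqM nsq_real /s nsq_real exprVn sqr_sqrtr ?(ltW t0) // /n2.
by move: (ht x) t0 (nsq v.1) (nsq v.2) => t t0 a b; field; rewrite gt_eqF.
Qed.

Section Balanced.
Variables (V V' : T -> C * C) (y : H3 R).
Lemma balancedZ : (forall p, exists2 k : C, k != 0 & V' p = (k * (V p).1, k * (V p).2)) ->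
  balanced P V y -> balanced P V' y.
Proof.
move=> h b A DA Ay j; rewrite -[RHS](b A DA Ay j); congr (Int P _); apply/funext => p.
have [k k0 ->] := h p; rewrite -[RHS](svZ j _ k0); congr (sv j _).
by rewrite /mulv /=; congr (_, _); ring.
Qed.
End Balanced.

Variable d : nat.

Lemma rat_coefs_deg (f : RatMap R d) : deg_coefs (rat_coefs f).
Proof. exact: set_valP (repr f). Qed.

Lemma rat_fun_proj (f : RatMap R d) v : v != 0 -> rat_fun f (proj v) = proj (homp (rat_coefs f) v).
Proof.
case: v => a b v0; rewrite /rat_fun; case: (rat_coefs f) => p q.
have [b0|b0] := eqVneq b 0.
  have a0 : a != 0 by move: v0; rewrite xpair_eqE b0 eqxx andbT.
  rewrite b0 /proj /= eqxx /homp !hom_inf /= mulf_eq0 expf_eq0 (negbTE a0) andbF orbF.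
  by case: eqP => // q0; rewrite -mulf_div divff ?mulr1 // expf_neq0.
have -> : (a, b) = (b * (a / b, 1 : C).1, b * (a / b, 1 : C).2) by rewrite /= mulr1 mulrC mulfVK.
have bd : b ^+ d != 0 by rewrite expf_neq0.
rewrite hompZ /proj /= !mulr1 (negbTE b0) mulrC mulKf // !hom1 mulf_eq0 (negbTE bd) /=.
by case: eqP => // q0; rewrite -mulf_div divff ?mul1r.
Qed.

Definition lift_at (c : coefs R d) (M : 'M[C]_2) (p : T) : C * C := homp c (mulv M (cpt p, 1)).
(** Up to a scalar factor this is [lift_at c (frame x)], written so that the polynomials are
    evaluated at [hz x + ht x * z] with second coordinate 1. *)
Definition rat_lift (c : coefs R d) (x : H3 R) (p : T) : C * C := homp c (hz x + (ht x)%:C%C * cpt p, 1).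

Lemma lift_at_ccont c M A : ccont (fun p => (mulv A (lift_at c M p)).1) /\ ccont (fun p => (mulv A (lift_at c M p)).2).
Proof.
have c1 (a b : C) : ccont (fun p : R * R => a * cpt p + b * 1).
  by apply: ccont_lin; [exact: cpt_ccont|exact: ccont_cst].
by split; apply: ccont_lin; apply: ccont_hom.
Qed.

Lemma rat_lift_ccont c x : ccont (fun p => (rat_lift c x p).1) /\ ccont (fun p => (rat_lift c x p).2).
Proof.
have c1 : ccont (fun p : R * R => hz x + (ht x)%:C%C * cpt p).
  by apply: ccontD; [exact: ccont_cst|apply: ccontM; [exact: ccont_cst|exact: cpt_ccont]].
by split; apply: ccont_hom => //; exact: ccont_cst.
Qed.

Lemma vmeas_lift c x : vmeas (rat_lift c x).
Proof. by have [h1 h2] := rat_lift_ccont c x; exact: (ct_vmeas h1 h2). Qed.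

Lemma lift_neq0 c x p : deg_coefs c -> rat_lift c x p != 0.
Proof. by move=> hc; apply: homp_neq0 => //; exact: pt1_neq0. Qed.

Lemma sphere_measureE (B : set (Chat R)) : sphere_measure B = P [set p | B (Some (cpt p))].
Proof. by []. Qed.

Lemma barycenter_balanced (f : RatMap R d) (M : 'M[C]_2) y : \det M = 1 ->
  is_barycenter (pushforward (pushforward (@sphere_measure R) (mobC M)) (rat_fun f)) y <->
  balanced P (lift_at (rat_coefs f) M) y.
Proof.
move=> DM; have hc := rat_coefs_deg f; set c := rat_coefs f in hc *.
have M0 : \det M != 0 by rewrite DM oner_eq0.
have key (A : 'M[C]_2) (j : 'I_3) : \det A = 1 ->
  (\int[pushforward (pushforward (pushforward (@sphere_measure R) (mobC M)) (rat_fun f)) (mobC A)]_x (stereo x 0 j)%:E =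
   (Int P (fun p => sv j (mulv A (lift_at c M p))))%:E)%E.
  move=> DA; have A0 : \det A != 0 by rewrite DA oner_eq0.
  have W0 p : mulv A (lift_at c M p) != 0.
    apply: mulv_neq0 => //; apply: homp_neq0 => //; apply: mulv_neq0 => //; exact: pt1_neq0.
  have [h1 h2] := lift_at_ccont c M A.
  have mW : vmeas (fun p => mulv A (lift_at c M p)) by exact: (ct_vmeas h1 h2).
  have gE : (fun p => mobC A (rat_fun f (mobC M (Some (cpt p))))) = (fun p => proj (mulv A (lift_at c M p))).
    apply/funext => p; have -> : Some (cpt p) = proj (cpt p, 1) by rewrite /proj /= oner_eq0 divr1.
    have v0 : mulv M (cpt p, 1) != 0 by apply: mulv_neq0 => //; exact: pt1_neq0.
    by rewrite mobC_proj ?pt1_neq0 // rat_fun_proj // mobC_proj //; exact: homp_neq0.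
  have mE : pushforward (pushforward (pushforward (@sphere_measure R) (mobC M)) (rat_fun f)) (mobC A) =
      pushforward P (fun p => proj (mulv A (lift_at c M p)) : Chat R).
    by rewrite -gE; apply/funext => B; exact: sphere_measureE.
  rewrite mE; exact: integral_stereo_proj.
split=> h A DA Ay j; have := h A DA Ay j; rewrite key //; first by move=> [].
by move=> ->.
Qed.

(** Two frames at the same point differ by a matrix of SU(2), and the spherical measure is invariant
    under it. *)
Lemma balanced_frames c (M M' : 'M[C]_2) y : deg_coefs c -> \det M = 1 -> \det M' = 1 ->
  mobH M (H3o R) = mobH M' (H3o R) ->
  balanced P (lift_at c M) y -> balanced P (lift_at c M') y.
Proof.
move=> hc DM DM' e b A DA Ay j; rewrite -[RHS](b A DA Ay j).
have [M1 [DM1 K1 K2]] := mulv_adjK DM.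
have M0 : \det M != 0 by rewrite DM oner_eq0.
have A0 : \det A != 0 by rewrite DA oner_eq0.
pose U := M1 *m M'.
have DU : \det U = 1 by rewrite det_mulmx DM1 DM' mulr1.
have MU v : mulv M (mulv U v) = mulv M' v by rewrite mulvM K2.
have nU v : n2 (mulv U v) = n2 v.
  by rewrite -(mobH_from0 _ DM erefl) MU e (mobH_from0 _ DM' erefl).
pose G v := mulv A (homp c (mulv M v)).
have E1 : (fun p => sv j (mulv A (lift_at c M' p))) = fun p => sv j (G (mulv U (cpt p, 1))).
  by apply/funext => p; rewrite /G MU.
have E2 : (fun p => sv j (mulv A (lift_at c M p))) = fun p => sv j (G (cpt p, 1)) by [].
have G0 v : v != 0 -> G v != 0.
  by move=> v0; apply: mulv_neq0 => //; apply: homp_neq0 => //; exact: mulv_neq0.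
have GZ (k : C) v : k != 0 -> exists2 l : C, l != 0 & G (k * v.1, k * v.2) = (l * (G v).1, l * (G v).2).
  move=> k0; exists (k ^+ d); first by rewrite expf_neq0.
  rewrite /G; have -> : mulv M (k * v.1, k * v.2) = (k * (mulv M v).1, k * (mulv M v).2).
    by rewrite /mulv /=; congr (_, _); ring.
  by rewrite hompZ /mulv /=; congr (_, _); ring.
have cG (g h : R * R -> C) : ccont g -> ccont h ->
    ccont (fun p => (G (g p, h p)).1) /\ ccont (fun p => (G (g p, h p)).2).
  move=> cg ch; have cl (a b' : C) : ccont (fun p : R * R => a * g p + b' * h p) by exact: ccont_lin.
  by split; apply: ccont_lin; apply: ccont_hom.
rewrite E1 E2; exact: (@sph_invariant_sv R G G0 GZ cG U j DU nU).
Qed.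

Lemma balanced_lift c x y : balanced P (rat_lift c x) y <-> balanced P (lift_at c (frame x)) y.
Proof.
have s0 : 0 < Num.sqrt (ht x) by rewrite sqrtr_gt0 ht_gt0.
have k0 : (Num.sqrt (ht x))^-1%:C%C != 0 :> C by rewrite fmorph_eq0 invr_eq0 gt_eqF.
have E p : lift_at c (frame x) p =
  ((Num.sqrt (ht x))^-1%:C%C ^+ d * (rat_lift c x p).1, (Num.sqrt (ht x))^-1%:C%C ^+ d * (rat_lift c x p).2).
  rewrite /lift_at mulv_frame /= mulr1 [_ + hz x]addrC.
  by rewrite -(hompZ c _ (hz x + (ht x)%:C%C * cpt p, 1)) /= ?mulr1.
split; apply: balancedZ => p.
  by exists ((Num.sqrt (ht x))^-1%:C%C ^+ d); [rewrite expf_neq0|].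
exists ((Num.sqrt (ht x))^-1%:C%C ^+ d)^-1; first by rewrite invr_eq0 expf_neq0.
by rewrite E /= !mulKf ?expf_neq0 //; case: (rat_lift c x p).
Qed.

(** The choice in [bary_ext] may come with any frame at x; it is transported to [frame x]. Existence
    rules out the default value. *)
Lemma bary_ext_balanced (f : RatMap R d) x : (exists y, balanced P (rat_lift (rat_coefs f) x) y) ->
  balanced P (rat_lift (rat_coefs f) x) (bary_ext (rat_fun f) x).
Proof.
move=> [y0 hy0]; have hc := rat_coefs_deg f.
rewrite /bary_ext; case: xgetP => [y _ [M [DM Mx /(barycenter_balanced f _ DM) b]]|/(_ y0)[]].
  apply/balanced_lift; apply: (balanced_frames hc DM (det_frame x) _ b).
  by rewrite Mx frame0.
exists (frame x); split; [exact: det_frame|exact: frame0|].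
apply: (iffRL (barycenter_balanced f y0 (det_frame x))).
exact: (iffLR (balanced_lift _ _ _) hy0).
Qed.

Hypothesis hd : (1 <= d)%N.

(** A linear relation would make one of two coprime polynomials a constant multiple of the other, so
    that both are constant, against d >= 1. Consequently no line of C^2 carries positive mass, which
    gives uniqueness of the barycentre. *)
Lemma coefs_indep (c : coefs R d) (u : C * C) : deg_coefs c -> u != 0 -> u.1 *: poly_of c.1 + u.2 *: poly_of c.2 != 0.
Proof.
move=> [cop sz] u0; set q := _ + _.
apply/negP => /eqP qE.
have : (maxn (size (poly_of c.1)) (size (poly_of c.2)) <= 1)%N; last by rewrite sz ltnS leqNgt hd.
have dv (a b0 : C) (A B : {poly C}) : a != 0 -> coprimep A B -> a *: A + b0 *: B = 0 -> (maxn (size A) (size B) <= 1)%N.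
  move=> a0 cAB e; have AE : A = (- (b0 / a)) *: B.
    apply: (scalerI a0); apply/eqP; rewrite scalerA mulrN mulrCA divff // mulr1 scaleNr -addr_eq0 e //.
  have dBA : B %| A by apply/dvdpP; exists (- (b0 / a))%:P; rewrite mul_polyC.
  have : B %| gcdp A B by rewrite dvdp_gcd dBA dvdpp.
  have g1 : size (gcdp A B) = 1%N by apply/eqP; rewrite -/(coprimep A B).
  move=> /dvdp_leq; rewrite g1 -size_poly_eq0 g1 => /(_ isT) sB.
  by rewrite geq_max sB andbT (leq_trans _ sB) // AE size_scale_leq.
have [u1|u1] := eqVneq u.1 0; last exact: dv u1 cop qE.
have u2 : u.2 != 0 by apply: contra u0 => /eqP u2; apply/eqP; case: (u) u1 u2 => a b0 /= -> ->.
by rewrite maxnC; apply: dv u2 _ _; [rewrite coprimep_sym|rewrite addrC; exact: qE].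
Qed.

Lemma lift_unique c x y y' : deg_coefs c -> balanced P (rat_lift c x) y -> balanced P (rat_lift c x) y' -> y = y'.
Proof.
move=> hc b b'.
apply: (@balanced_unique _ _ _ P (rat_lift c x) (vmeas_lift c x) (fun p => lift_neq0 x p hc) y y' (mass_sph_gt0 R) b b').
move=> u u0; pose q : {poly C} := u.1 *: poly_of c.1 + u.2 *: poly_of c.2.
have q0 : q != 0 by exact: coefs_indep.
pose l : {poly C} := (ht x)%:C%C *: 'X + (hz x)%:P.
have t0 : (ht x)%:C%C != 0 :> C by rewrite fmorph_eq0 gt_eqF // ht_gt0.
have ql0 : q \Po l != 0.
  rewrite comp_poly2_eq0 // /l size_polyDl ?size_scale ?size_polyX //.
  by rewrite (leq_ltn_trans (size_polyC_leq1 _)).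
have [mZ Z0] := poly_zero_null ql0.
rewrite -[RHS](sph_null mZ Z0); congr (sph _); apply/seteqP; split => p /=; rewrite horner_comp /q /l !hornerE /rat_lift /homp !hom1 /= [hz x + _]addrC //.
Qed.

End BarycentricExtension.

(** * Polynomials sampled at integers and the Gram point *)

Section Interpolation.
Variable R : realType.
Local Notation C := R[i].

Lemma cabsN (z : C) : cabs (- z) = cabs z.
Proof. exact: normcN. Qed.

Definition separated (s : R) (r : seq C) : Prop :=
  pairwise (fun z w => s <= cabs (z - w)) r.

Lemma poly_div_XsubC (p : {poly C}) (a : C) n : (size p <= n.+1)%N ->
  exists2 q : {poly C}, (size q <= n)%N & p = q * ('X - a%:P) + (p.[a])%:P.
Proof.
move=> sp; exists (p %/ ('X - a%:P)).
  by rewrite size_divp ?polyXsubC_eq0 // size_XsubC /= leq_subLR add1n.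
rewrite -modp_XsubC; exact: divp_eq.
Qed.

(** By induction on the number of nodes: dividing p - p(a) by X - a at one node a leaves a
    polynomial of smaller degree that is at most 2 e / s at the other nodes. The constant depends
    only on n, s and rho. *)
Lemma interpolation_growth n (s rho : R) : 0 < s -> exists2 K : R, 0 <= K &
  forall (p : {poly C}) (r : seq C) (e : R), (size p <= n)%N -> size r = n -> separated s r ->
    (forall z, z \in r -> cabs z <= rho) -> (forall z, z \in r -> cabs p.[z] <= e) ->
    0 <= e -> forall x, cabs p.[x] <= K * (1 + cabs x) ^+ n * e.
Proof.
move=> s0; elim: n => [|n [K K0 ih]].
  exists 0 => // p r e; rewrite leqn0 size_poly_eq0 => /eqP -> _ _ _ _ _ x.
  by rewrite horner0 Normc.normc0 !mul0r.
have [c c0 ec] : exists2 c : R, 0 <= c & c = (1 + `|rho|) * K * (2 / s).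
  exists ((1 + `|rho|) * K * (2 / s)) => //.
  by apply: mulr_ge0; [apply: mulr_ge0 => //; exact: addr_ge0|rewrite divr_ge0 // ltW].
exists (1 + c); first exact: addr_ge0.
move=> p [//|a r] e sp [sr] /= /andP[sa sep] br bp e0 x.
have [q sq pE] := poly_div_XsubC a sp.
have pa : cabs p.[a] <= e by apply: bp; rewrite inE eqxx.
have ra : cabs a <= `|rho| by apply: le_trans (br a _) (ler_norm _); rewrite inE eqxx.
have qz z : z \in r -> cabs q.[z] <= 2 / s * e.
  move=> zr; have saz : s <= cabs (a - z) by move/allP: sa => /(_ z zr).
  have pz : cabs p.[z] <= e by apply: bp; rewrite inE zr orbT.
  have E : q.[z] * (z - a) = p.[z] - p.[a] by rewrite [in RHS]pE !hornerE; ring.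
  have : cabs q.[z] * cabs (z - a) <= e + e.
    by rewrite -Normc.normcM E; apply: (le_trans (cabsB _ _)); exact: lerD.
  rewrite -(cabsN (z - a)) opprB => h.
  rewrite mulrAC ler_pdivlMr // (le_trans (ler_wpM2l (cabs_ge0 _) saz)) // (le_trans h) //.
  by rewrite mulrC mulr_natr mulr2n.
have qx : cabs q.[x] <= K * (1 + cabs x) ^+ n * (2 / s * e).
  apply: (ih q r (2 / s * e) sq sr sep _ qz) => //; first by move=> z zr; apply: br; rewrite inE zr orbT.
  by rewrite mulr_ge0 // divr_ge0 // ltW.
have x0 := cabs_ge0 x; have r0 := normr_ge0 rho.
have xa : cabs (x - a) <= (1 + `|rho|) * (1 + cabs x).
  apply: (le_trans (cabsB _ _)); have := mulr_ge0 r0 x0; nra.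
have X1 : 1 <= (1 + cabs x) ^+ n.+1 by rewrite exprn_ege1 // lerDl.
rewrite pE !hornerE; apply: (le_trans (@le_normcD R _ _)).
have -> : (1 + c) * (1 + cabs x) ^+ n.+1 * e = c * (1 + cabs x) ^+ n.+1 * e + (1 + cabs x) ^+ n.+1 * e by ring.
apply: lerD; last by rewrite (le_trans pa) // ler_peMl.
rewrite Normc.normcM mulrC; apply: (le_trans (ler_pM (cabs_ge0 _) (cabs_ge0 _) xa qx)).
rewrite ec exprS; move: ((1 + cabs x) ^+ n) => Y; rewrite le_eqVlt; apply/orP; left; apply/eqP; ring.
Qed.

Lemma interpolation_bound n (s rho X : R) : 0 < s -> 0 <= X -> exists2 K : R, 0 <= K &
  forall (p : {poly C}) (r : seq C) (e : R), (size p <= n)%N -> size r = n -> separated s r ->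
    (forall z, z \in r -> cabs z <= rho) -> (forall z, z \in r -> cabs p.[z] <= e) ->
    0 <= e -> forall x, cabs x <= X -> cabs p.[x] <= K * e.
Proof.
move=> s0 X0; have [K K0 h] := @interpolation_growth n s rho s0.
exists (K * (1 + X) ^+ n); first by rewrite mulr_ge0 // exprn_ge0 // addr_ge0.
move=> p r e sp sr sep br bp e0 x xX.
apply: (le_trans (h p r e sp sr sep br bp e0 x)); rewrite ler_wpM2r // ler_wpM2l //.
by rewrite lerXn2r ?nnegrE ?addr_ge0 ?cabs_ge0 // lerD2l.
Qed.

Local Notation leb := (@lebesgue_measure R).
Local Notation RR := (measurableTypeR R).
Local Notation mu2 := (leb \x leb)%E.
Local Notation T := (RR * RR)%type.
Local Notation P := (@sph R).
Local Notation Re := complex.Re.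
Local Notation Im := complex.Im.

Definition square (s : R) (z : C) : set T :=
  (`[Re z - s, Re z + s]%classic : set R) `*` (`[Im z - s, Im z + s]%classic : set R).

Lemma measurable_square s z : measurable (square s z).
Proof. by apply: measurableX; exact: measurable_itv. Qed.

Lemma dens_le1 (p : R * R) : dens p <= 1.
Proof.
have h1 := sqr_ge0 p.1; have h2 := sqr_ge0 p.2.
have p1 : 1 <= pi :> R by have := @pi_ge2 R; lra.
rewrite /dens invf_le1; last first.
  by rewrite mulr_gt0 ?pi_gt0 // exprn_gt0 // -addrA ltr_pwDl // addr_ge0.
have q1 : 1 <= (1 + p.1 ^+ 2 + p.2 ^+ 2) ^+ 2 by rewrite -addrA exprn_ege1 // lerDl addr_ge0.
by have := ler_pM ler01 ler01 p1 q1; rewrite mul1r.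
Qed.

Lemma sph_square s z : 0 <= s -> (P (square s z) <= (4 * s ^+ 2)%:E)%E.
Proof.
move=> s0; have ms := measurable_square s z.
have ml (a : R) : leb (`[a - s, a + s]%classic : set R) = (2 * s)%:E.
  rewrite lebesgue_measure_itv /= lte_fin.
  have [h|h] := ltP (a - s) (a + s).
    by rewrite -EFinB; congr (_%:E); ring.
  by congr (_%:E); lra.
have mu2s : mu2 (square s z) = (4 * s ^+ 2)%:E.
  pose A1 : set R := `[Re z - s, Re z + s]%classic; pose A2 : set R := `[Im z - s, Im z + s]%classic.
  transitivity (leb A1 * leb A2)%E.
    by apply: product_measure1E; exact: measurable_itv.
  by rewrite !ml -EFinM; congr (_%:E); ring.
have -> : ((4 * s ^+ 2)%:E = \int[mu2]_(p in square s z) (cst 1%E p) :> \bar R)%E.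
  by rewrite integral_cst // mul1e.
apply: ge0_le_integral => //.
- by move=> p _; rewrite lee_fin ltW // dens_gt0.
- by apply: measurable_funTS; apply/measurable_EFinP; exact: meas_dens.
- by move=> p _; rewrite lee_fin dens_le1.
Qed.

Lemma notin_square s (z w : C) : ~ square s z (Re w, Im w) -> s <= cabs (z - w).
Proof.
apply: contra_notP => /negP; rewrite -ltNge => h.
have h1 := le_lt_trans (cabs_ge_Re _) h; have h2 := le_lt_trans (cabs_ge_Im _) h.
move: h1 h2; case: z w {h} => a b [a' b'] /=; rewrite !ltr_norml => /andP[h1 h2] /andP[h3 h4].
by split; rewrite /= in_itv /=; apply/andP; split; lra.
Qed.

Lemma separated_points n (s : R) (E : set T) : 0 <= s -> measurable E ->
  ((n%:R * (4 * s ^+ 2))%:E < P E)%E ->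
  exists2 r : seq C, size r = n.+1 /\ separated s r & forall z, z \in r -> E (Re z, Im z).
Proof.
move=> s0 mE; have step k (r : seq C) : size r = k -> ((k%:R * (4 * s ^+ 2))%:E < P E)%E ->
  exists2 z : C, E (Re z, Im z) & all (fun w => s <= cabs (z - w)) r.
  move=> sr hE; pose U := \bigcup_(w in [set` r]) square s w.
  have [mU PU] : measurable U /\ (P U <= (k%:R * (4 * s ^+ 2))%:E)%E.
    rewrite /U -sr {sr hE U}; elim: r => [|w r [mU PU]].
      rewrite (_ : [set` [::]] = set0) ?bigcup_set0 ?measure0 ?mul0r //.
      by apply/seteqP; split.
    have -> : \bigcup_(w0 in [set` w :: r]) square s w0 = square s w `|` \bigcup_(w in [set` r]) square s w.
      apply/seteqP; split => p /=.
        by move=> [v]; rewrite /= inE => /orP[/eqP->|vr] h; [left|right; exists v].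
      by move=> [h|[v vr h]]; [exists w; rewrite //= inE eqxx|exists v; rewrite //= inE vr orbT].
    have mw := measurable_square s w; split; first exact: measurableU.
    apply: (le_trans (measureU2 _ mw mU)).
    apply: (le_trans (leeD (sph_square w s0) PU)).
    rewrite -EFinD lee_fin -[size (w :: r)]/(size r).+1 -(natr1 (size r)).
    by rewrite le_eqVlt; apply/orP; left; apply/eqP; ring.
  have : ~ E `<=` U.
    by move=> EU; have := le_lt_trans PU hE; rewrite ltNge le_measure ?inE.
  move=> /existsNP[p /not_implyP[Ep Up]]; exists (cpt p); first by case: p Ep {Up}.
  apply/allP => w wr; rewrite -cabsN opprB; apply: notin_square => h; apply: Up.
  by exists w => //=; case: p h {Ep}.
elim: n => [|n ih] hE.
  have [z Ez _] := step 0%N [::] erefl hE.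
  by exists [:: z] => // w; rewrite inE => /eqP->.
have hE' : ((n%:R * (4 * s ^+ 2))%:E < P E)%E.
  apply: le_lt_trans hE; rewrite lee_fin ler_wpM2r ?ler_nat // mulr_ge0 // sqr_ge0 //.
have [r [sr sep] Er] := ih hE'.
have [z Ez az] := step n.+1 r sr hE.
exists (z :: r); first by split; rewrite /= ?sr // /separated /= az.
by move=> w; rewrite inE => /orP[/eqP->//|]; exact: Er.
Qed.

End Interpolation.

(** * Orthogonality at the nodes and spread on the sphere *)

Section GramSchmidt.
Variable R : realType.
Local Notation C := R[i].
Local Notation RR := (measurableTypeR R).
Local Notation T := (RR * RR)%type.
Local Notation P := (@sph R).
Variable d : nat.
Implicit Types A B L : {poly C}.

Definition ev2 A : R := \sum_(j < d.+1) nsq A.[j%:R].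
Definition ip A B : C := \sum_(j < d.+1) A.[j%:R] * conjc B.[j%:R].

Lemma ev2_ge0 A : 0 <= ev2 A.
Proof. by apply: sumr_ge0 => j _; exact: nsq_ge0. Qed.

Lemma ev2_term A (j : 'I_d.+1) : nsq A.[j%:R] <= ev2 A.
Proof.
rewrite /ev2 (bigD1 j) //= lerDl; apply: sumr_ge0 => i _; exact: nsq_ge0.
Qed.

Lemma cabs_nat (n : nat) : cabs (n%:R : C) = n%:R.
Proof. by rewrite -(rmorph_nat (real_complex R)) cabs_real ger0_norm. Qed.

Lemma separated_nat : separated 1 [seq (j%:R : C) | j <- iota 0 d.+1].
Proof.
rewrite /separated pairwise_map; apply/(pairwiseP 0%N) => i j; rewrite !inE size_iota => ih jh ij.
change (is_true (1 <= cabs ((nth 0%N (iota 0 d.+1) i)%:R - (nth 0%N (iota 0 d.+1) j)%:R : C))).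
rewrite !nth_iota // !add0n -cabsN opprB -natrB ?(ltnW ij) // cabs_nat ler1n subn_gt0 //.
Qed.

Lemma ev2_gt0 A : (size A <= d.+1)%N -> A != 0 -> 0 < ev2 A.
Proof.
move=> sA A0; rewrite lt_neqAle ev2_ge0 andbT; apply/negP => /eqP e.
have z j : (j < d.+1)%N -> root A (j%:R).
  move=> jd; rewrite /root -nsq_eq0 eq_le nsq_ge0 andbT [X in _ <= X]e.
  exact: (ev2_term A (Ordinal jd)).
pose rs := [seq (j%:R : C) | j <- iota 0 d.+1].
have urs : uniq rs.
  rewrite map_inj_in_uniq ?iota_uniq // => i j _ _ /eqP.
  by rewrite eqr_nat => /eqP.
have h : all (root A) rs.
  by apply/allP => x /mapP[j]; rewrite mem_iota add0n => /andP[_ jd] ->; exact: z.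
by have := max_poly_roots A0 h urs; rewrite size_map size_iota ltnNge sA.
Qed.

Lemma horner_lin (a b : C) A B x : (a *: A + b *: B).[x] = a * A.[x] + b * B.[x].
Proof. by rewrite !hornerE. Qed.

Lemma ev2_lin (a b : C) A B : (ev2 (a *: A + b *: B))%:C%C =
  (nsq a * ev2 A + nsq b * ev2 B)%:C%C + (a * conjc b * ip A B + conjc (a * conjc b * ip A B)).
Proof.
rewrite /ev2 /ip 2!mulr_sumr rmorph_sum mulr_sumr -!big_split rmorph_sum /=.
rewrite [conjc (\sum_ _ _)]rmorph_sum -!big_split; apply: eq_bigr => j _ /=.
rewrite horner_lin; move: A.[_] B.[_] => x y.
case: a b x y => [a1 a2] [b1 b2] [x1 x2] [y1 y2]; rewrite /nsq /=.
by apply/eqP; rewrite eq_complex /=; apply/andP; split; apply/eqP; ring.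
Qed.

Lemma ev2_orth (a b : C) A B : ip A B = 0 -> ev2 (a *: A + b *: B) = nsq a * ev2 A + nsq b * ev2 B.
Proof.
move=> e; have := ev2_lin a b A B; rewrite e !mulr0 rmorph0 !addr0.
by move=> /(congr1 (@complex.Re R)).
Qed.

Lemma ev2Z (a : C) A : ev2 (a *: A) = nsq a * ev2 A.
Proof. by rewrite /ev2 mulr_sumr; apply: eq_bigr => j _; rewrite hornerZ nsqM. Qed.

Lemma ipZr (a : C) A B : ip A (a *: B) = conjc a * ip A B.
Proof.
rewrite /ip mulr_sumr; apply: eq_bigr => j _.
by rewrite [X in conjc X]hornerZ rmorphM /= mulrCA.
Qed.

Lemma hermE (v a : C * C) : nsq (herm v a) = nsq (conjc a.1 * v.1 + conjc a.2 * v.2).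
Proof. by rewrite /herm mulrC [v.2 * _]mulrC. Qed.

Lemma sph_disc (e : R) : 0 < e -> exists2 rho : R, 0 <= rho &
  fine (P [set p | rho < cabs (cpt p)]) <= e.
Proof.
move=> e0; pose F (n : nat) : set T := [set p | n%:R < cabs (cpt p)].
have mc : measurable_fun setT (fun p : T => cabs (cpt p)).
  apply: ct_meas; have -> : (fun p : R * R => cabs (cpt p)) = fun p => Num.sqrt (nsq (cpt p)).
    by apply/funext => p; rewrite nsqE sqrtr_sqr ger0_norm // cabs_ge0.
  by apply: ctcomp; [exact: sqrt_continuous|apply: ct_nsq; exact: cpt_ccont].
have mF n : measurable (F n).
  have -> : F n = (fun p : T => cabs (cpt p)) @^-1` `]n%:R, +oo[%classic.
    by apply/seteqP; split => p; rewrite /preimage /= in_itv /= andbT.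
  by rewrite -[X in measurable X]setTI; apply: mc.
have F0 : \bigcap_n F n = set0.
  apply/seteqP; split => // p /= h; have := h (Num.trunc (cabs (cpt p))).+1 I.
  by rewrite /F /= ltNge (ltW (truncnS_gt _)).
have ni : nonincreasing_seq F.
  move=> m n mn; apply/subsetPset => p; rewrite /F /=; apply: le_lt_trans.
  by rewrite ler_nat.
have /= := @nonincreasing_cvg_mu _ _ _ P F _ mF _ ni.
rewrite F0 measure0 => /(_ _ measurable0) h.
have {}h : (P \o F) n @[n --> \oo] --> (0 : \bar R).
  by apply: h; rewrite -ge0_fin_numE // fin_num_measure.
move/fine_cvgP : h => [_ h].
have [N _ hN] := cvgr_lt 0 h e e0.
by exists N%:R => //; exact/ltW/(hN N (leqnn N)).
Qed.

(** If a small cap carried too much mass, the combination L of A and B would be small at d + 1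
    separated points, hence at the nodes by interpolation. But the norm of L at the nodes is exactly
    n2 a times that of B, because A and B are orthogonal of equal norm. *)
Lemma uniform_spread : exists2 eps : R, 0 < eps <= 1 &
  forall A B, (size A <= d.+1)%N -> (size B <= d.+1)%N -> 0 < ev2 B -> ev2 A = ev2 B -> ip A B = 0 ->
  spread P eps (fun p => (A.[cpt p], B.[cpt p])).
Proof.
have m0 := mass_sph_gt0 R; set m := mass P in m0.
have m8 : 0 < m / 8 by rewrite divr_gt0.
have [rho rho0 hrho] := sph_disc m8.
(* Of the quarter of the mass one half, m / 8, is spent on the complement of a disc. This s makes d
   squares of half-side s too small to cover the other half, so that d + 1 separated points are
   found in it. *)
pose s := Num.sqrt (m / 8 / (4 * d.+1%:R)).
have s2 : s ^+ 2 = m / 8 / (4 * d.+1%:R) by rewrite sqr_sqrtr // divr_ge0 ?(ltW m8) // mulr_ge0.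
have s0 : 0 < s by rewrite sqrtr_gt0 divr_gt0 // mulr_gt0.
have [K1 K10 hK1] := @interpolation_bound R d.+1 1 d%:R rho ltr01 rho0.
have [K2 K20 hK2] := @interpolation_bound R d.+1 s rho d%:R s0 (ler0n _ _).
pose Z := d.+1%:R * (K2 ^+ 2 * (2 * K1 ^+ 2)).
have Z0 : 0 <= Z by rewrite /Z !mulr_ge0 ?sqr_ge0.
exists ((1 + Z)^-1).
  by rewrite invr_gt0 invf_le1 ?lerDl ?Z0 ?ltr_wpDr.
move=> A B sA sB N0 EAB IAB a a0; set N := ev2 B in N0 EAB *; set eps := (1 + Z)^-1.
rewrite leNgt; apply/negP => big.
have e0 : 0 < eps by rewrite invr_gt0 ltr_wpDr.
have na : 0 < n2 a by rewrite n2_gt0.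
pose L := conjc a.1 *: A + conjc a.2 *: B.
have sL : (size L <= d.+1)%N.
  by rewrite (leq_trans (size_polyD _ _)) // geq_max !(leq_trans (size_scale_leq _ _)).
have nsqJ (z : C) : nsq (conjc z) = nsq z by case: z => x y; rewrite /nsq /= sqrrN.
have evL : ev2 L = n2 a * N by rewrite /L ev2_orth // EAB !nsqJ -mulrDl.
pose S : set T := [set p | nsq (herm (A.[cpt p], B.[cpt p]) a) <= eps * (n2 (A.[cpt p], B.[cpt p]) * n2 a)].
pose D : set T := [set p | rho < cabs (cpt p)].
have hornc p : ccont (fun q : R * R => p.[cpt q]) by apply: ccont_horner; exact: cpt_ccont.
have mle (f g : T -> R) : measurable_fun setT f -> measurable_fun setT g -> measurable [set p | f p <= g p].
  by move=> mf mg; rewrite -[X in measurable X]setTI; exact: measurable_fun_le.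
have mS : measurable S.
  apply: mle.
    apply: ct_meas; under eq_fun do rewrite hermE /= -horner_lin; exact: ct_nsq.
  apply: ct_meas; apply: ctM; [exact: ct_cst|apply: ctM; [exact: ct_n2|exact: ct_cst]].
have mD : measurable D.
  have -> : D = ~` [set p | nsq (cpt p) <= rho ^+ 2].
    apply/seteqP; split => p; rewrite /D /= nsqE ler_sqr ?nnegrE ?cabs_ge0 // ltNge; first by move/negP.
    by move=> h; apply/negP.
  by apply: measurableC; apply: mle => //; apply: ct_meas; apply: ct_nsq; exact: cpt_ccont.
have big' : ((m / 8)%:E < P (S `\` D))%E.
  rewrite ltNge; apply/negP => sm.
  have : (P S <= (m / 8 + m / 8)%:E)%E.
    have -> : S = (S `\` D) `|` (S `&` D) by rewrite setUC setUIDK.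
    apply: (le_trans (measureU2 _ _ _)); [exact: measurableD|exact: measurableI|].
    rewrite EFinD leeD //; apply: (@le_trans _ _ (P D)).
      by apply: le_measure; rewrite ?inE //; exact: measurableI.
    by rewrite -(fineK (fin_num_measure P D mD)) lee_fin.
  rewrite -(fineK (fin_num_measure P S mS)) lee_fin; move: big; rewrite -/S -/m; lra.
have hsep : ((d%:R * (4 * s ^+ 2))%:E < P (S `\` D))%E.
  apply: le_lt_trans big'; rewrite lee_fin s2.
  have dd : 0 < d.+1%:R :> R by [].
  have -> : d%:R * (4 * (m / 8 / (4 * d.+1%:R))) = (m / 8) * (d%:R / d.+1%:R) by field; rewrite gt_eqF.
  by rewrite -[X in _ <= X]mulr1 ler_wpM2l ?(ltW m8) // ler_pdivrMr // mul1r ler_nat.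
have [r [sr sep] hr] := separated_points (ltW s0) (measurableD mS mD) hsep.
have rr z : z \in r -> cabs z <= rho.
  by move=> /hr[_]; rewrite /D /= leNgt => /negP; case: z.
have bd (M : {poly C}) : (size M <= d.+1)%N -> ev2 M = N -> forall z, cabs z <= rho -> nsq M.[z] <= K1 ^+ 2 * N.
  move=> sM eM z zr.
  have h := hK1 M _ (Num.sqrt N) sM _ separated_nat _ _ (sqrtr_ge0 _) z zr.
  rewrite nsqE -[X in K1 ^+ 2 * X](sqr_sqrtr (ltW N0)) -exprMn ler_sqr ?nnegrE ?cabs_ge0 ?mulr_ge0 ?sqrtr_ge0 //.
  apply: h; first by rewrite size_map size_iota.
    move=> w /mapP[j]; rewrite mem_iota add0n => /andP[_ jd] ->; rewrite cabs_nat ler_nat -ltnS //.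
  move=> w /mapP[j]; rewrite mem_iota add0n => /andP[_ jd] ->.
  rewrite -ler_sqr ?nnegrE ?cabs_ge0 ?sqrtr_ge0 // sqr_sqrtr ?(ltW N0) // -nsqE -eM.
  exact: (ev2_term M (Ordinal jd)).
pose del := Num.sqrt (eps * (2 * K1 ^+ 2 * N * n2 a)).
have d2 : del ^+ 2 = eps * (2 * K1 ^+ 2 * N * n2 a).
  by rewrite sqr_sqrtr // !mulr_ge0 ?sqr_ge0 // ltW.
have Lr z : z \in r -> cabs L.[z] <= del.
  move=> zr; have [] := hr z zr; rewrite /S /= hermE /= => h _.
  have cz : cpt (complex.Re z, complex.Im z) = z by rewrite /cpt; case: z {zr h}.
  move: h; rewrite cz -horner_lin -/L => h.
  rewrite -ler_sqr ?nnegrE ?cabs_ge0 ?sqrtr_ge0 // -nsqE d2 (le_trans h) // ler_wpM2l ?(ltW e0) //.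
  rewrite ler_wpM2r ?(ltW na) // /n2 /=.
  have := bd A sA EAB z (rr z zr); have := bd B sB erefl z (rr z zr); lra.
have Lj (j : 'I_d.+1) : nsq L.[j%:R] <= K2 ^+ 2 * del ^+ 2.
  rewrite nsqE -exprMn ler_sqr ?nnegrE ?cabs_ge0 ?mulr_ge0 ?sqrtr_ge0 //.
  by apply: (hK2 L r del) => //; rewrite ?sqrtr_ge0 // cabs_nat ler_nat -ltnS ltn_ord.
have : ev2 L <= \sum_(j < d.+1) (K2 ^+ 2 * del ^+ 2) by apply: ler_sum => j _; exact: Lj.
rewrite sumr_const card_ord -[_ *+ _]mulr_natl evL d2.
have -> : d.+1%:R * (K2 ^+ 2 * (eps * (2 * K1 ^+ 2 * N * n2 a))) = (Z * eps) * (n2 a * N) by rewrite /Z; ring.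
rewrite -[X in X <= _]mul1r ler_pM2r ?mulr_gt0 // /eps ler_pdivlMr ?ltr_wpDr // mul1r; lra.
Qed.

End GramSchmidt.

Section GramPoint.
Variable R : realType.
Local Notation C := R[i].
Local Notation RR := (measurableTypeR R).
Local Notation T := (RR * RR)%type.
Local Notation P := (@sph R).

(** The vectors ([hz y], 1) and (1, 0) suffice: the mean of the two inequalities they give is the
    bound on the cosh. *)
Lemma hcosh_form_le (x y : H3 R) (k : R) : (forall v, form x v <= k * form y v) -> hcosh x y <= k.
Proof.
move=> h; have tx := ht_gt0 x; have ty := ht_gt0 y.
have h1 := h (hz y, 1); have h2 := h (1, 0).
move: h1 h2; rewrite /form /= !mulr1 !mulr0 !subr0 subrr nsq0 nsq1 !mulr0 !addr0 !add0r mulr1.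
rewrite hcoshE -(nsqN (hz x - hz y)) opprB.
have := nsq_ge0 (hz y - hz x); move: (nsq _) (ht x) (ht y) tx ty => n t s t0 s0 n0.
move=> h1 h2.
have e1 : n + t ^+ 2 <= k * s * t by move: h1; rewrite mulr1 expr2 mulfK ?gt_eqF // ler_pdivrMr.
have e2 : s <= k * t.
  have -> : s = s * t * (1 / t) by field; rewrite gt_eqF.
  have -> : k * t = s * t * (k * (1 / s)) by field; rewrite gt_eqF.
  by rewrite ler_wpM2l // ltW // mulr_gt0.
rewrite ler_pdivrMr ?mulr_gt0 //.
by have := ler_wpM2l (ltW s0) e2; lra.
Qed.

Lemma spreadZ (eps : R) (W W' : T -> C * C) :
  (forall p, exists2 k : C, k != 0 & W' p = (k * (W p).1, k * (W p).2)) -> spread P eps W -> spread P eps W'.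
Proof.
move=> h s a a0; rewrite (_ : [set x | _] = [set x | nsq (herm (W x) a) <= eps * (n2 (W x) * n2 a)]); first exact: s.
apply/seteqP; split => p /=; have [k k0 ->] := h p;
  have nk : 0 < nsq k by rewrite nsq_gt0.
all: have -> : herm (k * (W p).1, k * (W p).2) a = k * herm (W p) a by rewrite /herm /=; ring.
all: have -> : n2 (k * (W p).1, k * (W p).2) = nsq k * n2 (W p)
      by transitivity (nsq (k * (W p).1) + nsq (k * (W p).2)); rewrite // !nsqM -mulrDr.
all: have -> : eps * (nsq k * n2 (W p) * n2 a) = nsq k * (eps * (n2 (W p) * n2 a)) by ring.
all: by rewrite nsqM ler_pM2l.
Qed.

Variable d : nat.
Hypothesis hd : (1 <= d)%N.
Implicit Types (c : coefs R d) (x : H3 R).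
Local Notation ev2 := (@ev2 R d).
Local Notation ip := (@ip R d).

Definition shp x (p : {poly C}) : {poly C} := p \Po ((ht x)%:C%C *: 'X + (hz x)%:P).

Lemma size_affine x : size ((ht x)%:C%C *: 'X + (hz x)%:P : {poly C}) = 2%N.
Proof.
have t0 : (ht x)%:C%C != 0 :> C by rewrite fmorph_eq0 gt_eqF // ht_gt0.
by rewrite size_polyDl ?size_scale ?size_polyX // (leq_ltn_trans (size_polyC_leq1 _)).
Qed.

Lemma size_shp x p : size (shp x p) = size p.
Proof. by rewrite size_comp_poly2 // size_affine. Qed.

Lemma shp_eq0 x p : (shp x p == 0) = (p == 0).
Proof. by rewrite -!size_poly_eq0 size_shp. Qed.

Lemma horner_shp x p z : (shp x p).[z] = p.[hz x + (ht x)%:C%C * z].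
Proof. by rewrite horner_comp !hornerE addrC. Qed.

Lemma shp_lin x (a b : C) p q : shp x (a *: p + b *: q) = a *: shp x p + b *: shp x q.
Proof. by rewrite /shp comp_polyD !comp_polyZ. Qed.

Lemma shp0 L : ev2 (shp (H3o R) L) = ev2 L.
Proof. by apply: eq_bigr => j _; rewrite horner_shp /hz /ht /= add0r mul1r. Qed.

Section Point.
Variables (c : coefs R d) (x : H3 R).
Hypothesis hc : deg_coefs c.
Definition gA := shp x (poly_of c.1).
Definition gB := shp x (poly_of c.2).
(** Gram-Schmidt for P and Q, read at the points z + j t: beta is the coefficient of the projection
    of P on Q, and alpha the ratio of the norms of P - beta Q and Q. In the frame of the point
    (beta, alpha) the pair becomes orthogonal with equal norms. *)
Definition gbeta : C := ip gA gB / (ev2 gB)%:C%C.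
Definition galpha : R := Num.sqrt (ev2 (gA - gbeta *: gB) / ev2 gB).
Definition gram : H3 R := insubd (H3o R) (gbeta, galpha).

Lemma size_coefs : (size (poly_of c.1) <= d.+1)%N /\ (size (poly_of c.2) <= d.+1)%N.
Proof. by split; exact: size_poly. Qed.

Lemma size_gA : (size gA <= d.+1)%N. Proof. by rewrite size_shp; case: size_coefs. Qed.
Lemma size_gB : (size gB <= d.+1)%N. Proof. by rewrite size_shp; case: size_coefs. Qed.

Lemma lin_neq0 (u : C * C) : u != 0 -> u.1 *: gA + u.2 *: gB != 0.
Proof. by move=> u0; rewrite -shp_lin shp_eq0 coefs_indep. Qed.

Lemma evB_gt0 : 0 < ev2 gB.
Proof.
apply: ev2_gt0; first exact: size_gB.
have := @lin_neq0 (0, 1); rewrite /= scale0r add0r scale1r; apply; exact: pt1_neq0.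
Qed.

Lemma evA_gt0 : 0 < ev2 (gA - gbeta *: gB).
Proof.
apply: ev2_gt0.
  by rewrite (leq_trans (size_polyD _ _)) // geq_max size_gA size_polyN (leq_trans (size_scale_leq _ _)) // size_gB.
have := @lin_neq0 (1, - gbeta); rewrite /= scale1r scaleNr; apply.
by rewrite xpair_eqE oner_eq0.
Qed.

Lemma galpha_gt0 : 0 < galpha.
Proof. by rewrite sqrtr_gt0 divr_gt0 ?evA_gt0 ?evB_gt0. Qed.

Lemma gram_val : hz gram = gbeta /\ ht gram = galpha.
Proof. by rewrite /hz /ht /gram insubdK // unfold_in /= galpha_gt0. Qed.

Lemma ip_orth : ip (gA - gbeta *: gB) gB = 0.
Proof.
have -> : ip (gA - gbeta *: gB) gB = ip gA gB - gbeta * (ev2 gB)%:C%C.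
  rewrite /ip /ev2 rmorph_sum mulr_sumr -sumrB; apply: eq_bigr => j _.
  by rewrite !hornerE mulrBl -mulrA mulcJ.
by rewrite /gbeta mulfVK ?subrr // fmorph_eq0 gt_eqF // evB_gt0.
Qed.

Lemma evA_alpha : ev2 (gA - gbeta *: gB) = galpha ^+ 2 * ev2 gB.
Proof.
by rewrite sqr_sqrtr ?divr_ge0 ?ev2_ge0 // mulfVK // gt_eqF // evB_gt0.
Qed.

(** Up to a factor independent of v, the form of the Gram point is the norm of v2 P - v1 Q at the
    nodes. Both the growth estimate and the passage to the ultralimit rest on this identity. *)
Lemma gram_form v : form gram v * (ev2 gB * galpha) = ev2 (shp x (v.2 *: poly_of c.1 - v.1 *: poly_of c.2)).
Proof.
have -> : shp x (v.2 *: poly_of c.1 - v.1 *: poly_of c.2) = v.2 *: (gA - gbeta *: gB) + (v.2 * gbeta - v.1) *: gB.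
  by rewrite -scaleNr shp_lin scalerBr scalerBl scalerA scaleNr addrA subrK.
rewrite ev2_orth ?ip_orth // evA_alpha /form; have [-> ->] := gram_val.
have -> : nsq (v.2 * gbeta - v.1) = nsq (v.1 - gbeta * v.2) by rewrite -nsqN opprB mulrC.
by field; rewrite gt_eqF // galpha_gt0.
Qed.

Lemma gram_lift p : mulv (to0 gram) (rat_lift c x p) =
  ((Num.sqrt galpha)^-1%:C%C * (gA - gbeta *: gB).[cpt p], (Num.sqrt galpha)^-1%:C%C * (galpha%:C%C *: gB).[cpt p]).
Proof.
have [e1 e2] := gram_val; rewrite mulv_to0 e1 e2 /rat_lift /homp !hom1 /=.
rewrite -!horner_shp -/gA -/gB; congr (_, _); first by rewrite !hornerE.
rewrite hornerZ mulrA -rmorphM /=; congr (_%:C%C * _).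
by rewrite -[X in _ = _ * X](sqr_sqrtr (ltW galpha_gt0)) expr2 mulKf // gt_eqF // sqrtr_gt0 galpha_gt0.
Qed.

End Point.

(** In the frame of the Gram point the lift is, up to a scalar, a pair to which [uniform_spread]
    applies. This gives both the existence of the barycentre and its distance from the Gram
    point. *)
Lemma bary_near_gram : exists2 K : R, 0 <= K & forall (f : RatMap R d) x,
  (exists y, balanced P (rat_lift (rat_coefs f) x) y) /\
  hcosh (gram (rat_coefs f) x) (bary_ext (rat_fun f) x) <= K.
Proof.
have [eps /andP[e0 e1] hs] := uniform_spread R d.
exists (2 / eps ^+ 2); first by rewrite divr_ge0 // exprn_ge0 // ltW.
move=> f x; have hc := rat_coefs_deg f; set c := rat_coefs f in hc *.
have a0 := galpha_gt0 x hc; have B0 := evB_gt0 x hc.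
have sp : spread P eps (fun p => mulv (to0 (gram c x)) (rat_lift c x p)).
  apply: spreadZ (hs (gA c x - gbeta c x *: gB c x) ((galpha c x)%:C%C *: gB c x) _ _ _ _ _).
  - move=> p; exists (Num.sqrt (galpha c x))^-1%:C%C; last exact: gram_lift.
    by rewrite fmorph_eq0 invr_eq0 gt_eqF // sqrtr_gt0.
  - by rewrite (leq_trans (size_polyD _ _)) // geq_max size_gA size_polyN (leq_trans (size_scale_leq _ _)) // size_gB.
  - by rewrite (leq_trans (size_scale_leq _ _)) // size_gB.
  - by rewrite ev2Z nsq_real mulr_gt0 // exprn_gt0.
  - by rewrite ev2Z nsq_real evA_alpha.
  - by rewrite ipZr ip_orth // mulr0.
have e01 : 0 < eps <= 1 by rewrite e0.
have V0 p : rat_lift c x p != 0 by exact: lift_neq0.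
have ex := exists_balanced (vmeas_lift c x) V0 e01 (mass_sph_gt0 R) sp.
split=> //; rewrite -fc0_to0.
apply: (balanced_bound (vmeas_lift c x) V0 (to0_det _) (to0P _) e01 (mass_sph_gt0 R) sp).
exact: bary_ext_balanced.
Qed.

(** The norms of a polynomial at the nodes and at the points z + j t bound each other up to powers
    of 1 + |z| + t, and of its quotient by t. This compares the two forms in both directions, up to
    the ratio of the factors N; in the product of the two estimates the ratio cancels, whence the
    square. *)
Lemma gram_growth : exists2 K : R, 0 <= K & forall c x, deg_coefs c ->
  hcosh (gram c x) (gram c (H3o R)) ^+ 2 <= K * hcosh (H3o R) x ^+ (2 * d.+1).
Proof.
have [K0 K00 hK] := @interpolation_growth R d.+1 1 d%:R ltr01.
pose D : R := d.+1%:R.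
have D1 : 1 <= D by rewrite ler1n.
have D0 : 0 <= D by rewrite (le_trans ler01).
have ex (L : {poly C}) z : (size L <= d.+1)%N -> nsq L.[z] <= K0 ^+ 2 * (1 + cabs z) ^+ (2 * d.+1) * ev2 L.
  move=> sL; have h := hK L _ (Num.sqrt (ev2 L)) sL _ (separated_nat R d) _ _ (sqrtr_ge0 _) z.
  have c0 := cabs_ge0 z.
  rewrite nsqE -[X in _ * X](sqr_sqrtr (ev2_ge0 d L)) mulnC exprM -!exprMn ler_sqr ?nnegrE ?cabs_ge0 //.
  - apply: h; first by rewrite size_map size_iota.
      by move=> w /mapP[j]; rewrite mem_iota add0n => /andP[_ jd] ->; rewrite cabs_nat ler_nat -ltnS.
    move=> w /mapP[j]; rewrite mem_iota add0n => /andP[_ jd] ->.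
    rewrite -ler_sqr ?nnegrE ?cabs_ge0 ?sqrtr_ge0 // sqr_sqrtr ?ev2_ge0 // -nsqE.
    exact: (ev2_term L (Ordinal jd)).
  - by rewrite !mulr_ge0 ?sqrtr_ge0 // exprn_ge0 // addr_ge0.
pose Q := D * K0 ^+ 2.
have Q0 : 0 <= Q by rewrite mulr_ge0 // sqr_ge0.
exists (Q ^+ 2 * (D ^+ 2 * 6) ^+ (2 * d.+1)).
  by rewrite mulr_ge0 ?sqr_ge0 // exprn_ge0 // mulr_ge0 // sqr_ge0.
move=> c x hc; set z := hz x; set t := ht x.
have t0 : 0 < t := ht_gt0 x.
have z0 := cabs_ge0 z.
have up (L : {poly C}) : (size L <= d.+1)%N -> ev2 (shp x L) <= Q * (D * (1 + cabs z + t)) ^+ (2 * d.+1) * ev2 L.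
  move=> sL; have -> : Q * (D * (1 + cabs z + t)) ^+ (2 * d.+1) * ev2 L =
      \sum_(j < d.+1) (K0 ^+ 2 * (D * (1 + cabs z + t)) ^+ (2 * d.+1) * ev2 L).
    by rewrite sumr_const card_ord -[RHS]mulr_natl /Q /D; ring.
  apply: ler_sum => j _; rewrite horner_shp -/z -/t; apply: (le_trans (ex L _ sL)).
  rewrite ler_wpM2r ?ev2_ge0 // ler_wpM2l ?sqr_ge0 // lerXn2r ?nnegrE ?addr_ge0 ?cabs_ge0 //.
    by rewrite mulr_ge0 // !addr_ge0 // ltW.
  have : cabs (z + t%:C%C * j%:R) <= cabs z + t * d%:R.
    apply: (le_trans (@le_normcD R _ _)); rewrite lerD2l Normc.normcM cabs_nat cabs_real gtr0_norm //.
    by rewrite ler_wpM2l ?(ltW t0) // ler_nat -ltnS.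
  have : d%:R <= D by rewrite ler_nat.
  have := ler0n R d; nra.
have dn (L : {poly C}) : (size L <= d.+1)%N -> ev2 L <= Q * (D * (1 + cabs z + t) / t) ^+ (2 * d.+1) * ev2 (shp x L).
  move=> sL; have -> : Q * (D * (1 + cabs z + t) / t) ^+ (2 * d.+1) * ev2 (shp x L) =
      \sum_(j < d.+1) (K0 ^+ 2 * (D * (1 + cabs z + t) / t) ^+ (2 * d.+1) * ev2 (shp x L)).
    by rewrite sumr_const card_ord -[RHS]mulr_natl /Q /D; ring.
  apply: ler_sum => j _.
  have tC : t%:C%C != 0 :> C by rewrite fmorph_eq0 gt_eqF.
  have -> : L.[j%:R] = (shp x L).[(j%:R - z) / t%:C%C].
    by rewrite horner_shp -/z -/t mulrCA divff // mulr1 addrC subrK.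
  have sL' : (size (shp x L) <= d.+1)%N by rewrite size_shp.
  apply: (le_trans (ex _ _ sL')).
  rewrite ler_wpM2r ?ev2_ge0 // ler_wpM2l ?sqr_ge0 // lerXn2r ?nnegrE ?addr_ge0 ?cabs_ge0 //.
    by rewrite divr_ge0 ?(ltW t0) // mulr_ge0 // !addr_ge0 // ltW.
  rewrite Normc.normcM Normc.normcV cabs_real gtr0_norm // ler_pdivlMr // mulrDl mul1r mulfVK ?gt_eqF //.
  have : cabs (j%:R - z) <= d%:R + cabs z.
    by apply: (le_trans (cabsB _ _)); rewrite lerD2r cabs_nat ler_nat -ltnS.
  have : d%:R + 1 = D by rewrite natr1.
  have := ler0n R d; nra.
have swap (a b p q : R) : 0 < p -> a * (b * q) <= a * (q / p) * b * p.
  by move=> p0; rewrite le_eqVlt; apply/orP; left; apply/eqP; field; rewrite gt_eqF.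
pose N y := ev2 (gB c y) * galpha c y.
have N0 y : 0 < N y by rewrite mulr_gt0 // ?evB_gt0 ?galpha_gt0.
set X := 1 + cabs z + t in up dn.
have X0 : 0 <= X by rewrite !addr_ge0 // ltW.
set e := (2 * d.+1)%N in up dn *.
have sL v : (size (v.2 *: poly_of c.1 - v.1 *: poly_of c.2)%R <= d.+1)%N.
  by rewrite (leq_trans (size_polyD _ _)) // geq_max size_polyN !(leq_trans (size_scale_leq _ _)) ?size_poly.
have h1 : hcosh (gram c x) (gram c (H3o R)) <= Q * (D * X) ^+ e * (N (H3o R) / N x).
  apply: hcosh_form_le => v; rewrite -[_ <= _](ler_pM2r (N0 x)) gram_form //.
  apply: (le_trans (up _ (sL v))); rewrite -shp0 -gram_form // -/(N _).
  exact: swap.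
have h2 : hcosh (gram c x) (gram c (H3o R)) <= Q * (D * X / t) ^+ e * (N x / N (H3o R)).
  rewrite hcoshC; apply: hcosh_form_le => v; rewrite -[_ <= _](ler_pM2r (N0 (H3o R))) gram_form // shp0.
  apply: (le_trans (dn _ (sL v))); rewrite -gram_form // -/(N _).
  exact: swap.
have hc0 : 0 <= hcosh (gram c x) (gram c (H3o R)) by rewrite (le_trans ler01) // hcosh_ge1.
rewrite expr2; apply: (le_trans (ler_pM hc0 hc0 h1 h2)).
have -> : Q * (D * X) ^+ e * (N (H3o R) / N x) * (Q * (D * X / t) ^+ e * (N x / N (H3o R))) =
  Q ^+ 2 * (D ^+ 2 * (X ^+ 2 / t)) ^+ e.
  have -> : D ^+ 2 * (X ^+ 2 / t) = (D * X) * (D * X / t) by ring.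
  rewrite [(D * X * (D * X / t)) ^+ e]exprMn; move: ((D * X) ^+ e) ((D * X / t) ^+ e) (N _) (N _) (N0 (H3o R)) (N0 x) => u v p q p0 q0.
  by field; rewrite !gt_eqF.
rewrite -mulrA -exprMn; apply: ler_wpM2l; first exact: sqr_ge0.
rewrite lerXn2r ?nnegrE //.
- by rewrite mulr_ge0 ?sqr_ge0 // divr_ge0 ?sqr_ge0 // ltW.
- by rewrite !mulr_ge0 ?sqr_ge0 // (le_trans ler01) // hcosh_ge1.
(* (1 + |z| + t)^2 <= 3 (1 + |z|^2 + t^2) = 6 t cosh, where cosh is that of the distance from the
   centre to (z, t). *)
rewrite -[X in _ <= X]mulrA; apply: ler_wpM2l; first exact: sqr_ge0.
rewrite hcoshE /hz /ht /= sub0r nsqN -/(hz x) -/z -/(ht x) -/t nsqE expr1n mulr1.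
rewrite mulrA ler_pdivrMr // [X in _ <= X](_ : _ = 3 * (cabs z ^+ 2 + 1 + t ^+ 2)); last by field; rewrite gt_eqF.
rewrite /X; move: (cabs z) => s; clear; have := sqr_ge0 (s - t); have := sqr_ge0 (s - 1); have := sqr_ge0 (t - 1); nra.
Qed.

End GramPoint.

(** * Preimages of the centre *)

Lemma near_uniform (R : realType) (X Y : topologicalType) (f : X * Y -> R) (K : set Y) (x : X) (e : R) :
  continuous f -> compact K -> 0 < e -> \forall x' \near x, forall y, K y -> `|f (x', y) - f (x, y)| <= e.
Proof.
move=> cf cK e0.
have h : \forall x' \near x, K `<=` (fun y => `|f (x', y) - f (x, y)| <= e).
  apply: (proj1 (compact_near_coveringP K) cK X (nbhs x) (fun x' y => `|f (x', y) - f (x, y)| <= e)) => y Ky.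
  have e2 : 0 < e / 2 by rewrite divr_gt0.
  have h1 : \forall p \near (x, y), `|f (x, y) - f p| <= e / 2.
    by have /cvgrPdist_le := cf (x, y); apply.
  have h2 : \forall y' \near y, `|f (x, y) - f (x, y')| <= e / 2.
    have c2 : continuous (fun y' => f (x, y')).
      by apply: (@ct_pair _ _ _ _ f (fun=> x) id) => //; [exact: cst_continuous|move=> ?; exact: cvg_id].
    by have /cvgrPdist_le := c2 y; apply.
  case: h1 => -[U V] /= [Ux Vy] UV.
  exists (V `&` [set y' | `|f (x, y) - f (x, y')| <= e / 2], U); first by split => //; exact: filterI.
  move=> [y' x'] [/= [Vy' hy'] Ux'].
  have := UV (x', y') (conj Ux' Vy') => /= hx'.
  rewrite distrC (_ : _ - _ = (f (x, y') - f (x, y)) + (f (x, y) - f (x', y'))); last by ring.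
  apply: (le_trans (ler_normD _ _)); rewrite distrC; lra.
by apply: filterS h => x' h y Ky; exact: h.
Qed.

Lemma open_gt_ct (R : realType) (X : topologicalType) (f : X -> R) (a : R) : continuous f -> open [set x | a < f x].
Proof. by move=> cf; exact: (@open_comp _ _ f [set x | a < x] (fun p _ => cf p) (@open_gt R a)). Qed.

Lemma closed_le_ct (R : realType) (X : topologicalType) (f : X -> R) (a : R) : continuous f -> closed [set x | f x <= a].
Proof. by move=> cf; exact: (@closed_comp _ _ f [set x | x <= a] (fun p _ => cf p) (@closed_le R a)). Qed.

Section ParametricIntegral.
Variable R : realType.
Local Notation C := R[i].
Local Notation RR := (measurableTypeR R).
Local Notation T := (RR * RR)%type.
Local Notation P := (@sph R).

Lemma ct_cabs : continuous (fun p : R * R => cabs (cpt p)).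
Proof.
have -> : (fun p : R * R => cabs (cpt p)) = fun p => Num.sqrt (nsq (cpt p)).
  by apply/funext => p; rewrite nsqE sqrtr_sqr ger0_norm // cabs_ge0.
by apply: ctcomp; [exact: sqrt_continuous|apply: ct_nsq; exact: cpt_ccont].
Qed.

Lemma disc_compact (rho : R) : compact [set p : R * R | cabs (cpt p) <= rho].
Proof.
pose B : set R := `[- rho, rho]%classic.
apply: (@subclosed_compact _ _ (B `*` B)).
- exact: closed_le_ct ct_cabs.
- by apply: compact_setX; exact: segment_compact.
- move=> p /= hp; split; rewrite /B /= in_itv /= -ler_norml.
    exact: (le_trans (cabs_ge_Re (cpt p))).
  exact: (le_trans (cabs_ge_Im (cpt p))).
Qed.

Lemma measurable_disc (rho : R) : measurable ([set p | rho < cabs (cpt p)] : set T).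
Proof.
have : open [set p : R * R | rho < cabs (cpt p)] by exact: open_gt_ct ct_cabs.
exact: open_plane_measurable.
Qed.

(** Outside a large disc the mass is small and the integrand bounded; on the disc, which is compact,
    the convergence is uniform. *)
Lemma ct_Int (X : topologicalType) (f : X * (R * R) -> R) : continuous f ->
  (forall x, `|f x| <= 1) -> continuous (fun x => Int P (fun p => f (x, p))).
Proof.
move=> cf fb; have m0 := mass_sph_gt0 R; apply: ct_eps => x e e0.
have bf x' : bm (fun p : T => f (x', p)).
  split; last by exists 1.
  apply: ct_meas; apply: (@ct_pair _ _ _ _ f (fun=> x') id) => //; first exact: cst_continuous.
  by move=> ?; exact: cvg_id.
have e4 : 0 < e / 4 by rewrite divr_gt0.
have [rho rho0 hrho] := sph_disc e4.
have e2m : 0 < e / 2 / mass P by rewrite divr_gt0 // divr_gt0.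
have := near_uniform x cf (@disc_compact rho) e2m; apply: filterS => x' h.
pose D : set T := [set p | rho < cabs (cpt p)].
have mD : measurable D by exact: measurable_disc.
have bD : bm (\1_D : T -> R) := bm_indic mD.
have bg : bm (fun p => e / 2 / mass P + 2 * \1_D p).
  by apply: bmD; [exact: bm_cst|apply: bmM; [exact: bm_cst|exact: bD]].
have bsub : bm (fun p => f (x', p) + - f (x, p)) by exact: (bmD (bf x') (bmN (bf x))).
have le1 p : `|f (x', p) + - f (x, p)| <= e / 2 / mass P + 2 * \1_D p.
  rewrite indicE; case: (boolP (p \in D)) => pD.
    rewrite mulr1; apply: (le_trans (ler_normB _ _)).
    by have := fb (x', p); have := fb (x, p); lra.
  rewrite mulr0 addr0; apply: h; move/negP: pD; rewrite inE /D /= => /negP; rewrite -leNgt //.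
have E : Int P (fun p => e / 2 / mass P + 2 * \1_D p) = e / 2 + 2 * fine (P D).
  rewrite (IntD P (bm_cst _)); last by apply: bmM; [exact: bm_cst|exact: bD].
  rewrite Int_cst IntZ // Int_indic // mulfVK // gt_eqF //.
have ub : Int P (fun p => f (x', p) + - f (x, p)) <= e.
  apply: (@le_trans _ _ (e / 2 + 2 * fine (P D))); last by have : fine (P D) <= e / 4 := hrho; lra.
  rewrite -E; apply: (Int_le P) => // p; exact: le_trans (ler_norm _) (le1 p).
have lb : - e <= Int P (fun p => f (x', p) + - f (x, p)).
  apply: (@le_trans _ _ (- (e / 2 + 2 * fine (P D)))); first by have : fine (P D) <= e / 4 := hrho; lra.
  rewrite -E -IntN //; apply: (Int_le P) => //; first exact: bmN.
  by move=> p; have := le1 p; rewrite ler_norml => /andP[].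
rewrite (IntD P (bf x')) ?IntN // in ub lb; last exact: bmN.
by rewrite distrC ler_norml; apply/andP; split.
Qed.

Variables (W : C -> C * C).
Hypothesis cW : ccont (fun p : R * R => (W (cpt p)).1) /\ ccont (fun p : R * R => (W (cpt p)).2).
Hypothesis W0 : forall z, W z != 0.

(** The formula also makes sense at height t = 0, where it is the mass times the point W z of the
    sphere. This extends the field continuously to the boundary. *)
Definition balance_at (j : 'I_3) (q : (R * R) * R) : R :=
  Int P (fun p => sv j (W (cpt q.1 + q.2%:C%C * cpt p))).

Lemma ct_svW j : continuous (fun p : R * R => sv j (W (cpt p))).
Proof.
have e z : W z = ((W z).1, (W z).2) by case: (W z).
under eq_fun do rewrite e; case: cW => c1 c2.
by apply: (@ct_sv _ _ j _ _ c1 c2) => p; rewrite -e.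
Qed.

Lemma ct_balance_at j : continuous (balance_at j).
Proof.
have E (q : ((R * R) * R) * (R * R)) : cpt q.1.1 + q.1.2%:C%C * cpt q.2 = cpt (q.1.1.1 + q.1.2 * q.2.1, q.1.1.2 + q.1.2 * q.2.2) :> C.
  by rewrite /cpt /=; simpc.
have c1 : continuous (fun q : ((R * R) * R) * (R * R) => q.1.1.1).
  by apply: (ct_fst (f := fun y : (R * R) * R => y.1.1)); apply: (ct_fst (f := fun y : R * R => y.1)) => y; exact: cvg_fst.
have c2 : continuous (fun q : ((R * R) * R) * (R * R) => q.1.1.2).
  by apply: (ct_fst (f := fun y : (R * R) * R => y.1.2)); apply: (ct_fst (f := fun y : R * R => y.2)) => y; exact: cvg_snd.
have c3 : continuous (fun q : ((R * R) * R) * (R * R) => q.1.2).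
  by apply: (ct_fst (f := fun y : (R * R) * R => y.2)) => y; exact: cvg_snd.
have c4 : continuous (fun q : ((R * R) * R) * (R * R) => q.2.1).
  by apply: (ct_snd (f := fun y : R * R => y.1)) => y; exact: cvg_fst.
have c5 : continuous (fun q : ((R * R) * R) * (R * R) => q.2.2).
  by apply: (ct_snd (f := fun y : R * R => y.2)) => y; exact: cvg_snd.
pose h1 (q : ((R * R) * R) * (R * R)) : R := q.1.1.1 + q.1.2 * q.2.1.
pose h2 (q : ((R * R) * R) * (R * R)) : R := q.1.1.2 + q.1.2 * q.2.2.
have k1 : continuous h1 by apply: ctD => //; exact: ctM.
have k2 : continuous h2 by apply: ctD => //; exact: ctM.
have K : continuous (fun q => (fun p => sv j (W (cpt p))) (h1 q, h2 q)).
  have hh := @ct_svW j.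
  have := @ct_pair R R R ((R * R) * R * (R * R))%type _ h1 h2 hh k1 k2.
  exact.
have -> : balance_at j = fun x => Int P (fun p => sv j (W (cpt (h1 (x, p), h2 (x, p))))).
  by apply/funext => x; rewrite /balance_at; congr (Int P _); apply/funext => p; rewrite (E (x, p)).
apply: (ct_Int K) => q; exact: sv_le1.
Qed.

End ParametricIntegral.

Section ZeroExistence.
Variable R : realType.
Local Notation C := R[i].
Local Notation RR := (measurableTypeR R).
Local Notation T := (RR * RR)%type.
Local Notation P := (@sph R).

(* The cosine of the angle between the lines of W and v0 on the sphere. *)
Definition line_cos (v0 v : C * C) : R := \sum_j sv j v * Sv j v0 / n2 v0.

Lemma line_cosE v0 v : v0 != 0 -> v != 0 -> line_cos v0 v = 2 * nsq (herm v v0) / (n2 v * n2 v0) - 1.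
Proof.
move=> v00 vn; rewrite nsq_herm /line_cos.
have [e1 e2 e3] := SvE3 v; have [f1 f2 f3] := SvE3 v0.
rewrite sum3E /sv e1 e2 e3 f1 f2 f3.
have n1 : n2 v != 0 by rewrite gt_eqF // n2_gt0.
have n0 : n2 v0 != 0 by rewrite gt_eqF // n2_gt0.
by field; rewrite n1 n0.
Qed.

(** With E = v - b v0, the hypothesis gives 7 |E|^2 <= |v|^2. The squared sine of the angle between
    the complex lines is at most |E|^2 / |v|^2, and the angle doubles on the sphere: the cosine is
    at least 1 - 2 / 7. *)
Lemma line_cos_near v0 v (b : C) : v0 != 0 -> v != 0 -> b != 0 ->
  16 * n2 (v.1 - b * v0.1, v.2 - b * v0.2) <= nsq b * n2 v0 -> 5 / 7 <= line_cos v0 v.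
Proof.
move=> v00 vn b0; set E1 := v.1 - _; set E2 := v.2 - _ => h.
have p0 : 0 < n2 v0 by rewrite n2_gt0.
have pv : 0 < n2 v by rewrite n2_gt0.
have pb : 0 < nsq b by rewrite nsq_gt0.
have lag : n2 v * n2 v0 - nsq (herm v v0) = nsq (E1 * v0.2 - E2 * v0.1).
  have -> : E1 * v0.2 - E2 * v0.1 = v.1 * v0.2 - v.2 * v0.1 by rewrite /E1 /E2; ring.
  by case: v {vn h E1 E2 pv} => -[? ?] [? ?]; case: v0 {v00 p0} => -[? ?] [? ?]; rewrite /herm /n2 /nsq /=; ring.
have lag2 : nsq (E1 * v0.2 - E2 * v0.1) <= n2 (E1, E2) * n2 v0.
  rewrite -subr_ge0 (_ : _ - _ = nsq (herm (E1, E2) v0)) ?nsq_ge0 //.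
  by move: E1 E2 {h lag} => [? ?] [? ?]; case: v0 {v00 p0} => -[? ?] [? ?]; rewrite /herm /n2 /nsq /=; ring.
have big : nsq b * n2 v0 <= 2 * n2 v + 2 * n2 (E1, E2).
  have -> : nsq b * n2 v0 = n2 (v.1 - E1, v.2 - E2).
    have -> : v.1 - E1 = b * v0.1 by rewrite /E1; ring.
    have -> : v.2 - E2 = b * v0.2 by rewrite /E2; ring.
    by transitivity (nsq (b * v0.1) + nsq (b * v0.2)); rewrite // !nsqM -mulrDr.
  have := nsqD_le v.1 (- E1); have := nsqD_le v.2 (- E2); rewrite !nsqN.
  rewrite /n2 /=; lra.
have e0 := n2_ge0 (E1, E2).
rewrite line_cosE // lerBrDr -[_ / (n2 v * n2 v0)]mulrA mulrA ler_pdivlMr ?mulr_gt0 //.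
have h7 : 7 * n2 (E1, E2) <= n2 v by lra.
have := ler_wpM2r (ltW p0) h7; lra.
Qed.

Lemma line_cos_ge v0 v : v0 != 0 -> v != 0 -> -1 <= line_cos v0 v.
Proof.
move=> v00 vn; rewrite line_cosE // lerBrDr addNr divr_ge0 // ?mulr_ge0 ?nsq_ge0 ?n2_ge0 //.
Qed.

(** The cosine is at least 5 / 7 off B and at least -1 on B. As B has at most a quarter of the mass,
    the mean is at least 5 / 7 - 3 / 7. *)
Lemma Int_line_cos v0 (V : T -> C * C) (B : set T) : v0 != 0 -> vmeas V -> (forall p, V p != 0) -> measurable B ->
  (forall p, ~ B p -> 5 / 7 <= line_cos v0 (V p)) -> fine (P B) <= mass P / 4 ->
  0 < \sum_j Int P (fun p => sv j (V p)) * Sv j v0.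
Proof.
move=> v00 mV V0 mB good small; have m0 := mass_sph_gt0 R.
have p0 : 0 < n2 v0 by rewrite n2_gt0.
have E : \sum_j Int P (fun p => sv j (V p)) * Sv j v0 = n2 v0 * Int P (fun p => line_cos v0 (V p)).
  have -> : (fun p => line_cos v0 (V p)) = fun p => \sum_j (Sv j v0 / n2 v0) * sv j (V p).
    by apply/funext => p; apply: eq_bigr => j _; rewrite -mulrA mulrC.
  rewrite (Int_sum3 P _ (fun j => bm_sv j mV)) mulr_sumr; apply: eq_bigr => j _.
  by field; rewrite gt_eqF.
rewrite E mulr_gt0 //.
have bD : bm (\1_B : T -> R) := bm_indic mB.
have bl : bm (fun p : T => 5 / 7 + - (12 / 7 * \1_B p) : R).
  by apply: bmD; [exact: bm_cst|apply: bmN; apply: bmM; [exact: bm_cst|exact: bD]].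
apply: (@lt_le_trans _ _ (Int P (fun p : T => 5 / 7 + - (12 / 7 * \1_B p) : R))).
  rewrite (IntD P (bm_cst _)); last by apply: bmN; apply: bmM; [exact: bm_cst|exact: bD].
  rewrite Int_cst IntN; last by apply: bmM; [exact: bm_cst|exact: bD].
  by rewrite IntZ // Int_indic //; lra.
apply: (Int_le P) => //.
  have -> : (fun p => line_cos v0 (V p)) = fun p => sv ord0 (V p) * (Sv ord0 v0 / n2 v0) +
     sv (inord 1) (V p) * (Sv (inord 1) v0 / n2 v0) + sv (inord 2) (V p) * (Sv (inord 2) v0 / n2 v0).
    by apply/funext => p; rewrite /line_cos sum3E !mulrA.
  by apply: bmD; [apply: bmD|]; apply: bmM; do ?[exact: bm_cst|exact: bm_sv].
move=> p; rewrite indicE; case: (boolP (p \in B)) => pB.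
  by have := line_cos_ge v00 (V0 p); rewrite -[true%:R]/(1 : R); lra.
rewrite mulr0 oppr0 addr0; apply: good; move/negP: pB; rewrite inE //.
Qed.

Lemma cabs_cis (x : R) : cabs (cis x) = 1.
Proof.
by rewrite -[RHS]sqrtr1 -(nsq_cis x) nsqE sqrtr_sqr ger0_norm ?cabs_ge0.
Qed.

(** On the side |z| = 1 and on the top t = 1 of a cylinder, most points z + t p of the sphere seen
    from (z, t) lie in a fixed annulus. The exceptions are large p and, unless t is small, p near -
    z / t. *)
Lemma bad_set_small : exists eta R0 : R, [/\ 0 < eta, eta <= 1, 1 <= R0 &
  forall (z : C) (t : R), cabs z <= 1 -> 0 <= t <= 1 -> (cabs z = 1 \/ t = 1) ->
  exists2 B : set T, measurable B /\ fine (P B) <= mass P / 4 &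
    forall p, ~ B p -> eta <= cabs (z + t%:C%C * cpt p) <= R0].
Proof.
have m0 := mass_sph_gt0 R; have m8 : 0 < mass P / 8 by rewrite divr_gt0.
have [rho rho0 hrho] := sph_disc m8.
pose D : set T := [set p | rho < cabs (cpt p)].
have mD : measurable D by exact: measurable_disc.
have rho1 : 0 < rho + 1 by rewrite ltr_wpDl.
pose tau := (2 * (rho + 1))^-1.
have tau0 : 0 < tau by rewrite invr_gt0 mulr_gt0.
have tau1 : tau * (2 * (rho + 1)) = 1 by rewrite mulVf // gt_eqF // mulr_gt0.
pose s := Num.min 1 (mass P / 32).
have s0 : 0 < s by rewrite lt_min ltr01 divr_gt0.
have s2 : 4 * s ^+ 2 <= mass P / 8.
  have h1 : s <= 1 by rewrite ge_min lexx.
  have h2 : s <= mass P / 32 by rewrite ge_min lexx orbT.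
  have := ler_wpM2l (ltW s0) h1; rewrite expr2; lra.
pose eta := Num.min (1 / 2) (s * tau).
have eta0 : 0 < eta by rewrite lt_min divr_gt0 // mulr_gt0.
have eta2 : eta <= 1 / 2 by rewrite ge_min lexx.
have etas : eta <= s * tau by rewrite ge_min lexx orbT.
exists eta, (1 + rho); split => //; [lra|lra|].
move=> z t z1 /andP[t0 t1] zt.
have up p : ~ D p -> cabs (z + t%:C%C * cpt p) <= 1 + rho.
  move=> /negP; rewrite -leNgt => h; apply: (le_trans (@le_normcD R _ _)); apply: lerD => //.
  rewrite Normc.normcM cabs_real ger0_norm //.
  by apply: (le_trans _ h); rewrite ler_piMl ?cabs_ge0.
have fD : fine (P D) <= mass P / 8 := hrho.
(* Below tau the height is not 1, so |z| = 1; and tau is chosen so that |t p| <= 1 / 2 for |p| <=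
   rho. *)
have [tt|tt] := ltP t tau.
  exists D; first by split => //; lra.
  move=> p Dp; rewrite up // andbT; have zz : cabs z = 1 by case: zt => // e; move: tt tau1; rewrite e; nra.
  have : cabs (t%:C%C * cpt p) <= 1 / 2.
    rewrite Normc.normcM cabs_real ger0_norm //; move/negP: Dp; rewrite -leNgt => h.
    have := ler_pM t0 (cabs_ge0 _) (ltW tt) h; nra.
  have : cabs z <= cabs (z + t%:C%C * cpt p) + cabs (t%:C%C * cpt p).
    by have := cabsB (z + t%:C%C * cpt p) (t%:C%C * cpt p); rewrite addrK.
  rewrite zz; lra.
have tp : 0 < t by exact: lt_le_trans tau0 tt.
have tC : t%:C%C != 0 :> C by rewrite fmorph_eq0 gt_eqF.
pose Q := square s (- z / t%:C%C).
have mQ : measurable Q by exact: measurable_square.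
exists (D `|` Q).
  split; first exact: measurableU.
  have : (P (D `|` Q) <= (mass P / 8 + mass P / 8)%:E)%E.
    apply: (le_trans (measureU2 _ mD mQ)); rewrite EFinD; apply: leeD.
      by rewrite -(fineK (fin_num_measure P D mD)) lee_fin.
    by apply: (le_trans (sph_square _ (ltW s0))); rewrite lee_fin.
  by rewrite -(fineK (fin_num_measure P _ (measurableU _ _ mD mQ))) lee_fin; lra.
move=> p /not_orP[Dp Qp]; rewrite up // andbT.
have : s <= cabs (- z / t%:C%C - cpt p).
  by apply: notin_square; case: p Qp {Dp}.
have -> : z + t%:C%C * cpt p = - (t%:C%C * (- z / t%:C%C - cpt p)).
  by rewrite mulrBr mulrCA divff // mulr1 opprB opprK addrC.
rewrite cabsN Normc.normcM cabs_real gtr0_norm // => h.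
apply: (le_trans etas); rewrite mulrC; apply: ler_pM => //; exact: ltW.
Qed.

(** Here a cylinder |z| <= 1, 0 < t <= 1 takes the place of the half-ball. On its side and top most
    of the mass comes from the annulus, where W is close to the line of v0, so the balance field is
    at an acute angle to v0. On its bottom the field is W, which winds k times near the rim. *)
Lemma zero_existence : exists eta R0 : R, [/\ 0 < eta, eta <= 1, 1 <= R0 &
  forall (W : C -> C * C) (c : C) (k : nat) (v0 : C * C), (0 < k)%N -> c != 0 -> v0 != 0 ->
  ccont (fun p : R * R => (W (cpt p)).1) /\ ccont (fun p : R * R => (W (cpt p)).2) ->
  (forall z, W z != 0) ->
  (forall z, eta <= cabs z <= R0 ->
    16 * n2 ((W z).1 - c * z ^+ k * v0.1, (W z).2 - c * z ^+ k * v0.2) <= nsq (c * z ^+ k) * n2 v0) ->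
  exists z t, [/\ cabs z <= 1, 0 < t <= 1 & forall j, Int P (fun p => sv j (W (z + t%:C%C * cpt p))) = 0]].
Proof.
have [eta [R0 [eta0 eta1 R01 hB]]] := bad_set_small.
exists eta, R0; split => // W c k v0 k0 c0 v00 cW W0 near.
apply: contrapT => nz.
have G0' z t : cabs z <= 1 -> 0 < t <= 1 -> 0 < \sum_j Int P (fun p => sv j (W (z + t%:C%C * cpt p))) ^+ 2.
  move=> z1 t1; rewrite lt_neqAle sumr_ge0 ?andbT; last by move=> j _; exact: sqr_ge0.
  apply/negP => /eqP /esym/eqP; rewrite psumr_eq0; last by move=> j _; exact: sqr_ge0.
  move=> /allP h; apply: nz; exists z, t; split => // j.
  by have := h j (mem_index_enum _); rewrite sqrf_eq0 => /eqP.
pose pol (x : R * R) : R * R := (x.1 * cos x.2, x.1 * sin x.2).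
have polE x : cpt (pol x) = (x.1)%:C%C * cis x.2 by rewrite /cpt /cis /pol /=; simpc.
have cpol : continuous pol.
  have c1 : continuous (fun x : R * R => x.1) by move=> x; exact: cvg_fst.
  have c2 : continuous (fun x : R * R => x.2) by move=> x; exact: cvg_snd.
  apply: ct_mkpair; apply: ctM => //.
    by apply: (ctcomp (h := @cos R)) => //; exact: continuous_cos.
  by apply: (ctcomp (h := @sin R)) => //; exact: continuous_sin.
have ncp x : 0 <= x.1 <= 1 -> cabs (cpt (pol x)) <= 1.
  by move=> /andP[h1 h2]; rewrite polE Normc.normcM cabs_cis mulr1 cabs_real ger0_norm.
have mV z t : vmeas (fun p : T => W (z + t%:C%C * cpt p)).
  have e (p : R * R) : z + t%:C%C * cpt p = cpt (complex.Re z + t * p.1, complex.Im z + t * p.2).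
    by rewrite /cpt; case: z => a b /=; simpc.
  have ca : continuous (fun p : R * R => (complex.Re z + t * p.1, complex.Im z + t * p.2)).
    have c1 : continuous (fun x : R * R => x.1) by move=> x; exact: cvg_fst.
    have c2 : continuous (fun x : R * R => x.2) by move=> x; exact: cvg_snd.
    by apply: ct_mkpair; apply: ctD; do ?exact: ct_cst; apply: ctM => //; exact: ct_cst.
  have eW (q : C) : W q = ((W q).1, (W q).2) by case: (W q).
  have -> : (fun p : T => W (z + t%:C%C * cpt p)) = fun p : T => ((W (z + t%:C%C * cpt p)).1, (W (z + t%:C%C * cpt p)).2).
    by apply/funext => p; case: (W _).
  case: cW => w1 w2; apply: ct_vmeas; under eq_fun do rewrite e;
    [exact: (ccont_comp w1 ca)|exact: (ccont_comp w2 ca)].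
have dpos z t : cabs z <= 1 -> 0 <= t <= 1 -> (cabs z = 1 \/ t = 1) ->
    0 < \sum_j Int P (fun p => sv j (W (z + t%:C%C * cpt p))) * Sv j v0.
  move=> z1 t1 zt; have [B [mB sB] good] := hB z t z1 t1 zt.
  apply: (Int_line_cos v00 (mV z t) _ mB) => // p Bp.
  have g := good p Bp; have /andP[ge _] := g.
  apply: (@line_cos_near _ _ (c * (z + t%:C%C * cpt p) ^+ k)) => //; last exact: near.
  rewrite mulf_neq0 // expf_neq0 //; apply/eqP => e0; move: ge.
  by rewrite e0 Normc.normc0 leNgt eta0.
pose G j (x : R * R) (t : R) : R := balance_at W j (pol x, t).
have GE j x t : G j x t = Int P (fun p => sv j (W (cpt (pol x) + t%:C%C * cpt p))) by [].
have e2 : 2 * pi = pi *+ 2 :> R by rewrite mulr_natl.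
have k00 : k = 0%N; last by rewrite k00 in k0.
apply: (@no_nonvanishing_lift R G (fun x => (W (cpt (pol x))).1) (fun x => (W (cpt (pol x))).2) v0 c k) => //.
- move=> j; apply: (@ct_pair _ _ _ _ (balance_at W j) (fun p : (R * R) * R => pol p.1) (fun p => p.2)).
  + exact: ct_balance_at.
  + by move=> p; apply: (continuous_comp (f := fst)); [exact: cvg_fst|exact: cpol].
  + by move=> p; exact: cvg_snd.
- by case: cW => w1 _; exact: (ccont_comp w1 cpol).
- by case: cW => _ w2; exact: (ccont_comp w2 cpol).
- move=> x t x1 x2 /andP[t0 t1]; under eq_bigr do rewrite -expr2 GE.
  have [t00|t00] := eqVneq t 0; last by apply: G0'; [exact: ncp|rewrite lt_neqAle eq_sym t00 t0].
  rewrite t00; under eq_bigr do (under eq_fun do rewrite mul0r addr0; rewrite Int_cst exprMn).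
  by rewrite -mulr_suml sv_unit // mul1r exprn_gt0 // mass_sph_gt0.
- by move=> x; case: (W (cpt (pol x))) (W0 (cpt (pol x))).
- move=> x; exists (mass P / n2 (W (cpt (pol x)))).
    by rewrite divr_gt0 ?mass_sph_gt0 // n2_gt0.
  move=> j; rewrite GE; under eq_fun do rewrite mul0r addr0.
  by rewrite Int_cst /sv; case: (W (cpt (pol x))) => a b /=; ring.
- by move=> j r t; rewrite /G /pol /= e2 cos2pi sin2pi cos0 sin0.
- by move=> r; rewrite /pol /= e2 cos2pi sin2pi cos0 sin0.
- by move=> j x t; rewrite /G /pol /= !mul0r.
- by move=> x; rewrite /pol /= !mul0r.
- move=> x x1 x2; under eq_bigr do rewrite GE.
  by apply: dpos; [exact: ncp|rewrite ler01 lexx|right].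
- move=> x t x2 t1; under eq_bigr do rewrite GE.
  have h : cabs (cpt (pol (1, x))) = 1 by rewrite polE mul1r cabs_cis.
  by apply: dpos => //; [rewrite h|left].
- move=> x x2; rewrite !polE /= mul1r -cisX.
  have := near (cis x); rewrite cabs_cis eta1 R01 => /(_ isT).
  rewrite nsqM nsqX nsq_cis expr1n mulr1; have := n2_ge0 ((W (cis x)).1 - c * cis x ^+ k * v0.1, (W (cis x)).2 - c * cis x ^+ k * v0.2).
  by lra.
Qed.

End ZeroExistence.

Section Zeros.
Variables (R : realType) (d : nat).
Hypothesis hd : (1 <= d)%N.
Local Notation C := R[i].
Local Notation RR := (measurableTypeR R).
Local Notation T := (RR * RR)%type.
Local Notation P := (@sph R).
Implicit Types (c : coefs R d) (x : H3 R).

Definition is_zero c x : Prop := forall j, Int P (fun p => sv j (rat_lift c x p)) = 0.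

Lemma mulv_to0o (v : C * C) : mulv (to0 (H3o R)) v = v.
Proof.
by rewrite mulv_to0 /hz /ht /= sqrtr1 invr1 mul0r subr0 !mul1r; case: v.
Qed.

Lemma zeroP (f : RatMap R d) x : bary_ext (rat_fun f) x = H3o R <-> is_zero (rat_coefs f) x.
Proof.
have hc := rat_coefs_deg f; have [K _ /(_ f x)[ex _]] := bary_near_gram R hd.
have b := bary_ext_balanced ex.
split=> [e j|z].
  rewrite e in b; have := balanced_frame b j; rewrite -[X in _ -> X]/(_ = _) => <-.
  by congr (Int P _); apply/funext => p; rewrite mulv_to0o.
apply: (lift_unique hd hc b); apply: frame_balancedE; [exact: vmeas_lift|by move=> p; exact: lift_neq0|].
by move=> j; rewrite -[RHS](z j); congr (Int P _); apply/funext => p; rewrite mulv_to0o.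
Qed.

Definition lead c : C * C := (c.1 0 ord_max, c.2 0 ord_max).

Lemma lead_neq0 c : deg_coefs c -> lead c != 0.
Proof.
move=> hc; have := @homp_neq0 _ _ c (1, 0) hc; rewrite /homp !hom_inf expr1n !mulr1; apply.
by rewrite xpair_eqE oner_eq0.
Qed.

Lemma cabs_sum_le n (F : 'I_n -> C) (B : R) : (forall i, cabs (F i) <= B) -> cabs (\sum_i F i) <= n%:R * B.
Proof.
move=> h; apply: (le_trans (cabs_sum _)); apply: (le_trans (ler_sum _ (fun i _ => h i))).
by rewrite sumr_const card_ord -[B *+ n]mulr_natl.
Qed.

Lemma hom_lead_near (p : 'rV[C]_d.+1) : exists2 L : R, 0 <= L & forall u, 1 <= cabs u ->
  cabs (hom p (u, 1) - u ^+ d * p 0 ord_max) <= L * cabs u ^+ d.-1.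
Proof.
pose B := \sum_i cabs (p 0 i).
have B0 : 0 <= B by apply: sumr_ge0 => i _; exact: cabs_ge0.
have Bi i : cabs (p 0 i) <= B.
  by rewrite /B (bigD1 i) //= lerDl; apply: sumr_ge0 => k _; exact: cabs_ge0.
exists (d%:R * B); first by rewrite mulr_ge0.
move=> u u1; rewrite /hom big_ord_recr /= subnn expr0 mulr1 [u ^+ d * _]mulrC addrK -mulrA.
apply: cabs_sum_le => i; rewrite expr1n mulr1 Normc.normcM cabsX.
apply: ler_pM; [exact: cabs_ge0|by rewrite exprn_ge0 ?cabs_ge0|exact: Bi|].
by rewrite ler_weXn2l // -ltnS prednK.
Qed.

Lemma homp_lead_near c : deg_coefs c -> exists2 M : R, 1 <= M & forall u, M <= cabs u ->
  16 * n2 ((homp c (u, 1)).1 - u ^+ d * (lead c).1, (homp c (u, 1)).2 - u ^+ d * (lead c).2) <=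
  nsq (u ^+ d) * n2 (lead c).
Proof.
move=> hc; have [L1 L10 h1] := hom_lead_near c.1; have [L2 L20 h2] := hom_lead_near c.2.
have N0 : 0 < n2 (lead c) by rewrite n2_gt0 lead_neq0.
pose M := 1 + 16 * (L1 ^+ 2 + L2 ^+ 2) / n2 (lead c).
have LL : 0 <= 16 * (L1 ^+ 2 + L2 ^+ 2) by rewrite mulr_ge0 // addr_ge0 // sqr_ge0.
have q0 : 0 <= 16 * (L1 ^+ 2 + L2 ^+ 2) / n2 (lead c) by rewrite divr_ge0 // ltW.
have M1 : 1 <= M by rewrite lerDl.
exists M => // u Mu; have u1 : 1 <= cabs u by exact: le_trans Mu.
have u0 := cabs_ge0 u.
have := h1 u u1; have := h2 u u1; rewrite /n2 /= !nsqE cabsX.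
set a := cabs (hom c.1 _ - _); set b := cabs (hom c.2 _ - _) => hb ha.
have hud : cabs u ^+ d = cabs u * cabs u ^+ d.-1 by rewrite -exprS prednK.
set X := cabs u ^+ d.-1 in ha hb hud; have X0 : 0 <= X by rewrite exprn_ge0.
have a2 : a ^+ 2 <= L1 ^+ 2 * X ^+ 2.
  by rewrite -exprMn lerXn2r ?nnegrE ?cabs_ge0 ?mulr_ge0.
have b2 : b ^+ 2 <= L2 ^+ 2 * X ^+ 2.
  by rewrite -exprMn lerXn2r ?nnegrE ?cabs_ge0 ?mulr_ge0.
apply: (@le_trans _ _ (16 * (L1 ^+ 2 + L2 ^+ 2) * X ^+ 2)).
  rewrite -mulrA ler_wpM2l //; lra.
rewrite hud; set N' := cabs _ ^+ 2 + cabs _ ^+ 2; have N'E : N' = n2 (lead c) by rewrite /n2 !nsqE.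
have -> : (cabs u * X) ^+ 2 * N' = (cabs u ^+ 2 * N') * X ^+ 2 by ring.
apply: ler_wpM2r; first exact: sqr_ge0.
have : cabs u <= cabs u ^+ 2 by rewrite expr2 ler_peMl.
have : 16 * (L1 ^+ 2 + L2 ^+ 2) / n2 (lead c) <= cabs u by rewrite (le_trans _ Mu) // /M lerDr.
rewrite ler_pdivrMr // N'E => k1 k2.
by apply: (le_trans k1); rewrite ler_wpM2r // ltW.
Qed.

Lemma homp_ccont c : ccont (fun p : R * R => (homp c (cpt p, 1)).1) /\ ccont (fun p : R * R => (homp c (cpt p, 1)).2).
Proof. by split; apply: ccont_hom; do ?[exact: cpt_ccont|exact: ccont_cst]. Qed.

Definition mkpt (z : C) (t : R) : H3 R := insubd (H3o R) (z, t).

Lemma mkptE z t : 0 < t -> hz (mkpt z t) = z /\ ht (mkpt z t) = t.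
Proof. by move=> t0; rewrite /hz /ht /mkpt insubdK. Qed.

(** Near infinity the map is close to u^d times its vector of leading coefficients. The scale s = M
    / eta brings the annulus of [zero_existence] into that region, with k = d. *)
Lemma exists_zero c : deg_coefs c -> exists x, is_zero c x.
Proof.
move=> hc; have [M M1 hM] := homp_lead_near hc.
have [eta [R0 [eta0 eta1 R01 hz0]]] := zero_existence R.
pose s := M / eta; have s0 : 0 < s by rewrite divr_gt0 // (lt_le_trans ltr01).
have sC : s%:C%C != 0 :> C by rewrite fmorph_eq0 gt_eqF.
have [|||||z [t [z1 /andP[t0 t1] hzt]]] := hz0 (fun w => homp c (s%:C%C * w, 1)) (s%:C%C ^+ d) d (lead c) hd.
- by rewrite expf_neq0.
- exact: lead_neq0.
- have c1 : ccont (fun p : R * R => s%:C%C * cpt p) by apply: ccontM; [exact: ccont_cst|exact: cpt_ccont].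
  by split; apply: ccont_hom => //; exact: ccont_cst.
- by move=> w; apply: homp_neq0 => //; exact: pt1_neq0.
- move=> w /andP[w1 _]; rewrite -exprMn; apply: hM.
  rewrite Normc.normcM cabs_real gtr0_norm //; have -> : M = s * eta by rewrite /s mulfVK ?gt_eqF.
  by rewrite ler_pM2l.
exists (mkpt (s%:C%C * z) (s * t)) => j; rewrite -[RHS](hzt j); congr (Int P _); apply/funext => p.
have [e1 e2] := mkptE (s%:C%C * z) (mulr_gt0 s0 t0).
rewrite /rat_lift e1 e2 (_ : (s * t)%:C%C = s%:C%C * t%:C%C) ?rmorphM //.
by congr (sv j (homp c (_, 1))); ring.
Qed.

(** The maximum keeps the denominator away from 0 on the whole chart; at heights at least m this is
    the cosh of the distance to the centre. *)
Definition dist_fun (m : R) (q : (R * R) * R) : R := (nsq (cpt q.1) + q.2 ^+ 2 + 1) / (2 * Num.max m q.2).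

(** The set of zeros is compact: it is closed, bounded because the leading term dominates far out,
    and away from height 0 because the field there has norm equal to the mass. *)
Lemma zero_max c : deg_coefs c -> exists2 x, is_zero c x & forall y, is_zero c y -> hcosh (H3o R) y <= hcosh (H3o R) x.
Proof.
move=> hc; have [M M1 hM] := homp_lead_near hc.
have M0 : 0 < M by rewrite (lt_le_trans ltr01).
have [eta [R0 [eta0 eta1 R01 hB]]] := bad_set_small R.
have W0 z : homp c (z, 1) != 0 by apply: homp_neq0 => //; exact: pt1_neq0.
have cW := homp_ccont c.
pose Z (q : (R * R) * R) : R := \sum_j balance_at (fun z => homp c (z, 1)) j q ^+ 2.
have cZ : continuous Z.
  rewrite /Z; under eq_fun do rewrite sum3E.
  by do 2?[apply: ctD]; apply: ctX; exact: ct_balance_at.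
have ZE x : is_zero c x <-> Z ((complex.Re (hz x), complex.Im (hz x)), ht x) = 0.
  have E j : balance_at (fun z => homp c (z, 1)) j ((complex.Re (hz x), complex.Im (hz x)), ht x) =
      Int P (fun p => sv j (rat_lift c x p)).
    by rewrite /balance_at; congr (Int P _); apply/funext => p; rewrite /rat_lift /cpt /=; case: (hz x).
  rewrite /Z; under eq_bigr do rewrite E.
  split=> [z|/eqP]; first by apply: big1 => j _; rewrite z expr0n.
  rewrite psumr_eq0; last by move=> j _; exact: sqr_ge0.
  by move=> /allP h j; have := h j (mem_index_enum _); rewrite sqrf_eq0 => /eqP.
pose Lam := M / eta; have Lam0 : 0 < Lam by rewrite divr_gt0.
have bound x : is_zero c x -> cabs (hz x) <= Lam /\ ht x <= Lam.
  move=> zx; have t0 := ht_gt0 x; set lam := Num.max (cabs (hz x)) (ht x).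
  have lam0 : 0 < lam by rewrite lt_max t0 orbT.
  suff : lam <= Lam by rewrite /lam ge_max => /andP.
  (* Dividing by lam puts the point on the side or top of the unit cylinder. If lam exceeds M / eta,
     most values u have modulus at least M, so they are close to the line of [lead c] and the field
     cannot vanish. *)
  rewrite leNgt; apply/negP => big.
  have lC : lam%:C%C != 0 :> C by rewrite fmorph_eq0 gt_eqF.
  have [] := hB (hz x / lam%:C%C) (ht x / lam).
  - by rewrite Normc.normcM Normc.normcV cabs_real gtr0_norm // ler_pdivrMr // mul1r le_max lexx.
  - by rewrite divr_ge0 ?(ltW t0) ?(ltW lam0) //= ler_pdivrMr // mul1r le_max lexx orbT.
  - rewrite Normc.normcM Normc.normcV cabs_real gtr0_norm // /lam.
    have [h|h] := leP (cabs (hz x)) (ht x); [right|left]; rewrite divff // gt_eqF //.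
    exact: lt_trans h.
  move=> B [mB sB] good.
  have := @Int_line_cos R (lead c) (rat_lift c x) B (lead_neq0 hc) (vmeas_lift c x) (fun p => lift_neq0 x p hc) mB _ sB.
  rewrite big1 ?ltxx; last by move=> j _; rewrite zx mul0r.
  move=> h; suff : false by []; apply: h => p Bp; have /andP[g _] := good p Bp.
  set u := hz x + (ht x)%:C%C * cpt p.
  have uE : u = lam%:C%C * (hz x / lam%:C%C + (ht x / lam)%:C%C * cpt p).
    by rewrite mulrDr mulrCA divff // mulr1 mulrA -rmorphM /= mulrCA divff ?mulr1 // gt_eqF.
  have ub : M <= cabs u.
    rewrite uE Normc.normcM cabs_real gtr0_norm // (le_trans _ (ler_wpM2l (ltW lam0) g)) //.
    by move: big; rewrite /Lam ltr_pdivrMr // => /ltW.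
  apply: (@line_cos_near _ _ _ (u ^+ d)); rewrite ?lead_neq0 // ?lift_neq0 //; last exact: hM.
  rewrite expf_neq0 //; apply/eqP => u0; move: ub; rewrite u0 Normc.normc0 leNgt M0 //.
pose box : set ((R * R) * R) := (`[- Lam, Lam]%classic `*` `[- Lam, Lam]%classic) `*` `[0, Lam]%classic.
pose S : set ((R * R) * R) := box `&` [set q | Z q <= 0].
have cS : compact S.
  apply: compact_closedI; last exact: closed_le_ct.
  by do !apply: compact_setX; exact: segment_compact.
have Zge q : 0 <= Z q by apply: sumr_ge0 => j _; exact: sqr_ge0.
have Szero x : is_zero c x -> S ((complex.Re (hz x), complex.Im (hz x)), ht x).
  move=> zx; have [b1 b2] := bound x zx; split; last by rewrite /= (iffLR (ZE x) zx).
  split; [split|]; rewrite /= in_itv /= -?ler_norml.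
  - exact: le_trans (cabs_ge_Re _) b1.
  - exact: le_trans (cabs_ge_Im _) b1.
  - by rewrite b2 ltW // ht_gt0.
(* At height 0 the integrand is constant, so Z equals the square of the mass there. *)
have Spos q : S q -> 0 < q.2.
  move=> [[_ /=]]; rewrite in_itv /= => /andP[t0 _] Zq; rewrite lt_neqAle t0 andbT; apply/eqP => e.
  have : Z q = mass P ^+ 2.
    rewrite /Z -[RHS]mul1r -(sv_unit (W0 (cpt q.1))) mulr_suml; apply: eq_bigr => j _.
    by rewrite /balance_at -e; under eq_fun do rewrite mul0r addr0; rewrite Int_cst exprMn.
  by move=> h; move: Zq; rewrite h leNgt exprn_gt0 ?mass_sph_gt0.
have Sback q : S q -> exists2 x, is_zero c x & q = ((complex.Re (hz x), complex.Im (hz x)), ht x).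
  move=> Sq; have [e1 e2] := mkptE (cpt q.1) (Spos q Sq).
  exists (mkpt (cpt q.1) q.2); last by rewrite e1 e2 /cpt /=; case: q {Sq e1 e2} => -[? ?] ?.
  apply/ZE; rewrite e1 e2; have [_ /= Zq] := Sq.
  by apply/eqP; rewrite eq_le Zge andbT; move: Zq; case: q {Sq e1 e2} => -[? ?] ?.
have [x0 zx0] := exists_zero hc.
have Sne : S !=set0 by exists ((complex.Re (hz x0), complex.Im (hz x0)), ht x0); exact: Szero.
have [m m0 hmin] : exists2 m : R, 0 < m & forall q, S q -> m <= q.2.
  have [|qm Sqm h] := compact_EVT_min Sne cS (f := fun q : (R * R) * R => q.2).
    by apply: continuous_subspaceT => q; exact: cvg_snd.
  by exists qm.2 => [|q Sq]; [apply: Spos; exact: set_mem|exact/h/mem_set].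
have [|qM SqM hmax] := compact_EVT_max Sne cS (f := dist_fun m).
  apply: continuous_subspaceT; have c2 : continuous (fun q : (R * R) * R => q.2) by move=> q; exact: cvg_snd.
  apply: ctM.
    apply: ctD; [apply: ctD; [|exact: ctX]|exact: ct_cst].
    apply: (ct_fst (f := fun p : R * R => nsq (cpt p))); apply: ct_nsq; exact: cpt_ccont.
  apply: ctV; first by move=> q; rewrite mulf_neq0 // gt_eqF // lt_max m0.
  apply: ctM; first exact: ct_cst.
  apply: (@ctcomp _ _ (fun t : R => Num.max m t)) => //.
  by move=> t; apply: continuous_max => //; exact: cst_continuous.
have distE x : is_zero c x -> dist_fun m ((complex.Re (hz x), complex.Im (hz x)), ht x) = hcosh (H3o R) x.
  move=> zx; have := hmin _ (Szero x zx) => /= mx.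
  have o1 : hz (H3o R) = 0 by [].
  have o2 : ht (H3o R) = 1 by [].
  have ez : cpt (complex.Re (hz x), complex.Im (hz x)) = hz x by case: (hz x).
  rewrite /dist_fun /= max_r // hcoshE o1 o2 sub0r nsqN expr1n mulr1 ez; congr (_ / _); ring.
have [x zx qE] := Sback qM (set_mem SqM).
exists x => // y zy; rewrite -(distE y zy) -(distE x zx) -qE; apply: hmax; apply: mem_set; exact: Szero.
Qed.

End Zeros.

(** * The absolute value of the Robinson field *)

Lemma ultra_bounded_cvg (R : realType) (T : Type) (F : set_system T) (u : T -> R) (B : R) :
  UltraFilter F -> (\forall n \near F, `|u n| <= B) -> exists l : R, u @ F --> l.
Proof.
move=> UF hB; have cs := @segment_compact R (- B) B.
have FB : (u @ F) `[- B, B]%classic by apply: filterS hB => n /=; rewrite in_itv /= -ler_norml.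
have [l [_ cl]] := cs _ (fmap_proper_filter u _) FB.
exists l => V nV; case: (in_ultra_setVsetC (u @^-1` V) UF) => // h.
by have [x []] := cl (~` V) V h nV.
Qed.

Lemma max_half (R : realType) (a b : R) : Num.max a b = 2^-1 * (a + b + `|a - b|).
Proof. by have [ab|ab] := leP a b; [rewrite ler0_norm ?subr_le0|rewrite gtr0_norm ?subr_gt0]; lra. Qed.

Lemma cvg_maxr (R : realType) (T : Type) (F : set_system T) (FF : Filter F) (u v : T -> R) (a b : R) :
  u @ F --> a -> v @ F --> b -> (fun n => Num.max (u n) (v n)) @ F --> Num.max a b.
Proof.
move=> ua vb; under eq_fun do rewrite max_half; rewrite max_half.
apply: cvgM; first exact: cvg_cst.
by apply: cvgD; [exact: cvgD|apply: cvg_norm; exact: cvgB].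
Qed.

Section RobinsonValue.
Variables (R : realType) (w : free_ultrafilter) (rho : infinitesimal R w).
Local Notation C := R[i].
Local Notation K := (robinson rho).
Local Notation absK := (@robinson_abs R w rho).
Implicit Types (x y : K) (u v : nat -> C).

Lemma rho_lt_half : \forall n \near ultraset w, rho n < 1 / 2.
Proof. by apply: rho_lt; rewrite divr_gt0. Qed.

(* [expR] of the limit of this sequence is the absolute value. *)
Definition lv u (n : nat) : R := ln (cabs (u n)) / - ln (rho n).

Lemma represents_moderate x u : represents x u -> exists N, \forall n \near ultraset w, cabs (u n) < rho n ^- N.
Proof. by move=> [t tE _]; apply/moderateP; rewrite -tE; case: t {tE}. Qed.

Lemma represents_of_moderate u N : (\forall n \near ultraset w, cabs (u n) < rho n ^- N) ->
  represents (of_seq rho u) u.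
Proof. by move=> h; apply: of_seqP; apply/moderateP; exists N. Qed.

Lemma pi_eq0 (t : robinson0 rho) : ((\pi_K t)%qT = 0 :> K) <->
  forall N, \forall n \near ultraset w, cabs (repr (val t) n) < rho n ^+ N.
Proof.
rewrite -(rmorph0 (\pi_K)%qT); split.
  by move=> /eqP; rewrite -Quotient.idealrBE subr0 negl_robE => /asboolP.
by move=> h; apply/eqP; rewrite -Quotient.idealrBE subr0 negl_robE; apply/asboolP.
Qed.

Lemma represents_eq0 x u : represents x u ->
  (x = 0 <-> forall N, \forall n \near ultraset w, cabs (u n) < rho n ^+ N).
Proof.
move=> [t tE <-]; rewrite pi_eq0 tE; split=> h N; apply: filterS2 (h N) (hyper_reprE w u) => n + e.
  by rewrite e.
by rewrite e.
Qed.

Lemma representsD x y u v : represents x u -> represents y v -> represents (x + y) (u + v).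
Proof.
move=> [t tE <-] [s sE <-]; exists (t + s); last by rewrite rmorphD.
by rewrite rmorphD /= tE sE /hyper_class rmorphD.
Qed.

Lemma representsN x u : represents x u -> represents (- x) (- u).
Proof.
move=> [t tE <-]; exists (- t); last by rewrite rmorphN.
by rewrite rmorphN /= tE /hyper_class rmorphN.
Qed.

Lemma representsM x y u v : represents x u -> represents y v -> represents (x * y) (u * v).
Proof.
move=> [t tE <-] [s sE <-]; exists (t * s); last by rewrite rmorphM.
by rewrite rmorphM /= tE sE /hyper_class rmorphM.
Qed.

Lemma represents1 : represents (1 : K) (1 : nat -> C).
Proof. by exists 1; rewrite ?rmorph1 // /hyper_class rmorph1. Qed.

Lemma represents0 : represents (0 : K) (0 : nat -> C).
Proof. by exists 0; rewrite ?rmorph0 // /hyper_class rmorph0. Qed.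

Lemma represents_sub0 x u v : represents x u -> represents x v ->
  forall N, \forall n \near ultraset w, cabs (u n - v n) < rho n ^+ N.
Proof.
move=> hu hv; have := representsD hu (representsN hv); rewrite subrr => /represents_eq0 h.
exact: (iffLR h erefl).
Qed.

Lemma represents_near x u v : represents x u -> (\forall n \near ultraset w, u n = v n) -> represents x v.
Proof.
move=> [t tE <-] h; exists t => //; rewrite tE; apply/eqP.
rewrite /hyper_class -Quotient.idealrBE; apply/asboolP; apply: filterS h => n e.
by rewrite -[LHS]/(u n - v n) e subrr.
Qed.

Lemma represents_neq0 x u : represents x u -> x != 0 ->
  exists N, \forall n \near ultraset w, rho n ^+ N <= cabs (u n).
Proof.
move=> hu x0; have /existsNP [N hN] : ~ forall N : nat, \forall n \near ultraset w, cabs (u n) < rho n ^+ N.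
  by move=> /(represents_eq0 hu) e; rewrite e eqxx in x0.
exists N; case: (@in_ultra_setVsetC _ _ [set n | cabs (u n) < rho n ^+ N] (ultra_ultra w)) => //.
by apply: filterS => n /= /negP; rewrite -leNgt.
Qed.

Lemma lnrho_lt0 : \forall n \near ultraset w, ln (rho n) < 0.
Proof. by apply: filterS rho_lt_half => n h; apply: ln_lt0; rewrite inf_gt0 (lt_trans h) //; lra. Qed.

Lemma lnrho_large (B : R) : \forall n \near ultraset w, B < - ln (rho n).
Proof.
apply: filterS (rho_lt rho (expR_gt0 (- B))) => n h.
by rewrite ltrNr -[X in _ < X]expRK ltr_ln ?posrE ?inf_gt0 ?expR_gt0.
Qed.

Lemma cst_over_lnrho (c : R) : (fun n => c / - ln (rho n)) @ ultraset w --> (0 : R).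
Proof.
apply/cvgrPdist_le => e e0; apply: filterS (lnrho_large (`|c| / e)) => n h.
have l0 : 0 < - ln (rho n) by apply: le_lt_trans h; rewrite divr_ge0 // ltW.
rewrite sub0r normrN normrM normfV [X in _ / X]gtr0_norm // ler_pdivrMr //.
by move: h; rewrite ltr_pdivrMr // mulrC => /ltW.
Qed.

Lemma lv_bounded x u : represents x u -> x != 0 ->
  exists B, \forall n \near ultraset w, `|lv u n| <= B.
Proof.
move=> hu x0; have [N hN] := represents_neq0 hu x0; have [M hM] := represents_moderate hu.
exists (N%:R + M%:R); apply: filterS3 hN hM lnrho_lt0 => n h1 h2 l0.
have r0 := inf_gt0 rho n; have u0 : 0 < cabs (u n) by rewrite (lt_le_trans _ h1) // rho_expn.
have e1 : N%:R * ln (rho n) <= ln (cabs (u n)).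
  by rewrite mulr_natl -lnXn // ler_ln ?posrE ?rho_expn.
have e2 : ln (cabs (u n)) <= - (M%:R * ln (rho n)).
  by rewrite mulr_natl -lnXn // -lnV ?posrE ?rho_expn // ler_ln ?posrE ?invr_gt0 ?rho_expn // ltW.
have n0 := ler0n R N; have m0 := ler0n R M.
have l1 : 0 < - ln (rho n) by rewrite oppr_gt0.
by rewrite /lv ler_norml ler_pdivlMr // ler_pdivrMr //; apply/andP; split; move: e1 e2 n0 m0 l1; clear; move: (ln _) (ln _) N%:R M%:R => *; nra.
Qed.

Lemma lv_cvg x u : represents x u -> x != 0 -> exists l : R, lv u @ ultraset w --> l.
Proof.
move=> hu x0; have [B hB] := lv_bounded hu x0.
exact: (ultra_bounded_cvg (ultra_ultra w) hB).
Qed.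

Lemma lv_squeeze u v (l c : R) : (\forall n \near ultraset w, cabs (u n) != 0) ->
  (\forall n \near ultraset w, cabs (u n) <= expR c * cabs (v n) /\ cabs (v n) <= expR c * cabs (u n)) ->
  lv u @ ultraset w --> l -> lv v @ ultraset w --> l.
Proof.
move=> u0 h hl; have h0 := cst_over_lnrho c.
have a1 : (fun n => lv u n - c / - ln (rho n)) @ ultraset w --> l.
  by rewrite -[l]subr0; apply: cvgB.
have a2 : (fun n => lv u n + c / - ln (rho n)) @ ultraset w --> l.
  by rewrite -[l]addr0; apply: cvgD.
apply: (squeeze_cvgr _ a1 a2); apply: filterS3 h u0 lnrho_lt0 => n [h1 h2] un l0.
have e0 := expR_gt0 c; have up : 0 < cabs (u n) by rewrite lt_neqAle eq_sym un cabs_ge0.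
have vp : 0 < cabs (v n) by have := lt_le_trans up h1; rewrite pmulr_rgt0.
have l1 : 0 < - ln (rho n) by rewrite oppr_gt0.
rewrite /lv -mulrBl -mulrDl; apply/andP; split; rewrite ler_pM2r ?invr_gt0 //.
  rewrite lerBlDr; have -> : ln (cabs (v n)) + c = ln (expR c * cabs (v n)) by rewrite lnM ?posrE // expRK addrC.
  by rewrite ler_ln ?posrE // mulr_gt0.
have -> : ln (cabs (u n)) + c = ln (expR c * cabs (u n)) by rewrite lnM ?posrE // expRK addrC.
by rewrite ler_ln ?posrE // mulr_gt0.
Qed.

(* |u n - v n| < rho^(N + 1) <= |u n| / 2 makes the quotient of moduli lie in [1/2, 2]. *)
Lemma lv_same x u v : represents x u -> represents x v -> x != 0 ->
  forall l : R, lv u @ ultraset w --> l -> lv v @ ultraset w --> l.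
Proof.
move=> hu hv x0 l hl; have [N hN] := represents_neq0 hu x0.
have hs := represents_sub0 hu hv N.+1.
have e2 : expR (ln 2) = 2 :> R by rewrite lnK // posrE.
apply: (lv_squeeze (c := ln 2) _ _ hl).
  by apply: filterS hN => n h; rewrite gt_eqF // (lt_le_trans _ h) // rho_expn.
apply: filterS3 hN hs rho_lt_half => n h1 h2 h3; rewrite e2.
have r0 := rho_expn rho N n; have rn := inf_gt0 rho n.
have d1 : cabs (u n) <= cabs (u n - v n) + cabs (v n).
  by have := @le_normcD R (u n - v n) (v n); rewrite subrK.
have d2 : cabs (v n) <= cabs (u n) + cabs (u n - v n).
  by have := cabsB (u n) (u n - v n); rewrite opprB addrCA subrr addr0.
move: h2; rewrite exprS => h2; have h4 : rho n * rho n ^+ N <= 1 / 2 * rho n ^+ N by rewrite ler_wpM2r // ltW.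
move: h1 (lt_le_trans h2 h4) d1 d2; clear; move: (rho n ^+ N) => *; split; lra.
Qed.

Lemma abs0 : absK 0 = 0.
Proof. by rewrite /robinson_abs eqxx. Qed.

Lemma abs_gt0 x : x != 0 -> 0 < absK x.
Proof. by move=> x0; rewrite /robinson_abs (negbTE x0) expR_gt0. Qed.

Lemma abs_ge0 x : 0 <= absK x.
Proof. by have [->|/abs_gt0/ltW//] := eqVneq x 0; rewrite abs0. Qed.

Lemma abs_eq0 x : (absK x == 0) = (x == 0).
Proof.
by apply/idP/idP => [|/eqP ->]; [apply: contraTT => /abs_gt0/gt_eqF ->|rewrite abs0].
Qed.

(** The absolute value is defined with the canonical representative; [lv_same] transfers the limit
    to any other one. *)
Lemma abs_cvg x u : represents x u -> x != 0 -> lv u @ ultraset w --> ln (absK x).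
Proof.
move=> hu x0; have hr := represents_rep x; have [l hl] := lv_cvg hr x0.
apply: (lv_same hr hu x0); rewrite /robinson_abs (negbTE x0) expRK.
have -> : - lim ((fun n => ln (cabs (rep x n)) / ln (rho n)) @ ultraset w) = l => //.
have h : (fun n => ln (cabs (rep x n)) / ln (rho n)) @ ultraset w --> - l.
  have -> : (fun n => ln (cabs (rep x n)) / ln (rho n)) = fun n => - lv (rep x) n.
    by apply/funext => n; rewrite /lv invrN mulrN opprK.
  exact: cvgN.
by rewrite (cvg_lim _ h) // opprK.
Qed.

Lemma abs_uniq x u (l : R) : represents x u -> x != 0 -> lv u @ ultraset w --> l -> absK x = expR l.
Proof.
move=> hu x0 hl; rewrite -[LHS]lnK ?posrE ?abs_gt0 //; congr expR.
exact: (cvg_unique _ (abs_cvg hu x0) hl).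
Qed.

Lemma represents_near_neq0 x u : represents x u -> x != 0 -> \forall n \near ultraset w, u n != 0.
Proof.
move=> hu x0; have [N hN] := represents_neq0 hu x0; apply: filterS hN => n h.
by apply/eqP => e; move: h; rewrite e Normc.normc0 leNgt rho_expn.
Qed.

Lemma cabs_gt0 (z : C) : z != 0 -> 0 < cabs z.
Proof.
move=> z0; rewrite lt_neqAle cabs_ge0 andbT eq_sym; apply: contra z0 => /eqP/Normc.eq0_normc -> //.
Qed.

Lemma absM x y : absK (x * y) = absK x * absK y.
Proof.
have [->|x0] := eqVneq x 0; first by rewrite mul0r abs0 mul0r.
have [->|y0] := eqVneq y 0; first by rewrite mulr0 abs0 mulr0.
have hx := represents_rep x; have hy := represents_rep y.
rewrite -[absK x]lnK ?posrE ?abs_gt0 // -[absK y]lnK ?posrE ?abs_gt0 // -expRD.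
have hxy := representsM hx hy.
have xy0 : x * y != 0.
  by apply/eqP => e; move: y0; rewrite -[y]mul1r -(robinson_mulVf x0) -mulrA e mulr0 eqxx.
apply: (abs_uniq hxy xy0).
apply: (@cvg_trans _ ((fun n => lv (rep x) n + lv (rep y) n) @ ultraset w)); last first.
  exact: (cvgD (abs_cvg hx x0) (abs_cvg hy y0)).
apply: near_eq_cvg; apply: filterS2 (represents_near_neq0 hx x0) (represents_near_neq0 hy y0) => n xn yn.
rewrite /lv -mulrDl -lnM ?posrE ?cabs_gt0 //.
by rewrite -Normc.normcM.
Qed.

Lemma abs1 : absK 1 = 1.
Proof.
have := absM 1 1; rewrite mulr1 => /eqP; rewrite -[X in X == _]mulr1 (inj_eq (mulfI _)) ?abs_eq0 ?oner_eq0 // => /eqP <- //.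
Qed.

Lemma absN x : absK (- x) = absK x.
Proof.
have h : absK (-1) ^+ 2 = 1 by rewrite expr2 -absM mulrNN mulr1 abs1.
have h1 : absK (-1) = 1.
  by apply/eqP; rewrite -(@eqrXn2 _ 2) ?abs_ge0 // h expr1n.
by rewrite -mulN1r absM h1 mul1r.
Qed.

Lemma absB x y : absK (x - y) = absK (y - x).
Proof. by rewrite -absN opprB. Qed.

(** The modulus of the sum is at most twice the larger modulus, and the constant ln 2 disappears
    after division by - ln rho. *)
Lemma absD x y : absK (x + y) <= Num.max (absK x) (absK y).
Proof.
have [->|x0] := eqVneq x 0; first by rewrite add0r le_max lexx orbT.
have [->|y0] := eqVneq y 0; first by rewrite addr0 le_max lexx.
have [->|s0] := eqVneq (x + y) 0; first by rewrite abs0 le_max abs_ge0.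
have hx := represents_rep x; have hy := represents_rep y; have hs := representsD hx hy.
rewrite -ler_ln ?posrE ?abs_gt0 ?lt_max ?abs_gt0 //.
have lnmax (a b : R) : 0 < a -> 0 < b -> ln (Num.max a b) = Num.max (ln a) (ln b).
  move=> a0 b0; have [ab|ab] := leP a b; first by rewrite max_r // ler_ln.
  by rewrite max_l // ler_ln ?posrE // ltW.
rewrite lnmax ?abs_gt0 //.
have cm : (fun n => Num.max (lv (rep x) n) (lv (rep y) n)) @ ultraset w --> Num.max (ln (absK x)) (ln (absK y)).
  exact: (cvg_maxr _ (abs_cvg hx x0) (abs_cvg hy y0)).
have h : (fun n => ln 2 / - ln (rho n) + Num.max (lv (rep x) n) (lv (rep y) n)) @ ultraset w -->
    Num.max (ln (absK x)) (ln (absK y)).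
  by have := cvgD (cst_over_lnrho (ln 2)) cm; rewrite add0r; exact.
apply: (ler_cvg_to (abs_cvg hs s0) h).
apply: filterS3 (filterI (represents_near_neq0 hx x0) (represents_near_neq0 hs s0)) (represents_near_neq0 hy y0) lnrho_lt0 => n [xn sn] yn l0.
have l1 : 0 < - ln (rho n) by rewrite oppr_gt0.
have px := cabs_gt0 xn; have py := cabs_gt0 yn; have ps := cabs_gt0 sn.
have -> : Num.max (lv (rep x) n) (lv (rep y) n) = ln (Num.max (cabs (rep x n)) (cabs (rep y n))) / - ln (rho n).
  by rewrite lnmax // /lv maxr_pMl ?invr_ge0 ?(ltW l1).
rewrite /lv -mulrDl ler_pM2r ?invr_gt0 // -lnM ?posrE ?lt_max ?px // ler_ln ?posrE // ?mulr_gt0 ?lt_max ?px //.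
apply: (le_trans (@le_normcD R _ _)).
have h1 : cabs (rep x n) <= Num.max (cabs (rep x n)) (cabs (rep y n)) by rewrite le_max lexx.
have h2 : cabs (rep y n) <= Num.max (cabs (rep x n)) (cabs (rep y n)) by rewrite le_max lexx orbT.
by rewrite mulr_natl mulr2n lerD.
Qed.

(** The witness is the class of the sequence rho_n to the power - ln s. *)
Lemma abs_surj (s : R) : 0 < s -> exists2 x, x != 0 & absK x = s.
Proof.
move=> s0; pose u n : C := (expR (ln s * - ln (rho n)))%:C%C.
have un n : cabs (u n) = expR (ln s * - ln (rho n)) by rewrite cabs_real gtr0_norm ?expR_gt0.
have rE N n : rho n ^+ N = expR (- (N%:R * - ln (rho n))).
  by rewrite mulrN opprK mulr_natl -lnXn ?inf_gt0 // lnK // posrE rho_expn.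
pose N := (Num.trunc `|ln s|).+1.
have hN : `|ln s| < N%:R by exact: truncnS_gt.
have hm : \forall n \near ultraset w, cabs (u n) < rho n ^- N.
  apply: filterS lnrho_lt0 => n l0; rewrite un rE -expRN opprK ltr_expR ltr_pM2r ?oppr_gt0 //.
  by rewrite (le_lt_trans (ler_norm _)).
have hr := represents_of_moderate hm.
have x0 : of_seq rho u != 0.
  apply/eqP => /(represents_eq0 hr) /(_ N) h.
  have /filter_ex [] // : \forall n \near ultraset w, False.
  apply: filterS2 h lnrho_lt0 => n; rewrite un rE ltr_expR => h l0.
  move: h; rewrite -mulNr ltr_pM2r ?oppr_gt0 // => h.
  by move: hN; rewrite ltr_norml; lra.
exists (of_seq rho u) => //; rewrite -[s in RHS]lnK ?posrE //.
apply: (abs_uniq hr x0).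
have : (fun n => ln s) @ ultraset w --> ln s by exact: cvg_cst.
apply: cvg_trans; apply: near_eq_cvg; apply: filterS lnrho_lt0 => n l0.
by rewrite /lv un expRK mulfK // gt_eqF // oppr_gt0.
Qed.

(** A nonzero constant has a bounded logarithm, which vanishes after division by - ln rho. The
    residue characteristic is therefore 0, as sampling at integers requires. *)
Lemma abs_nat (m : nat) : (0 < m)%N -> absK m%:R = 1.
Proof.
move=> m0; have hr : represents (m%:R : K) (fun=> m%:R).
  elim: m {m0} => [|m ih]; first exact: represents0.
  have := representsD ih represents1; rewrite natr1; congr represents.
  by apply/funext => n; rewrite -[LHS]/(m%:R + 1) natr1.
have mp : 0 < cabs (m%:R : C) by rewrite cabs_gt0 // pnatr_eq0 -lt0n.
have x0 : m%:R != 0 :> K.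
  apply/eqP => /(represents_eq0 hr) /(_ 1%N) h.
  have /filter_ex [] // : \forall n \near ultraset w, False.
  by apply: filterS2 h (rho_lt rho mp) => n; rewrite expr1 => h1 h2; have := lt_trans h1 h2; rewrite ltxx.
by rewrite (abs_uniq hr x0 (cst_over_lnrho _)) expR0.
Qed.

End RobinsonValue.

(** * Divergence of the radii *)

Section Radius.
Variables (R : realType) (d : nat).
Hypothesis hd : (1 <= d)%N.
Local Notation C := R[i].
Local Notation RR := (measurableTypeR R).
Local Notation T := (RR * RR)%type.
Local Notation P := (@sph R).
Implicit Types (c : coefs R d) (x : H3 R) (f : RatMap R d).

Lemma arcosh_le (a b : R) : 1 <= a -> a <= b -> arcosh a <= arcosh b.
Proof.
move=> a1 ab; have b1 := le_trans a1 ab.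
have pos (u : R) : 1 <= u -> 0 < u + Num.sqrt (u ^+ 2 - 1).
  by move=> u1; rewrite ltr_pwDl ?sqrtr_ge0 // (lt_le_trans ltr01).
rewrite /arcosh ler_ln ?posrE ?pos // lerD // ler_wsqrtr // lerB // ler_sqr // nnegrE.
  exact: le_trans a1.
exact: le_trans b1.
Qed.

Lemma bary_radiusP f :
  (exists2 x, bary_ext (rat_fun f) x = H3o R & hdist (H3o R) x = bary_radius f) /\
  (forall x, bary_ext (rat_fun f) x = H3o R -> hdist (H3o R) x <= bary_radius f).
Proof.
have [x0 z0 hmax] := zero_max hd (rat_coefs_deg f).
pose D := [set hdist (H3o R) y | y in bary_ext (rat_fun f) @^-1` [set H3o R]].
have [Dr ub] : D (bary_radius f) /\ ubound D (bary_radius f).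
  have : exists m, [set m | D m /\ ubound D m] m.
    exists (hdist (H3o R) x0); split; first by exists x0 => //; exact/(zeroP hd).
    move=> _ [y hy <-]; apply: arcosh_le; first exact: hcosh_ge1.
    by apply: hmax; apply/(zeroP hd).
  by move=> /(xgetPex 0).
split; first by case: Dr => x h1 h2; exists x.
by move=> x hx; apply: ub; exists x.
Qed.

Lemma poly_ofZ (k : C) (p : 'rV[C]_d.+1) : poly_of (k *: p) = k *: poly_of p.
Proof. by apply/polyP => i; rewrite coefZ !coef_poly mxE; case: ifP; rewrite ?mulr0. Qed.

Lemma deg_coefsZ (k : C) c : k != 0 -> deg_coefs c -> deg_coefs (k *: c).
Proof.
move=> k0 [h1 h2]; split; rewrite !poly_ofZ; first by rewrite coprimepZl // coprimepZr.
by rewrite !size_scale.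
Qed.

Lemma max_modulus_ge c i : cabs (c.1 0 i) <= max_modulus c /\ cabs (c.2 0 i) <= max_modulus c.
Proof.
have h : Num.max (cabs (c.1 0 i)) (cabs (c.2 0 i)) <= max_modulus c by apply: le_bigmax.
by split; apply: le_trans h; rewrite le_max lexx ?orbT.
Qed.

Lemma max_modulus_lt c (e : R) : 0 < e -> (forall i, cabs (c.1 0 i) < e /\ cabs (c.2 0 i) < e) -> max_modulus c < e.
Proof. by move=> e0 h; apply/bigmax_ltP; split => // i _; rewrite gt_max; case: (h i) => -> ->. Qed.

Lemma max_modulus_gt0 c : deg_coefs c -> 0 < max_modulus c.
Proof.
move=> hc; have := lead_neq0 hc; rewrite /lead xpair_eqE negb_and => /orP[|] /cabs_gt0 h; apply: (lt_le_trans h).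
  by case: (max_modulus_ge c ord_max).
by case: (max_modulus_ge c ord_max).
Qed.

Lemma max_modulusZ c (k : R) : 0 <= k -> max_modulus (k%:C%C *: c) = k * max_modulus c.
Proof.
move=> k0; rewrite /max_modulus; elim/big_rec2: _ => [|i y1 y2 _ ->]; first by rewrite mulr0.
by rewrite !mxE !Normc.normcM cabs_real ger0_norm // !maxr_pMr.
Qed.

Definition normalized f : coefs R d := ((max_modulus (rat_coefs f))%:C%C)^-1 *: rat_coefs f.

Lemma normalized_factor f : ((max_modulus (rat_coefs f))%:C%C)^-1 != 0 :> C.
Proof. by rewrite invr_eq0 fmorph_eq0 gt_eqF // max_modulus_gt0 //; exact: rat_coefs_deg. Qed.

Lemma normalized_deg f : deg_coefs (normalized f).
Proof. by apply: deg_coefsZ; [exact: normalized_factor|exact: rat_coefs_deg]. Qed.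

Lemma max_modulus_normalized f : max_modulus (normalized f) = 1.
Proof.
have h := max_modulus_gt0 (rat_coefs_deg f).
rewrite /normalized -fmorphV max_modulusZ ?invr_ge0 ?ltW // mulVf // gt_eqF //.
Qed.

Lemma normalized_class f : (\pi_(RatMap R d) (exist _ (normalized f) (mem_set (normalized_deg f)) : set_type (@deg_coefs R d)))%qT = f.
Proof.
rewrite -[RHS]reprK; apply/eqquotP; apply/asboolP.
exists (max_modulus (rat_coefs f))%:C%C; first by rewrite -invr_eq0 normalized_factor.
rewrite /= set_valE /= /normalized scalerA divff ?scale1r //.
by rewrite -invr_eq0 normalized_factor.
Qed.

Lemma is_zeroZ (k : C) c x : k != 0 -> is_zero c x -> is_zero (k *: c) x.
Proof.
move=> k0 h j; rewrite -[RHS](h j); congr (Int P _); apply/funext => p; rewrite /rat_lift.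
have homZl q v : hom (k *: q) v = k * hom q v :> C.
  by rewrite /hom mulr_sumr; apply: eq_bigr => i _; rewrite mxE !mulrA.
by rewrite /homp /= !homZl (svZ j (hom c.1 _, hom c.2 _) k0).
Qed.

Lemma normalized_zero f x : is_zero (normalized f) x <-> is_zero (rat_coefs f) x.
Proof.
split; last exact/is_zeroZ/normalized_factor.
move=> /(is_zeroZ (k := (max_modulus (rat_coefs f))%:C%C)).
have n0 : (max_modulus (rat_coefs f))%:C%C != 0 :> C by rewrite -invr_eq0 normalized_factor.
by rewrite /normalized scalerA divff // scale1r; apply.
Qed.

(* A sequence of coefficients converging in [deg_coefs] gives a compact set of maps. *)
Lemma not_degenerating (f : nat -> RatMap R d) c (g : nat -> nat) : deg_coefs c -> (forall k, (k <= g k)%N) ->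
  (forall k i, cabs (c.1 0 i - (normalized (f (g k))).1 0 i) < k.+1%:R^-1 /\
               cabs (c.2 0 i - (normalized (f (g k))).2 0 i) < k.+1%:R^-1) -> ~ degenerating f.
Proof.
move=> hc gk close dg; pose u0 : set_type (@deg_coefs R d) := exist _ c (mem_set hc).
pose x0 : RatMap R d := (\pi_(RatMap R d) u0)%qT.
pose K : set (RatMap R d) := [set x0] `|` [set f (g k) | k in setT].
suff /dg [N _ hN] : compact K by apply: (hN (g N) (gk N)); right; exists N.
(* A neighbourhood in the quotient pulls back to an open set of coefficients, which contains all the
   normalized coefficients from some index on. *)
have tail V : nbhs x0 V -> V x0 /\ exists N, forall k, (N <= k)%N -> V (f (g k)).
  rewrite nbhsE => -[V1 [oO Ox0] OV]; split; first exact: OV.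
  have : nbhs u0 (\pi_(RatMap R d)%qT @^-1` V1) by apply: open_nbhs_nbhs; split.
  rewrite nbhsE => -[_ [[W oW <-] /= Wc] hW].
  have : nbhs c W by apply: open_nbhs_nbhs; split.
  move=> [[A B] /= [[A' hA' sA] [B' hB' sB]] sW].
  have fin (v : 'rV[C]_d.+1) (Q : 'I_1 -> 'I_d.+1 -> set C) : (forall i j, nbhs (v i j) (Q i j)) ->
      exists N, forall k, (N <= k)%N -> forall j (z : C), cabs (v 0 j - z) < k.+1%:R^-1 -> Q 0 j z.
    move=> hQ; have /(_ _)/cid2 h j : exists2 e : R, 0 < e & forall z, cabs (v 0 j - z) < e -> Q 0 j z.
      exact/nbhsC.
    exists (\max_j (Num.trunc (s2val (h j))^-1).+1)%N => k hk j z hz'.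
    apply: (s2valP' (h j)); apply: (lt_le_trans hz').
    rewrite -[X in _ <= X]invrK lef_pV2 ?posrE ?invr_gt0 ?(s2valP (h j)) //.
    apply: ltW; apply: (lt_trans (truncnS_gt _)); rewrite ltr_nat ltnS.
    by apply: leq_trans hk; exact: (@leq_bigmax _ (fun j => (Num.trunc (s2val (h j))^-1).+1)).
  have [N1 h1] := fin _ _ hA'; have [N2 h2] := fin _ _ hB'.
  exists (maxn N1 N2) => k; rewrite geq_max => /andP[k1 k2].
  apply: OV; rewrite -(normalized_class (f (g k))); apply: hW; apply: (sW); split => /=.
    by apply: sA => i j; rewrite ord1; have [cl _] := close k j; exact: (h1 k k1 j _ cl).
  by apply: sB => i j; rewrite ord1; have [_ cl] := close k j; exact: (h2 k k2 j _ cl).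
rewrite compact_ultra => F UF FK.
(* An ultrafilter on K either contains some singleton of the sequence, and converges there, or
   avoids every finite initial part, and then converges to x0. *)
have [[k Fk]|nF] := pselect (exists k, F [set f (g k)]).
  exists (f (g k)); split; first by right; exists k.
  by move=> V /nbhs_singleton Vk; apply: filterS Fk => _ ->.
exists x0; split; first by left.
move=> V /tail [Vx0 [N hN]].
have : F [set y | forall k, (k < N)%N -> y <> f (g k)].
  elim: (N) => [|M ih]; first by apply: filterS filterT.
  have hM : F (~` [set f (g M)]).
    by case: (@in_ultra_setVsetC _ _ [set f (g M)] UF) => // h; case: nF; exists M.
  apply: filterS2 ih hM => y h1 h2 k; rewrite ltnS leq_eqVlt => /orP[/eqP -> //|]; exact: h1.
apply: filterS2 FK => y [-> //|[k _ <-]] h.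
case: (leqP N k) => [/hN //|kN]; by case: (h k kN).
Qed.

End Radius.

(** * The local picture at a common zero of the limit *)

Section Degeneration.
Variables (R : realType) (d : nat).
Local Notation C := R[i].
Local Notation RR := (measurableTypeR R).
Local Notation T := (RR * RR)%type.
Local Notation P := (@sph R).
Implicit Types (c : coefs R d) (x : H3 R) (M : 'M[C]_2).

Lemma common_zero c : ~ deg_coefs c -> exists2 v, v != 0 & homp c v = 0.
Proof.
move=> nc; have [s1 s2] := size_coefs c.
have [e|ne] := eqVneq (maxn (size (poly_of c.1)) (size (poly_of c.2))) d.+1; last first.
  have top (p : 'rV[C]_d.+1) : (size (poly_of p) <= d)%N -> p 0 ord_max = 0.
    move=> /(nth_default 0); rewrite coef_poly ltnSn => <-; congr (p 0 _); apply: val_inj.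
    by rewrite /= inordK.
  have : (maxn (size (poly_of c.1)) (size (poly_of c.2)) <= d)%N.
    by rewrite -ltnS ltn_neqAle ne geq_max s1.
  rewrite geq_max => /andP[/top t1 /top t2]; exists (1, 0); first by rewrite xpair_eqE oner_eq0.
  by rewrite /homp !hom_inf t1 t2 !mul0r.
have : ~~ coprimep (poly_of c.1) (poly_of c.2) by apply/negP => h; apply: nc.
rewrite /coprimep => /closed_rootP [h]; rewrite root_gcd => /andP[/rootP h1 /rootP h2].
by exists (h, 1); rewrite ?xpair_eqE ?oner_eq0 ?andbF // /homp !hom1 h1 h2.
Qed.

Lemma line_poly (p : 'rV[C]_d.+1) M : exists L : {poly C}, forall w, L.[w] = hom p (mulv M (w, 1)).
Proof.
exists (\sum_i p 0 i *: ((M 0 0 *: 'X + (M 0 1)%:P) ^+ i * (M 1 0 *: 'X + (M 1 1)%:P) ^+ (d - i))) => w.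
rewrite horner_sum; apply: eq_bigr => i _.
by rewrite hornerZ hornerM !horner_exp !hornerD !hornerZ !hornerX !hornerC /mulv /= !mulr1 mulrA.
Qed.

Lemma horner_eq0 (L : {poly C}) : (forall z, L.[z] = 0) -> L = 0.
Proof.
move=> h; apply/eqP; apply/negPn/negP => L0.
have := @max_poly_roots _ L [seq i%:R | i <- iota 0 (size L)] L0.
rewrite size_map size_iota ltnn map_inj_uniq ?iota_uniq; last by move=> a b /eqP; rewrite eqr_nat => /eqP.
by move=> H; suff : false by []; apply: H => //; apply/allP => z _; apply/rootP.
Qed.

(** The chart w -> M (w, 1) reaches every z outside at most one value; there the factor
    [M 0 0 - M 1 0 * z], a nonzero polynomial, vanishes. *)
Lemma hom_line_eq0 (p : 'rV[C]_d.+1) M : \det M = 1 -> (forall w, hom p (mulv M (w, 1)) = 0) -> p = 0.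
Proof.
move=> DM h.
have : poly_of p * ((M 0 0)%:P - M 1 0 *: 'X) = 0.
  apply: horner_eq0 => z; rewrite hornerM hornerD hornerN hornerZ hornerX hornerC -hom1.
  pose u := (M 1 1 * z - M 0 1, M 0 0 - M 1 0 * z).
  have uE : (z, 1) = mulv M u.
    by move: DM; rewrite det2 /mulv /= => DM; congr (_, _); [rewrite -[LHS]mul1r|]; rewrite -DM; ring.
  have [e|u0] := eqVneq (M 0 0 - M 1 0 * z) 0; first by rewrite e mulr0.
  have -> : hom p (z, 1) = 0; last by rewrite mul0r.
  rewrite uE; have -> : mulv M u = (u.2 * (mulv M (u.1 / u.2, 1)).1, u.2 * (mulv M (u.1 / u.2, 1)).2).
    by rewrite /mulv /=; congr (_, _); field.
  by rewrite homZ h mulr0.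
move=> /eqP; rewrite mulf_eq0 => /orP[/eqP p0|/eqP e].
  apply/rowP => i; have := congr1 (fun q : {poly C} => q`_i) p0.
  by rewrite coef_poly ltn_ord coef0 inord_val mxE.
have e0 : M 0 0 = 0 by have := congr1 (horner^~ 0) e; rewrite /= hornerD hornerN hornerZ hornerX !hornerC mulr0 subr0.
have := congr1 (horner^~ 1) e; rewrite /= hornerD hornerN hornerZ hornerX !hornerC e0 add0r mulr1 => /eqP; rewrite oppr_eq0 => /eqP e1.
by move: DM; rewrite det2 e0 e1 mul0r mulr0 subrr => /eqP; rewrite eq_sym oner_eq0.
Qed.

Lemma horner_disc_bound (L : {poly C}) : exists2 B : R, 0 <= B & forall w, cabs w <= 1 -> cabs L.[w] <= B.
Proof.
exists (\sum_(i < size L) cabs L`_i); first by apply: sumr_ge0 => i _; exact: cabs_ge0.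
move=> w w1; rewrite horner_coef; apply: (le_trans (cabs_sum _)); apply: ler_sum => i _.
by rewrite Normc.normcM cabsX ler_piMr ?cabs_ge0 // exprn_ile1 ?cabs_ge0.
Qed.

Lemma common_order (L1 L2 : {poly C}) : ~ (L1 = 0 /\ L2 = 0) -> exists k Q1 Q2,
  [/\ L1 = Q1 * 'X^k, L2 = Q2 * 'X^k & (Q1.[0], Q2.[0]) != 0].
Proof.
move=> n0; have ex : exists k, (L1`_k != 0) || (L2`_k != 0).
  apply: contrapT => h; apply: n0; split; apply/polyP => k; rewrite coef0; apply: contrapT => /eqP e; apply: h; exists k;
  by rewrite e ?orbT.
case: (ex_minnP ex) => k hk kmin; exists k, (drop_poly k L1), (drop_poly k L2).
have low i : (i < k)%N -> L1`_i = 0 /\ L2`_i = 0.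
  move=> ik; split; apply: contrapT => /eqP e; have := kmin i; rewrite e ?orbT => /(_ isT); by rewrite leqNgt ik.
have tk (L : {poly C}) : (forall i, (i < k)%N -> L`_i = 0) -> L = drop_poly k L * 'X^k.
  move=> h; rewrite -[LHS](poly_take_drop k); have -> : take_poly k L = 0; last by rewrite add0r.
  by apply/polyP => i; rewrite coef_take_poly coef0; case: ifP => // /h.
split; [by apply: tk => i /low[]|by apply: tk => i /low[]|].
by rewrite !horner_coef0 !coef_drop_poly add0n xpair_eqE negb_and.
Qed.

Lemma linear_error (Q : {poly C}) : exists2 B : R, 0 <= B & forall w, cabs w <= 1 -> cabs (Q.[w] - Q.[0]) <= cabs w * B.
Proof.
have : root (Q - Q.[0]%:P) 0 by rewrite /root hornerD hornerN hornerC subrr.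
move=> /factor_theorem [q qE]; have [B B0 hB] := horner_disc_bound q; exists B => // w w1.
have -> : Q.[w] - Q.[0] = w * q.[w].
  have := congr1 (horner^~ w) qE; rewrite /= hornerD hornerN hornerC => ->.
  by rewrite hornerM hornerD hornerX hornerN hornerC subr0 mulrC.
by rewrite Normc.normcM ler_wpM2l ?cabs_ge0 ?hB.
Qed.

Lemma form_hcosh0 x v : form x v <= 4 * hcosh (H3o R) x * n2 v.
Proof.
have t0 := ht_gt0 x; have o1 : hz (H3o R) = 0 by []. have o2 : ht (H3o R) = 1 by [].
rewrite hcoshE o1 o2 sub0r nsqN expr1n mulr1 /form ler_pdivrMr //.
have -> : 4 * ((nsq (hz x) + 1 + ht x ^+ 2) / (2 * ht x)) * n2 v * ht x = 2 * (nsq (hz x) + 1 + ht x ^+ 2) * n2 v.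
  by field; rewrite gt_eqF.
have := nsqD_le v.1 (- (hz x * v.2)); rewrite nsqN nsqM /n2.
have := nsq_ge0 (hz x); have := nsq_ge0 v.1; have := nsq_ge0 v.2; have := sqr_ge0 (ht x).
move: (nsq (hz x)) (nsq v.1) (nsq v.2) (ht x ^+ 2) (nsq (_ - _)) => a b e f g *; nra.
Qed.

(** A zero found at (z, t) in the chart M corresponds to the point x obtained by moving the centre
    by the frame of (z, t) and then by M. Its form at M (1, 0) is 1 / t, so a small t puts x far
    from the centre. *)
Lemma zero_of_line c M (z : C) (t : R) : deg_coefs c -> \det M = 1 -> 0 < t ->
  (forall j, Int P (fun p => sv j (homp c (mulv M (z + t%:C%C * cpt p, 1)))) = 0) ->
  exists2 x, is_zero c x & t^-1 <= 4 * n2 (mulv M (1, 0)) * hcosh (H3o R) x.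
Proof.
move=> hc DM t0 hI; have [e1 e2] := mkptE z t0; set x' := mkpt z t in e1 e2.
pose F := frame x'; have DF : \det F = 1 by exact: det_frame.
have DMF : \det (M *m F) = 1 by rewrite det_mulmx DM DF mulr1.
pose x := mobH (M *m F) (H3o R); exists x.
  have b : balanced P (lift_at c (M *m F)) (H3o R).
    have s0 : (Num.sqrt t)^-1%:C%C != 0 :> C by rewrite fmorph_eq0 invr_eq0 gt_eqF // sqrtr_gt0.
    apply: frame_balancedE.
    - have c1 (a b' : C) : ccont (fun p : R * R => a * cpt p + b' * 1).
        by apply: ccont_lin; [exact: cpt_ccont|exact: ccont_cst].
      have h1 := ccont_hom c.1 (c1 ((M *m F) 0 0) ((M *m F) 0 1)) (c1 ((M *m F) 1 0) ((M *m F) 1 1)).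
      have h2 := ccont_hom c.2 (c1 ((M *m F) 0 0) ((M *m F) 0 1)) (c1 ((M *m F) 1 0) ((M *m F) 1 1)).
      exact: (ct_vmeas h1 h2).
    - move=> p; apply: homp_neq0 => //; apply: mulv_neq0; [by rewrite DMF oner_neq0|exact: pt1_neq0].
    - move=> j; rewrite -[RHS](hI j); congr (Int P _); apply/funext => p; rewrite mulv_to0o /lift_at mulvM mulv_frame e1 e2 /=.
      set s := (Num.sqrt t)^-1%:C%C.
      have -> : mulv M (s * (t%:C%C * cpt p + z * 1), s * 1) =
          (s * (mulv M (z + t%:C%C * cpt p, 1)).1, s * (mulv M (z + t%:C%C * cpt p, 1)).2).
        by rewrite /mulv /=; congr (_, _); ring.
      by rewrite hompZ svZ // expf_neq0.
  have {}b : balanced P (rat_lift c x) (H3o R).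
    by apply/balanced_lift; apply: (balanced_frames hc DMF (det_frame x) _ b); rewrite frame0.
  move=> j; rewrite -[RHS](balanced_frame b j); congr (Int P _); apply/funext => p; by rewrite mulv_to0o.
have [u uE] := mulv_surj (1, 0) DF.
have h1 : form x (mulv M (1, 0)) = t^-1.
  rewrite uE -mulvM (mobH_from0 _ DMF erefl) -(mobH_from0 _ DF (frame0 x')) -uE /form e1 e2 /=.
  by rewrite mulr0 subr0 nsq1 nsq0 mulr0 addr0 mul1r.
by rewrite -h1; have := form_hcosh0 x (mulv M (1, 0)); rewrite mulrAC.
Qed.

End Degeneration.

Section FarZero.
Variables (R : realType) (d : nat).
Local Notation C := R[i].
Implicit Types (c : coefs R d) (x : H3 R).

Lemma n2D_le (u v : C * C) : n2 (u.1 + v.1, u.2 + v.2) <= 2 * n2 u + 2 * n2 v.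
Proof.
have h1 := nsqD_le u.1 v.1; have h2 := nsqD_le u.2 v.2; rewrite /n2 /=.
by move: (nsq (_ + _)) (nsq (_ + _)) (nsq u.1) (nsq v.1) (nsq u.2) (nsq v.2) h1 h2 => *; lra.
Qed.

Lemma hom_close (p q : 'rV[C]_d.+1) (B e : R) v : 1 <= B -> cabs v.1 <= B -> cabs v.2 <= B ->
  (forall i, cabs (p 0 i - q 0 i) <= e) -> cabs (hom p v - hom q v) <= d.+1%:R * (e * B ^+ d).
Proof.
move=> B1 h1 h2 he; have B0 : 0 <= B := le_trans ler01 B1.
rewrite /hom -sumrB; apply: cabs_sum_le => i.
rewrite -!mulrA -mulrBl !Normc.normcM !cabsX ler_pM ?mulr_ge0 ?exprn_ge0 ?cabs_ge0 //.
have -> : B ^+ d = B ^+ i * B ^+ (d - i) by rewrite -exprD subnKC // -ltnS.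
by rewrite ler_pM ?exprn_ge0 ?cabs_ge0 // lerXn2r ?nnegrE ?cabs_ge0.
Qed.

(** A matrix of determinant 1 with second column v, so that v corresponds to w = 0 in the chart w ->
    M (w, 1). *)
Definition completing (v : C * C) : 'M[C]_2 := \matrix_(i, j)
  if j == 0 then (if i == 0 then conjc v.2 / (n2 v)%:C%C else - conjc v.1 / (n2 v)%:C%C)
  else (if i == 0 then v.1 else v.2).

Lemma det_completing v : v != 0 -> \det (completing v) = 1.
Proof.
rewrite -n2_gt0 => v0; have n0 : (n2 v)%:C%C != 0 :> C by rewrite fmorph_eq0 gt_eqF.
rewrite det2 !mxE /=.
have -> : conjc v.2 / (n2 v)%:C%C * v.2 - v.1 * (- conjc v.1 / (n2 v)%:C%C) =
  (v.1 * conjc v.1 + v.2 * conjc v.2) / (n2 v)%:C%C by ring.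
by rewrite !mulcJ -rmorphD divff.
Qed.

(** In the chart at a common zero v, the limit is w^k (Q1, Q2) with (Q1, Q2) not both 0 at the
    origin and k > 0. Rescaling by a small del puts the approximating maps in the situation of
    [zero_existence], which yields a zero of height at most del in this chart. *)
Lemma far_zero (F : set_system nat) (FF : ProperFilter F) (c : nat -> coefs R d) (cs : coefs R d) (A : R) :
  (forall n, deg_coefs (c n)) -> cs != 0 -> ~ deg_coefs cs ->
  (forall e : R, 0 < e -> \forall n \near F, forall i, cabs ((c n).1 0 i - cs.1 0 i) < e /\ cabs ((c n).2 0 i - cs.2 0 i) < e) ->
  \forall n \near F, exists2 x, is_zero (c n) x & A <= hcosh (H3o R) x.
Proof.
move=> hc cs0 ncs lim; have [eta [R0 [eta0 eta1 R01 ex]]] := zero_existence R.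
have [v v0 hv] := common_zero ncs; pose M := completing v; have DM : \det M = 1 := det_completing v0.
have [L1 hL1] := line_poly cs.1 M; have [L2 hL2] := line_poly cs.2 M.
have Mv : mulv M (0, 1) = v by rewrite /mulv !mxE /= !mulr0 !add0r !mulr1; case: (v).
have [L10 L20] : L1.[0] = 0 /\ L2.[0] = 0 by rewrite hL1 hL2 Mv; case: hv.
have Ln0 : ~ (L1 = 0 /\ L2 = 0).
  move=> [e1 e2]; move: cs0; apply/negP/negPn.
  have -> : cs = (cs.1, cs.2) by case: (cs).
  by rewrite xpair_eqE; apply/andP; split; apply/eqP; apply: (hom_line_eq0 DM) => w; rewrite -?hL1 -?hL2 ?e1 ?e2 horner0.
have [k [Q1 [Q2 [E1 E2 a0]]]] := common_order Ln0; set a := (_, _) in a0.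
have k0 : (0 < k)%N.
  rewrite lt0n; apply/eqP => e; move: a0; rewrite /a e expr0 !mulr1 in E1 E2 *.
  by rewrite -E1 -E2 L10 L20 xpair_eqE eqxx.
have na : 0 < n2 a by rewrite n2_gt0.
have [B1 B10 hB1] := linear_error Q1; have [B2 B20 hB2] := linear_error Q2.
pose B := B1 ^+ 2 + B2 ^+ 2; have B0 : 0 <= B by rewrite addr_ge0 ?sqr_ge0.
pose m := n2 (mulv M (1, 0)); have m0 : 0 <= m by exact: n2_ge0.
pose D1 := n2 a / (64 * (B + 1)); have D10 : 0 < D1 by rewrite divr_gt0 // mulr_gt0 // ltr_wpDl.
pose d0 := Num.min 1 D1; have d00 : 0 < d0 by rewrite lt_min ltr01.
have d01 : d0 <= 1 by rewrite ge_min lexx.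
have R00 : 0 < R0 := lt_le_trans ltr01 R01.
pose G0 := 4 * (`|A| + 1) * (m + 1).
have G00 : 0 < G0 by rewrite !mulr_gt0 ?ltr_wpDl.
(* The first bound keeps the rescaled annulus in the disc where (Q1, Q2) is close to its value a at
   0; the second makes 1 / del large enough for the distance bound A. *)
pose del := Num.min (d0 / R0) G0^-1.
have del0 : 0 < del by rewrite lt_min divr_gt0 ?invr_gt0.
pose BM := 1 + \sum_i \sum_j cabs (M i j).
have BMij i j : cabs (M i j) <= \sum_i \sum_j cabs (M i j).
  rewrite (bigD1 i) //= (bigD1 j) //= -addrA lerDl addr_ge0 //.
    by apply: sumr_ge0 => *; exact: cabs_ge0.
  by apply: sumr_ge0 => *; apply: sumr_ge0 => *; exact: cabs_ge0.
have BM1 : 1 <= BM by rewrite lerDl; apply: sumr_ge0 => *; apply: sumr_ge0 => *; exact: cabs_ge0.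
have line_bound i w : cabs w <= 1 -> cabs (M i 0 * w + M i 1) <= BM.
  move=> w1; apply: (le_trans (@le_normcD R _ _)); rewrite Normc.normcM.
  have : cabs (M i 0) * cabs w <= cabs (M i 0) by rewrite ler_piMr ?cabs_ge0.
  suff h : cabs (M i 0) + cabs (M i 1) <= \sum_i \sum_j cabs (M i j).
    by move: h; rewrite /BM; move: (cabs (M i 0)) (cabs (M i 1)) (\sum_i _) (_ * _) => *; lra.
  rewrite [X in _ <= X](bigD1 i) //= big_ord_recl big_ord1.
  have -> : lift ord0 ord0 = 1 :> 'I_2 by apply: val_inj.
  by rewrite lerDl; apply: sumr_ge0 => *; apply: sumr_ge0 => *; exact: cabs_ge0.
pose G := (del * eta) ^+ 2 ^+ k * n2 a.
have Gp : 0 < G by rewrite mulr_gt0 ?exprn_gt0 // mulr_gt0.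
pose S := 2 * (d.+1%:R * BM ^+ d) ^+ 2.
have S0 : 0 < S by rewrite mulr_gt0 ?exprn_gt0 // mulr_gt0 ?ltr0n // exprn_gt0 // (lt_le_trans ltr01).
(* On the annulus |u^k|^2 n2 a is at least G. The coefficient error and the error of linearization
   are each at most a 64th of it; the squared norm of their sum costs a factor 2, which leaves the
   16 demanded by [zero_existence]. *)
pose e := Num.min 1 (G / (64 * S)).
have e0 : 0 < e.
  rewrite lt_min ltr01 /=; apply: divr_gt0 => //; exact: mulr_gt0.
have eS : e ^+ 2 * S <= G / 64.
  have e1 : e <= 1 by rewrite ge_min lexx.
  have e2 : e <= G / (64 * S) by rewrite ge_min lexx orbT.
  have S64 : 0 < 64 * S by exact: mulr_gt0.
  move: e2; rewrite ler_pdivlMr // => e2.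
  have : e ^+ 2 * S <= e * S by rewrite ler_pM2r // expr2 ler_piMr // ltW.
  by move: e2; move: (e ^+ 2 * S) => X; rewrite mulrCA; move: (e * S) => *; lra.
apply: filterS (lim e e0) => n hn.
pose W w := homp (c n) (mulv M (del%:C%C * w, 1)).
have close w : cabs w <= 1 -> n2 ((homp (c n) (mulv M (w, 1))).1 - L1.[w], (homp (c n) (mulv M (w, 1))).2 - L2.[w]) <= G / 64.
  move=> w1; rewrite hL1 hL2; apply: le_trans eS.
  have hb i : cabs (M i 0 * w + M i 1 * 1) <= BM by rewrite mulr1 line_bound.
  have h1 := @hom_close (c n).1 cs.1 BM e (mulv M (w, 1)) BM1 (hb 0) (hb 1) (fun i => ltW (proj1 (hn i))).
  have h2 := @hom_close (c n).2 cs.2 BM e (mulv M (w, 1)) BM1 (hb 0) (hb 1) (fun i => ltW (proj2 (hn i))).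
  have sq (z : C) (b : R) : cabs z <= b -> nsq z <= b ^+ 2.
    by move=> zb; rewrite nsqE lerXn2r ?nnegrE ?cabs_ge0 // (le_trans (cabs_ge0 z)).
  apply: (le_trans (lerD (sq _ _ h1) (sq _ _ h2))).
  rewrite /S; move: (d.+1%:R) (BM ^+ d) => ? ?.
  by rewrite le_eqVlt; apply/orP; left; apply/eqP; ring.
have [z [t [z1 /andP[t0 t1] hI]]] : exists z t, [/\ cabs z <= 1, 0 < t <= 1 &
    forall j, Int (@sph R) (fun p => sv j (W (z + t%:C%C * cpt p))) = 0].
  apply: (ex W (del%:C%C ^+ k) k a k0) => //.
  - by rewrite expf_neq0 // fmorph_eq0 gt_eqF.
  - have cl (x y : C) : ccont (fun p : R * R => x * (del%:C%C * cpt p) + y * 1).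
      apply: ccont_lin; last exact: ccont_cst.
      by apply: ccontM; [exact: ccont_cst|exact: cpt_ccont].
    by split; apply: ccont_hom; exact: cl.
  - move=> w; apply: homp_neq0 => //; apply: mulv_neq0; [by rewrite DM oner_neq0|exact: pt1_neq0].
  move=> w /andP[w1 w2]; pose u := del%:C%C * w.
  have cu : cabs u = del * cabs w by rewrite Normc.normcM cabs_real gtr0_norm.
  have ud0 : cabs u <= d0.
    rewrite cu; have : del <= d0 / R0 by rewrite ge_min lexx.
    rewrite ler_pdivlMr //; apply: le_trans; by rewrite ler_pM2l.
  have u1 := le_trans ud0 d01.
  rewrite -exprMn -/u.
  have -> : ((W w).1 - u ^+ k * a.1, (W w).2 - u ^+ k * a.2) =
     (((W w).1 - L1.[u]) + u ^+ k * (Q1.[u] - Q1.[0]), ((W w).2 - L2.[u]) + u ^+ k * (Q2.[u] - Q2.[0])).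
    by rewrite E1 E2 !hornerM !hornerXn /=; congr (_, _); ring.
  have h := n2D_le ((W w).1 - L1.[u], (W w).2 - L2.[u]) (u ^+ k * (Q1.[u] - Q1.[0]), u ^+ k * (Q2.[u] - Q2.[0])).
  have h1 := close u u1.
  have h2 : n2 (u ^+ k * (Q1.[u] - Q1.[0]), u ^+ k * (Q2.[u] - Q2.[0])) <= nsq (u ^+ k) * (n2 a / 64).
    rewrite /n2 !nsqM -mulrDr; apply: ler_wpM2l; first exact: nsq_ge0.
    have sq (z : C) (b : R) : cabs z <= b -> nsq z <= b ^+ 2.
      by move=> zb; rewrite nsqE lerXn2r ?nnegrE ?cabs_ge0 // (le_trans (cabs_ge0 z)).
    apply: (le_trans (lerD (sq _ _ (hB1 u u1)) (sq _ _ (hB2 u u1)))).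
    rewrite !exprMn -mulrDr -/B.
    have q1 : cabs u ^+ 2 <= D1.
      apply: (@le_trans _ _ (cabs u)); first by rewrite expr2 ler_piMr ?cabs_ge0.
      by apply: (le_trans ud0); rewrite ge_min lexx orbT.
    apply: (@le_trans _ _ (D1 * (B + 1))); first by rewrite ler_pM ?sqr_ge0 // lerDl.
    by rewrite /D1 le_eqVlt; apply/orP; left; apply/eqP; rewrite -/(n2 a); field; rewrite gt_eqF // ltr_wpDl.
  have h3 : G <= nsq (u ^+ k) * n2 a.
    rewrite ler_pM2r // nsqX nsqE lerXn2r ?nnegrE ?sqr_ge0 // lerXn2r ?nnegrE ?cabs_ge0 ?(ltW (mulr_gt0 del0 eta0)) //.
    by rewrite cu ler_pM2l.
  move: h h1 h2 h3; rewrite mulrA; move: (n2 _) (n2 _) (n2 _) (nsq _ * _) => *; lra.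
have dt0 : 0 < del * t by rewrite mulr_gt0.
have [|x zx hx] := @zero_of_line R d (c n) M (del%:C%C * z) (del * t) (hc n) DM dt0.
  move=> j; rewrite -[RHS](hI j); congr (Int _ _); apply/funext => p; congr (sv j (homp _ (mulv M (_, 1)))).
  by rewrite rmorphM /= mulrDr mulrA.
exists x => //; rewrite -/m in hx.
have g1 : G0 <= (del * t)^-1.
  rewrite -[G0]invrK lef_pV2 ?posrE ?invr_gt0 //.
  apply: (@le_trans _ _ del); first by rewrite ler_piMr // ltW.
  by rewrite ge_min lexx orbT.
have g2 := le_trans g1 hx; have hx1 := hcosh_ge1 (H3o R) x.
rewrite leNgt; apply/negP => lt.
have : 4 * m * hcosh (H3o R) x < G0.
  rewrite /G0 -!mulrA ltr_pM2l // mulrC.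
  have nA := ler_norm A; have A1 : hcosh (H3o R) x < `|A| + 1 by lra.
  apply: (@le_lt_trans _ _ ((`|A| + 1) * m)); first by rewrite ler_wpM2r // ltW.
  by rewrite ltr_pM2l ?ltrDl // ltr_wpDl.
by rewrite ltNge g2.
Qed.

End FarZero.

Section RadiusInfinity.
Variables (R : realType) (d : nat).
Hypothesis hd : (1 <= d)%N.
Local Notation C := R[i].

Lemma ultra_limit_coefs (F : set_system nat) (c : nat -> coefs R d) : UltraFilter F ->
  (forall n i, cabs ((c n).1 0 i) <= 1 /\ cabs ((c n).2 0 i) <= 1) ->
  exists cs : coefs R d, forall e : R, 0 < e ->
    \forall n \near F, forall i, cabs ((c n).1 0 i - cs.1 0 i) < e /\ cabs ((c n).2 0 i - cs.2 0 i) < e.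
Proof.
move=> UF hb.
have clim (u : nat -> C) : (forall n, cabs (u n) <= 1) -> {l : C | forall e : R, 0 < e -> \forall n \near F, cabs (u n - l) < e}.
  move=> hu; apply: cid.
  have [a ha] : exists a : R, (fun n => complex.Re (u n)) @ F --> a.
    by apply: (ultra_bounded_cvg (B := 1) UF); apply: nearW => n; apply: le_trans (cabs_ge_Re _) (hu n).
  have [b hb'] : exists b : R, (fun n => complex.Im (u n)) @ F --> b.
    by apply: (ultra_bounded_cvg (B := 1) UF); apply: nearW => n; apply: le_trans (cabs_ge_Im _) (hu n).
  exists (a +i* b)%C => e e0; have e2 : 0 < e / 2 by rewrite divr_gt0.
  move/cvgrPdist_lt/(_ _ e2): ha => ha; move/cvgrPdist_lt/(_ _ e2): hb' => hb'.
  apply: filterS2 ha hb' => n h1 h2; apply: (le_lt_trans (cabs_le_ReIm _)).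
  have -> : e = e / 2 + e / 2 by field.
  by move: h1 h2; case: (u n) => x y /=; rewrite !(distrC _ x) !(distrC _ y) => h1 h2; apply: ltrD.
pose l1 i := clim (fun n => (c n).1 0 i) (fun n => proj1 (hb n i)).
pose l2 i := clim (fun n => (c n).2 0 i) (fun n => proj2 (hb n i)).
exists (\row_i sval (l1 i), \row_i sval (l2 i)) => e e0.
have all_near (Q : 'I_d.+1 -> nat -> Prop) : (forall i, \forall n \near F, Q i n) -> \forall n \near F, forall i, Q i n.
  by move=> h; exact: filter_forall.
apply: all_near => i; have FF : ProperFilter F by exact: ultra_proper.
apply: filterS2 (proj2_sig (l1 i) e e0) (proj2_sig (l2 i) e e0) => n; rewrite !mxE; by split.
Qed.

(** If the radii did not diverge, an ultrafilter finer than the tails would live on indices with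
    radius below some A. Along it the normalized coefficients converge: a limit of full degree
    contradicts degeneration, any other limit produces a zero beyond A. *)
Lemma radius_infinity (f : nat -> RatMap R d) : degenerating f -> (fun n => bary_radius (f n)) @ \oo --> +oo.
Proof.
move=> dg; apply/cvgryPge => A; apply: contrapT => nA.
pose Bd := [set n | bary_radius (f n) < A].
have PB : ProperFilter (within Bd \oo).
  apply: Build_ProperFilter_ex => Q hQ; apply: contrapT => nQ; apply: nA.
  apply: (@filterS nat \oo _ [set n | Bd n -> Q n]) => [n /= h|]; last exact: hQ.
  by rewrite leNgt; apply/negP => b; apply: nQ; exists n; exact: h.
have [F [UF sF]] := ultraFilterLemma PB.
have FB : F Bd by apply: sF; apply: nearW.
have Foo (Q : set nat) : (\forall n \near \oo, Q n) -> F Q by move=> h; apply: sF; apply: filterS h.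
pose c n := normalized (f n).
have c1 n i : cabs ((c n).1 0 i) <= 1 /\ cabs ((c n).2 0 i) <= 1.
  by rewrite -(max_modulus_normalized (f n)); exact: max_modulus_ge.
have [cs lim] := ultra_limit_coefs UF c1.
have FF : ProperFilter F by exact: ultra_proper.
have [hcs|ncs] := pselect (deg_coefs cs).
  have h k : {g : nat | (k <= g)%N /\ forall i, cabs (cs.1 0 i - (c g).1 0 i) < k.+1%:R^-1 /\ cabs (cs.2 0 i - (c g).2 0 i) < k.+1%:R^-1}.
    apply: cid; have k0 : 0 < (k.+1%:R^-1 : R) by rewrite invr_gt0 ltr0n.
    have : F [set n | (k <= n)%N] by apply: Foo; exists k.
    move=> h; have [n [n1 n2]] := filter_ex (filterI h (lim _ k0)); exists n; split => // i; have [i1 i2] := n2 i.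
    by split; rewrite -cabsN opprB.
  apply: (not_degenerating hcs (g := fun k => sval (h k)) _ _ dg) => k; first by case: (proj2_sig (h k)).
  by case: (proj2_sig (h k)).
have cs0 : cs != 0.
  apply/eqP => e; have h2 : 0 < (2^-1 : R) by rewrite invr_gt0.
  have [n hn] := filter_ex (lim _ h2).
  have : max_modulus (c n) < 2^-1.
    apply: max_modulus_lt => // i; have := hn i; rewrite e.
    by move: ((c n).1 0 i) ((c n).2 0 i) => p q; rewrite !mxE !subr0.
  by rewrite max_modulus_normalized; apply/negP; rewrite -leNgt invf_le1 // ler1n.
have := far_zero FF (expR A) (fun n => normalized_deg (f n)) cs0 ncs lim.
move=> /(filterI FB) /filter_ex [n [Bn [x zx hx]]].
have [_ /(_ x) h] := bary_radiusP hd (f n).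
have : hdist (H3o R) x <= bary_radius (f n) by exact: (h (iffRL (zeroP hd (f n) x) (iffLR (normalized_zero (f n) x) zx))).
move=> /le_lt_trans /(_ Bn); rewrite ltNge => /negP; apply.
rewrite /hdist /arcosh -[A in A <= _]expRK ler_ln ?posrE ?expR_gt0 //.
  by apply: (le_trans hx); rewrite lerDl sqrtr_ge0.
by rewrite ltr_pwDl ?sqrtr_ge0 // (lt_le_trans (expR_gt0 A)).
Qed.

End RadiusInfinity.

(** * Spherical completeness of the Robinson field *)

Section SphericalCompleteness.
Variables (R : realType) (w : free_ultrafilter) (rho : infinitesimal R w).
Local Notation C := R[i].
Local Notation K := (robinson rho).
Local Notation absK := (@robinson_abs R w rho).
Implicit Types (x y : K) (u v : nat -> C).

Lemma expr_rho n N : rho n ^+ N = expR (- (N%:R * - ln (rho n))).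
Proof. by rewrite mulrN opprK mulr_natl -lnXn ?inf_gt0 // lnK // posrE rho_expn. Qed.

Lemma lv_le u n (B : R) : ln (rho n) < 0 -> u n != 0 -> (lv rho u n <= B) = (cabs (u n) <= expR (B * - ln (rho n))).
Proof.
move=> l0 u0; rewrite /lv ler_pdivrMr ?oppr_gt0 // -[X in ln _ <= X]expRK ler_ln ?posrE ?expR_gt0 //.
exact: cabs_gt0.
Qed.

(** With its converse [abs_le_of_near], this translates |x| <= s into bounds on a representing
    sequence, at the price of an arbitrarily small loss e in the exponent. *)
Lemma abs_le_near x u (s e : R) : represents x u -> 0 < s -> absK x <= s -> 0 < e ->
  \forall n \near ultraset w, cabs (u n) <= expR ((ln s + e) * - ln (rho n)).
Proof.
move=> hu s0 xs e0; have [x0|x0] := eqVneq x 0.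
  pose N := (Num.trunc `|ln s + e|).+1.
  apply: filterS2 (iffLR (represents_eq0 hu) x0 N) (lnrho_lt0 rho) => n h l0; apply: (le_trans (ltW h)).
  rewrite expr_rho ler_expR -mulNr ler_pM2r ?oppr_gt0 // lerNl (le_trans (ler_norm _)) // normrN ltW //.
  exact: truncnS_gt.
have lx : ln (absK x) < ln s + e.
  by apply: (@le_lt_trans _ _ (ln s)); [rewrite ler_ln ?posrE ?abs_gt0|rewrite ltrDl].
have := abs_cvg hu x0; move=> /cvgr_lt /(_ _ lx) h.
apply: filterS3 h (lnrho_lt0 rho) (represents_near_neq0 hu x0) => n h l0 un.
by rewrite -lv_le // ltW.
Qed.

Lemma abs_le_of_near x u (s : R) : represents x u -> 0 < s ->
  (forall e, 0 < e -> \forall n \near ultraset w, cabs (u n) <= expR ((ln s + e) * - ln (rho n))) -> absK x <= s.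
Proof.
move=> hu s0 h; have [->|x0] := eqVneq x 0; first by rewrite abs0 ltW.
rewrite -ler_ln ?posrE ?abs_gt0 //; apply/ler_addgt0Pr => e e0.
apply: (ler_cvg_to (abs_cvg hu x0) (cvg_cst (ln s + e))).
by apply: filterS3 (h e e0) (lnrho_lt0 rho) (represents_near_neq0 hu x0) => n hn l0 un; rewrite lv_le.
Qed.

Lemma represents_of_bound u (B : R) : (\forall n \near ultraset w, cabs (u n) <= expR (B * - ln (rho n))) ->
  represents (of_seq rho u) u.
Proof.
move=> h; pose N := (Num.trunc `|B|).+1.
apply: (@represents_of_moderate _ _ _ _ N); apply: filterS2 h (lnrho_lt0 rho) => n h l0; apply: (le_lt_trans h).
rewrite expr_rho -expRN opprK ltr_expR ltr_pM2r ?oppr_gt0 //; apply: (le_lt_trans (ler_norm _)).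
exact: truncnS_gt.
Qed.

(* The centre is a diagonal sequence: its n-th entry comes from the last ball whose
   relations to the previous ones already hold, up to a vanishing error, at n. *)
Lemma spherically_complete (p : nat -> K) (r : nat -> R) : (forall i, 0 < r i) ->
  (forall i, cball absK (p i.+1) (r i.+1) `<=` cball absK (p i) (r i)) ->
  exists z, forall i, absK (p i - z) <= r i.
Proof.
move=> r0 sub; pose u i := rep (p i).
have nest i j : (i <= j)%N -> cball absK (p j) (r j) `<=` cball absK (p i) (r i).
  move=> /subnKC <-; elim: (j - i)%N => [|m ih]; first by rewrite addn0.
  by rewrite addnS; apply: subset_trans ih; exact: sub.
have dist i j : (i <= j)%N -> absK (p i - p j) <= r i.
  move=> ij; rewrite absB; apply: (nest i j ij (p j)); rewrite /cball /= subrr abs0; exact: ltW.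
pose eps k : R := k.+1%:R^-1.
have eps0 k : 0 < eps k by rewrite invr_gt0 ltr0n.
(* The condition k <= n makes the largest k with n in A k exist for each n. *)
pose A k := [set n | (k <= n)%N /\ forall i j : 'I_k.+1, (i <= j)%N ->
   cabs (u i n - u j n) <= expR ((ln (r i) + eps k) * - ln (rho n))].
have wA k : ultraset w (A k).
  apply: filterI; first by apply: free_oo; exists k.
  have FF := ultra_proper_filter w.
  apply: filter_forall => i; apply: filter_forall => j.
  have [ij|ij] := boolP (i <= j)%N; last by apply: nearW => n h.
  have h := representsD (represents_rep (p i)) (representsN (represents_rep (p j))).
  by apply: filterS (abs_le_near h (r0 i) (dist i j ij) (eps0 k)) => n hn _.
have ex n : {k' : nat | forall k, A k n -> A k' n /\ (k <= k')%N}.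
  apply: cid; have [[k hk]|nk] := pselect (exists k, A k n); last by exists 0%N => k hk; case: nk; exists k.
  have ex1 : exists k, `[< A k n >] by exists k; apply/asboolP.
  have bd k' : `[< A k' n >] -> (k' <= n)%N by move=> /asboolP [].
  case: (ex_maxnP ex1 bd) => m /asboolP hm mmax; exists m => k1 h1; split => //.
  by apply: mmax; apply/asboolP.
pose v n := u (sval (ex n)) n.
have close i e : 0 < e -> \forall n \near ultraset w, cabs (u i n - v n) <= expR ((ln (r i) + e) * - ln (rho n)).
  move=> e0; pose k := maxn i (Num.trunc e^-1).+1.
  apply: filterS2 (wA k) (lnrho_lt0 rho) => n hn l0; have [[_ h] kk] := proj2_sig (ex n) k hn.
  have ik : (i < (sval (ex n)).+1)%N by rewrite ltnS (leq_trans _ kk) // leq_max leqnn.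
  have := h (Ordinal ik) ord_max; rewrite /= -ltnS => /(_ ik) {}h; apply: (le_trans h).
  rewrite ler_expR ler_pM2r ?oppr_gt0 // lerD2l -[e]invrK lef_pV2 ?posrE ?ltr0n ?invr_gt0 //.
  apply: ltW; apply: (lt_le_trans (truncnS_gt _)); rewrite ler_nat (leq_trans _ (leq_trans kk _)) //.
  by rewrite leq_max leqnn orbT.
have hy := represents_of_bound (close 0%N 1 ltr01).
exists (p 0%N - of_seq rho (fun n => u 0%N n - v n)) => i.
have h1 := representsD (represents_rep (p i)) (representsN (representsD (represents_rep (p 0%N)) (representsN hy))).
apply: (abs_le_of_near _ (r0 i) (close i)); apply: represents_near h1 _; apply: nearW => n.
by rewrite -[LHS]/(u i n - (u 0%N n - (u 0%N n - v n))) subKr.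
Qed.

End SphericalCompleteness.

(** * Balls and points of Berkovich space *)

(** The properties of the Robinson absolute value used on the Berkovich side: ultrametric, residue
    characteristic 0, value group all positive reals, and spherically complete. *)
Record maximal_abs (R : realType) (K : closedFieldType) (absK : K -> R) : Prop := MaximalAbs {
  mabs_ge0 : forall x, 0 <= absK x;
  mabs_eq0 : forall x, (absK x == 0) = (x == 0);
  mabsM : forall x y, absK (x * y) = absK x * absK y;
  mabsD : forall x y, absK (x + y) <= Num.max (absK x) (absK y);
  mabs_nat : forall n, (0 < n)%N -> absK n%:R = 1;
  mabs_surj : forall s, 0 < s -> exists x, absK x = s;
  mabs_center : forall (p : nat -> K) (r : nat -> R), (forall i, 0 < r i) ->
    (forall i, cball absK (p i.+1) (r i.+1) `<=` cball absK (p i) (r i)) ->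
    exists z, forall i, absK (p i - z) <= r i }.

Section Balls.
Variables (R : realType) (K : closedFieldType) (absK : K -> R).
Hypothesis V : maximal_abs absK.
Implicit Types (x y z a c : K) (g h : {poly K}) (s : R).

Lemma mabs0 : absK 0 = 0. Proof. by apply/eqP; rewrite mabs_eq0. Qed.
Lemma mabs1 : absK 1 = 1. Proof. exact: (mabs_nat V (n := 1)). Qed.

Lemma mabsN x : absK (- x) = absK x.
Proof.
have h : absK (-1) = 1.
  by apply/eqP; rewrite -(@eqrXn2 _ 2) ?(mabs_ge0 V) // expr1n expr2 -(mabsM V) mulrNN mulr1 mabs1.
by rewrite -mulN1r (mabsM V) h mul1r.
Qed.

Lemma mabsB x y : absK (x - y) = absK (y - x).
Proof. by rewrite -mabsN opprB. Qed.

Lemma mabsV x : absK x^-1 = (absK x)^-1.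
Proof.
have [->|x0] := eqVneq x 0; first by rewrite invr0 mabs0 invr0.
have a0 : absK x != 0 by rewrite (mabs_eq0 V).
by apply: (mulfI a0); rewrite -(mabsM V) !divff // mabs1.
Qed.

Lemma mabsD_le x y s : absK x <= s -> absK y <= s -> absK (x + y) <= s.
Proof. by move=> xs ys; apply: (le_trans (mabsD V x y)); rewrite ge_max xs. Qed.

Lemma mabsD_lt x y s : absK x < s -> absK y < s -> absK (x + y) < s.
Proof. by move=> xs ys; apply: (le_lt_trans (mabsD V x y)); rewrite gt_max xs. Qed.

Lemma mabsDl x y : absK y < absK x -> absK (x + y) = absK x.
Proof.
move=> yx; apply/eqP; rewrite eq_le mabsD_le ?(ltW yx) //= leNgt; apply/negP => h.
have := mabsD_lt (x := x + y) (y := - y) h; rewrite mabsN addrK => /(_ yx); by rewrite ltxx.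
Qed.

(* Each a in rs is too close to at most one of the points z + j sigma. *)
Lemma generic_point z c (rs : seq K) : c != 0 -> exists2 j : nat, (j <= size rs)%N &
  forall a, a \in rs -> absK (z + j%:R * c - a) = Num.max (absK c) (absK (z - a)).
Proof.
move=> c0; have sc : 0 < absK c by rewrite lt_neqAle eq_sym (mabs_eq0 V) c0 (mabs_ge0 V).
have cj (j : nat) : absK (j%:R * c) <= absK c.
  by case: j => [|j]; rewrite ?mul0r ?mabs0 ?(mabs_ge0 V) // (mabsM V) (mabs_nat V) ?mul1r.
have all a j : absK (z + j%:R * c - a) < Num.max (absK c) (absK (z - a)) -> absK (z + j%:R * c - a) < absK c.
  have [le|lt] := leP (absK (z - a)) (absK c); first by [].
  have jl : absK (j%:R * c) < absK (z - a) := le_lt_trans (cj j) lt.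
  by rewrite addrAC (mabsDl jl) ltxx.
have two a j k : absK (z + j%:R * c - a) < absK c -> absK (z + k%:R * c - a) < absK c -> j = k.
  wlog jk : j k / (j <= k)%N.
    by move=> h h1 h2; case/orP: (leq_total j k) => jk; [exact: h|apply/esym; exact: h].
  move=> h1 h2; have := mabsD_lt h2 (y := - (z + j%:R * c - a)); rewrite mabsN => /(_ h1).
  have -> : z + k%:R * c - a - (z + j%:R * c - a) = (k - j)%N%:R * c by rewrite natrB //; ring.
  have [e _|ne] := eqVneq j k => //.
  by rewrite (mabsM V) (mabs_nat V) ?mul1r ?ltxx // subn_gt0 ltn_neqAle ne.
apply: contrapT => nj.
have bad (j : 'I_(size rs).+1) : {i : 'I_(size rs) | absK (z + j%:R * c - nth 0 rs i) < absK c}.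
  apply: cid; apply: contrapT => h; apply: nj; exists j; first by rewrite -ltnS.
  move=> a ars; apply/eqP; rewrite eq_le; apply/andP; split.
    rewrite addrAC addrC; apply: (le_trans (mabsD V _ _)); rewrite ge_max le_max cj /= le_max lexx orbT //.
  rewrite leNgt; apply/negP => /all lt; apply: h.
  have ia : (index a rs < size rs)%N by rewrite index_mem.
  by exists (Ordinal ia); rewrite /= nth_index.
have inj : injective (fun j => sval (bad j)).
  move=> j k e; apply: val_inj; have hj := svalP (bad j); have hk := svalP (bad k).
  by apply: (two _ _ _ hj); rewrite [sval (bad j)]e.
by have := leq_card _ inj; rewrite !card_ord ltnn.
Qed.

Definition roots_of g : seq K := sval (closed_field_poly_normal g).

Lemma roots_ofE g : g = lead_coef g *: \prod_(a <- roots_of g) ('X - a%:P).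
Proof. exact: svalP (closed_field_poly_normal g). Qed.

Lemma mabs_prod (rs : seq K) (F : K -> K) : absK (\prod_(a <- rs) F a) = \prod_(a <- rs) absK (F a).
Proof. by elim/big_rec2 : _ => [|i y1 y2 _ <-]; [exact: mabs1|rewrite (mabsM V)]. Qed.

Lemma mabs_horner g y : absK g.[y] = absK (lead_coef g) * \prod_(a <- roots_of g) absK (y - a).
Proof.
rewrite {1}[g]roots_ofE hornerZ (mabsM V) horner_prod mabs_prod; congr (_ * _).
by apply: eq_bigr => a _; rewrite hornerXsubC.
Qed.

(** The Gauss norm of the ball B(z, s), in factored form. *)
Definition gauss z s g : R := absK (lead_coef g) * \prod_(a <- roots_of g) Num.max s (absK (z - a)).

Lemma gauss_ge z s g y : absK (y - z) <= s -> absK g.[y] <= gauss z s g.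
Proof.
move=> ys; rewrite mabs_horner; apply: ler_wpM2l; first exact: mabs_ge0.
apply: ler_prod => a _; rewrite mabs_ge0 //=.
have -> : y - a = (y - z) + (z - a) by rewrite addrA subrK.
by apply: (le_trans (mabsD V _ _)); rewrite ge_max !le_max ys lexx orbT.
Qed.

Lemma gauss_generic z c (gs : seq {poly K}) : c != 0 ->
  exists2 j : nat, (j <= size (flatten [seq roots_of g | g <- gs]))%N &
    forall g, g \in gs -> absK g.[z + j%:R * c] = gauss z (absK c) g.
Proof.
move=> c0; have [j jle hj] := generic_point z (flatten [seq roots_of g | g <- gs]) c0.
exists j => // g gin; rewrite mabs_horner; congr (_ * _); apply: eq_big_seq => a ain; apply: hj.
by apply/flattenP; exists (roots_of g) => //; exact: map_f.
Qed.

Lemma size_roots_of g : g != 0 -> size (roots_of g) = (size g).-1.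
Proof.
move=> g0; have := congr1 (fun p : {poly K} => size p) (roots_ofE g); rewrite /= size_scale ?lead_coef_eq0 //.
by rewrite size_prod_XsubC => ->.
Qed.

Lemma mabs_gt0 c : c != 0 -> 0 < absK c.
Proof. by move=> c0; rewrite lt_neqAle eq_sym (mabs_eq0 V) c0 (mabs_ge0 V). Qed.

Lemma mabs_scale s : 0 < s -> exists2 c, c != 0 & absK c = s.
Proof.
move=> s0; have [c cs] := mabs_surj V s0; exists c => //.
by rewrite -(mabs_eq0 V) cs gt_eqF.
Qed.

Lemma mabs_nat_le (j : nat) : absK j%:R <= 1.
Proof. by case: j => [|j]; rewrite ?mabs0 // (mabs_nat V). Qed.

Lemma shift_in_ball z c (j : nat) : absK (z + j%:R * c - z) <= absK c.
Proof. by rewrite addrAC subrr add0r (mabsM V) ler_piMl ?(mabs_ge0 V) // mabs_nat_le. Qed.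

Lemma ball_normE z s g : 0 < s -> ball_norm absK z s g = gauss z s g.
Proof.
move=> s0; have [c c0 cs] := mabs_scale s0.
have ub : ubound [set absK g.[y] | y in cball absK z s] (gauss z s g).
  by move=> _ [y hy <-]; exact: gauss_ge.
have [j _ hj] := gauss_generic z [:: g] c0.
have at_ : [set absK g.[y] | y in cball absK z s] (gauss z s g).
  exists (z + j%:R * c); first by rewrite /cball /= -cs shift_in_ball.
  by rewrite hj ?mem_seq1 ?eqxx // cs.
apply/eqP; rewrite eq_le; apply/andP; split; first by apply: sup_le_ub => //; exists (gauss z s g).
by apply: ub_le_sup => //; exists (gauss z s g).
Qed.

Lemma ball_norm_ge z s g y : 0 < s -> absK (y - z) <= s -> absK g.[y] <= ball_norm absK z s g.
Proof. by move=> s0 ys; rewrite ball_normE //; exact: gauss_ge. Qed.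

(** A single point of the ball attains the norms of finitely many polynomials at once.
    Multiplicativity and the ultrametric inequality then follow from those of [absK]. *)
Lemma ball_norm_generic z c (gs : seq {poly K}) : c != 0 ->
  exists y, absK (y - z) <= absK c /\ forall g, g \in gs -> absK g.[y] = ball_norm absK z (absK c) g.
Proof.
move=> c0; have [j _ hj] := gauss_generic z gs c0; exists (z + j%:R * c); split; first exact: shift_in_ball.
by move=> g /hj ->; rewrite ball_normE // mabs_gt0.
Qed.

(** At most d roots exclude at most d of the d + 1 points z + j c, so the norm is attained at one of
    them. These are the points used in the Gram matrix. *)
Lemma ball_norm_sample z c g (d : nat) : c != 0 -> (size g <= d.+1)%N ->
  exists2 j : nat, (j <= d)%N & absK g.[z + j%:R * c] = ball_norm absK z (absK c) g.
Proof.
move=> c0 sg; have [->|g0] := eqVneq g 0.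
  by exists 0%N => //; have [y [_ /(_ 0)]] := ball_norm_generic z [:: 0] c0; rewrite mem_seq1 eqxx !horner0; exact.
have [j jle hj] := gauss_generic z [:: g] c0; exists j.
  by move: jle; rewrite /= cats0 size_roots_of // => /leq_trans; apply; rewrite -ltnS prednK // lt0n size_poly_eq0.
by rewrite hj ?mem_seq1 ?eqxx // ball_normE // mabs_gt0.
Qed.

Lemma ball_norm_ge0 z s g : 0 < s -> 0 <= ball_norm absK z s g.
Proof.
move=> s0; have := @ball_norm_ge z s g z s0; rewrite subrr mabs0 => /(_ (ltW s0)).
by apply: le_trans; exact: mabs_ge0.
Qed.

Lemma ball_normC z s c : 0 < s -> ball_norm absK z s c%:P = absK c.
Proof.
move=> s0; have [k k0 <-] := mabs_scale s0.
by have [y [_ <- //]] := ball_norm_generic z [:: c%:P] k0; rewrite ?mem_seq1 // hornerC.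
Qed.

Lemma ball_normM z s g h : 0 < s -> ball_norm absK z s (g * h) = ball_norm absK z s g * ball_norm absK z s h.
Proof.
move=> s0; have [k k0 <-] := mabs_scale s0.
have [y [_ hy]] := ball_norm_generic z [:: g; h; g * h] k0.
by rewrite -!hy ?inE ?eqxx ?orbT // hornerM (mabsM V).
Qed.

Lemma ball_norm_max z s g h : 0 < s ->
  ball_norm absK z s (g + h) <= Num.max (ball_norm absK z s g) (ball_norm absK z s h).
Proof.
move=> s0; have [k k0 <-] := mabs_scale s0.
have [y [_ hy]] := ball_norm_generic z [:: g; h; g + h] k0.
by rewrite -!hy ?inE ?eqxx ?orbT // hornerD (mabsD V).
Qed.

Lemma ball_normD z s g h : 0 < s -> ball_norm absK z s (g + h) <= ball_norm absK z s g + ball_norm absK z s h.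
Proof.
move=> s0; apply: (le_trans (ball_norm_max z g h s0)).
by rewrite ge_max lerDl lerDr !ball_norm_ge0.
Qed.

Lemma ball_normX z s a : 0 < s -> ball_norm absK z s ('X - a%:P) = Num.max s (absK (z - a)).
Proof.
move=> s0; have [k k0 <-] := mabs_scale s0.
have [j _ hj] := generic_point z [:: a] k0.
apply/eqP; rewrite eq_le; apply/andP; split.
  have [y [yz hy]] := ball_norm_generic z [:: 'X - a%:P] k0.
  rewrite -hy ?mem_seq1 // hornerXsubC; have -> : y - a = (y - z) + (z - a) by rewrite addrA subrK.
  by apply: (le_trans (mabsD V _ _)); rewrite ge_max !le_max yz lexx orbT.
rewrite -(hj a) ?mem_seq1 // -hornerXsubC; apply: ball_norm_ge; first exact: mabs_gt0.
exact: shift_in_ball.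
Qed.

Definition ball_snorm z s (s0 : 0 < s) : A1Berk absK :=
  @A1BerkPoint R K absK (ball_norm absK z s) (fun g => ball_norm_ge0 z g s0) (fun c => ball_normC z c s0)
    (fun g h => ball_normM z g h s0) (fun g h => ball_normD z g h s0).

Lemma ball_snorm_type2 z s (s0 : 0 < s) : ~ type1 (ball_snorm z s0).
Proof.
move=> [a /(_ ('X - a%:P))]; rewrite hornerXsubC subrr mabs0 /= ball_normX // => /eqP.
by rewrite gt_eqF // lt_max s0.
Qed.

Definition ball_point z s (s0 : 0 < s) : HBerk absK := exist _ (ball_snorm z s0) (@ball_snorm_type2 z s s0).

Lemma ball_pointP z s (s0 : 0 < s) : is_ball_point (ball_point z s0) z s.
Proof. by []. Qed.

Lemma hberk_ext (x y : HBerk absK) : (forall g, hsnorm x g = hsnorm y g) -> x = y.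
Proof.
case: x => [[n1 a1 b1 c1 d1] t1]; case: y => [[n2 a2 b2 c2 d2] t2] /= h.
have e : n1 = n2 by apply/funext => g; exact: h.
clear h; move: a2 b2 c2 d2 t2; rewrite -e => a2 b2 c2 d2.
rewrite (Prop_irrelevance a2 a1) (Prop_irrelevance b2 b1) (Prop_irrelevance c2 c1) (Prop_irrelevance d2 d1) => t2.
by rewrite (Prop_irrelevance t2 t1).
Qed.

End Balls.

(** The power trick: a linear factor n + 1 is lost against any exponential. It turns the triangle
    inequality of a multiplicative norm into an ultrametric one. *)
Lemma le_of_expn_growth (R : realType) (u M : R) : 0 <= u -> 0 <= M ->
  (forall n, u ^+ n <= n.+1%:R * M ^+ n) -> u <= M.
Proof.
move=> u0 M0 h; rewrite leNgt; apply/negP => Mu.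
have [Me|Mn] := eqVneq M 0.
  by have := h 1%N; rewrite Me !expr1 mulr0 leNgt (le_lt_trans M0 Mu).
have Mp : 0 < M by rewrite lt_neqAle eq_sym Mn.
pose e := u / M - 1; have e0 : 0 < e by rewrite subr_gt0 ltr_pdivlMr // mul1r.
have uE : u = (1 + e) * M by rewrite /e addrC subrK divfK.
have hp n : (1 + e) ^+ n <= n.+1%:R.
  by have := h n; rewrite uE exprMn ler_pM2r // exprn_gt0.
have bern n : 1 + n%:R * e <= (1 + e) ^+ n.
  elim: n => [|n ih]; first by rewrite mul0r addr0 expr0.
  rewrite exprS; apply: (@le_trans _ _ ((1 + e) * (1 + n%:R * e))); last by rewrite ler_pM2l // ltr_wpDl.
  rewrite -(natr1 n); have : 0 <= n%:R * e ^+ 2 by rewrite mulr_ge0 // sqr_ge0.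
  by move: n%:R => m hm; move: hm; rewrite expr2 => hm; lra.
(* Bernoulli's inequality, squared, gives (1 + n e)^2 <= 2 n + 1, which fails once n e^2 > 2. *)
pose n := (Num.trunc (2 / e ^+ 2)).+1.
have hn : 2 < n%:R * e ^+ 2 by rewrite -ltr_pdivrMr ?exprn_gt0 // truncnS_gt.
have n0 : 0 < (n%:R : R) by rewrite ltr0n.
have h1 : (1 + n%:R * e) ^+ 2 <= (2 * n)%N.+1%:R.
  apply: le_trans (hp (2 * n)%N); rewrite mulnC exprM lerXn2r ?nnegrE //.
    by rewrite addr_ge0 // mulr_ge0 // ltW.
  by rewrite exprn_ge0 // addr_ge0 // ltW.
move: h1; rewrite -(natr1 (2 * n)) natrM; have := mulr_gt0 n0 e0.
have : n%:R * 2 < n%:R * (n%:R * e ^+ 2) by rewrite ltr_pM2l.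
by move: (n%:R) => m; rewrite !expr2; nra.
Qed.

Section BerkovichBalls.
Variables (R : realType) (K : closedFieldType) (absK : K -> R).
Hypothesis V : maximal_abs absK.
Implicit Types (z a c : K) (g h : {poly K}) (s : R).

Section Point.
Variable x : HBerk absK.
Local Notation N := (hsnorm x).

Lemma hsnorm_ge0 g : 0 <= N g. Proof. exact: snorm_ge0. Qed.
Lemma hsnormC c : N c%:P = absK c. Proof. exact: snormC. Qed.
Lemma hsnormM g h : N (g * h) = N g * N h. Proof. exact: snormM. Qed.
Lemma hsnormD g h : N (g + h) <= N g + N h. Proof. exact: snormD. Qed.

Lemma hsnormX g n : N (g ^+ n) = N g ^+ n.
Proof.
elim: n => [|n ih]; first by rewrite !expr0 -[1]/(1%:P) hsnormC (mabs1 V).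
by rewrite !exprS hsnormM ih.
Qed.

Lemma hsnorm_sum n (F : 'I_n -> {poly K}) : N (\sum_i F i) <= \sum_i N (F i).
Proof.
elim/big_rec2: _ => [|i y1 y2 _ h]; first by rewrite -[0]/(0%:P) hsnormC (mabs0 V).
by apply: (le_trans (hsnormD _ _)); rewrite lerD2l.
Qed.

(** The definition only gives the triangle inequality. Binomial coefficients have absolute value at
    most 1, so the n-th power of the sum has norm at most (n + 1) times the n-th power of the
    maximum. *)
Lemma hsnorm_max g h : N (g + h) <= Num.max (N g) (N h).
Proof.
apply: le_of_expn_growth; rewrite ?le_max ?hsnorm_ge0 // => n.
rewrite -hsnormX exprDn; apply: (le_trans (hsnorm_sum _)).
have -> : n.+1%:R * Num.max (N g) (N h) ^+ n = \sum_(i < n.+1) Num.max (N g) (N h) ^+ n.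
  by rewrite sumr_const card_ord -[RHS]mulr_natl.
apply: ler_sum => i _.
rewrite -[X in N X]mulr_natl -polyC_natr !hsnormM hsnormC !hsnormX.
have -> : Num.max (N g) (N h) ^+ n = 1 * (Num.max (N g) (N h) ^+ (n - i) * Num.max (N g) (N h) ^+ i).
  by rewrite -exprD subnK ?mul1r // -ltnS.
have m0 : 0 <= Num.max (N g) (N h) by rewrite le_max hsnorm_ge0.
apply: ler_pM; rewrite ?(mabs_ge0 V) ?mulr_ge0 ?exprn_ge0 ?hsnorm_ge0 ?(mabs_nat_le V) //.
by apply: ler_pM; rewrite ?exprn_ge0 ?hsnorm_ge0 // lerXn2r ?nnegrE ?hsnorm_ge0 // le_max lexx ?orbT.
Qed.

Lemma hsnormN g : N (- g) = N g.
Proof. by rewrite -mulN1r -polyCN hsnormM hsnormC (mabsN V) (mabs1 V) mul1r. Qed.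

Local Notation rad a := (N ('X - a%:P)).

Lemma rad_gt0 a : 0 < rad a.
Proof.
rewrite lt_neqAle hsnorm_ge0 andbT eq_sym; apply/eqP => r0; apply: (proj2_sig x); exists a => g.
have /factor_theorem [q qE] : root (g - g.[a]%:P) a by rewrite /root hornerD hornerN hornerC subrr.
have e0 : N (g - g.[a]%:P) = 0 by rewrite qE hsnormM r0 mulr0.
apply/eqP; rewrite eq_le; apply/andP; split.
  rewrite -[g in snorm _ g](subrK g.[a]%:P); apply: (le_trans (hsnormD _ _)).
  by rewrite e0 add0r hsnormC.
rewrite -hsnormC; have -> : g.[a]%:P = - (g - g.[a]%:P) + g by rewrite opprB subrK.
by apply: (le_trans (hsnormD _ _)); rewrite hsnormN e0 add0r.
Qed.

Lemma rad_dist a c : absK (a - c) <= Num.max (rad a) (rad c).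
Proof.
rewrite -hsnormC; have -> : (a - c)%:P = - ('X - a%:P) + ('X - c%:P) :> {poly K}.
  by rewrite polyCB opprB addrA subrK.
by apply: (le_trans (hsnorm_max _ _)); rewrite hsnormN.
Qed.

Lemma rad_shift a c : rad c <= Num.max (rad a) (absK (a - c)).
Proof.
have -> : 'X - c%:P = ('X - a%:P) + (a - c)%:P :> {poly K} by rewrite polyCB addrA subrK.
by apply: (le_trans (hsnorm_max _ _)); rewrite hsnormC.
Qed.

(** The norm of X - a is the radius at which the balls about a begin to lie above x. Balls with
    radii tending to the infimum are nested, and a common centre attains it; this is where type IV
    points are excluded. *)
Lemma rad_min : exists z, forall a, rad z <= rad a.
Proof.
pose S := [set rad a | a in [set: K]]; pose I := inf S.
have hI : has_inf S.
  by split; [exists (rad 0), 0|exists 0 => _ [a _ <-]; exact: hsnorm_ge0].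
have Ile a : I <= rad a by apply: ge_inf; [case: hI|exists a].
have I0 : 0 <= I by apply: lb_le_inf; [case: hI|move=> _ [a _ <-]; exact: hsnorm_ge0].
pose s i : R := I + i.+1%:R^-1.
have s0 i : 0 < s i by rewrite ltr_wpDl // invr_gt0 ltr0n.
have ex i : {a | rad a <= s i}.
  apply: cid; have [|_ [a _ <-] lt] := @inf_adherent _ S i.+1%:R^-1 _ hI; first by rewrite invr_gt0 ltr0n.
  by exists a; exact: ltW.
have sS i : s i.+1 <= s i by rewrite lerD2l lef_pV2 ?posrE ?ltr0n // ler_nat.
have [|z hz] := mabs_center V (p := fun i => sval (ex i)) s0.
  move=> i y; rewrite /cball /= => hy.
  have -> : y - sval (ex i) = (y - sval (ex i.+1)) + (sval (ex i.+1) - sval (ex i)) by rewrite addrA subrK.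
  apply: (mabsD_le V); first exact: le_trans (sS i).
  apply: (le_trans (rad_dist _ _)); rewrite ge_max (le_trans (svalP (ex i.+1)) (sS i)) /=.
  exact: (svalP (ex i)).
exists z => a; apply: le_trans (Ile a); apply/ler_addgt0Pr => e e0.
pose i := Num.trunc e^-1; apply: (@le_trans _ _ (s i)).
  by apply: (le_trans (rad_shift (sval (ex i)) z)); rewrite ge_max (svalP (ex i)) hz.
rewrite lerD2l -[e]invrK lef_pV2 ?posrE ?ltr0n ?invr_gt0 //; apply/ltW; exact: truncnS_gt.
Qed.

(** With z a centre of least radius, the norm of X - c is the maximum of that radius and |z - c|. A
    polynomial splits into linear factors, so x is the Gauss norm of that ball. *)
Lemma hberk_is_ball : exists z s (s0 : 0 < s), x = ball_point V z s0.
Proof.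
have [z hz] := rad_min; exists z, (rad z), (rad_gt0 z).
have radE c : rad c = Num.max (rad z) (absK (z - c)).
  apply/eqP; rewrite eq_le rad_shift ge_max hz /=; apply: (le_trans (rad_dist _ _)).
  by rewrite ge_max hz lexx.
apply: hberk_ext => g; rewrite /hsnorm /= (ball_normE V) ?rad_gt0 // /gauss -/(hsnorm x g).
rewrite {1}[g]roots_ofE -mul_polyC hsnormM hsnormC; congr (_ * _).
elim/big_rec2: _ => [|a y1 y2 _ <-]; first by rewrite -[1]/(1%:P) hsnormC (mabs1 V).
by rewrite hsnormM radE.
Qed.

End Point.

Lemma ball_point_eq z z' s s' (s0 : 0 < s) (s0' : 0 < s') : s = s' -> absK (z - z') <= s ->
  ball_point V z s0 = ball_point V z' s0'.
Proof.
move=> es zz; apply: hberk_ext => g; rewrite /hsnorm /= /ball_norm -es; congr (sup (image _ _)).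
apply/seteqP; split => y; rewrite /cball /= => hy.
  have -> : y - z' = (y - z) + (z - z') by rewrite addrA subrK.
  exact: (mabsD_le V).
have -> : y - z = (y - z') + (z' - z) by rewrite addrA subrK.
by apply: (mabsD_le V) => //; rewrite (mabsB V).
Qed.

Lemma max_dist_eq (a a' b b' : K) s t : absK (a - a') <= s -> absK (b - b') <= t ->
  Num.max (Num.max s t) (absK (a - b)) = Num.max (Num.max s t) (absK (a' - b')).
Proof.
have half (u u' v v' : K) : absK (u - u') <= s -> absK (v - v') <= t ->
    Num.max (Num.max s t) (absK (u - v)) <= Num.max (Num.max s t) (absK (u' - v')).
  move=> hu hv; rewrite ge_max le_max lexx /=.
  have -> : u - v = (u - u') + ((u' - v') + (v' - v)) by ring.
  apply: (mabsD_le V); first by rewrite !le_max hu.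
  apply: (mabsD_le V); first by rewrite !le_max lexx !orbT.
  by rewrite (mabsB V) !le_max hv orbT.
move=> ha hb; apply/eqP; rewrite eq_le half //= half // (mabsB V) //.
Qed.

(** Spherical completeness gives a common centre c, so the norms of X - c along the sequence are
    just the radii; comparing with X - z shows that c lies in the ball of x and that the radii tend
    to s. *)
Lemma nested_limit (x : HBerk absK) (p : nat -> K) (r : nat -> R) z s : is_ball_point x z s -> nested_to x p r ->
  exists c, [/\ forall i, absK (p i - c) <= r i, absK (c - z) <= s & r @ \oo --> s].
Proof.
move=> [s0 xE] [r0 sub lim]; have [c hc] := mabs_center V r0 sub; exists c.
have lc : r @ \oo --> Num.max s (absK (z - c)).
  have := lim ('X - c%:P); rewrite xE (ball_normX V) //.
  have -> // : (fun i => ball_norm absK (p i) (r i) ('X - c%:P)) = r.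
  by apply/funext => i; rewrite (ball_normX V) // max_l.
have ls : (fun i => ball_norm absK (p i) (r i) ('X - z%:P)) @ \oo --> s.
  by have := lim ('X - z%:P); rewrite xE (ball_normX V) // subrr (mabs0 V) max_l // ltW.
have le : Num.max s (absK (z - c)) <= s.
  apply: (ler_cvg_to lc ls); apply: nearW => i; rewrite (ball_normX V) //.
  by rewrite le_max lexx.
split => //; first by move: le; rewrite ge_max (mabsB V) => /andP[].
by rewrite max_l // in lc; move: le; rewrite ge_max => /andP[].
Qed.

(** All admissible nested sequences give the same limit: in terms of common centres, only the radii
    vary, and they converge. *)
Lemma berk_dist_ball (x y : HBerk absK) z s z' s' : is_ball_point x z s -> is_ball_point y z' s' ->
  berk_dist x y = ball_dist absK z s z' s'.
Proof.
move=> hx hy; have [s0 xE] := hx; have [s0' yE] := hy.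
have nest (u : HBerk absK) a t : is_ball_point u a t -> nested_to u (fun=> a) (fun=> t).
  by move=> [t0 uE]; split => // [i|g]; [exact: subset_refl|have -> := uE g; exact: cvg_cst].
pose L := [set l : R | exists p r q t, [/\ nested_to x p r, nested_to y q t &
    (fun i => ball_dist absK (p i) (r i) (q i) (t i)) @ \oo --> l]].
have Lb : L (ball_dist absK z s z' s').
  by exists (fun=> z), (fun=> s), (fun=> z'), (fun=> s'); split; [exact: nest|exact: nest|exact: cvg_cst].
have : L (berk_dist x y) by rewrite /berk_dist; apply: xgetPex; exists (ball_dist absK z s z' s').
move=> [p [r [q [t [nx ny lim]]]]].
have [c [c1 c2 c3]] := nested_limit hx nx; have [c' [c1' c2' c3']] := nested_limit hy ny.
have [r0 _ _] := nx; have [t0 _ _] := ny.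
apply: (cvg_unique _ lim) => //.
have -> : (fun i => ball_dist absK (p i) (r i) (q i) (t i)) =
   fun i => 2 * ln (Num.max (Num.max (r i) (t i)) (absK (c - c'))) - ln (r i) - ln (t i).
  by apply/funext => i; rewrite /ball_dist (max_dist_eq (c1 i) (c1' i)).
rewrite /ball_dist -(max_dist_eq c2 c2').
have lnc (u : nat -> R) (l : R) : 0 < l -> u @ \oo --> l -> (fun i => ln (u i)) @ \oo --> ln l.
  by move=> l0 ul; apply: (cvg_comp _ _ ul); exact: continuous_ln.
apply: cvgB; last exact: lnc.
apply: cvgB; last exact: lnc.
apply: cvgM; first exact: cvg_cst.
apply: lnc; first by rewrite !lt_max s0.
apply: cvg_maxr; [exact: cvg_maxr|exact: cvg_cst].
Qed.

End BerkovichBalls.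

Section AffineBalls.
Variables (R : realType) (K : closedFieldType) (absK : K -> R).
Hypothesis V : maximal_abs absK.
Implicit Types (a b c p : K) (s : R).

Lemma ball_point_center (x : HBerk absK) p s b : is_ball_point x p s -> absK (b - p) <= s -> is_ball_point x b s.
Proof.
move=> [s0 xE] bp; split => // g; rewrite xE; rewrite mabsB // in bp.
exact: (congr1 (fun y => hsnorm y g) (ball_point_eq V s0 s0 erefl bp)).
Qed.

Lemma affine_ball a b p s : 0 < s -> [set a * z + b | z in cball absK 0 1] = cball absK p s ->
  [/\ a != 0, absK a = s & absK (b - p) <= s].
Proof.
move=> s0 e; have [c c0 cs] := mabs_scale V s0.
have inp y : absK (y - p) <= s -> exists2 z, absK z <= 1 & a * z + b = y.
  move=> yp; have : cball absK p s y by [].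
  by rewrite -e => -[z hz <-]; exists z => //; move: hz; rewrite /cball /= subr0.
have out z : absK z <= 1 -> absK (a * z + b - p) <= s.
  move=> z1; have : [set a * z + b | z in cball absK 0 1] (a * z + b) by exists z => //; rewrite /cball /= subr0.
  by rewrite e.
have bp : absK (b - p) <= s by have := out 0; rewrite mulr0 add0r (mabs0 V) => /(_ ler01).
have hp : absK (p - p) <= s by rewrite subrr (mabs0 V) ltW.
have hc : absK (p + c - p) <= s by rewrite addrAC subrr add0r cs.
have [z0 z01 e0] := inp p hp; have [z2 z21 e2] := inp (p + c) hc.
have sa : s <= absK a.
  rewrite -cs; have -> : c = a * (z2 - z0).
    transitivity ((p + c) - p); first by rewrite addrAC subrr add0r.
    by rewrite -e2 -e0; ring.
  rewrite (mabsM V) ler_piMr ?(mabs_ge0 V) //; apply: (mabsD_le V) => //; by rewrite (mabsN V).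
have as_ : absK a <= s.
  have -> : a = (a * 1 + b - p) + (p - b) by ring.
  by apply: (mabsD_le V); [apply: out; rewrite (mabs1 V)|rewrite (mabsB V)].
have ea : absK a = s by apply/eqP; rewrite eq_le as_ sa.
by split => //; rewrite -(mabs_eq0 V) ea gt_eqF.
Qed.

Lemma affine_unit_ball a b : a != 0 -> [set a * z + b | z in cball absK 0 1] = cball absK b (absK a).
Proof.
move=> a0; apply/seteqP; split => [_ [z hz <-]|y].
  by move: hz; rewrite /cball /= subr0 addrK (mabsM V) => hz; rewrite ler_piMr ?(mabs_ge0 V).
rewrite /cball /= => hy; exists ((y - b) / a); last by rewrite mulrC divfK // subrK.
by rewrite /cball /= subr0 (mabsM V) (mabsV V) ler_pdivrMr ?(mabs_gt0 V) // mul1r.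
Qed.

Lemma ball_point_uniq (x : HBerk absK) p s q t : is_ball_point x p s -> is_ball_point x q t -> s = t /\ absK (p - q) <= s.
Proof.
move=> [s0 xE] [t0 xE'].
have N c : Num.max s (absK (p - c)) = Num.max t (absK (q - c)) by rewrite -!(ball_normX V) // -xE xE'.
have h1 := N p; rewrite subrr (mabs0 V) [in LHS]max_l ?(ltW s0) // in h1.
have h2 := N q; rewrite subrr (mabs0 V) [in RHS]max_l ?(ltW t0) // in h2.
have st : s = t.
  by apply/eqP; rewrite eq_le; apply/andP; split; [rewrite -h2|rewrite h1]; rewrite le_max lexx.
by split => //; rewrite h1 (mabsB V) le_max lexx orbT.
Qed.

Lemma ball_dist_same p s q : absK (p - q) <= s -> ball_dist absK p s q s = 0.
Proof. by move=> h; rewrite /ball_dist maxxx max_l // mulr_natl mulr2n addrK subrr. Qed.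

Lemma ball_dist_eq0 p s q t : 0 < s -> 0 < t -> ball_dist absK p s q t = 0 -> s = t /\ absK (p - q) <= s.
Proof.
move=> s0 t0; rewrite /ball_dist; set m := Num.max (Num.max s t) _ => d0.
have m0 : 0 < m by rewrite !lt_max s0.
have l1 : ln s <= ln m by rewrite ler_ln ?posrE // !le_max lexx.
have l2 : ln t <= ln m by rewrite ler_ln ?posrE // !le_max lexx orbT.
have e1 : s = m by apply: (@ln_inj R); rewrite ?posrE //; apply/eqP; rewrite eq_le l1 /=; lra.
have e2 : t = m by apply: (@ln_inj R); rewrite ?posrE //; apply/eqP; rewrite eq_le l2 /=; lra.
by split; [rewrite e1 e2|rewrite e1 !le_max lexx !orbT].
Qed.

End AffineBalls.

(** * Comparison with the asymptotic cone *)

Lemma robinson_maximal (R : realType) (w : free_ultrafilter) (rho : infinitesimal R w) :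
  maximal_abs (@robinson_abs R w rho).
Proof.
split; [exact: abs_ge0|exact: abs_eq0|exact: absM|exact: absD|exact: abs_nat| |exact: spherically_complete].
by move=> s /(abs_surj rho) [x _ <-]; exists x.
Qed.

Section ConePoints.
Variables (R : realType) (w : free_ultrafilter) (r : nat -> R).
Hypothesis hr : r @ \oo --> +oo.
Local Notation C := R[i].
Local Notation rho := (exp_scale w hr).
Local Notation K := (robinson rho).
Local Notation absK := (@robinson_abs R w rho).

Lemma lnrhoE n : - ln (rho n) = r n.
Proof. by rewrite /= expRK opprK. Qed.

Lemma r_large (B : R) : \forall n \near ultraset w, B < r n.
Proof. by apply: filterS (lnrho_large rho B) => n; rewrite lnrhoE. Qed.

Lemma cst_over_r (c : R) : (fun n => c / r n) @ ultraset w --> (0 : R).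
Proof. by have := cst_over_lnrho rho c; under eq_fun do rewrite lnrhoE. Qed.

Lemma affine_pt (a b : C) : a != 0 -> mobH (affine_mx a b) (H3o R) = mkpt b (cabs a).
Proof.
move=> a0; have D : \det (affine_mx a b) != 0 by rewrite det2 !mxE /= mulr1 mulr0 subr0.
have [e1 e2] := mkptE b (cabs_gt0 a0); have [h1 h2] := mobH_val (H3o R) D.
have A10 : affine_mx a b 1 0 = 0 by rewrite mxE.
have A11 : affine_mx a b 1 1 = 1 by rewrite mxE.
have A00 : affine_mx a b 0 0 = a by rewrite mxE.
have A01 : affine_mx a b 0 1 = b by rewrite mxE.
have o1 : hz (H3o R) = 0 by []. have o2 : ht (H3o R) = 1 by [].
have q1 : qden (affine_mx a b) (H3o R) = 1 by rewrite /qden A10 A11 mul0r add0r nsq1 nsq0 mul0r addr0.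
apply: h3_ext; rewrite ?e1 ?e2 ?h1 ?h2 q1 ?det2 A10 A11 A00 A01 ?o1 ?o2.
  by rewrite !mulr0 !add0r conjc0 mulr0 mul0r addr0 conjc1 mulr1 invr1 mulr1.
by rewrite !mulr0 subr0 !mulr1 invr1 mulr1.
Qed.

Lemma arcosh_bounds (c : R) : 1 <= c -> ln c <= arcosh c <= ln 2 + ln c.
Proof.
move=> c1; have c0 : 0 < c := lt_le_trans ltr01 c1.
have s0 : 0 <= Num.sqrt (c ^+ 2 - 1) := sqrtr_ge0 _.
rewrite /arcosh -lnM ?posrE // !ler_ln ?posrE ?mulr_gt0 //; try by rewrite ltr_wpDr.
rewrite lerDl s0 mulr_natl mulr2n lerD2l /=.
rewrite -[X in _ <= X](ger0_norm (ltW c0)) -sqrtr_sqr ler_wsqrtr // lerBlDr lerDl //.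
Qed.

(** Twice t s cosh is a sum of three squares, each at most m^2 and one of them equal to it. So the
    cosh is within a factor 2 of m^2 / (t s), and [arcosh] differs from [ln] by at most ln 2. *)
Lemma hdist_estimate (x y : H3 R) :
  `|hdist x y - (2 * ln (Num.max (Num.max (ht x) (ht y)) (cabs (hz x - hz y))) - ln (ht x) - ln (ht y))| <= ln 4.
Proof.
set m := Num.max (Num.max _ _) _; have t0 := ht_gt0 x; have s0 := ht_gt0 y.
have m0 : 0 < m by rewrite !lt_max t0.
have mt : ht x <= m by rewrite !le_max lexx.
have ms : ht y <= m by rewrite !le_max lexx orbT.
have mz : cabs (hz x - hz y) <= m by rewrite !le_max lexx orbT.
have /andP[h1 h2] := arcosh_bounds (hcosh_ge1 x y).
pose q := m ^+ 2 / (ht x * ht y).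
have q0 : 0 < q by rewrite divr_gt0 ?exprn_gt0 // mulr_gt0.
have qE : ln q = 2 * ln m - ln (ht x) - ln (ht y).
  rewrite /q ln_div ?posrE ?exprn_gt0 ?mulr_gt0 // lnXn // lnM ?posrE // mulr_natl opprD addrA //.
have hE : hcosh x y = (cabs (hz x - hz y) ^+ 2 + ht x ^+ 2 + ht y ^+ 2) / 2 / (ht x * ht y).
  by rewrite hcoshE nsqE; field; rewrite !gt_eqF.
have sq (u : R) : 0 <= u -> u <= m -> u ^+ 2 <= m ^+ 2.
  by move=> u0 um; rewrite lerXn2r ?nnegrE // ltW.
have q1 : hcosh x y <= 2 * q.
  rewrite hE /q mulrA ler_pM2r ?invr_gt0 ?mulr_gt0 //.
  have := sq _ (cabs_ge0 _) mz; have := sq _ (ltW t0) mt; have := sq _ (ltW s0) ms; have := sqr_ge0 m; lra.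
have q2 : q <= 2 * hcosh x y.
  rewrite hE /q mulrA ler_pM2r ?invr_gt0 ?mulr_gt0 // mulrCA divff // mulr1.
  have : m ^+ 2 = ht x ^+ 2 \/ m ^+ 2 = ht y ^+ 2 \/ m ^+ 2 = cabs (hz x - hz y) ^+ 2.
    rewrite /m; case: (leP (Num.max _ _)) => _; [by right; right|].
    by case: (leP (ht x)) => _; [right; left|left].
  have := sqr_ge0 (ht x); have := sqr_ge0 (ht y); have := sqr_ge0 (cabs (hz x - hz y)).
  by move=> ? ? ? [->|[->|->]]; lra.
have hp : 0 < hcosh x y := lt_le_trans ltr01 (hcosh_ge1 x y).
have p2 : 0 < 2 :> R by [].
have l1 : ln (hcosh x y) <= ln 2 + ln q.
  by rewrite -lnM ?posrE // ler_ln ?posrE //; exact: (mulr_gt0 p2 q0).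
have l2 : ln q <= ln 2 + ln (hcosh x y).
  by rewrite -lnM ?posrE // ler_ln ?posrE //; exact: (mulr_gt0 p2 hp).
have l4 : ln 4 = ln 2 + ln 2 :> R by rewrite -lnM ?posrE // -natrM.
have l2p : 0 <= ln 2 :> R by rewrite ln_ge0 // ler1n.
by rewrite -qE ler_norml l4 /hdist; lra.
Qed.

(** The case y = 0 is separate because the logarithms of |u n| then need not converge after
    rescaling; but |u n| falls below every power of rho, hence below m n. *)
Lemma log_max (m : nat -> R) (M : R) (y : K) (u : nat -> C) : (\forall n \near ultraset w, 0 < m n) -> 0 < M ->
  (fun n => ln (m n) / r n) @ ultraset w --> ln M -> represents y u ->
  (fun n => ln (Num.max (m n) (cabs (u n))) / r n) @ ultraset w --> ln (Num.max M (absK y)).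
Proof.
move=> m0 M0 lim hu; have [y0|y0] := eqVneq y 0.
  rewrite y0 abs0 max_l ?(ltW M0) //; apply: (@cvg_trans _ ((fun n => ln (m n) / r n) @ ultraset w)) => //.
  pose N := (Num.trunc `|ln M - 1|).+1.
  have lt : ln M - 1 < ln M by rewrite ltrBlDr ltrDl.
  move/cvgr_gt/(_ _ lt): lim => lim.
  apply: near_eq_cvg; apply: filterS3 (filterI lim (r_large 0)) m0 (iffLR (represents_eq0 hu) y0 N) => n [h1 r0] mn h.
  congr (ln _ / _); rewrite max_l //; apply: (le_trans (ltW h)).
  rewrite expr_rho lnrhoE -[X in _ <= X]lnK ?posrE // ler_expR -mulNr.
  move: h1; rewrite ltr_pdivlMr // => /ltW; apply: le_trans; rewrite ler_pM2r //.
  rewrite lerNl (le_trans (ler_norm _)) // normrN ltW //; exact: truncnS_gt.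
have lnmax (a b : R) : 0 < a -> 0 < b -> ln (Num.max a b) = Num.max (ln a) (ln b).
  move=> a0 b0; have [ab|ab] := leP a b; first by rewrite max_r // ler_ln.
  by rewrite max_l // ler_ln ?posrE // ltW.
rewrite lnmax ?abs_gt0 //.
apply: (@cvg_trans _ ((fun n => Num.max (ln (m n) / r n) (lv rho u n)) @ ultraset w)); last first.
  exact: (cvg_maxr _ lim (abs_cvg hu y0)).
apply: near_eq_cvg.
apply: filterS3 (represents_near_neq0 hu y0) m0 (r_large 0) => n un mn r0.
by rewrite /lv lnrhoE lnmax ?cabs_gt0 // maxr_pMl // invr_ge0 ltW.
Qed.

Lemma log_abs (a : K) (u : nat -> C) : represents a u -> a != 0 ->
  (fun n => ln (cabs (u n)) / r n) @ ultraset w --> ln (absK a).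
Proof. by move=> hu a0; have := abs_cvg hu a0; rewrite /lv; under eq_fun do rewrite lnrhoE. Qed.

Lemma hdist_cvg (a a' b b' : K) (u u' v v' : nat -> C) : represents a u -> represents a' u' ->
  represents b v -> represents b' v' -> a != 0 -> a' != 0 ->
  (fun n => hdist (mkpt (v n) (cabs (u n))) (mkpt (v' n) (cabs (u' n))) / r n) @ ultraset w -->
  ball_dist absK b (absK a) b' (absK a').
Proof.
move=> hu hu' hv hv' a0 a0'; have un := represents_near_neq0 hu a0; have un' := represents_near_neq0 hu' a0'.
have c1 := log_abs hu a0; have c2 := log_abs hu' a0'.
have up : \forall n \near ultraset w, 0 < cabs (u n) by apply: filterS un => n /cabs_gt0.
have c3 := log_max up (abs_gt0 a0) c1 hu'.
have up2 : \forall n \near ultraset w, 0 < Num.max (cabs (u n)) (cabs (u' n)).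
  by apply: filterS up => n h; rewrite lt_max h.
have m0 : 0 < Num.max (absK a) (absK a') by rewrite lt_max abs_gt0.
have c4 := log_max up2 m0 c3 (representsD hv (representsN hv')).
pose L n := 2 * (ln (Num.max (Num.max (cabs (u n)) (cabs (u' n))) (cabs (v n - v' n))) / r n) - ln (cabs (u n)) / r n - ln (cabs (u' n)) / r n.
have cL : L @ ultraset w --> ball_dist absK b (absK a) b' (absK a').
  by rewrite /ball_dist; apply: cvgB c2; apply: cvgB c1; apply: cvgM c4; exact: cvg_cst.
have h1 : (fun n => L n - ln 4 / r n) @ ultraset w --> ball_dist absK b (absK a) b' (absK a').
  by rewrite -[X in _ --> X]subr0; apply: cvgB => //; exact: cst_over_r.
have h2 : (fun n => L n + ln 4 / r n) @ ultraset w --> ball_dist absK b (absK a) b' (absK a').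
  by rewrite -[X in _ --> X]addr0; apply: cvgD => //; exact: cst_over_r.
apply: (squeeze_cvgr _ h1 h2); apply: filterS3 un un' (r_large 0) => n an an' rn.
have [e1 e2] := mkptE (v n) (cabs_gt0 an); have [e3 e4] := mkptE (v' n) (cabs_gt0 an').
have := hdist_estimate (mkpt (v n) (cabs (u n))) (mkpt (v' n) (cabs (u' n))).
rewrite /= e1 e2 e3 e4 ler_norml /L => /andP[h3 h4].
rewrite mulrA -!mulrBl -mulrDl !ler_pM2r ?invr_gt0 //.
by move: h3 h4; move: (hdist _ _) (ln _) (ln _) (ln _) (ln _); clear => A B D E G *; lra.
Qed.

End ConePoints.

Section ConeClasses.
Variables (R : realType) (w : free_ultrafilter) (r : nat -> R).
Implicit Types (y : Defs.bseq r) (p : cone w r).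

Lemma cone_class_eq y y' : (fun n => hdist (y n) (y' n) / r n) @ ultraset w --> (0 : R) ->
  cone_class w y = cone_class w y'.
Proof. by move=> h; apply/eqquotP/asboolP. Qed.

Lemma cone_class_near y y' : (\forall n \near ultraset w, y n = y' n) -> cone_class w y = cone_class w y'.
Proof.
move=> h; apply: cone_class_eq; apply: (@cvg_trans _ ((fun=> 0 : R) @ ultraset w)); last exact: cvg_cst.
by apply: near_eq_cvg; apply: filterS h => n ->; rewrite hdistxx mul0r.
Qed.

Lemma cone_reprK p : cone_class w (repr p) = p.
Proof. exact: reprK. Qed.

Lemma cone_repr_close y : (fun n => hdist (val (repr (cone_class w y)) n) (y n) / r n) @ ultraset w --> (0 : R).
Proof.
have /eqquotP/asboolP : cone_class w (repr (cone_class w y)) = cone_class w y by exact: cone_reprK.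
exact.
Qed.

Lemma cone_dist_class y y' (l : R) : (\forall n \near ultraset w, 0 < r n) ->
  (fun n => hdist (y n) (y' n) / r n) @ ultraset w --> l -> cone_dist (cone_class w y) (cone_class w y') = l.
Proof.
move=> rp hl; rewrite /cone_dist; apply: cvg_lim => //.
have c1 := cone_repr_close y; have c2 := cone_repr_close y'.
set Y := val (repr (cone_class w y)) in c1 *; set Y' := val (repr (cone_class w y')) in c2 *.
have h1 : (fun n => hdist (y n) (y' n) / r n - (hdist (Y n) (y n) / r n + hdist (Y' n) (y' n) / r n)) @ ultraset w --> l.
  by rewrite -[X in _ --> X]subr0 -[X in _ - X]addr0; apply: cvgB => //; exact: cvgD.
have h2 : (fun n => hdist (y n) (y' n) / r n + (hdist (Y n) (y n) / r n + hdist (Y' n) (y' n) / r n)) @ ultraset w --> l.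
  by rewrite -[X in _ --> X]addr0 -[X in _ + X]addr0; apply: cvgD => //; exact: cvgD.
apply: (squeeze_cvgr _ h1 h2); apply: filterS rp => n rn.
rewrite -!mulrDl -mulrBl !ler_pM2r ?invr_gt0 //.
have t1 := hdist_triangle (y n) (Y n) (y' n); have t2 := hdist_triangle (Y n) (Y' n) (y' n).
have t3 := hdist_triangle (Y n) (y n) (Y' n); have t4 := hdist_triangle (y n) (y' n) (Y' n).
rewrite (hdistC (y n) (Y n)) in t1; rewrite (hdistC (y' n) (Y' n)) in t4.
by apply/andP; split; lra.
Qed.

Lemma bseq_of_near (u : nat -> H3 R) (c : R) : (\forall n \near ultraset w, hdist (H3o R) (u n) / r n <= c) ->
  exists y : Defs.bseq r, \forall n \near ultraset w, y n = u n.
Proof.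
move=> h; pose v n := if hdist (H3o R) (u n) / r n <= c then u n else H3o R.
have bv : `[< exists c : R, forall n, hdist (H3o R) (v n) / r n <= c >].
  apply/asboolP; exists (Num.max c 0) => n; rewrite /v; case: ifP => hc; rewrite le_max ?hc //.
  by rewrite hdistxx mul0r lexx orbT.
by exists (BSeq bv); apply: filterS h => n /= hn; rewrite /v hn.
Qed.

End ConeClasses.

Section PhiMap.
Variables (R : realType) (w : free_ultrafilter) (r : nat -> R).
Hypothesis hr : r @ \oo --> +oo.
Local Notation C := R[i].
Local Notation rho := (exp_scale w hr).
Local Notation K := (robinson rho).
Local Notation absK := (@robinson_abs R w rho).
Local Notation V := (robinson_maximal rho).

Lemma r_pos : \forall n \near ultraset w, 0 < r n.
Proof. exact: (r_large w hr 0). Qed.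

Lemma abs_pos (a : K) : a != 0 -> 0 < absK a. Proof. exact: abs_gt0. Qed.

Lemma chart_ball_point (x : HBerk absK) a b : is_chart x a b -> a != 0 /\ is_ball_point x b (absK a).
Proof.
move=> [p [s [hx e]]]; have [s0 _] := hx; have [a0 as_ bp] := affine_ball V s0 e.
by split => //; rewrite as_; exact: (ball_point_center V hx bp).
Qed.

Lemma chart_exists (x : HBerk absK) a b : a != 0 -> is_ball_point x b (absK a) -> is_chart x a b.
Proof. by move=> a0 hx; exists b, (absK a); split => //; exact: (affine_unit_ball V). Qed.

Lemma scaled_ball_point (x : HBerk absK) : exists a b, a != 0 /\ is_ball_point x b (absK a).
Proof.
have [z [s [s0 ->]]] := hberk_is_ball V x; have [a a0 as_] := mabs_scale V s0.
by exists a, z; split => //; rewrite as_; exact: ball_pointP.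
Qed.

Lemma mkpt01 : mkpt 0 1 = H3o R.
Proof. by have [e1 e2] := mkptE (0 : C) (@ltr01 R); apply: h3_ext; rewrite ?e1 ?e2. Qed.

Lemma chart_bseq (a b : K) (u v : nat -> C) : represents a u -> represents b v -> a != 0 ->
  exists y : Defs.bseq r, \forall n \near ultraset w, y n = mkpt (v n) (cabs (u n)).
Proof.
move=> hu hv a0; have o0 : (1 : K) != 0 by rewrite oner_neq0.
have lim := hdist_cvg (represents1 rho) hu (represents0 rho) hv o0 a0.
apply: (@bseq_of_near _ _ _ _ (ball_dist absK 0 (absK 1) b (absK a) + 1)).
have lt : ball_dist absK 0 (absK 1) b (absK a) < ball_dist absK 0 (absK 1) b (absK a) + 1 by rewrite ltrDl.
move/cvgr_le/(_ _ lt): lim; apply: filterS => n.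
by rewrite -[(0 : nat -> C) n]/(0 : C) -[(1 : nat -> C) n]/(1 : C) Normc.normc1 mkpt01.
Qed.

(** Two choices of centre, scale and representatives for the same ball are at [ball_dist] 0, so by
    [hdist_cvg] they give the same class. *)
Lemma phi_value (x : HBerk absK) : exists p : cone w r, forall a b (u v : nat -> C), a != 0 ->
  is_ball_point x b (absK a) -> represents a u -> represents b v ->
  exists2 y : Defs.bseq r, \forall n \near ultraset w, y n = mkpt (v n) (cabs (u n)) & p = cone_class w y.
Proof.
have [a0 [b0 [na0 hx0]]] := scaled_ball_point x.
have [y0 hy0] := chart_bseq (represents_rep a0) (represents_rep b0) na0.
exists (cone_class w y0) => a b u v na hx hu hv; have [y hy] := chart_bseq hu hv na; exists y => //.
have lim := hdist_cvg (represents_rep a0) hu (represents_rep b0) hv na0 na.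
apply: cone_class_eq.
have d0 : ball_dist absK b0 (absK a0) b (absK a) = 0.
  by have [e db] := ball_point_uniq V hx0 hx; rewrite -e; exact: ball_dist_same.
rewrite d0 in lim; apply: cvg_trans lim; apply: near_eq_cvg.
by apply: filterS2 hy hy0 => n -> ->.
Qed.

Definition phi (x : HBerk absK) : cone w r := sval (cid (phi_value x)).

Lemma phiP x a b (u v : nat -> C) : a != 0 -> is_ball_point x b (absK a) -> represents a u -> represents b v ->
  exists2 y : Defs.bseq r, \forall n \near ultraset w, y n = mkpt (v n) (cabs (u n)) & phi x = cone_class w y.
Proof. exact: (svalP (cid (phi_value x))). Qed.

Lemma phi_is_Phi : is_Phi phi.
Proof.
move=> x; split.
  by have [a [b [a0 hx]]] := scaled_ball_point x; exists a, b; exact: chart_exists.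
move=> a b u v /chart_ball_point [a0 hx] hu hv; have [y hy e] := phiP a0 hx hu hv.
exists y => //; apply: filterS2 hy (represents_near_neq0 hu a0) => n -> un; split => //.
by rewrite affine_pt.
Qed.

Lemma phi_isometry x x' : cone_dist (phi x) (phi x') = berk_dist x x'.
Proof.
have [a [b [a0 hx]]] := scaled_ball_point x; have [a' [b' [a0' hx']]] := scaled_ball_point x'.
have [y hy ->] := phiP a0 hx (represents_rep a) (represents_rep b).
have [y' hy' ->] := phiP a0' hx' (represents_rep a') (represents_rep b').
rewrite (berk_dist_ball V hx hx'); apply: cone_dist_class; first exact: r_pos.
have := hdist_cvg (represents_rep a) (represents_rep a') (represents_rep b) (represents_rep b') a0 a0'.
by apply: cvg_trans; apply: near_eq_cvg; apply: filterS2 hy hy' => n -> ->.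
Qed.

Lemma phi_inj : injective phi.
Proof.
move=> x x' e; have : berk_dist x x' = 0.
  rewrite -phi_isometry e -[phi x']cone_reprK; apply: cone_dist_class; first exact: r_pos.
  by under eq_fun do rewrite hdistxx mul0r; exact: cvg_cst.
have [z [s [s0 xE]]] := hberk_is_ball V x; have [z' [s' [s0' xE']]] := hberk_is_ball V x'.
rewrite xE xE' (berk_dist_ball V (ball_pointP V z s0) (ball_pointP V z' s0')) => d0.
by have [e1 e2] := ball_dist_eq0 s0 s0' d0; exact: ball_point_eq.
Qed.

(** The coordinates of a bounded sequence are moderate and its heights are not negligible, so they
    define a ball over the Robinson field. The exponent c + 1 instead of c absorbs the factor 2
    between the cosh and the coordinates. *)
Lemma bseq_coords (u : Defs.bseq r) : exists a b : K, [/\ a != 0, represents a (fun n => (ht (u n))%:C%C),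
  represents b (fun n => hz (u n)) & forall x, is_ball_point x b (absK a) -> phi x = cone_class w u].
Proof.
have [c hc] : exists c : R, forall n, hdist (H3o R) (u n) / r n <= c by case: (u) => v hv; exact: (asboolW hv).
have bound : \forall n \near ultraset w, [/\ cabs (hz (u n)) <= expR ((c + 1) * r n),
    ht (u n) <= expR ((c + 1) * r n) & expR (- ((c + 1) * r n)) <= ht (u n)].
  apply: filterS2 r_pos (r_large w hr (ln 2)) => n r0 r2.
  have t0 := ht_gt0 (u n); have := hc n; rewrite ler_pdivrMr // => hd.
  have [h1 _] := andP (arcosh_bounds (hcosh_ge1 (H3o R) (u n))).
  have hE : hcosh (H3o R) (u n) <= expR (c * r n).
    by rewrite -ler_ln ?posrE ?expR_gt0 ?(lt_le_trans ltr01 (hcosh_ge1 _ _)) // expRK (le_trans h1).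
  have E0 := expR_gt0 (c * r n).
  have e2 : 2 <= expR (r n) by rewrite -[X in X <= _]lnK ?posrE // ler_expR ltW.
  have EE : 2 * expR (c * r n) <= expR ((c + 1) * r n).
    have -> : (c + 1) * r n = c * r n + r n by ring.
    by rewrite expRD mulrC ler_pM2l.
  have o1 : hz (H3o R) = 0 by []. have o2 : ht (H3o R) = 1 by [].
  move: hE; rewrite hcoshE o1 o2 sub0r nsqN expr1n mulr1 ler_pdivrMr ?mulr_gt0 // => hE.
  have n0 := nsq_ge0 (hz (u n)).
  move: n0 hE; rewrite nsqE; move: (cabs_ge0 (hz (u n))); set Z := cabs _; set t := ht _ in t0 *.
  set E := expR (c * r n) in E0 EE * => Z0 n0 hE.
  have tE : t <= 2 * E by have := sqr_ge0 Z; nra.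
  have Et : 1 <= 2 * E * t by have := sqr_ge0 Z; have := sqr_ge0 t; nra.
  split; [|exact: le_trans EE|].
    by apply: (le_trans _ EE); nra.
  rewrite expRN -[X in _ <= X]invrK lef_pV2 ?posrE ?invr_gt0 ?expR_gt0 //; apply: (le_trans _ EE).
  by rewrite -[X in X <= _]mul1r ler_pdivrMr.
pose A n : C := (ht (u n))%:C%C.
have hA : represents (of_seq rho A) A.
  apply: (@represents_of_bound _ _ _ _ (c + 1)); apply: filterS bound => n [_ h _].
  by rewrite lnrhoE cabs_real gtr0_norm ?ht_gt0.
have hB : represents (of_seq rho (fun n => hz (u n))) (fun n => hz (u n)).
  by apply: (@represents_of_bound _ _ _ _ (c + 1)); apply: filterS bound => n [h _ _]; rewrite lnrhoE.
set a := of_seq rho A in hA; set b := of_seq rho _ in hB.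
have a0 : a != 0.
  apply/eqP => /(represents_eq0 hA) h; pose N := (Num.trunc `|c + 1|).+1.
  have /filter_ex [] // : \forall n \near ultraset w, False.
  apply: filterS3 (h N) bound r_pos => n; rewrite expr_rho lnrhoE cabs_real gtr0_norm ?ht_gt0 // => h1 [_ _ h2] r0.
  have := le_lt_trans h2 h1; rewrite ltr_expR ltrN2 ltr_pM2r // ltNge (le_trans (ler_norm _)) // ltW //.
  exact: truncnS_gt.
exists a, b; split => // x hx; have [y hy ->] := phiP a0 hx hA hB.
apply: cone_class_near; apply: filterS hy => n ->.
have [e1 e2] := mkptE (hz (u n)) (ht_gt0 (u n)).
by rewrite /A cabs_real gtr0_norm ?ht_gt0 //; apply: h3_ext; rewrite ?e1 ?e2.
Qed.

Lemma phi_surj p : exists x, phi x = p.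
Proof.
have [a [b [a0 _ _ h]]] := bseq_coords (repr p).
by exists (ball_point V b (abs_pos a0)); rewrite h ?cone_reprK //; exact: ball_pointP.
Qed.

Lemma phi_bij : bijective phi.
Proof.
exists (fun p => sval (cid (phi_surj p))) => [x|p]; last exact: (svalP (cid (phi_surj p))).
by apply: phi_inj; exact: (svalP (cid (phi_surj (phi x)))).
Qed.

End PhiMap.

(** * The Berkovich action of a rational map *)

Lemma pi_fracE (D : idomainType) (y : {ratio D}) :
  (\pi_({fraction D}) y)%qT * FracField.tofrac (val y).2 = FracField.tofrac (val y).1.
Proof.
unlock FracField.tofrac; rewrite -[LHS]FracField.pi_mul; apply/eqmodP.
rewrite /= FracField.equivfE /FracField.mulf /= !numden_Ratio ?mulf_neq0 ?oner_eq0 ?denom_ratioP //.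
by rewrite !mulr1 mulrC.
Qed.

Section FracNorm.
Variables (R : realType) (K : closedFieldType) (absK : K -> R).
Hypothesis V : maximal_abs absK.
Local Notation tofrac := (@FracField.tofrac {poly K}).
Implicit Types (phi psi : {fraction {poly K}}) (p q g : {poly K}).

Lemma frac_reprE phi : (val (repr phi)).2 != 0 /\
  phi = tofrac (val (repr phi)).1 / tofrac (val (repr phi)).2.
Proof.
have d0 : (val (repr phi)).2 != 0 := denom_ratioP (repr phi); split => //.
have t0 : tofrac (val (repr phi)).2 != 0 by rewrite tofrac_eq0.
by apply: (mulIf t0); rewrite divfK // -pi_fracE reprK.
Qed.

Section Point.
Variable x : HBerk absK.
Local Notation N := (hsnorm x).

Lemma hsnorm_gt0 g : g != 0 -> 0 < N g.
Proof.
move=> g0; rewrite [g]roots_ofE -mul_polyC hsnormM hsnormC mulr_gt0 //.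
  by apply: (mabs_gt0 V); rewrite lead_coef_eq0.
elim/big_rec: _ => [|a y _ h]; first by rewrite -[1]/(1%:P) hsnormC (mabs1 V).
by rewrite hsnormM mulr_gt0 // (rad_gt0 V).
Qed.

Lemma frac_normE p q : q != 0 -> frac_norm x (tofrac p / tofrac q) = N p / N q.
Proof.
move=> q0; rewrite /frac_norm; set phi := tofrac p / tofrac q.
have [d0 e] := frac_reprE phi; set n := (val _).1 in e *; set m := (val _).2 in d0 e *.
have tq : tofrac q != 0 by rewrite tofrac_eq0.
have tm : tofrac m != 0 by rewrite tofrac_eq0.
have E : p * m = n * q.
  move/eqP: e; rewrite /phi (eqr_div _ _ tq tm) -!tofracM tofrac_eq; exact: eqP.
have := congr1 N E; rewrite !hsnormM => h.
have nq : N q != 0 by rewrite gt_eqF // hsnorm_gt0.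
have nm : N m != 0 by rewrite gt_eqF // hsnorm_gt0.
by apply/eqP; rewrite eqr_div // h.
Qed.

Lemma frac_normM phi psi : frac_norm x (phi * psi) = frac_norm x phi * frac_norm x psi.
Proof.
have [d0 e] := frac_reprE phi; have [d0' e'] := frac_reprE psi.
rewrite e e' mulf_div -!tofracM !frac_normE ?mulf_neq0 //.
by rewrite !hsnormM mulf_div.
Qed.

Lemma frac_norm_poly p : frac_norm x (tofrac p) = N p.
Proof.
have -> : tofrac p = tofrac p / tofrac 1 by rewrite tofrac1 divr1.
by rewrite frac_normE ?oner_neq0 // -[1]/(1%:P) hsnormC (mabs1 V) divr1.
Qed.

Lemma comp_fracE g phi : comp_frac g phi =
  tofrac (lead_coef g)%:P * \prod_(a <- roots_of g) (phi - tofrac a%:P).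
Proof.
rewrite {1}[g]roots_ofE /comp_frac.
rewrite map_polyZ rmorph_prod hornerZ horner_prod; congr (_ * _); apply: eq_bigr => a _.
by rewrite /= map_polyXsubC hornerXsubC.
Qed.

(* Two multiplicative functions on rational functions that agree on constants agree as
   soon as they agree on the differences phi - c. *)
Lemma berk_image_ball p q z s (s0 : 0 < s) : q != 0 ->
  (forall c, N (p - c *: q) = N q * Num.max s (absK (z - c))) ->
  forall g, hsnorm (ball_point V z s0) g = frac_norm x (comp_frac g (tofrac p / tofrac q)).
Proof.
move=> q0 h g; rewrite comp_fracE frac_normM frac_norm_poly hsnormC /hsnorm /= (ball_normE V) // /gauss.
congr (_ * _); have tq : tofrac q != 0 by rewrite tofrac_eq0.
elim/big_rec2: _ => [|a y1 y2 _ ->].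
  by have := hsnormC x 1; rewrite (mabs1 V) polyC1 -frac_norm_poly tofrac1.
rewrite frac_normM; congr (_ * _).
have -> : tofrac p / tofrac q - tofrac a%:P = tofrac (p - a *: q) / tofrac q.
  by rewrite -mul_polyC tofracB tofracM mulrBl mulfK.
by rewrite frac_normE // h mulrC mulKf // gt_eqF // hsnorm_gt0.
Qed.

End Point.
End FracNorm.

Section Representatives.
Variables (R : realType) (w : free_ultrafilter) (rho : infinitesimal R w).
Local Notation C := R[i].
Local Notation K := (robinson rho).
Local Notation absK := (@robinson_abs R w rho).

Lemma represents_sum (m : nat) (x : 'I_m -> K) (u : 'I_m -> nat -> C) : (forall i, represents (x i) (u i)) ->
  represents (\sum_i x i) (fun n => \sum_i u i n).
Proof.
move=> h; have -> : (fun n => \sum_i u i n) = \sum_i u i by apply/funext => n; rewrite fct_sumE.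
elim/big_rec2: _ => [|i y1 y2 _ hy]; first exact: represents0.
exact: representsD.
Qed.

Lemma represents_exp (x : K) (u : nat -> C) k : represents x u -> represents (x ^+ k) (fun n => u n ^+ k).
Proof.
move=> hu; elim: k => [|k ih]; first exact: represents1.
by rewrite exprS; have := representsM hu ih; congr represents; apply/funext => n; rewrite exprS.
Qed.

Lemma represents_nat k : represents (k%:R : K) (fun=> k%:R).
Proof.
elim: k => [|k ih]; first exact: represents0.
have := representsD ih (represents1 rho); rewrite -(natr1 k); congr represents.
by apply/funext => n; rewrite -(natr1 k).
Qed.

Lemma represents_bounded (u : nat -> C) : (forall n, cabs (u n) <= 1) -> represents (of_seq rho u) u.
Proof.
move=> h; apply: (@represents_of_bound _ _ _ _ 0); apply: nearW => n; by rewrite mul0r expR0.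
Qed.

Lemma represents_horner d (p : nat -> 'rV[C]_d.+1) (z : K) (zs : nat -> C) :
  (forall n i, cabs (p n 0 i) <= 1) -> represents z zs ->
  represents (\poly_(i < d.+1) of_seq rho (fun n => p n 0 (inord i))).[z] (fun n => (poly_of (p n)).[zs n]).
Proof.
move=> hp hz; rewrite horner_poly.
have -> : (fun n => (poly_of (p n)).[zs n]) = fun n => \sum_(i < d.+1) p n 0 (inord i) * zs n ^+ i.
  by apply/funext => n; rewrite horner_poly.
apply: represents_sum => i; apply: (representsM _ (represents_exp i hz)).
by apply: represents_bounded => n.
Qed.

(** An estimate for sequences with a constant factor B0 becomes an estimate of absolute values
    without it. *)
Lemma abs_dominated (I : finType) (x : K) (u : nat -> C) (y : I -> K) (v : I -> nat -> C) (s B0 : R) :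
  represents x u -> (forall i, represents (y i) (v i)) -> 0 <= s -> (forall i, absK (y i) <= s) ->
  (forall n B, 0 <= B -> (forall i, cabs (v i n) <= B) -> nsq (u n) <= B0 * B ^+ 2) -> absK x <= s.
Proof.
move=> hu hv s0 ys h; apply/ler_addgt0Pr => e' e'0; have s'0 : 0 < s + e' by rewrite ltr_wpDl.
apply: (abs_le_of_near hu s'0) => e e0; have e2 : 0 < e / 2 by rewrite divr_gt0.
have FF := ultra_proper_filter w.
have hB : \forall n \near ultraset w, forall i, cabs (v i n) <= expR ((ln (s + e') + e / 2) * - ln (rho n)).
  apply: filter_forall => i; apply: (abs_le_near (hv i) s'0 _ e2).
  by apply: (le_trans (ys i)); rewrite lerDl ltW.
(* For such n one has B0 <= exp (L e). Half of the loss e is used for the v i, the other half, after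
   squaring, pays for B0. *)
apply: filterS2 hB (lnrho_large rho (ln (Num.max 1 B0) / e)) => n hn; rewrite ltr_pdivrMr // => lr.
set L := - ln (rho n) in hn lr *.
have := h n _ (expR_ge0 _) hn; rewrite nsqE => h1.
rewrite -ler_sqr ?nnegrE ?cabs_ge0 ?expR_ge0 //; apply: (le_trans h1).
have m0 : 0 < Num.max 1 B0 by rewrite lt_max ltr01.
have hM : B0 <= expR (L * e).
  apply: (@le_trans _ _ (Num.max 1 B0)); first by rewrite le_max lexx orbT.
  by rewrite -[X in X <= _]lnK ?posrE // ler_expR ltW.
rewrite -!expRM_natl; apply: (@le_trans _ _ (expR (L * e) * expR (2 * ((ln (s + e') + e / 2) * L)))).
  by rewrite ler_wpM2r // expR_ge0.
rewrite -expRD ler_expR le_eqVlt; apply/orP; left; apply/eqP.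
by field.
Qed.

End Representatives.

Section GramEvaluation.
Variables (R : realType) (d : nat).
Local Notation C := R[i].

(** This is [gram_form] at the vector (g, 1), divided by the norm of Q. The factor k allows for
    normalized coefficients. *)
Lemma gram_eval (hd : (1 <= d)%N) (c : coefs R d) (x : H3 R) (k g : C) : deg_coefs c ->
  (nsq (g - hz (gram c x)) + ht (gram c x) ^+ 2) *
    \sum_(j < d.+1) nsq (poly_of (k *: c).2).[hz x + (ht x)%:C%C * j%:R] =
  \sum_(j < d.+1) nsq (poly_of (k *: c).1 - g *: poly_of (k *: c).2).[hz x + (ht x)%:C%C * j%:R].
Proof.
move=> hc; have h := gram_form hd x hc (g, 1); have [e1 e2] := gram_val hd x hc.
have t0 := galpha_gt0 hd x hc.
have L : \sum_(j < d.+1) nsq (poly_of (k *: c).2).[hz x + (ht x)%:C%C * j%:R] = nsq k * @ev2 R d (gB c x).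
  by rewrite /ev2 mulr_sumr; apply: eq_bigr => j _; rewrite poly_ofZ hornerZ nsqM horner_shp.
have Rr : \sum_(j < d.+1) nsq (poly_of (k *: c).1 - g *: poly_of (k *: c).2).[hz x + (ht x)%:C%C * j%:R] =
    nsq k * @ev2 R d (shp x (1 *: poly_of c.1 - g *: poly_of c.2)).
  rewrite /ev2 mulr_sumr; apply: eq_bigr => j _; rewrite horner_shp !poly_ofZ -nsqM; congr nsq.
  rewrite !hornerD !hornerN !hornerZ; move: (_.[_]) (_.[_]) => ? ?; ring.
rewrite L Rr -h /form /= e1 e2 mulr1 nsq1 mulr1.
by field; rewrite gt_eqF.
Qed.

End GramEvaluation.

(** * The conjugacy *)

Section Displacement.
Variables (R : realType) (d : nat).
Hypothesis hd : (1 <= d)%N.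

Lemma ln_hcosh_le (x y : H3 R) : ln (hcosh x y) <= hdist x y.
Proof. by have /andP[] := arcosh_bounds (hcosh_ge1 x y). Qed.

Lemma hdist_le_of (x y : H3 R) (B : R) : hcosh x y <= expR B -> hdist x y <= ln 2 + B.
Proof.
move=> h; have /andP[_ h2] := arcosh_bounds (hcosh_ge1 x y); apply: (le_trans h2); rewrite lerD2l.
by rewrite -[B]expRK ler_ln ?posrE ?expR_gt0 // (lt_le_trans ltr01 (hcosh_ge1 x y)).
Qed.

Lemma bary_gram_close : exists L : R, forall (f : RatMap R d) x,
  hdist (gram (rat_coefs f) x) (bary_ext (rat_fun f) x) <= L.
Proof.
have [K K0 hK] := bary_near_gram R hd; exists (ln 2 + ln (K + 1)) => f x.
apply: hdist_le_of; rewrite lnK ?posrE ?ltr_wpDl //; have [_ h] := hK f x.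
by apply: (le_trans h); rewrite lerDl.
Qed.

Lemma gram_lipschitz : exists2 L : R, 0 <= L & forall c x, @deg_coefs R d c ->
  hdist (gram c x) (gram c (H3o R)) <= L * (1 + hdist (H3o R) x).
Proof.
have [K K0 hK] := gram_growth R hd; pose k := ln (K + 1); pose D : R := (2 * d.+1)%:R.
have k0 : 0 <= k by rewrite ln_ge0 // lerDr.
have D0 : 0 <= D by rewrite ler0n.
have l20 : 0 <= ln 2 :> R by rewrite ln_ge0 // ler1n.
exists (ln 2 + k + D) => [|c x hc]; first by rewrite !addr_ge0.
have h0 := hdist_ge0 (H3o R) x; set t := hdist (H3o R) x in h0 *.
have hp : 0 < hcosh (gram c x) (gram c (H3o R)) := lt_le_trans ltr01 (hcosh_ge1 _ _).
have hq : 0 < hcosh (H3o R) x := lt_le_trans ltr01 (hcosh_ge1 _ _).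
have h1 : hcosh (gram c x) (gram c (H3o R)) <= expR (k + D * t).
  apply: (@le_trans _ _ (hcosh (gram c x) (gram c (H3o R)) ^+ 2)).
    by rewrite expr2 ler_peMr ?hcosh_ge1 // ltW.
  apply: (le_trans (hK c x hc)); rewrite expRD lnK ?posrE ?ltr_wpDl //.
  apply: ler_pM; rewrite ?exprn_ge0 ?(ltW hq) ?lerDl //.
  rewrite /D expRM_natl.
  by rewrite lerXn2r ?nnegrE ?(ltW hq) ?expR_ge0 // -[X in X <= _]lnK ?posrE // ler_expR ln_hcosh_le.
apply: (le_trans (hdist_le_of h1)); nra.
Qed.

(** There is a point y at distance [bary_radius f] from the centre with image the centre. The Gram
    points of y, of the centre and of x are compared in turn, and each Gram point is near its
    barycentric image. *)
Lemma bary_displacement : exists2 L : R, 0 <= L & forall (f : RatMap R d) x,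
  hdist (H3o R) (bary_ext (rat_fun f) x) <= L * (1 + bary_radius f + hdist (H3o R) x).
Proof.
have arith (e1 e2 e3 e4 e5 e6 e7 l n B1 B2 : R) : e1 <= l -> e2 <= l -> e3 <= B1 -> e4 <= B2 ->
    e5 <= e2 + e6 -> e6 <= e7 + e1 -> e7 <= e4 + e3 -> l <= n -> e5 <= 2 * n + B1 + B2 by lra.
have [L1 hL1] := bary_gram_close; have [L2 L20 hL2] := gram_lipschitz.
exists (2 * `|L1| + 2 * L2) => [|f x]; first by rewrite addr_ge0 // mulr_ge0.
have [[y ey ry] _] := bary_radiusP hd f; have hc := rat_coefs_deg f.
have a1 := hL1 f x; have a2 := hL1 f y; have b1 := hL2 _ x hc; have b2 := hL2 _ y hc.
rewrite ey ry in a2 b2 *.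
set g := gram _ in a1 a2 b1 b2; set E := bary_ext _ x in a1 *.
have t1 := hdist_triangle (H3o R) (g y) E; have t2 := hdist_triangle (g y) (g x) E.
have t3 := hdist_triangle (g y) (g (H3o R)) (g x).
have {}a2 : hdist (H3o R) (g y) <= L1 by rewrite hdistC.
have {}b1 : hdist (g (H3o R)) (g x) <= L2 * (1 + hdist (H3o R) x) by rewrite hdistC.
have h0 := hdist_ge0 (H3o R) x; have r0 : 0 <= bary_radius f by rewrite -ry hdist_ge0.
have n1 := ler_norm L1; have n0 := normr_ge0 L1.
apply: (@le_trans _ _ (2 * `|L1| + L2 * (1 + hdist (H3o R) x) + L2 * (1 + bary_radius f))).
  exact: (arith _ _ _ _ _ _ _ _ _ _ _ a1 a2 b1 b2 t1 t2 t3 n1).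
move: h0 r0 n0 L20; clear; move: (hdist _ _) (bary_radius f) (`|L1|) => t r l t0 r0 l0 L20.
rewrite -subr_ge0; have -> : (2 * l + 2 * L2) * (1 + r + t) - (2 * l + L2 * (1 + t) + L2 * (1 + r)) =
  2 * (l * (r + t)) + L2 * (r + t) by ring.
by rewrite addr_ge0 // !mulr_ge0 // addr_ge0.
Qed.

End Displacement.

Section ImageBall.
Variables (R : realType) (w : free_ultrafilter) (rho : infinitesimal R w) (d : nat).
Hypothesis hd : (1 <= d)%N.
Variable f : nat -> RatMap R d.
Local Notation C := R[i].
Local Notation K := (robinson rho).
Local Notation absK := (@robinson_abs R w rho).
Local Notation V := (robinson_maximal rho).
Local Notation c := (fun n => normalized (f n)).

Definition lim_num : {poly K} := \poly_(i < d.+1) of_seq rho (fun n => (normalized (f n)).1 0 (inord i)).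
Definition lim_den : {poly K} := \poly_(i < d.+1) of_seq rho (fun n => (normalized (f n)).2 0 (inord i)).

Lemma assoc_mapE : assoc_map rho f = FracField.tofrac lim_num / FracField.tofrac lim_den.
Proof. by []. Qed.

Lemma normalized_le n i : cabs ((normalized (f n)).1 0 i) <= 1 /\ cabs ((normalized (f n)).2 0 i) <= 1.
Proof. by rewrite -(max_modulus_normalized (f n)); exact: max_modulus_ge. Qed.

(** The largest coefficient has modulus 1 for every n, so the coefficients cannot all be
    negligible. *)
Lemma lim_neq0 : ~ (lim_num = 0 /\ lim_den = 0).
Proof.
move=> [e1 e2]; have FF := ultra_proper_filter w.
have small (p : nat -> 'rV[C]_d.+1) : (forall n i, cabs (p n 0 i) <= 1) ->
    \poly_(i < d.+1) of_seq rho (fun n => p n 0 (inord i)) = 0 :> {poly K} ->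
    \forall n \near ultraset w, forall i, cabs (p n 0 i) < 1 / 2.
  move=> hp e; apply: filter_forall => i.
  have := congr1 (fun q : {poly K} => q`_i) e; rewrite /= coef_poly ltn_ord coef0 inord_val => h.
  have hr := represents_bounded rho (fun n => hp n i).
  apply: filterS2 (iffLR (represents_eq0 hr) h 1%N) (rho_lt_half rho) => n h1 h2.
  by apply: (lt_trans h1); rewrite expr1.
have s1 := small _ (fun n i => proj1 (normalized_le n i)) e1.
have s2 := small _ (fun n i => proj2 (normalized_le n i)) e2.
have [n [h1 h2]] := filter_ex (filterI s1 s2).
have := @max_modulus_lt R d (normalized (f n)) (1 / 2) (divr_gt0 ltr01 (ltr0Sn _ 1)) (fun i => conj (h1 i) (h2 i)).
rewrite max_modulus_normalized; apply/negP; rewrite -leNgt; lra.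
Qed.

Section Point.
Variables (u : nat -> H3 R) (a b al be : K).
Local Notation g := (fun n => gram (rat_coefs (f n)) (u n)).
Hypotheses (ha : represents a (fun n => (ht (u n))%:C%C)) (hb : represents b (fun n => hz (u n))).
Hypotheses (hal : represents al (fun n => (ht (g n))%:C%C)) (hbe : represents be (fun n => hz (g n))).
Hypotheses (a0 : a != 0).

Definition sample n (j : nat) : C := hz (u n) + (ht (u n))%:C%C * j%:R.

Lemma represents_sample (j : nat) : represents (b + j%:R * a) (fun n => sample n j).
Proof.
have := representsD hb (representsM (represents_nat rho j) ha); congr represents.
by apply/funext => n; rewrite /sample mulrC.
Qed.

Lemma represents_den (j : nat) : represents lim_den.[b + j%:R * a] (fun n => (poly_of (normalized (f n)).2).[sample n j]).
Proof. exact: (represents_horner (fun n i => proj2 (normalized_le n i)) (represents_sample j)). Qed.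

Lemma represents_diff (k : K) (v : nat -> C) (j : nat) : represents k v ->
  represents (lim_num - k *: lim_den).[b + j%:R * a]
    (fun n => (poly_of (normalized (f n)).1 - v n *: poly_of (normalized (f n)).2).[sample n j]).
Proof.
move=> hk; have h1 := represents_horner (fun n i => proj1 (normalized_le n i)) (represents_sample j).
rewrite hornerD hornerN hornerZ.
have := representsD h1 (representsN (representsM hk (represents_den j))); congr represents.
by apply/funext => n; rewrite hornerD hornerN hornerZ.
Qed.

Lemma sample_gram (v : C) n :
  (nsq (v - hz (g n)) + ht (g n) ^+ 2) * \sum_(j < d.+1) nsq (poly_of (normalized (f n)).2).[sample n j] =
  \sum_(j < d.+1) nsq (poly_of (normalized (f n)).1 - v *: poly_of (normalized (f n)).2).[sample n j].
Proof. exact: (gram_eval hd (u n) _ v (rat_coefs_deg (f n))). Qed.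

Lemma sum_nsq_le (F : 'I_d.+1 -> C) (B : R) : (forall j, cabs (F j) <= B) -> \sum_j nsq (F j) <= d.+1%:R * B ^+ 2.
Proof.
move=> h; apply: (@le_trans _ _ (\sum_(j < d.+1) B ^+ 2)).
  by apply: ler_sum => j _; rewrite nsqE lerXn2r ?nnegrE ?cabs_ge0 // (le_trans (cabs_ge0 _) (h j)).
by rewrite sumr_const card_ord -[X in X <= _]mulr_natl.
Qed.

Lemma nsq_le_sum (F : 'I_d.+1 -> C) j : nsq (F j) <= \sum_j nsq (F j).
Proof. by rewrite (bigD1 j) //= lerDl; apply: sumr_ge0 => i _; exact: nsq_ge0. Qed.

Lemma size_lim : (size lim_den <= d.+1)%N /\ forall k, (size (lim_num - k *: lim_den)%R <= d.+1)%N.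
Proof.
have s1 : (size lim_num <= d.+1)%N by exact: size_poly.
have s2 : (size lim_den <= d.+1)%N by exact: size_poly.
split => // k; rewrite (leq_trans (size_polyD _ _)) // geq_max s1 size_polyN.
exact: leq_trans (size_scale_leq _ _) s2.
Qed.

Lemma in_ball (j : nat) : absK (b + j%:R * a - b) <= absK a.
Proof. exact: (shift_in_ball V). Qed.

(** The norm on the left is attained at one node; by [sample_gram] the square there is at most (|k -
    beta|^2 + alpha^2) times the sum of the squares of Q at the nodes. *)
Lemma diff_norm_le (k : K) : ball_norm absK b (absK a) (lim_num - k *: lim_den) <=
  ball_norm absK b (absK a) lim_den * Num.max (absK al) (absK (be - k)).
Proof.
have [_ /(_ k) sz] := size_lim; have p0 := abs_gt0 a0.
have [j0 jd <-] := ball_norm_sample V b a0 sz.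
(* The Boolean separates the contributions of |k - beta| and of alpha, which become the two members
   of the maximum. *)
pose y (i : 'I_d.+1 * bool) : K := (if i.2 then k - be else al) * lim_den.[b + i.1%:R * a].
pose v (i : 'I_d.+1 * bool) (n : nat) : C :=
  (if i.2 then rep k n - hz (g n) else (ht (g n))%:C%C) * (poly_of (normalized (f n)).2).[sample n i.1].
have hk := represents_rep k.
have hv i : represents (y i) (v i).
  case: i => j [].
    exact: (representsM (representsD hk (representsN hbe)) (represents_den j)).
  exact: (representsM hal (represents_den j)).
apply: (abs_dominated (B0 := 2 * d.+1%:R) (represents_diff j0 hk) hv).
- by apply: mulr_ge0; [exact: (ball_norm_ge0 V)|rewrite le_max abs_ge0].
- move=> i; rewrite /y absM mulrC; apply: ler_pM; rewrite ?abs_ge0 //.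
    exact: (ball_norm_ge V _ p0 (in_ball _)).
  by case: (i.2); rewrite le_max; [rewrite (absB k be) lexx orbT|rewrite lexx].
move=> n B B0 hB; have jlt : (j0 < d.+1)%N by [].
have := nsq_le_sum (fun j => (poly_of (normalized (f n)).1 - rep k n *: poly_of (normalized (f n)).2).[sample n j]) (Ordinal jlt).
move=> /le_trans; apply; rewrite -sample_gram mulrDl !mulr_sumr.
have h1 := @sum_nsq_le (fun j => v (j, true) n) B (fun j => hB (j, true)).
have h2 := @sum_nsq_le (fun j => v (j, false) n) B (fun j => hB (j, false)).
have -> : 2 * d.+1%:R * B ^+ 2 = d.+1%:R * B ^+ 2 + d.+1%:R * B ^+ 2 by rewrite -mulrA mulr_natl mulr2n.
apply: lerD; [apply: le_trans h1|apply: le_trans h2]; apply: ler_sum => j _; rewrite /v /= nsqM //.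
by rewrite nsq_real.
Qed.

(** Used with e = k - beta and with e = alpha, so that each member of the maximum is bounded
    separately. *)
Lemma diff_norm_ge (k e : K) (ve : nat -> C) (vk : nat -> C) : represents k vk -> represents e ve ->
  (forall n, nsq (ve n) <= nsq (vk n - hz (g n)) + ht (g n) ^+ 2) ->
  ball_norm absK b (absK a) lim_den * absK e <= ball_norm absK b (absK a) (lim_num - k *: lim_den).
Proof.
move=> hk he le; have [sz _] := size_lim; have p0 := abs_gt0 a0.
have [j0 jd <-] := ball_norm_sample V b a0 sz.
have jlt : (j0 < d.+1)%N by [].
rewrite -absM; apply: (abs_dominated (B0 := d.+1%:R) (representsM (represents_den j0) he)
  (fun j : 'I_d.+1 => represents_diff j hk)).
- exact: (ball_norm_ge0 V).
- by move=> j; exact: (ball_norm_ge V _ p0 (in_ball _)).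
move=> n B B0 hB; apply: le_trans (sum_nsq_le hB); rewrite -sample_gram.
rewrite -[nsq (_ n)]/(nsq ((poly_of (normalized (f n)).2).[sample n j0] * ve n)) nsqM mulrC.
apply: ler_pM; rewrite ?nsq_ge0 //.
exact: (nsq_le_sum (fun j => (poly_of (normalized (f n)).2).[sample n j]) (Ordinal jlt)).
Qed.

(** The maximum is the norm of X - k on the ball B(beta, |alpha|). This is the hypothesis under
    which [berk_image_ball] identifies that ball as the image. *)
Lemma diff_norm (k : K) : ball_norm absK b (absK a) (lim_num - k *: lim_den) =
  ball_norm absK b (absK a) lim_den * Num.max (absK al) (absK (be - k)).
Proof.
apply/eqP; rewrite eq_le diff_norm_le /=; have hk := represents_rep k.
have [h|h] := leP (absK al) (absK (be - k)).
  rewrite absB; apply: (diff_norm_ge hk (representsD hk (representsN hbe))) => n.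
  by rewrite lerDl sqr_ge0.
apply: (diff_norm_ge hk hal) => n; by rewrite nsq_real lerDr nsq_ge0.
Qed.

Lemma lim_den_neq0 : lim_den != 0.
Proof.
apply/negP => /eqP e; have := diff_norm 0; rewrite scale0r subr0 e -polyC0 (ball_normC V) ?abs_gt0 // abs0 mul0r.
have [n0|n0] := eqVneq lim_num 0; first by case: (lim_neq0 (conj n0 e)).
by move=> h; have := hsnorm_gt0 V (ball_point V b (abs_gt0 a0)) n0; rewrite /hsnorm /= h ltxx.
Qed.

Lemma image_ball (al0 : al != 0) q : hsnorm (ball_point V be (abs_gt0 al0)) q =
  frac_norm (ball_point V b (abs_gt0 a0)) (comp_frac q (assoc_map rho f)).
Proof.
rewrite assoc_mapE; apply: (berk_image_ball V (abs_gt0 al0) lim_den_neq0) => k; exact: diff_norm.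
Qed.

End Point.
End ImageBall.

Section Conjugacy.
Variables (R : realType) (w : free_ultrafilter) (d : nat).
Hypothesis hd : (1 <= d)%N.
Variable f : nat -> RatMap R d.
Local Notation r := (fun n => bary_radius (f n)).
Hypothesis hr : r @ \oo --> +oo.
Local Notation C := R[i].
Local Notation rho := (exp_scale w hr).
Local Notation K := (robinson rho).
Local Notation absK := (@robinson_abs R w rho).
Local Notation V := (robinson_maximal rho).
Local Notation E := (fun n => bary_ext (rat_fun (f n))).

Lemma bary_radius_ge0 (g : RatMap R d) : 0 <= bary_radius g.
Proof. by have [[x _ <-] _] := bary_radiusP hd g; exact: hdist_ge0. Qed.

(** Boundedness is required at every n, whereas the displacement estimate is useful only where the
    radius is at least 1. *)
Lemma bary_bseq (u : Defs.bseq r) : exists v : Defs.bseq r, forall n, v n = bary_ext (rat_fun (f n)) (u n).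
Proof.
have [L L0 hL] := bary_displacement R hd.
have [c hc] : exists c : R, forall n, hdist (H3o R) (u n) / bary_radius (f n) <= c by case: (u) => v hv; exact: (asboolW hv).
have [N _ hN] : \forall n \near \oo, 1 <= bary_radius (f n) by move/cvgryPge: hr; exact.
pose q n := hdist (H3o R) (bary_ext (rat_fun (f n)) (u n)) / bary_radius (f n).
have q0 n : 0 <= q n by rewrite divr_ge0 ?hdist_ge0 ?bary_radius_ge0.
(* The finitely many remaining indices are bounded by the sum of their values. *)
have s0 : 0 <= \sum_(n < N) q n by apply: sumr_ge0.
have c0 : 0 <= L * (2 + Num.max c 0) by rewrite mulr_ge0 // addr_ge0 // le_max lexx orbT.
have bd : `[< exists c : R, forall n, hdist (H3o R) (bary_ext (rat_fun (f n)) (u n)) / bary_radius (f n) <= c >].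
  apply/asboolP; exists (L * (2 + Num.max c 0) + \sum_(n < N) q n) => n; rewrite -/(q n).
  have [Nn|nN] := leqP N n; last first.
    by rewrite -[X in X <= _]add0r lerD // (bigD1 (Ordinal nN)) //= lerDl sumr_ge0.
  rewrite -[X in X <= _]addr0 lerD //; have r1 := hN n Nn; have r0 := lt_le_trans ltr01 r1.
  have := hc n; rewrite /q !ler_pdivrMr // => h1; apply: (le_trans (hL (f n) (u n))).
  rewrite -mulrA; apply: ler_wpM2l => //.
  have h2 : c * bary_radius (f n) <= Num.max c 0 * bary_radius (f n) by rewrite ler_pM2r // le_max lexx.
  by move: h1 h2 r1; clear; move: (hdist _ _) (bary_radius _) (Num.max _ _) => *; lra.
by exists (BSeq bd).
Qed.

(** The Gram points define the image ball; they stay at bounded distance from the images under E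
    f_n, so after division by r_n both sequences have the same class. *)
Lemma image_exists (u : Defs.bseq r) (x : HBerk absK) : phi x = cone_class w u ->
  exists y : HBerk absK, (forall q, hsnorm y q = frac_norm x (comp_frac q (assoc_map rho f))) /\
    exists2 v : Defs.bseq r, forall n, v n = bary_ext (rat_fun (f n)) (u n) & phi y = cone_class w v.
Proof.
move=> xu; have [a [b [a0 ha hb hphi]]] := bseq_coords w hr u.
have xE : x = ball_point V b (abs_gt0 a0).
  by apply: phi_inj; rewrite xu hphi //; exact: ball_pointP.
have [v hv] := bary_bseq u; have [L hL] := bary_gram_close R hd.
have [c hc] : exists c : R, forall n, hdist (H3o R) (v n) / bary_radius (f n) <= c by case: (v) => v' hv'; exact: (asboolW hv').
have rp := r_pos w hr.
have [y' hy'] : exists y' : Defs.bseq r, \forall n \near ultraset w, y' n = gram (rat_coefs (f n)) (u n).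
  apply: (@bseq_of_near _ _ _ _ (c + `|L|)); apply: filterS2 rp (r_large w hr 1) => n r0 r1.
  have t := hdist_triangle (H3o R) (v n) (gram (rat_coefs (f n)) (u n)).
  have h1 := hL (f n) (u n); rewrite -hv hdistC in h1.
  have := hc n; rewrite !ler_pdivrMr // => h2.
  have h3 : L <= `|L| * bary_radius (f n).
    by apply: (le_trans (ler_norm L)); rewrite ler_peMr // ltW.
  by move: t h1 h2 h3; clear; rewrite mulrDl; move: (hdist _ _) (hdist _ _) (hdist _ _) (_ * _) (_ * _) => *; lra.
have [al [be [al0 hal hbe hphi']]] := bseq_coords w hr y'.
have hal' : represents al (fun n => (ht (gram (rat_coefs (f n)) (u n)))%:C%C).
  by apply: (represents_near hal); apply: filterS hy' => n ->.
have hbe' : represents be (fun n => hz (gram (rat_coefs (f n)) (u n))).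
  by apply: (represents_near hbe); apply: filterS hy' => n ->.
exists (ball_point V be (abs_gt0 al0)); split.
  by move=> q; rewrite xE; exact: (image_ball hd ha hb hal' hbe' a0 al0 q).
exists v => //; rewrite hphi'; last exact: ball_pointP.
apply: cone_class_eq; apply: (squeeze_cvgr _ (cvg_cst 0) (cst_over_r w hr L)).
apply: filterS2 rp hy' => n r0 ->; rewrite hv divr_ge0 ?hdist_ge0 ?(ltW r0) //=.
by rewrite ler_pM2r ?invr_gt0.
Qed.

Lemma conjugacy : exists (F : cone w r -> cone w r) (B : HBerk absK -> HBerk absK),
  [/\ is_limit_map E F, is_berk_map (assoc_map rho f) B & forall x, phi (B x) = F (phi x)].
Proof.
pose im x := cid (image_exists (u := repr (phi x)) (esym (cone_reprK (phi x)))).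
pose B x := sval (im x); pose G (p : cone w r) := sval (cid (phi_surj hr p)).
have GK p : phi (G p) = p := svalP (cid (phi_surj hr p)).
have hB : is_berk_map (assoc_map rho f) B by move=> x q; case: (svalP (im x)).
(* F is B transported by the bijection, so the conjugacy is immediate and the content is that F is
   the limit map. *)
exists (fun p => phi (B (G p))), B; split => //; last first.
  by move=> x; congr (phi (B _)); apply: phi_inj; rewrite GK.
(* For an arbitrary representative u of the class the image point found is again B of the same
   point, because its norm is determined by the rational map. *)
move=> u; have [y [hy [v hv e]]] := image_exists (GK (cone_class w u)).
exists v => //; rewrite -e; congr phi; apply: hberk_ext => q; rewrite hy; exact: hB.
Qed.

End Conjugacy.

Theorem theorem1p1 (R : realType) (w : free_ultrafilter) (d : nat)
    (hd : (1 <= d)%N) (f : nat -> RatMap R d) (hf : degenerating f) :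
  let r : nat -> R := fun n => bary_radius (f n) in
  exists hr : r @ \oo --> +oo,
  let rho := exp_scale w hr in
  exists (F : cone w r -> cone w r)
         (B : HBerk (@robinson_abs R w rho) -> HBerk (@robinson_abs R w rho))
         (Phi : HBerk (@robinson_abs R w rho) -> cone w r),
    [/\ is_limit_map (fun n => bary_ext (rat_fun (f n))) F,
        is_berk_map (assoc_map rho f) B &
        is_Phi Phi] /\
    [/\ bijective Phi,
        (forall x y, cone_dist (Phi x) (Phi y) = berk_dist x y) &
        (forall x, Phi (B x) = F (Phi x))].
Proof.
move=> r; exists (radius_infinity hd hf); move=> rho.
have [F [B [hF hB hFB]]] := conjugacy w hd (radius_infinity hd hf).
exists F, B, (@phi R w r (radius_infinity hd hf)); split; split => //.
- exact: phi_is_Phi.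
- exact: phi_bij.
exact: phi_isometry.
Qed.
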